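(* Let $\ell\in\{1,\dots,k\}$ and let $\theta=\lambda>\frac12$. Suppose $u$ is the exact solution of $u_t+u_x+u_{xx}+u_{xxxx}=0$ on $I\times(0,T]$, $I=(0,2\pi)$, $u(x,0)=u_0(x)$, with periodic boundary conditions, which is sufficiently smooth, e.g. $u\in W^{k+\ell+4,\infty}(\mathcal I_h)$ and $u_t\in W^{k+\ell+3,\infty}(\mathcal I_h)$. Let $(u_h,p_h,q_h,r_h)$ be the solution of the semi-discrete LDG scheme with generalized numerical fluxes with weights $\theta,\lambda$ (defined in the context), started from the numerical initial condition with parameter $\ell$ (defined in the context). Let $\bar e_v=v_I^\ell-v_h$ for $v=u,p,q,r$, where $v_I^\ell$ are the interpolation functions defined in the context. Then, for $t\in(0,T]$, $$\|\bar e_u(t)\|+\|\bar e_p(t)\|+\Big(\int_0^t\big(\|\bar e_q\|^2+\|\bar e_r\|^2\big)\,\mathrm d\tau\Big)^{1/2}\le C h^{k+\ell+1},$$ where $C$ depends on $\|u\|_{k+\ell+4,\infty}$ and $\|u_t\|_{k+\ell+3,\infty}$, but is independent of $h$.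
   Context: Mesh and spaces. $I=(0,2\pi)$ is partitioned into cells $I_j=(x_{j-1/2},x_{j+1/2})$, $j=1,\dots,N$, $\mathcal I_h=\{I_j\}_{j=1}^N$; $h_j=x_{j+1/2}-x_{j-1/2}$, $\bar h_j=h_j/2$, $h=\max_j h_j$; the mesh is quasi-uniform: $h_j\ge\gamma h$ for all $j$ with a fixed $\gamma>0$. $k\ge1$ is an integer, $P^m(I_j)$ is the space of polynomials of degree at most $m$ on $I_j$, and $V_h=\{v\in L^2(I): v|_{I_j}\in P^k(I_j)\ \forall j\}$. $(\cdot,\cdot)_j$ is the $L^2(I_j)$ inner product; $\|\cdot\|$ is the $L^2(I)$ norm. $W^{m,\infty}(\mathcal I_h)$ is the broken Sobolev space with norm $\|v\|_{m,\infty}=\max_j\|v\|_{W^{m,\infty}(I_j)}$. $v^{\pm}_{j+1/2}$ are the right/left limits at $x_{j+1/2}$, with periodic identification of $x_{1/2}$ and $x_{N+1/2}$. Weights. For a real weight $\sigma$, $\tilde\sigma=1-\sigma$ and $w^{(\sigma)}_{j+1/2}=\sigma w^-_{j+1/2}+\tilde\sigma w^+_{j+1/2}$. The two weights satisfy $\theta,\lambda\ne\frac12$. LDG scheme. Put $p=u_x$, $q=p_x$, $r=q_x$, and $$\mathcal H_j^{\alpha}(w,v)=(w,v_x)_j-w^{(\alpha)}v^-|_{j+1/2}+w^{(\alpha)}v^+|_{j-1/2}.$$ Find $u_h,p_h,q_h,r_h$ with values in $V_h$ such that for all $v,\phi,\psi,\zeta\in V_h$ and all $j$: $((u_h)_t,v)_j-\mathcal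 H_j^{\theta}(u_h,v)-\mathcal H_j^{\tilde\lambda}(p_h,v)-\mathcal H_j^{\tilde\theta}(r_h,v)=0$; $(r_h,\phi)_j+\mathcal H_j^{\lambda}(q_h,\phi)=0$; $(q_h,\psi)_j+\mathcal H_j^{\tilde\lambda}(p_h,\psi)=0$; $(p_h,\zeta)_j+\mathcal H_j^{\theta}(u_h,\zeta)=0$. Generalized Gauss–Radau projection. For a weight $\sigma\neq\frac12$, $P_\sigma v\in V_h$ is the unique function with $\int_{I_j}(v-P_\sigma v)\phi\,dx=0$ for all $\phi\in P^{k-1}(I_j)$ and $(v-P_\sigma v)^{(\sigma)}_{j+1/2}=0$, $j=1,\dots,N$. Correction functions. $D_x^{-1}v(x)=\frac1{\bar h_j}\int_{x_{j-1/2}}^x v(\tilde x)\,d\tilde x$ for $x\in I_j$. Set $w_u^0=u-P_\theta u$, $w_p^0=p-P_{\tilde\lambda}p$, $w_q^0=q-P_\lambda q$, $w_r^0=r-P_{\tilde\theta}r$. For $i=1,\dots,k$, $w_u^i,w_p^i,w_q^i,w_r^i\in V_h$ are determined, for all $\phi\in P^{k-1}(I_j)$ and $j=1,\dots,N$, by $(w_u^i-\bar h_jD_x^{-1}w_p^{i-1},\phi)_j=0$, $(w_u^i)^{(\theta)}_{j+1/2}=0$; $(w_p^i-\bar h_jD_x^{-1}w_q^{i-1},\phi)_j=0$, $(w_p^i)^{(\tilde\lambda)}_{j+1/2}=0$; $(w_q^i-\bar h_jD_x^{-1}w_r^{i-1},\phi)_j=0$, $(w_q^i)^{(\lambda)}_{j+1/2}=0$;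 $(w_u^i+w_p^i+w_r^i+\bar h_jD_x^{-1}\partial_tw_u^{i-1},\phi)_j=0$, $(w_r^i)^{(\tilde\theta)}_{j+1/2}=0$. Set $W_v^\ell=\sum_{i=1}^\ell w_v^i$ and define the interpolation functions $u_I^\ell=P_\theta u-W_u^\ell$, $p_I^\ell=P_{\tilde\lambda}p-W_p^\ell$, $q_I^\ell=P_\lambda q-W_q^\ell$, $r_I^\ell=P_{\tilde\theta}r-W_r^\ell$. Numerical initial condition with parameter $\ell$. $r_h(x,0)=r_I^\ell(x,0)=P_{\tilde\theta}r_0(x)-W_r^\ell(x,0)$ with $r_0=\partial_x^3u_0$, and $q_h(\cdot,0),p_h(\cdot,0),u_h(\cdot,0)\in V_h$ are the solutions at $t=0$ of $(r_h,\phi)_j+\mathcal H_j^{\lambda}(q_h,\phi)=0$, $(q_h,\psi)_j+\mathcal H_j^{\tilde\lambda}(p_h,\psi)=0$, $(p_h,\zeta)_j+\mathcal H_j^{\theta}(u_h,\zeta)=0$ for all $\phi,\psi,\zeta\in V_h$ and all $j$, with $u_h(\cdot,0)$ normalized by conservation, $\int_I u_h(x,0)\,dx=\int_I u_0(x)\,dx$. *)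

(* Defs.v *)
From HB Require Import structures.
From mathcomp Require Import all_boot all_order all_algebra.
From mathcomp Require Import all_classical all_reals all_analysis.

Set Implicit Arguments.
Unset Strict Implicit.
Unset Printing Implicit Defensive.

Import Order.TTheory GRing.Theory Num.Theory numFieldNormedType.Exports.

Local Open Scope classical_set_scope.
Local Open Scope ring_scope.

(* Cells are numbered from 0: for [j : 'I_N], [cell M j] is the interval
   (node j, node j.+1), that is, I_{j+1} in one-based numbering. *)
Record mesh (R : realType) := Mesh {
  ncells : nat;
  node : nat -> R;
  node_first : node 0%N = 0;
  node_last : node ncells = 2 * pi;
  node_lt : forall j, (j < ncells)%N -> node j < node j.+1 }.

Definition domain (R : realType) : set R := `]0, 2 * pi[.

Definition cell (R : realType) (M : mesh R) (j : 'I_(ncells M)) : set R :=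
  `]node M j, node M j.+1[.

Definition cell_size (R : realType) (M : mesh R) (j : 'I_(ncells M)) : R :=
  node M j.+1 - node M j.

Definition half_size (R : realType) (M : mesh R) (j : 'I_(ncells M)) : R :=
  cell_size j / 2.

Definition mesh_size (R : realType) (M : mesh R) : R :=
  \big[Num.max/0]_(j < ncells M) cell_size j.

Definition quasi_uniform (R : realType) (gamma : R) (M : mesh R) : Prop :=
  forall j : 'I_(ncells M), gamma * mesh_size M <= cell_size j.

Definition in_Vh (R : realType) (M : mesh R) (k : nat) (v : R -> R) : Prop :=
  forall j : 'I_(ncells M), exists2 p : {poly R}, (size p <= k.+1)%N &
    forall x, cell j x -> v x = p.[x].

Definition inner (R : realType) (M : mesh R) (j : 'I_(ncells M))
    (w v : R -> R) : R :=
  \int[@lebesgue_measure R]_(x in cell j) (w x * v x).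

Definition L2norm (R : realType) (v : R -> R) : R :=
  Num.sqrt (\int[@lebesgue_measure R]_(x in @domain R) (v x ^+ 2)).

(* One-sided traces taken from inside cell j: [trace_r j v] is the left limit
   v^- at its right endpoint, [trace_l j v] the right limit v^+ at its left
   endpoint. *)
Definition trace_r (R : realType) (M : mesh R) (j : 'I_(ncells M))
    (v : R -> R) : R := lim (v @ (node M j.+1)^'-).

Definition trace_l (R : realType) (M : mesh R) (j : 'I_(ncells M))
    (v : R -> R) : R := lim (v @ (node M j)^'+).

(* The weighted trace at the right endpoint of cell j; [ordS] is the cyclic
   successor, which identifies the two endpoints of the domain. The weighted
   trace at the left endpoint of cell j is [wtrace sigma (ord_pred j) w]. *)
Definition wtrace (R : realType) (M : mesh R) (sigma : R) (j : 'I_(ncells M))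
    (w : R -> R) : R :=
  sigma * trace_r j w + (1 - sigma) * trace_l (ordS j) w.

Definition Hform (R : realType) (M : mesh R) (alpha : R) (j : 'I_(ncells M))
    (w v : R -> R) : R :=
  inner j w (derive1 v) - wtrace alpha j w * trace_r j v
  + wtrace alpha (ord_pred j) w * trace_l j v.

(* Derivative relative to the time interval [0, T]: two-sided at interior
   times and one-sided at t = 0 and t = T. The value at t = 0 is needed by the
   correction functions entering the numerical initial condition. *)
Definition time_quotient (R : realType) (f : R -> R) (t s : R) : R :=
  (f s - f t) / (s - t).

Definition tderivable (R : realType) (T : R) (f : R -> R) (t : R) : Prop :=
  cvg (time_quotient f t @ within `[0, T] t^').

Definition tderive (R : realType) (T : R) (f : R -> R) (t : R) : R :=
  lim (time_quotient f t @ within `[0, T] t^').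

Definition dt (R : realType) (T : R) (f : R -> R -> R) (t x : R) : R :=
  tderive T (fun s => f s x) t.

Definition test_function (R : realType) (a b : R) (phi : R -> R) : Prop :=
  (forall n x, derivable (derive1n n phi) x 1) /\
  (exists c d : R, [/\ a < c, d < b & forall x, ~ `[c, d]%classic x -> phi x = 0]).

Definition weak_derivative (R : realType) (a b : R) (i : nat)
    (f g : R -> R) : Prop :=
  forall phi, test_function a b phi ->
    \int[@lebesgue_measure R]_(x in `]a, b[) (f x * derive1n i phi x) =
    (-1) ^+ i * \int[@lebesgue_measure R]_(x in `]a, b[) (g x * phi x).

Definition weak_derivatives (R : realType) (a b : R) (m : nat)
    (f : R -> R) (g : nat -> R -> R) : Prop :=
  (forall x, `]a, b[%classic x -> g 0%N x = f x) /\
  (forall i, (i <= m)%N ->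
    measurable_fun `]a, b[ (g i) /\ weak_derivative a b i f (g i)).

(* Weak derivatives are unique almost everywhere, so the infimum ranges over
   at most one value when f is in W^{m,oo}(a, b); it is +oo otherwise. *)
Definition Winf_norm (R : realType) (a b : R) (m : nat) (f : R -> R) : \bar R :=
  ereal_inf [set y | exists2 g, weak_derivatives a b m f g &
    y = \big[maxe/0%E]_(i < m.+1)
          'N[@lebesgue_measure R]_+oo [EFin \o (g i \_ `]a, b[)]]%E.

Definition broken_norm (R : realType) (M : mesh R) (m : nat) (f : R -> R) :
    \bar R :=
  \big[maxe/0%E]_(j < ncells M) Winf_norm (node M j) (node M j.+1) m f.

Definition sup_broken_norm (R : realType) (M : mesh R) (T : R) (m : nat)
    (f : R -> R -> R) : \bar R :=
  ereal_sup [set broken_norm M m (f t) | t in `[0, T]].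

(* The spatially periodic solution, extended to the whole line. *)
Record exact_solution (R : realType) (T : R) (u0 : R -> R) (u : R -> R -> R) :
    Prop := {
  exact_periodic : forall t x, 0 <= t <= T -> u t (x + 2 * pi) = u t x;
  exact_dx : forall t x n, 0 <= t <= T -> (n < 4)%N ->
    derivable (derive1n n (u t)) x 1;
  exact_dt : forall t x, 0 <= t <= T -> tderivable T (fun s => u s x) t;
  exact_eq : forall t x, 0 < t <= T ->
    dt T u t x + derive1 (u t) x + derive1n 2 (u t) x + derive1n 4 (u t) x = 0;
  exact_init : forall x, u 0 x = u0 x }.

Definition is_ggr (R : realType) (M : mesh R) (k : nat) (sigma : R)
    (v Pv : R -> R) : Prop :=
  [/\ in_Vh M k Pv,
      forall (j : 'I_(ncells M)) (phi : {poly R}), (size phi <= k)%N ->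
        inner j (v \- Pv) (horner phi) = 0 &
      forall j : 'I_(ncells M), wtrace sigma j (v \- Pv) = 0].

Definition Dinv (R : realType) (M : mesh R) (j : 'I_(ncells M))
    (v : R -> R) (x : R) : R :=
  (half_size j)^-1 * \int[@lebesgue_measure R]_(y in `]node M j, x[) v y.

(* The correction functions of orders 0, ..., m on the time interval [0, T];
   [u, p, q, r] are the exact quantities and [Pu, Pp, Pq, Pr] their
   projections. [corr_dt] records the existence of the time derivative that
   occurs in the last equation of [corr_orth]; it is asked at interior points of
   cells only, since elements of V_h are determined only there. *)
Record corrections (R : realType) (M : mesh R) (k m : nat)
    (theta lambda T : R) (u p q r Pu Pp Pq Pr : R -> R -> R)
    (wu wp wq wr : nat -> R -> R -> R) : Prop := {
  corr0 : forall t x, 0 <= t <= T ->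
    [/\ wu 0%N t x = u t x - Pu t x, wp 0%N t x = p t x - Pp t x,
        wq 0%N t x = q t x - Pq t x & wr 0%N t x = r t x - Pr t x];
  corr_Vh : forall i t, (1 <= i <= m)%N -> 0 <= t <= T ->
    [/\ in_Vh M k (wu i t), in_Vh M k (wp i t),
        in_Vh M k (wq i t) & in_Vh M k (wr i t)];
  corr_dt : forall i t (j : 'I_(ncells M)) x, (i < m)%N -> 0 <= t <= T ->
    cell j x -> tderivable T (fun s => wu i s x) t;
  corr_orth : forall i t (j : 'I_(ncells M)) (phi : {poly R}),
    (i < m)%N -> 0 <= t <= T -> (size phi <= k)%N ->
    [/\ inner j (fun x => wu i.+1 t x - half_size j * Dinv j (wp i t) x)
          (horner phi) = 0,
        inner j (fun x => wp i.+1 t x - half_size j * Dinv j (wq i t) x)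
          (horner phi) = 0,
        inner j (fun x => wq i.+1 t x - half_size j * Dinv j (wr i t) x)
          (horner phi) = 0 &
        inner j (fun x => wu i.+1 t x + wp i.+1 t x + wr i.+1 t x
                          + half_size j * Dinv j (dt T (wu i) t) x)
          (horner phi) = 0];
  corr_trace : forall i t (j : 'I_(ncells M)), (1 <= i <= m)%N -> 0 <= t <= T ->
    [/\ wtrace theta j (wu i t) = 0, wtrace (1 - lambda) j (wp i t) = 0,
        wtrace lambda j (wq i t) = 0 & wtrace (1 - theta) j (wr i t) = 0] }.

Definition interp (R : realType) (l : nat) (Pv : R -> R -> R)
    (w : nat -> R -> R -> R) (t x : R) : R :=
  Pv t x - \sum_(1 <= i < l.+1) w i t x.

Definition auxiliary_eqs (R : realType) (M : mesh R) (k : nat)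
    (theta lambda : R) (uh ph qh rh : R -> R) : Prop :=
  forall (j : 'I_(ncells M)) (phi : R -> R), in_Vh M k phi ->
    [/\ inner j rh phi + Hform lambda j qh phi = 0,
        inner j qh phi + Hform (1 - lambda) j ph phi = 0 &
        inner j ph phi + Hform theta j uh phi = 0].

Record LDG_solution (R : realType) (M : mesh R) (k : nat)
    (theta lambda T : R) (uh ph qh rh : R -> R -> R) : Prop := {
  LDG_Vh : forall t, 0 <= t <= T ->
    [/\ in_Vh M k (uh t), in_Vh M k (ph t), in_Vh M k (qh t)
      & in_Vh M k (rh t)];
  LDG_continuous0 : forall (j : 'I_(ncells M)) x, cell j x ->
    uh t x @[t --> 0^'+] --> uh 0 x;
  LDG_dt : forall t (j : 'I_(ncells M)) x, 0 < t <= T -> cell j x ->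
    tderivable T (fun s => uh s x) t;
  LDG_evolution : forall t (j : 'I_(ncells M)) v, 0 < t <= T -> in_Vh M k v ->
    inner j (dt T uh t) v - Hform theta j (uh t) v
    - Hform (1 - lambda) j (ph t) v - Hform (1 - theta) j (rh t) v = 0;
  LDG_auxiliary : forall t, 0 < t <= T ->
    auxiliary_eqs M k theta lambda (uh t) (ph t) (qh t) (rh t) }.

Record initial_condition (R : realType) (M : mesh R) (k : nat)
    (theta lambda : R) (u0 rI0 uh0 ph0 qh0 rh0 : R -> R) : Prop := {
  init_r : forall (j : 'I_(ncells M)) x, cell j x -> rh0 x = rI0 x;
  init_auxiliary : auxiliary_eqs M k theta lambda uh0 ph0 qh0 rh0;
  init_mass : \int[@lebesgue_measure R]_(x in @domain R) uh0 x =
              \int[@lebesgue_measure R]_(x in @domain R) u0 x }.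

(* Main.v *)
(* Each correction function is built so that, integrating by parts cell by cell,
   it cancels the residual left by the preceding one, while all its weighted
   traces vanish.  Hence the errors [e_v] satisfy the LDG equations with data
   given by the last corrections [w_v^l] alone, which are of size
   [h^(k + l + 1)].  In an orthonormal basis of [V_h] the form with weight
   [theta] is a matrix [A] whose symmetric part is nonpositive ([theta > 1/2]),
   the form with weight [1 - theta] is [- A^T] (here [lambda = theta] enters),
   and the coordinates [x, y, z, w] of the errors of u, p, q, r satisfy
     y + A x = - b,  z - A^T y = - c,  w + A z = - d,
     (x + a)' = A x - A^T y - A^T w.
   Testing with [4 x - z] bounds the growth of [2 |x|^2 + |y|^2 / 2] and
   controls [|z|^2 + |w|^2].  As the energy also contains [c], which is only
   Lipschitz in time, Gronwall's lemma is used for a Dini derivative.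

   The sizes of the corrections and of their first time derivative follow by
   recursion from bounds for the time differences of [u - P u].  These reduce,
   through the equation, to divided differences of [u] and [u_t] in space,
   which the broken Sobolev norms control by duality with B-splines.  The
   initial errors are bounded by a discrete Poincare inequality applied
   successively to the errors of q, p and u. *)
Require Import Defs.
From HB Require Import structures.
From mathcomp Require Import all_boot all_order all_algebra.
From mathcomp Require Import all_classical all_reals all_analysis.
From mathcomp Require Import measurable_realfun ess_sup_inf.
From mathcomp Require Import ring lra zify.
Set Implicit Arguments.
Unset Strict Implicit.
Unset Printing Implicit Defensive.
Import Order.TTheory GRing.Theory Num.Theory numFieldNormedType.Exports.
Local Open Scope classical_set_scope.
Local Open Scope ring_scope.

(** * Integrals over open intervals *)

(** The obstacle is regularity. The exact solution has four space derivatives and one time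
    derivative in the classical sense; all further smoothness is weak and confined to single cells.
    Higher time derivatives of the projection errors are therefore replaced by iterated time
    differences, which always exist. The equation trades each of them for four space derivatives,
    except the last one, which is paid for by the norm of [u_t]. This gives the budget s + 4 n + i
    <= l + 6 for n time differences of the i-th correction of the s-th quantity. The recursion
    preserves it, since the correction of r at order i + 1 uses the time derivative of the
    correction of u at order i. At i = l it leaves the last corrections of u, p, q Lipschitz in
    time, but that of r merely bounded; so the errors of q and r are integrated through a continuous
    majorant.

    In the test function, [- z] produces the growth of [|y|^2 / 2], because [A^T y = z + c],
    together with the cross term [c . x]; [4 x] supplies the [2 |x|^2] that absorbs this cross
    term. *)

Definition itvint (R : realType) (a b : R) (f : R -> R) : R :=
  \int[@lebesgue_measure R]_(x in `]a, b[) f x.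

(** Boundedness is part of the notion so that the class is stable under products and primitives and
    consists of integrable functions. *)
Definition bmeas (R : realType) (a b : R) (f : R -> R) : Prop :=
  measurable_fun `]a, b[ f /\ exists B, forall x, a < x < b -> `|f x| <= B.

Section BoundedMeasurable.
Context (R : realType).
Implicit Types (a b c x y B : R) (f g : R -> R) (p : {poly R}).

Local Notation mu := (@lebesgue_measure R).

Lemma bmeas_ext a b f g :
  (forall x, a < x < b -> f x = g x) -> bmeas a b f -> bmeas a b g.
Proof.
move=> fg [mf [B fB]]; split; last by exists B => x xab; rewrite -fg// fB.
apply: eq_measurable_fun mf => x; rewrite inE/= in_itv/= => xab.
exact: fg.
Qed.

Lemma bmeas_cst a b c : bmeas a b (fun=> c).
Proof. by split; [exact: measurable_cst|exists `|c|]. Qed.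

Lemma bmeasD a b f g : bmeas a b f -> bmeas a b g -> bmeas a b (fun x => f x + g x).
Proof.
move=> [mf [B fB]] [mg [C gC]]; split; first exact: measurable_funD.
by exists (B + C) => x xab; rewrite (le_trans (ler_normD _ _))// lerD// ?fB ?gC.
Qed.

Lemma bmeasM a b f g : bmeas a b f -> bmeas a b g -> bmeas a b (fun x => f x * g x).
Proof.
move=> [mf [B fB]] [mg [C gC]]; split; first exact: measurable_funM.
by exists (B * C) => x xab; rewrite normrM ler_pM// ?fB ?gC.
Qed.

Lemma bmeasZ a b c f : bmeas a b f -> bmeas a b (fun x => c * f x).
Proof. by move=> /(bmeasM (bmeas_cst a b c)). Qed.

Lemma bmeasN a b f : bmeas a b f -> bmeas a b (fun x => - f x).
Proof. by move=> /(bmeasZ (-1)); apply: bmeas_ext => x _; rewrite mulN1r. Qed.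

Lemma bmeasB a b f g : bmeas a b f -> bmeas a b g -> bmeas a b (fun x => f x - g x).
Proof. by move=> mf /bmeasN mg; exact: bmeasD. Qed.

Lemma bmeas_sum a b (I : Type) (r : seq I) (P : pred I) (F : I -> R -> R) :
  (forall i, P i -> bmeas a b (F i)) ->
  bmeas a b (fun x => \sum_(i <- r | P i) F i x).
Proof.
move=> H; elim: r => [|i r IH].
  by apply: bmeas_ext (bmeas_cst a b 0) => x _; rewrite big_nil.
have [Pi|Pi] := boolP (P i).
  by apply: bmeas_ext (bmeasD (H i Pi) IH) => x _; rewrite big_cons Pi.
by apply: bmeas_ext IH => x _; rewrite big_cons (negbTE Pi).
Qed.

Lemma horner_bounded a b p : exists B, forall x, a <= x <= b -> `|p.[x]| <= B.
Proof.
elim/poly_ind: p => [|p c [B pB]].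
  by exists 0 => x _; rewrite horner0 normr0.
exists (B * (`|a| + `|b|) + `|c|) => x xab.
rewrite !hornerE (le_trans (ler_normD _ _))// lerD// normrM ler_pM// ?pB//.
have [x0|x0] := leP 0 x; first by
  rewrite (@le_trans _ _ `|b|) ?lerDr// !ger0_norm//; lra.
by rewrite (@le_trans _ _ `|a|) ?lerDl// !ltr0_norm//; lra.
Qed.

Lemma bmeas_horner a b p : bmeas a b (horner p).
Proof.
split; first exact: measurable_poly.
by have [B pB] := horner_bounded a b p; exists B => x xab; apply: pB; lra.
Qed.

Lemma bmeas_sub a b c d f : a <= c -> d <= b -> bmeas a b f -> bmeas c d f.
Proof.
move=> ac db [mf [B fB]]; split; last by exists B => x xcd; apply: fB; lra.
by apply: measurable_funS mf => // x /=; rewrite !in_itv/=; lra.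
Qed.

Lemma bmeas_continuous a b f : {within `[a, b], continuous f} -> bmeas a b f.
Proof.
move=> cf; split.
  have := subspace_continuous_measurable_fun (measurable_itv `[a, b]) cf.
  by apply: measurable_funS => // x /=; rewrite !in_itv/=; lra.
have := compact_bounded (continuous_compact cf (@segment_compact R a b)).
move=> [M [_ H]]; exists (M + 1) => x xab; apply: (H (M + 1)); first lra.
by exists x => //=; rewrite in_itv/=; lra.
Qed.

Lemma bmeas_integrable a b f : bmeas a b f ->
  (@lebesgue_measure R).-integrable `]a, b[ (EFin \o f).
Proof.
move=> [mf [B fB]]; apply: measurable_bounded_integrable => //=.
  rewrite lebesgue_measure_itv/=.
  by case: ifPn => // _; rewrite -EFinB ltry.
by exists B; split; [exact: num_real|move=> M BM x /=; rewrite in_itv/= => /fB/le_trans; apply;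
  exact: ltW].
Qed.

Lemma itvint_ext a b f g :
  (forall x, a < x < b -> f x = g x) -> itvint a b f = itvint a b g.
Proof.
move=> fg; apply: eq_Rintegral => x; rewrite inE/= in_itv/= => xab.
exact: fg.
Qed.

Lemma itvintD a b f g : bmeas a b f -> bmeas a b g ->
  itvint a b (fun x => f x + g x) = itvint a b f + itvint a b g.
Proof. by move=> /bmeas_integrable mf /bmeas_integrable mg; exact: RintegralD. Qed.

Lemma itvintZ a b c f : bmeas a b f -> itvint a b (fun x => c * f x) = c * itvint a b f.
Proof. by move=> /bmeas_integrable mf; exact: RintegralZl. Qed.

Lemma itvintN a b f : bmeas a b f -> itvint a b (fun x => - f x) = - itvint a b f.
Proof.
by move=> mf; rewrite -mulN1r -itvintZ//; apply: itvint_ext => x _; rewrite mulN1r.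
Qed.

Lemma itvintB a b f g : bmeas a b f -> bmeas a b g ->
  itvint a b (fun x => f x - g x) = itvint a b f - itvint a b g.
Proof. by move=> /bmeas_integrable mf /bmeas_integrable mg; exact: RintegralB. Qed.

Lemma itvint0 a b : itvint a b (fun=> 0) = 0.
Proof.
rewrite -[RHS](mul0r (itvint a b (fun=> 1))) -itvintZ; last exact: bmeas_cst.
by apply: itvint_ext => x _; rewrite mul0r.
Qed.

Lemma itvint_sum a b (I : Type) (r : seq I) (P : pred I) (F : I -> R -> R) :
  (forall i, P i -> bmeas a b (F i)) ->
  itvint a b (fun x => \sum_(i <- r | P i) F i x) =
  \sum_(i <- r | P i) itvint a b (F i).
Proof.
move=> H; elim: r => [|i r IH].
  by rewrite big_nil -[RHS](itvint0 a b); apply: itvint_ext => x _; rewrite big_nil.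
rewrite big_cons; have [Pi|Pi] := boolP (P i).
  rewrite -IH -itvintD; [|exact: H|exact: bmeas_sum].
  by apply: itvint_ext => x _; rewrite big_cons Pi.
by rewrite -IH; apply: itvint_ext => x _; rewrite big_cons (negbTE Pi).
Qed.

Lemma itvint_ge0 a b f : (forall x, a < x < b -> 0 <= f x) -> 0 <= itvint a b f.
Proof.
by move=> f0; apply: Rintegral_ge0 => x /=; rewrite in_itv/=; exact: f0.
Qed.

Lemma itvint_le a b f g : bmeas a b f -> bmeas a b g ->
  (forall x, a < x < b -> f x <= g x) -> itvint a b f <= itvint a b g.
Proof.
move=> mf mg fg; rewrite -subr_ge0 -itvintB//; apply: itvint_ge0 => x xab.
by rewrite subr_ge0 fg.
Qed.

Lemma itvint_cst a b c : a <= b -> itvint a b (fun=> c) = c * (b - a).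
Proof.
move=> ab; rewrite /itvint Rintegral_cst//= lebesgue_measure_itv/= lte_fin.
case: ltP => //= ba; have -> : a = b by apply/eqP; rewrite eq_le ab ba.
by rewrite subrr.
Qed.

Lemma itvint_bound a b f B : a <= b -> bmeas a b f ->
  (forall x, a < x < b -> `|f x| <= B) -> `|itvint a b f| <= B * (b - a).
Proof.
move=> ab mf fB; rewrite ler_norml -mulNr -!(itvint_cst _ ab); apply/andP; split.
  by apply: itvint_le => // [|x /fB]; [exact: bmeas_cst|rewrite ler_norml => /andP[]].
by apply: itvint_le => // [|x /fB]; [exact: bmeas_cst|rewrite ler_norml => /andP[]].
Qed.

Lemma itvint_split a b c f : a < b -> b < c -> bmeas a c f ->
  itvint a c f = itvint a b f + itvint b c f.
Proof.
move=> ab bc /bmeas_integrable mf; rewrite /itvint.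
have E : `]a, c[%classic = `]a, b] `|` `]b, c[ :> set R.
  by rewrite -itv_bndbnd_setU// bnd_simp// ltW.
rewrite E Rintegral_setU//; last 2 first.
- by rewrite -E.
- apply/disj_setPS => y [/=]; rewrite 2!in_itv/= => /andP[_ yx] /andP[].
  by rewrite ltNge yx.
congr (_ + _); rewrite -Rintegral_itv_bndo_bndc//.
by apply: integrableS mf => // x /=; rewrite !in_itv/=; lra.
Qed.

Lemma itvint_ftc a b f F : a < b -> {within `[a, b], continuous f} ->
  {within `[a, b], continuous F} ->
  (forall x, a < x < b -> is_derive x 1 F (f x)) -> itvint a b f = F b - F a.
Proof.
move=> ab cf cF dF; have := cF; move=> /(continuous_within_itvP _ ab)[_ Fa Fb].
have mf := bmeas_integrable (bmeas_continuous cf).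
rewrite /itvint Rintegral_itv_obnd_cbnd// Rintegral_itv_bndo_bndc; last first.
  by apply: integrableS (continuous_compact_integrable (@segment_compact R a b) cf) => // x /=;
    rewrite !in_itv/=; lra.
rewrite /Rintegral (@continuous_FTC2 _ f F)//.
  split => // x; rewrite in_itv/= => /dF; by case.
move=> x; rewrite in_itv/= => /dF => dFx; rewrite derive1E; exact: derive_val.
Qed.

Lemma itvint_ftc_poly a b p : a <= b -> itvint a b (horner p^`()) = p.[b] - p.[a].
Proof.
rewrite le_eqVlt => /predU1P[->|ab].
  by rewrite subrr /itvint set_itvoo0 Rintegral_set0.
have cp q : {within `[a, b], continuous (horner q)}.
  exact/continuous_subspaceT/continuous_horner.
apply: (itvint_ftc ab (cp _) (cp _)) => x _.
Qed.

(** Dominated convergence with a constant as dominating function. *)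
Lemma bmeas_cvg (f_ : nat -> R -> R) a b f (B : R) :
  (forall n, bmeas a b (f_ n)) ->
  (forall n x, a < x < b -> `|f_ n x| <= B) ->
  (forall x, a < x < b -> f_ n x @[n --> \oo] --> f x) ->
  [/\ bmeas a b f, (forall x, a < x < b -> `|f x| <= B) &
     itvint a b (f_ n) @[n --> \oo] --> itvint a b f].
Proof.
move=> mf_ bf_ f_f.
have bf x : a < x < b -> `|f x| <= B.
  move=> xab; have /cvg_norm := f_f x xab => /cvgP cf.
  have <- := cvg_lim (@Rhausdorff R) (cvg_norm (f_f x xab)).
  by apply: limr_le => //; apply: nearW => n; exact: bf_.
have mf : bmeas a b f.
  split; last by exists B.
  apply: (measurable_fun_cvg (h := f_)) => [n|x /=].
    by case: (mf_ n).
  by rewrite in_itv/=; exact: f_f.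
split => //.
have [|||||_ _] := @dominated_convergence _ _ R (@lebesgue_measure R) `]a, b[
  (measurable_itv _) (fun n => EFin \o f_ n) (EFin \o f) (fun=> B%:E).
- by move=> n; case: (bmeas_integrable (mf_ n)) => /integrableP[].
- by case: (bmeas_integrable mf) => /integrableP[].
- by apply: aeW => x /=; rewrite in_itv/= => /f_f ?; apply: cvg_EFin => //; exact: nearW.
- exact: bmeas_integrable (bmeas_cst a b B).
- by apply: aeW => x n /=; rewrite in_itv/= lee_fin; exact: bf_.
rewrite -[X in _ --> X -> _]fineK; first exact: fine_cvg.
exact/integrable_fin_num/bmeas_integrable.
Qed.

Lemma itvint_lip a b f B x y : bmeas a b f -> (forall x, a < x < b -> `|f x| <= B) ->
  a < x < b -> a < y < b -> `|itvint a y f - itvint a x f| <= B * `|y - x|.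
Proof.
move=> mf fB; wlog xy : x y / x <= y.
  move=> H xab yab; have [xy|/ltW yx] := leP x y; first exact: H.
  by rewrite distrC (distrC y) H.
move=> xab yab; move: xy; rewrite le_eqVlt => /predU1P[->|xy].
  by rewrite !subrr normr0 mulr0.
have my : bmeas a y f by apply: bmeas_sub mf; lra.
rewrite (@itvint_split a x y f)//; last by lra.
have yx : 0 <= y - x by lra.
rewrite addrAC subrr add0r (ger0_norm yx).
apply: itvint_bound; [exact: ltW|by apply: bmeas_sub mf; lra|].
by move=> z zxy; apply: fB; lra.
Qed.

Lemma itvint_primitive_bound a b f B x : bmeas a b f ->
  (forall x, a < x < b -> `|f x| <= B) -> a < x < b ->
  `|itvint a x f| <= B * (b - a).
Proof.
move=> mf fB xab; have B0 : 0 <= B by apply: le_trans (fB _ xab).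
rewrite (@le_trans _ _ (B * (x - a)))//.
  apply: itvint_bound; [lra|by apply: bmeas_sub mf; lra|].
  by move=> z zxy; apply: fB; lra.
by apply: ler_wpM2l => //; lra.
Qed.

(** A primitive of a bounded function is Lipschitz, hence continuous, hence measurable on the open
    interval. *)
Lemma bmeas_primitive a b f : bmeas a b f -> bmeas a b (fun x => itvint a x f).
Proof.
move=> mf; have [B fB] := mf.2; split; last first.
  by exists (B * (b - a)) => x xab; exact: itvint_primitive_bound.
apply: open_continuous_measurable_fun; first exact: interval_open.
move=> x; rewrite inE/= in_itv/= => xab.
have B0 : 0 <= B by apply: le_trans (fB _ xab).
apply/cvgrPdist_le => e e0; near=> y.
have yab : a < y < b.
  have : y \in `]a, b[ by near: y; apply: near_in_itvoo; rewrite in_itv.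
  by rewrite in_itv.
rewrite distrC (le_trans (itvint_lip mf fB xab yab))//.
rewrite (@le_trans _ _ ((B + 1) * `|y - x|))//; first by
  rewrite ler_wpM2r// lerDl.
have B1 : 0 < B + 1 by lra.
rewrite mulrC -ler_pdivlMr//.
rewrite distrC; near: y; apply: cvgr_dist_le; last by rewrite divr_gt0//; lra.
exact: cvg_id.
Unshelve. all: end_near. Qed.

(* Fubini on the triangle [y < x]. *)
Lemma itvint_by_parts a b g p : a <= b -> bmeas a b g ->
  itvint a b (fun x => itvint a x g * p^`().[x]) =
  p.[b] * itvint a b g - itvint a b (fun x => g x * p.[x]).
Proof.
move=> ab mg; pose D := `]a, b[%classic : set R.
have mD : measurable D by exact: measurable_itv.
have muD : (mu D < +oo)%E.
  by rewrite /D lebesgue_measure_itv/=; case: ifPn => // _; rewrite -EFinB ltry.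
(* [g] is only bounded and measurable, so its primitive need not be differentiable everywhere. Both
   sides are computed from the integral of [g y] times the derivative of [p] at [x] over this
   triangle. *)
pose T := [set z : R * R | z.2 < z.1].
have mT : measurable T.
  have -> : T = (fun z : R * R => z.1 - z.2) @^-1` `]0, +oo[.
    by apply/seteqP; split => z /=; rewrite in_itv/= andbT subr_gt0.
  rewrite -[X in measurable X]setTI.
  by apply: (measurable_funB measurable_fst measurable_snd) => //; exact: measurable_itv.
pose F (z : R * R) : R := g z.2 * p^`().[z.1] * \1_T z.
pose FD := (EFin \o F) \_ (D `*` D).
have mF : measurable_fun (D `*` D) F.
  apply: measurable_funM; last exact: measurable_indic.
  apply: measurable_funM.
    apply: (@measurable_comp _ _ _ _ _ _ D) => //.
    - by move=> _ [z [_ Dz] <-].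
    - exact: mg.1.
    - exact: measurable_funS measurable_snd.
  apply: (@measurable_comp _ _ _ _ _ _ D) => //.
  - by move=> _ [z [Dz _] <-].
  - exact: measurable_poly.
  - exact: measurable_funS measurable_fst.
have iF : (mu \x mu)%E.-integrable setT FD.
  apply: (iffLR (integrable_mkcond (mu := (mu \x mu)%E) (EFin \o F) (measurableX mD mD))).
  apply: measurable_bounded_integrable => //; first exact: measurableX.
    apply: (@le_lt_trans _ _ (mu D * mu D)%E).
      by rewrite le_eqVlt; apply/orP; left; apply/eqP; exact: product_measure1E.
    by rewrite lte_mul_pinfty// ge0_fin_numE.
  have [B gB] := mg.2; have [C pC] := horner_bounded a b p^`().
  exists (B * C); split; first exact: num_real.
  move=> M BM z [/=]; rewrite /D/= !in_itv/= => z1 z2.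
  rewrite /F (le_trans _ (ltW BM))// normrM -[leRHS]mulr1 ler_pM//.
    by rewrite normrM ler_pM// ?gB// pC//; lra.
  by rewrite indicE; case: (_ \in _); rewrite /= ?normr1 ?normr0.
have E1 x : (\int[mu]_y FD (x, y) =
    (((fun x => itvint a x g * p^`().[x]) \_ D) x)%:E)%E.
  rewrite patchE; have [xD|xD] := boolP (x \in D); last first.
    rewrite (eq_integral (fun=> 0%E)) ?integral0// => y _.
    by rewrite /FD patchE memNset// => -[/=]; move: xD; rewrite notin_setE.
  have xab : a < x < b by move: xD; rewrite inE/D/= in_itv.
  have mgx : bmeas a x g by apply: bmeas_sub mg; lra.
  rewrite mulrC -itvintZ// /itvint /Rintegral fineK; last first.
    by apply: integrable_fin_num => //; exact: bmeas_integrable (bmeasZ _ _).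
  rewrite integral_mkcond; apply: eq_integral => y _.
  rewrite /FD !patchE in_setX xD/=; rewrite /F/= indicE.
  have -> : (y \in `]a, x[%classic) = (y \in D) && ((x, y) \in T).
    by apply/idP/andP; rewrite /T /D !inE/= !in_itv/=; [lra|case; lra].
  case: (y \in D) => //=; case: (_ \in T) => /=; last by rewrite mulr0.
  by rewrite mulr1 mulrC.
have E2 y : (\int[mu]_x FD (x, y) =
    (((fun y => g y * (p.[b] - p.[y])) \_ D) y)%:E)%E.
  rewrite patchE; have [yD|yD] := boolP (y \in D); last first.
    rewrite (eq_integral (fun=> 0%E)) ?integral0// => x _.
    by rewrite /FD patchE memNset// => -[/=]; move: yD; rewrite notin_setE.
  have yab : a < y < b by move: yD; rewrite inE/D/= in_itv.
  rewrite -itvint_ftc_poly; last by lra.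
  have mh := bmeas_horner y b p^`().
  rewrite -itvintZ// /itvint /Rintegral fineK; last first.
    by apply: integrable_fin_num => //; exact: bmeas_integrable (bmeasZ _ _).
  rewrite integral_mkcond; apply: eq_integral => x _.
  rewrite /FD !patchE in_setX yD/= andbT; rewrite /F/= indicE.
  have -> : (x \in `]y, b[%classic) = (x \in D) && ((x, y) \in T).
    by apply/idP/andP; rewrite /T /D !inE/= !in_itv/=; [lra|case; lra].
  case: (x \in D) => //=; case: (_ \in T) => /=; last by rewrite mulr0.
  by rewrite mulr1.
have E : (\int[mu]_x (((fun x => itvint a x g * p^`().[x]) \_ D) x)%:E =
    \int[mu]_y (((fun y => g y * (p.[b] - p.[y])) \_ D) y)%:E)%E.
  transitivity (\int[mu]_x \int[mu]_y FD (x, y))%E.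
    by apply: eq_integral => x _; rewrite E1.
  transitivity (\int[mu]_y \int[mu]_x FD (x, y))%E; first exact: Fubini.
  by apply: eq_integral => x _; rewrite E2.
transitivity (itvint a b (fun y => g y * (p.[b] - p.[y]))).
  by rewrite /itvint [LHS]Rintegral_mkcond [RHS]Rintegral_mkcond; exact: (congr1 fine E).
have mgp : bmeas a b (fun x => g x * p.[x]) by apply: bmeasM => //; exact: bmeas_horner.
rewrite -itvintZ// -itvintB//; last exact: bmeasZ.
by apply: itvint_ext => x _; ring.
Qed.

End BoundedMeasurable.

(** * Orthogonal polynomials *)

Definition polydot (R : realType) (a b : R) (p q : {poly R}) : R :=
  itvint a b (fun x => p.[x] * q.[x]).

Section OrthogonalPolynomials.
Context (R : realType).
Implicit Types (a b c x y B : R) (p q : {poly R}).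

Lemma polydotE a b p q : polydot a b p q = itvint a b (horner (p * q)).
Proof. by apply: itvint_ext => x _; rewrite hornerM. Qed.

Lemma polydotC a b p q : polydot a b p q = polydot a b q p.
Proof. by rewrite !polydotE mulrC. Qed.

Lemma polydotDl a b p1 p2 q : polydot a b (p1 + p2) q = polydot a b p1 q + polydot a b p2 q.
Proof.
rewrite !polydotE -itvintD; try exact: bmeas_horner.
by apply: itvint_ext => x _; rewrite -hornerD mulrDl.
Qed.

Lemma polydotZl a b c p q : polydot a b (c *: p) q = c * polydot a b p q.
Proof.
rewrite !polydotE -itvintZ; last exact: bmeas_horner.
by apply: itvint_ext => x _; rewrite -hornerZ scalerAl.
Qed.

Lemma polydotNl a b p q : polydot a b (- p) q = - polydot a b p q.
Proof. by rewrite -scaleN1r polydotZl mulN1r. Qed.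

Lemma polydotBl a b p1 p2 q : polydot a b (p1 - p2) q = polydot a b p1 q - polydot a b p2 q.
Proof. by rewrite polydotDl polydotNl. Qed.

Lemma polydot0l a b q : polydot a b 0 q = 0.
Proof. by rewrite -(scale0r 0) polydotZl mul0r. Qed.

Lemma polydot_suml a b (I : Type) (r : seq I) (P : pred I) (F : I -> {poly R}) q :
  polydot a b (\sum_(i <- r | P i) F i) q = \sum_(i <- r | P i) polydot a b (F i) q.
Proof.
elim: r => [|i r IH]; first by rewrite !big_nil polydot0l.
by rewrite !big_cons; case: (P i); rewrite // polydotDl IH.
Qed.

Lemma polydot_sumr a b (I : Type) (r : seq I) (P : pred I) (F : I -> {poly R}) q :
  polydot a b q (\sum_(i <- r | P i) F i) = \sum_(i <- r | P i) polydot a b q (F i).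
Proof. by rewrite polydotC polydot_suml; apply: eq_bigr => i _; rewrite polydotC. Qed.

Lemma polydot_ge0 a b p : 0 <= polydot a b p p.
Proof. by apply: itvint_ge0 => x _; rewrite -expr2 sqr_ge0. Qed.

Lemma polydot_derivM a b p q : a <= b ->
  polydot a b p^`() q + polydot a b p q^`() = p.[b] * q.[b] - p.[a] * q.[a].
Proof.
move=> ab; rewrite !polydotE -itvintD; try exact: bmeas_horner.
rewrite -!hornerM -itvint_ftc_poly//; apply: itvint_ext => x _.
by rewrite derivM !hornerE.
Qed.

(** A nonzero [p] has fewer than [size p] roots, and the points [a + (b - a) / i.+2] supply that
    many; the shift in [i.+2] keeps them strictly inside. *)
Lemma poly_eq0_itv a b p : a < b -> (forall x, a < x < b -> p.[x] = 0) -> p = 0.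
Proof.
move=> ab p0; apply/eqP; apply: contraT => pn0.
pose s := [seq a + (b - a) / i.+2%:R | i <- iota 0 (size p)].
have us : uniq s.
  rewrite map_inj_uniq ?iota_uniq// => i j /addrI /mulfI.
  rewrite subr_eq0 gt_eqF// => /(_ isT)/invr_inj/eqP.
  by rewrite eqr_nat => /eqP[].
have rs : all (root p) s.
  apply/allP => _ /mapP[i _ ->]; apply/rootP/p0.
  have i0 : 0 < i.+2%:R :> R by rewrite ltr0n.
  rewrite ltrDl divr_gt0 ?subr_gt0//= -ltrBrDl ltr_pdivrMr//.
  by rewrite ltr_pMr ?subr_gt0// ltr1n.
by have := max_poly_roots pn0 rs us; rewrite size_map size_iota ltnn.
Qed.

Lemma poly_primitive p : exists2 q, q^`() = p & (size q <= (size p).+1)%N.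
Proof.
exists (\poly_(i < (size p).+1) (p`_i.-1 / i%:R)); last exact: size_poly.
apply/polyP => i; rewrite coef_deriv coef_poly ltnS.
case: ltnP => [_|ir]; last by rewrite mul0rn nth_default.
by rewrite -[LHS]mulr_natr/= mulfVK// pnatr_eq0.
Qed.

(** A primitive of the square of [p] is nondecreasing; having equal values at both ends, it is
    constant, so its derivative vanishes. *)
Lemma polydot_eq0 a b p : a < b -> polydot a b p p = 0 -> p = 0.
Proof.
move=> ab; rewrite polydotE => I0.
have [q qE _] := poly_primitive (p * p); rewrite -qE in I0.
have q0 x y : x <= y -> q.[x] <= q.[y].
  move=> xy; rewrite -subr_ge0 -itvint_ftc_poly//; apply: itvint_ge0 => z _.
  by rewrite qE hornerM -expr2 sqr_ge0.
have qa x : a < x < b -> (q - (q.[a])%:P).[x] = 0.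
  move=> /andP[ax xb]; rewrite !hornerE; apply/eqP; rewrite subr_eq0 eq_le.
  rewrite (q0 _ _ (ltW ax)) andbT (le_trans (q0 _ _ (ltW xb)))//.
  by move: I0; rewrite itvint_ftc_poly ?(ltW ab)// => /eqP; rewrite subr_eq0 => /eqP ->.
have /(congr1 deriv) := poly_eq0_itv ab qa.
rewrite deriv0 derivB derivC subr0 qE => /eqP.
by rewrite mulf_eq0 orbb => /eqP.
Qed.

(** Gram-Schmidt on the monomials: the new polynomial has exact degree [n], hence a nonzero norm by
    which it can be divided. *)
Lemma orthonormal_polys (n : nat) : exists phi : nat -> {poly R},
  (forall i, (i < n)%N -> size (phi i) = i.+1) /\
  (forall i j, (i < n)%N -> (j < n)%N -> polydot 0 1 (phi i) (phi j) = (i == j)%:R).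
Proof.
elim: n => [|n [phi [sphi ophi]]]; first by exists (fun=> 0).
pose w := 'X^n - \sum_(i < n) polydot 0 1 'X^n (phi i) *: phi i.
have ss : (size (\sum_(i < n) polydot 0 1 'X^n (phi i) *: phi i)%R <= n)%N.
  apply: (leq_trans (size_sum _ _ _)); apply/bigmax_leqP => i _.
  by rewrite (leq_trans (size_scale_leq _ _))// sphi.
have sw : size w = n.+1 by rewrite size_polyDl size_polyXn// size_polyN.
have w0 : w != 0 by rewrite -size_poly_eq0 sw.
have ow i : (i < n)%N -> polydot 0 1 w (phi i) = 0.
  move=> ni; rewrite polydotBl polydot_suml (bigD1 (Ordinal ni))//= big1 => [|j ji].
    by rewrite polydotZl ophi// eqxx mulr1 addr0 subrr.
  rewrite polydotZl ophi//; have -> : (j == i :> nat) = false by exact/negbTE.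
  by rewrite mulr0.
have pw : 0 < polydot 0 1 w w.
  rewrite lt_neqAle polydot_ge0 andbT eq_sym; apply: contra w0 => /eqP.
  by move/polydot_eq0 => ->.
pose c := (Num.sqrt (polydot 0 1 w w))^-1.
have c0 : c != 0 by rewrite invr_eq0 sqrtr_eq0 -ltNge.
exists (fun i => if (i < n)%N then phi i else c *: w); split.
  move=> i; rewrite ltnS => ni; case: ltnP => [/sphi//|ni'].
  have -> : i = n by apply/eqP; rewrite eqn_leq ni ni'.
  by rewrite size_scale.
move=> i j; rewrite !ltnS => ni nj.
case: ltnP => ni'; case: ltnP => nj'; first exact: ophi.
- rewrite polydotC polydotZl ow// mulr0.
  by have -> : (i == j) = false by apply/negbTE; rewrite neq_ltn (leq_trans ni').
- rewrite polydotZl ow// mulr0.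
  by have -> : (i == j) = false by apply/negbTE; rewrite neq_ltn (leq_trans nj')// orbT.
have -> : i = n by apply/eqP; rewrite eqn_leq ni ni'.
have -> : j = n by apply/eqP; rewrite eqn_leq nj nj'.
rewrite eqxx polydotZl polydotC polydotZl mulrA -expr2 exprVn sqr_sqrtr ?ltW// mulVf//.
by rewrite gt_eqF.
Qed.

Lemma poly_combination (phi : nat -> {poly R}) (n : nat) p :
  (forall i, (i < n)%N -> size (phi i) = i.+1) -> (size p <= n)%N ->
  exists d : nat -> R, p = \sum_(i < n) d i *: phi i.
Proof.
elim: n p => [|n IH] p sphi sp.
  exists (fun=> 0); rewrite big_ord0; apply/eqP.
  by rewrite -size_poly_eq0 -leqn0.
have sn : size (phi n) = n.+1 by exact: sphi.
have ln : (phi n)`_n != 0.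
  have -> : (phi n)`_n = lead_coef (phi n) by rewrite lead_coefE sn.
  by rewrite lead_coef_eq0 -size_poly_eq0 sn.
have [i ni||d dE] := IH (p - (p`_n / (phi n)`_n) *: phi n).
  by apply: sphi; exact: ltnW.
  apply/leq_sizeP => j; rewrite leq_eqVlt => /predU1P[<-|nj].
    by rewrite coefB coefZ mulfVK// subrr.
  have fj : (phi n)`_j = 0 by rewrite nth_default// sn.
  by rewrite coefB coefZ fj (nth_default _ (leq_trans sp nj)) mulr0 subr0.
exists (fun i => if i == n then p`_n / (phi n)`_n else d i).
rewrite big_ord_recr/= eqxx; apply/eqP; rewrite -subr_eq; apply/eqP.
rewrite dE; apply: eq_bigr => i _.
by have -> : (i == n :> nat) = false by apply/negbTE; rewrite neq_ltn ltn_ord.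
Qed.

(* [int (x L^2)' = (2k + 1) int L^2] and [int (L^2)' = 0] by orthogonality. *)
Lemma orthonormal_poly_ends (k : nat) (L : {poly R}) : size L = k.+1 ->
  (forall q, (size q <= k)%N -> polydot 0 1 L q = 0) -> polydot 0 1 L L = 1 ->
  L.[0] ^+ 2 = (k.*2.+1)%:R /\ L.[1] ^+ 2 = (k.*2.+1)%:R.
Proof.
move=> sL oL nL.
have sL' : (size L^`() <= k)%N.
  by rewrite -ltnS -sL lt_size_deriv// -size_poly_eq0 sL.
have pLL' : polydot 0 1 L L^`() = 0 by exact: oL.
have E0 : L.[1] * L.[1] = L.[0] * L.[0].
  have := polydot_derivM L L (@ler01 R).
  by rewrite polydotC pLL' addr0 => /eqP; rewrite eq_sym subr_eq0 => /eqP.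
have E1 : polydot 0 1 L ('X * L^`()) = k%:R.
  have : polydot 0 1 L ('X * L^`() - k%:R *: L) = 0.
    apply: oL; apply/leq_sizeP => j; rewrite coefB coefXM coefZ coef_deriv.
    case: j => [|j]; first by case: (k) => [|?]; rewrite //= mul0r subrr.
    rewrite /= leq_eqVlt => /predU1P[->|kj].
      by rewrite -[in X in X - _]mulr_natl subrr.
    by rewrite !nth_default ?sL ?mul0rn ?mulr0 ?subrr.
  rewrite polydotC polydotBl polydotZl nL mulr1 polydotC => /eqP.
  by rewrite subr_eq0 => /eqP.
have E2 : L.[1] * L.[1] = (k.*2.+1)%:R.
  have := polydot_derivM ('X * L) L (@ler01 R).
  rewrite derivM derivX mul1r polydotDl nL !hornerE subr0 => <-.
  rewrite polydotC E1; have -> : polydot 0 1 ('X * L) L^`() = polydot 0 1 L ('X * L^`()).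
    by rewrite !polydotE; congr (itvint _ _ (horner _)); ring.
  by rewrite E1 -addn1 natrD -addnn natrD; ring.
by split; rewrite expr2 -?E0.
Qed.

Definition to_ref a b : {poly R} := (b - a)^-1 *: ('X - a%:P).
Definition of_ref a b : {poly R} := (b - a) *: 'X + a%:P.

Lemma of_refK a b p : a < b -> (p \Po of_ref a b) \Po to_ref a b = p.
Proof.
move=> ab; have ba : b - a != 0 by rewrite subr_eq0 gt_eqF.
rewrite -comp_polyA /of_ref comp_polyD comp_polyZ comp_polyX comp_polyC.
by rewrite /to_ref scalerA mulfV// scale1r subrK comp_polyXr.
Qed.

Lemma to_refK a b p : a < b -> (p \Po to_ref a b) \Po of_ref a b = p.
Proof.
move=> ab; have ba : b - a != 0 by rewrite subr_eq0 gt_eqF.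
rewrite -comp_polyA /to_ref comp_polyZ comp_polyB comp_polyX comp_polyC.
by rewrite /of_ref addrK scalerA mulVf// scale1r comp_polyXr.
Qed.

Lemma size_to_ref a b p : a < b -> size (p \Po to_ref a b) = size p.
Proof.
move=> ab; have ba : (b - a)^-1 != 0 by rewrite invr_eq0 subr_eq0 gt_eqF.
by apply: size_comp_poly2; rewrite size_scale// size_XsubC.
Qed.

Lemma size_of_ref a b p : a < b -> size (p \Po of_ref a b) = size p.
Proof. by move=> ab; rewrite -[in RHS](of_refK p ab) size_to_ref. Qed.

Lemma polydot_of_ref a b p q : a < b ->
  polydot a b p q = (b - a) * polydot 0 1 (p \Po of_ref a b) (q \Po of_ref a b).
Proof.
move=> ab; rewrite !polydotE -comp_polyM.
have [r rE _] := poly_primitive (p * q); rewrite -rE itvint_ftc_poly ?(ltW ab)//.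
rewrite -itvintZ; last exact: bmeas_horner.
have E : (r \Po of_ref a b)^`() = (b - a) *: (r^`() \Po of_ref a b).
  rewrite deriv_comp /of_ref derivD derivZ derivX derivC addr0.
  by rewrite -scalerAr mulr1.
transitivity (itvint 0 1 (horner (r \Po of_ref a b)^`())); last first.
  by apply: itvint_ext => x _; rewrite E hornerZ.
rewrite itvint_ftc_poly// !horner_comp /of_ref !hornerE.
by congr (r.[_] - r.[_]); ring.
Qed.

(** Obtained by choice: only degrees and orthonormality up to index [k] are known, which
    characterises the normalised shifted Legendre polynomials up to sign. *)
Definition legendre (k : nat) : nat -> {poly R} := sval (cid (orthonormal_polys k.+1)).

Lemma size_legendre k i : (i <= k)%N -> size (legendre k i) = i.+1.
Proof. by rewrite /legendre; case: cid => /= f [+ _]; exact. Qed.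

Lemma legendre_ortho k i j : (i <= k)%N -> (j <= k)%N ->
  polydot 0 1 (legendre k i) (legendre k j) = (i == j)%:R.
Proof. by rewrite /legendre; case: cid => /= f [_]; exact. Qed.

Lemma legendre_ortho_ord k (i j : 'I_k.+1) :
  polydot 0 1 (legendre k i) (legendre k j) = (i == j)%:R.
Proof. by apply: legendre_ortho; rewrite -ltnS. Qed.

Lemma legendre_expand k p : (size p <= k.+1)%N ->
  p = \sum_(i < k.+1) polydot 0 1 p (legendre k i) *: legendre k i.
Proof.
move=> /(poly_combination (phi := legendre k))[i ik|d pE].
  by rewrite size_legendre// -ltnS.
rewrite {1}pE; apply: eq_bigr => i _; congr (_ *: _).
rewrite pE polydot_suml (bigD1 i)//= big1 => [|j ji].
  by rewrite polydotZl legendre_ortho_ord eqxx mulr1 addr0.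
by rewrite polydotZl legendre_ortho_ord (negbTE ji) mulr0.
Qed.

Lemma legendre_last_orth k q : (size q <= k)%N -> polydot 0 1 (legendre k k) q = 0.
Proof.
move=> /(poly_combination (phi := legendre k))[i ik|d ->].
  by rewrite size_legendre// ltnW.
rewrite polydot_sumr big1// => i _; rewrite polydotC polydotZl (legendre_ortho (ltnW (ltn_ord
  i)) (leqnn k)).
by rewrite (_ : (i == k :> nat) = false) ?mulr0// ltn_eqF.
Qed.

Definition itv_basis (k : nat) a b (i : nat) : {poly R} :=
  (Num.sqrt (b - a))^-1 *: (legendre k i \Po to_ref a b).

Lemma size_itv_basis k a b i : a < b -> (i <= k)%N -> size (itv_basis k a b i) = i.+1.
Proof.
move=> ab ik; rewrite size_scale ?size_to_ref ?size_legendre//.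
by rewrite invr_eq0 sqrtr_eq0 -ltNge subr_gt0.
Qed.

Lemma itv_basis_expand k a b p : a < b -> (size p <= k.+1)%N ->
  p = \sum_(i < k.+1) polydot a b p (itv_basis k a b i) *: itv_basis k a b i.
Proof.
move=> ab sp; have ba : 0 < b - a by rewrite subr_gt0.
have := legendre_expand (p := p \Po of_ref a b).
rewrite size_of_ref// => /(_ _ sp)/(congr1 (fun q => q \Po to_ref a b)).
rewrite of_refK// => {1}->; rewrite raddf_sum/=; apply: eq_bigr => i _.
transitivity (polydot 0 1 (p \Po of_ref a b) (legendre k i) *: (legendre k i \Po to_ref a b)).
  exact: comp_polyZ.
have -> : polydot a b p (itv_basis k a b i) =
    (b - a) * ((Num.sqrt (b - a))^-1 * polydot 0 1 (p \Po of_ref a b) (legendre k i)).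
  rewrite polydot_of_ref// /itv_basis comp_polyZ to_refK//; congr (_ * _).
  by rewrite polydotC polydotZl polydotC.
rewrite /itv_basis scalerA.
congr (_ *: _); have s2 : Num.sqrt (b - a) ^+ 2 = b - a by rewrite sqr_sqrtr ?ltW.
have s0 : Num.sqrt (b - a) != 0 by rewrite sqrtr_eq0 -ltNge.
by rewrite -[X in _ = X * _ / _]s2; field.
Qed.

Lemma itv_basis_parseval k a b p q : a < b -> (size p <= k.+1)%N ->
  polydot a b p q = \sum_(i < k.+1) polydot a b p (itv_basis k a b i) * polydot a b q (itv_basis
    k a b i).
Proof.
move=> ab sp; rewrite {1}(itv_basis_expand ab sp) polydot_suml; apply: eq_bigr => i _.
by rewrite polydotZl; congr (_ * _); exact: polydotC.
Qed.

Lemma itv_basis_ortho k a b i j : a < b -> (i <= k)%N -> (j <= k)%N ->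
  polydot a b (itv_basis k a b i) (itv_basis k a b j) = (i == j)%:R.
Proof.
move=> ab ik jk; have ba : 0 < b - a by rewrite subr_gt0.
rewrite polydotZl polydotC polydotZl polydotC polydot_of_ref// !to_refK// legendre_ortho// !mulrA.
by rewrite -invfM -expr2 sqr_sqrtr ?ltW// mulVf ?mul1r// gt_eqF.
Qed.

Lemma legendre_bounded k : exists2 M : R, 0 < M &
  forall i x, (i <= k)%N -> 0 <= x <= 1 -> `|(legendre k i).[x]| <= M.
Proof.
have /choice[M MP] : forall i : nat, exists B, forall x, 0 <= x <= 1 -> `|(legendre k i).[x]| <= B.
  by move=> i; exact: horner_bounded.
have M0 i : 0 <= M i by rewrite (le_trans _ (MP i 0 _))// lexx ler01.
exists (1 + \sum_(i < k.+1) M i).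
  by rewrite ltr_pwDl// sumr_ge0.
move=> i x ik x01; rewrite (le_trans (MP i x x01))//.
rewrite -ltnS in ik; rewrite (bigD1 (Ordinal ik))//= addrCA lerDl.
by rewrite addr_ge0// sumr_ge0.
Qed.

(** The inverse estimate between maximum and L2 norm. On the reference interval each Legendre
    coefficient is at most the L2 norm, by Parseval, and [k.+1] terms are summed; [b - a] comes from
    the change of variable. *)
Lemma sup_sqr_le_polydot k : exists2 C : R, 0 < C & forall a b p x, a < b ->
  (size p <= k.+1)%N -> a <= x <= b -> p.[x] ^+ 2 <= C / (b - a) * polydot a b p p.
Proof.
have [M M0 MP] := legendre_bounded k.
exists ((k.+1%:R * M) ^+ 2); first by rewrite exprn_gt0// mulr_gt0.
move=> a b p x ab sp xab; have ba : 0 < b - a by rewrite subr_gt0.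
rewrite polydot_of_ref// mulrA mulfVK ?gt_eqF//.
pose y := (x - a) / (b - a).
have y01 : 0 <= y <= 1.
  by rewrite divr_ge0 ?ler_pdivrMr//=; lra.
have -> : p.[x] = (p \Po of_ref a b).[y].
  rewrite horner_comp; congr (p.[_]); rewrite /of_ref hornerD hornerZ hornerX hornerC /y.
  by rewrite mulrC divfK ?subrK ?gt_eqF.
move: (p \Po _) (size_of_ref p ab) => q sq; rewrite -sq in sp.
pose s := Num.sqrt (polydot 0 1 q q).
have cs (i : 'I_k.+1) : `|polydot 0 1 q (legendre k i)| <= s.
  rewrite -sqrtr_sqr ler_wsqrtr//.
  have -> : polydot 0 1 q q = \sum_(j < k.+1) polydot 0 1 q (legendre k j) ^+ 2.
    rewrite {1}(legendre_expand sp) polydot_suml; apply: eq_bigr => j _.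
    by rewrite polydotZl expr2; congr (_ * _); exact: polydotC.
  by rewrite (bigD1 i)//= lerDl sumr_ge0// => j _; rewrite sqr_ge0.
have qy : `|q.[y]| <= k.+1%:R * M * s.
  rewrite (legendre_expand sp) horner_sum (le_trans (ler_norm_sum _ _ _))//.
  rewrite (@le_trans _ _ (\sum_(i < k.+1) M * s))//.
    by apply: ler_sum => i _; rewrite hornerZ normrM mulrC ler_pM// MP// -ltnS.
  by rewrite sumr_const card_ord -mulrA mulr_natl.
rewrite -[polydot _ _ _ _]sqr_sqrtr ?polydot_ge0// -exprMn -real_normK ?num_real//.
rewrite lerXn2r// nnegrE !mulr_ge0 ?sqrtr_ge0 ?ler0n//.
exact: ltW.
Qed.

(** Deliberately not normalised on [(a, b)]: its end values are then the same on all cells, so the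
    cyclic systems below have constant coefficients. *)
Definition leg_top (k : nat) a b : {poly R} := legendre k k \Po to_ref a b.

Lemma size_leg_top k a b : a < b -> size (leg_top k a b) = k.+1.
Proof. by move=> ab; rewrite size_to_ref// size_legendre. Qed.

Lemma leg_top_orth k a b q : a < b -> (size q <= k)%N -> polydot a b (leg_top k a b) q = 0.
Proof.
move=> ab sq; rewrite polydot_of_ref// to_refK// legendre_last_orth ?mulr0//.
by rewrite size_of_ref.
Qed.

Lemma leg_top_bounded k : exists2 M : R, 0 < M &
  forall a b x, a < b -> a <= x <= b -> `|(leg_top k a b).[x]| <= M.
Proof.
have [M M0 MP] := legendre_bounded k; exists M => // a b x ab xab.
have ba : 0 < b - a by rewrite subr_gt0.
rewrite horner_comp /to_ref !hornerE MP// mulrC.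
by rewrite divr_ge0 ?ler_pdivrMr//=; lra.
Qed.

(** Moments against degrees below [k] determine [p] up to a multiple of the top Legendre polynomial.
    The remaining part [p1] is tested with itself and bounded through the inverse estimate. *)
Lemma moments_bound k : exists2 C : R, 0 < C & forall a b p (g : R -> R) B, a < b ->
  (size p <= k.+1)%N -> bmeas a b g -> (forall x, a < x < b -> `|g x| <= B) ->
  (forall q, (size q <= k)%N -> itvint a b (fun x => (p.[x] - g x) * q.[x]) = 0) ->
  exists c p1, p = p1 + c *: leg_top k a b /\
    forall x, a <= x <= b -> `|p1.[x]| <= C * B.
Proof.
have [C C0 CP] := sup_sqr_le_polydot k; exists C => // a b p g B ab sp mg gB pg.
have ba : 0 < b - a by rewrite subr_gt0.
have B0 : 0 <= B.
  by rewrite (le_trans (normr_ge0 (g ((a + b) / 2))))// gB//; lra.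
have sL := size_leg_top k ab; set L := leg_top k a b in sL *.
have Lk : L`_k != 0.
  have -> : L`_k = lead_coef L by rewrite lead_coefE sL.
  by rewrite lead_coef_eq0 -size_poly_eq0 sL.
pose p1 := p - (p`_k / L`_k) *: L.
have sp1 : (size p1 <= k)%N.
  apply/leq_sizeP => j; rewrite leq_eqVlt => /predU1P[<-|nj].
    by rewrite coefB coefZ mulfVK// subrr.
  have fj : L`_j = 0 by rewrite nth_default// sL.
    by rewrite coefB coefZ fj (nth_default _ (leq_trans sp nj)) mulr0 subr0.
exists (p`_k / L`_k), p1; split; first by rewrite subrK.
have E : polydot a b p1 p1 = itvint a b (fun x => g x * p1.[x]).
  rewrite {1}/p1 polydotBl polydotZl leg_top_orth// mulr0 subr0.
  have := pg _ sp1; rewrite (itvint_ext (g := fun x => p.[x] * p1.[x] - g x * p1.[x])).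
    rewrite itvintB; [|exact: bmeasM (bmeas_horner _ _ _) (bmeas_horner _ _ _)|exact: bmeasM mg
      (bmeas_horner _ _ _)].
    by move=> /eqP; rewrite subr_eq0 => /eqP.
  by move=> x _; rewrite mulrBl.
pose S := Num.sqrt (C / (b - a) * polydot a b p1 p1).
have S0 : 0 <= C / (b - a) * polydot a b p1 p1.
  by rewrite mulr_ge0 ?polydot_ge0// divr_ge0// ltW.
have p1S x : a <= x <= b -> `|p1.[x]| <= S.
  by move=> xab; rewrite -sqrtr_sqr ler_wsqrtr// CP// (leq_trans sp1).
suff SC : S <= C * B by move=> x /p1S/le_trans; apply.
(* [S] is the bound that the inverse estimate gives for [p1]; testing yields a quadratic inequality
   for it, from which one factor is cancelled. *)
have : S ^+ 2 <= C * B * S.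
  rewrite sqr_sqrtr// E mulrAC ler_pdivrMr// -!mulrA (ler_wpM2l (ltW C0))//.
  apply: (le_trans (ler_norm _)); rewrite mulrA; apply: itvint_bound; first exact: ltW.
    by apply: bmeasM => //; exact: bmeas_horner.
  by move=> x xab; rewrite normrM ler_pM ?gB// p1S//; lra.
have : 0 <= S by exact: sqrtr_ge0.
rewrite le_eqVlt => /predU1P[<- _|S1]; first by rewrite mulr_ge0// ltW.
by rewrite expr2 ler_pM2r.
Qed.

End OrthogonalPolynomials.

(** * Divided differences *)

Lemma cvg_sum_seq (R : realType) (T : Type) (F : set_system T) {FF : Filter F}
    (I : eqType) (r : seq I) (h : I -> T -> R) (l : I -> R) :
  (forall i, i \in r -> h i x @[x --> F] --> l i) ->
  \sum_(i <- r) h i x @[x --> F] --> \sum_(i <- r) l i.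
Proof.
elim: r => [|i r IH] H.
  by rewrite big_nil; under eq_fun do rewrite big_nil; exact: cvg_cst.
rewrite big_cons; under eq_fun do rewrite big_cons.
apply: cvgD; first by apply: H; rewrite mem_head.
by apply: IH => j jr; apply: H; rewrite inE jr orbT.
Qed.

Lemma near_all_seq (T : Type) (F : set_system T) {FF : Filter F}
    (I : eqType) (r : seq I) (P : I -> T -> Prop) :
  (forall i, i \in r -> \forall x \near F, P i x) ->
  \forall x \near F, forall i, i \in r -> P i x.
Proof.
elim: r => [|i r IH] H; first by apply: nearW.
have H1 := IH (fun j jr => H j (mem_behead (s := i :: r) jr)).
have := H i (mem_head _ _); apply: filterS2 H1 => x H1 H2 j.
by rewrite inE => /predU1P[->|/H1].
Qed.

(* Divided differences of [u] of any order make sense although [u] is only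
   four times differentiable, and they commute with time differences. *)
Definition divdiff (R : realType) (f : R -> R) (ys : seq R) : R :=
  \sum_(y <- ys) f y / \prod_(z <- ys | z != y) (y - z).

(** Stands for a bound on the derivative of order [m] divided by m!. As only distinct points occur,
    it makes sense without any differentiability. *)
Definition divdiff_bounded (R : realType) (m : nat) (K a b : R) (f : R -> R) : Prop :=
  forall ys, uniq ys -> size ys = m.+1 -> (forall y, y \in ys -> a < y < b) ->
  `|divdiff f ys| <= K.

Section DividedDifferences.
Context (R : realType).
Implicit Types (a b c x y z K e : R) (f g : R -> R) (p q : {poly R}) (s t ys : seq R).

Lemma divdiff_perm f s t : perm_eq s t -> divdiff f s = divdiff f t.
Proof.
move=> st; rewrite /divdiff (perm_big _ st)/=; apply: eq_bigr => y _.
by rewrite (perm_big _ st).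
Qed.

Lemma divdiff_ext f g s : (forall y, y \in s -> f y = g y) -> divdiff f s = divdiff g s.
Proof. by move=> fg; apply: eq_big_seq => y ys; rewrite fg. Qed.

Lemma divdiffD f g s : divdiff (fun x => f x + g x) s = divdiff f s + divdiff g s.
Proof. by rewrite -big_split/=; apply: eq_bigr => y _; rewrite mulrDl. Qed.

Lemma divdiffZ c f s : divdiff (fun x => c * f x) s = c * divdiff f s.
Proof. by rewrite /divdiff big_distrr/=; apply: eq_bigr => y _; rewrite mulrA. Qed.

Lemma divdiffN f s : divdiff (fun x => - f x) s = - divdiff f s.
Proof. by rewrite -mulN1r -divdiffZ; apply: divdiff_ext => y _; rewrite mulN1r. Qed.

Lemma divdiffB f g s : divdiff (fun x => f x - g x) s = divdiff f s - divdiff g s.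
Proof. by rewrite divdiffD divdiffN. Qed.

Lemma prod_sub_neq0 y s : \prod_(z <- s | z != y) (y - z) != 0.
Proof.
rewrite prodf_seq_neq0; apply/allP => z _; apply/implyP => zy.
by rewrite subr_eq0 eq_sym.
Qed.

(** Partial fractions term by term: [(x - y) / ((j - x) * (j - y))] is [1 / (j - x) - 1 / (j - y)].
    The terms at [x] and [y] are treated apart. *)
Lemma divdiff_recr f x y s : uniq (x :: y :: s) ->
  divdiff f (x :: y :: s) * (x - y) = divdiff f (x :: s) - divdiff f (y :: s).
Proof.
move=> /= /andP[]; rewrite inE negb_or => /andP[xy xs] /andP[ys us].
have xy0 : x - y != 0 by rewrite subr_eq0.
have yx0 : y - x != 0 by rewrite subr_eq0 eq_sym.
have P w : w \notin s -> \prod_(z <- s | z != w) (w - z) = \prod_(z <- s) (w - z).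
  move=> ws; rewrite big_seq_cond [RHS]big_seq; apply: eq_bigl => z.
  by have [zs|//] := boolP (z \in s); apply: contraNneq ws => <-.
rewrite /divdiff !big_cons !eqxx/= xy (eq_sym y x) (negbTE xy)/= !P//.
have px : \prod_(z <- s) (x - z) != 0 by rewrite -P// prod_sub_neq0.
have py : \prod_(z <- s) (y - z) != 0 by rewrite -P// prod_sub_neq0.
set X := \prod_(z <- s) (x - z) in px *; set Y := \prod_(z <- s) (y - z) in py *.
have -> : \sum_(j <- s) f j / \prod_(z <- [:: x, y & s] | z != j) (j - z) =
   \sum_(j <- s) f j / ((j - x) * (j - y) * \prod_(z <- s | z != j) (j - z)).
  apply: eq_big_seq => j js; rewrite !big_cons.
  have -> : x != j by apply: contraNneq xs => ->.
  have -> : y != j by apply: contraNneq ys => ->.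
  by rewrite mulrA.
have -> : \sum_(j <- s) f j / \prod_(z <- x :: s | z != j) (j - z) =
   \sum_(j <- s) f j / ((j - x) * \prod_(z <- s | z != j) (j - z)).
  apply: eq_big_seq => j js; rewrite !big_cons.
  by have -> : x != j by apply: contraNneq xs => ->.
have -> : \sum_(j <- s) f j / \prod_(z <- y :: s | z != j) (j - z) =
   \sum_(j <- s) f j / ((j - y) * \prod_(z <- s | z != j) (j - z)).
  apply: eq_big_seq => j js; rewrite !big_cons.
  by have -> : y != j by apply: contraNneq ys => ->.
rewrite addrA mulrDl big_distrl/= opprD addrACA -sumrB; congr (_ + _).
  by field; rewrite xy0 px py yx0.
apply: eq_big_seq => j js; have := prod_sub_neq0 j s; set J := \prod_(_ <- _ | _) _ => J0.
have jx : j - x != 0 by rewrite subr_eq0; apply: contraNneq xs => <-.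
have jy : j - y != 0 by rewrite subr_eq0; apply: contraNneq ys => <-.
by field; rewrite jx jy J0.
Qed.

Definition lagrange f s : {poly R} :=
  \sum_(y <- s) (f y / \prod_(z <- s | z != y) (y - z)) *:
     \prod_(z <- s | z != y) ('X - z%:P).

Lemma size_count_neq y s : uniq s -> y \in s ->
  size s = (count (fun z => z != y) s).+1.
Proof.
move=> us ys; rewrite -(count_predC (pred1 y) s) (count_uniq_mem y us) ys add1n.
by congr _.+1; apply: eq_count.
Qed.

Lemma horner_prod_sub (P : pred R) x s :
  (\prod_(z <- s | P z) ('X - z%:P)).[x] = \prod_(z <- s | P z) (x - z).
Proof. by rewrite horner_prod; apply: eq_bigr => z _; rewrite hornerXsubC. Qed.

Lemma size_lagrange f s : uniq s -> (size (lagrange f s) <= size s)%N.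
Proof.
move=> us; rewrite /lagrange big_seq_cond (leq_trans (size_sum _ _ _))//.
apply/bigmax_leqP_seq => y ys _; rewrite (leq_trans (size_scale_leq _ _))//.
by rewrite -big_filter size_prod_XsubC size_filter (size_count_neq us ys).
Qed.

(** Newton's form of the interpolation error, obtained by comparing the coefficient of each value
    [f y] separately. *)
Lemma lagrange_newton f x s : uniq (x :: s) ->
  f x = (lagrange f s).[x] + divdiff f (x :: s) * \prod_(y <- s) (x - y).
Proof.
move=> /= /andP[xs us].
have P w : w \notin s -> \prod_(z <- s | z != w) (w - z) = \prod_(z <- s) (w - z).
  move=> ws; rewrite big_seq_cond [RHS]big_seq; apply: eq_bigl => z.
  by have [zs|//] := boolP (z \in s); apply: contraNneq ws => <-.
have px := prod_sub_neq0 x s; rewrite (P _ xs) in px.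
rewrite /divdiff !big_cons eqxx/= (P _ xs) mulrDl mulfVK// addrCA.
rewrite /lagrange horner_sum big_distrl/= -big_split/= big_seq big1 ?addr0//.
move=> y ys; have py := prod_sub_neq0 y s.
have xy : x != y by apply: contraNneq xs => ->.
have xy0 : x - y != 0 by rewrite subr_eq0.
have yx0 : y - x != 0 by rewrite subr_eq0 eq_sym.
rewrite hornerZ big_cons xy horner_prod_sub.
rewrite [X in _ + _ * X](bigD1_seq y)//=; set A := \prod_(z <- s | z != y) (y - z) in py *.
set B := \prod_(_ <- _ | _) _.
by field; rewrite py yx0.
Qed.

Lemma lagrange_interp f x s : uniq s -> x \in s -> (lagrange f s).[x] = f x.
Proof.
move=> us xs; rewrite /lagrange horner_sum (bigD1_seq x)//= hornerZ horner_prod_sub.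
rewrite mulfVK ?prod_sub_neq0// big_seq_cond big1 ?addr0// => y /andP[ys yx].
rewrite hornerZ horner_prod_sub [X in _ * X](_ : _ = 0) ?mulr0//.
apply/eqP; rewrite prodf_seq_eq0; apply/hasP; exists x => //.
by rewrite eq_sym yx/= subrr.
Qed.

Lemma coef_lagrange f s n : uniq s -> size s = n.+1 -> (lagrange f s)`_n = divdiff f s.
Proof.
move=> us sn; rewrite /lagrange coef_sum /divdiff; apply: eq_big_seq => y ys.
rewrite coefZ -big_filter.
have smooth : size (\prod_(z <- [seq z <- s | z != y]) ('X - z%:P)) = n.+1.
  by rewrite size_prod_XsubC size_filter -sn (size_count_neq us ys).
have : \prod_(z <- [seq z <- s | z != y]) ('X - z%:P) \is monic.
  exact: monic_prod_XsubC.
by move/monicP; rewrite lead_coefE smooth/= big_filter => ->; rewrite mulr1 big_filter.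
Qed.

Lemma rolle_seq (F F' : R -> R) a b y0 s :
  (forall x, a < x < b -> is_derive x 1 F (F' x)) ->
  path <%R y0 s -> (forall y, y \in y0 :: s -> a < y < b) ->
  (forall y, y \in y0 :: s -> F y = 0) ->
  exists t, [/\ size t = size s, sorted <%R t &
    forall z, z \in t -> [/\ a < z < b, y0 < z & F' z = 0]].
Proof.
move=> dF; elim: s y0 => [|y1 s IH] y0 /= ps sab F0; first by exists [::].
move: ps => /andP[y01 ps].
have [|||t [st sot tP]] := IH y1 => //.
- by move=> y ys; apply: sab; rewrite inE ys orbT.
- by move=> y ys; apply: F0; rewrite inE ys orbT.
have y0ab : a < y0 < b by apply: sab; rewrite mem_head.
have y1ab : a < y1 < b by apply: sab; rewrite !inE eqxx orbT.
have [|||z] := @Rolle R F y0 y1 y01.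
- by move=> x; rewrite in_itv/= => xy; have [] := dF x ltac:(lra).
- apply: derivable_within_continuous => x; rewrite in_itv/= => xy.
  by have [] := dF x ltac:(lra).
- by rewrite !F0 ?mem_head// !inE eqxx orbT.
rewrite in_itv/= => zy dz; exists (z :: t); split => /=.
- by rewrite st.
- rewrite path_min_sorted//; apply/allP => w /tP[_ y1w _].
  by rewrite (lt_trans _ y1w)//; case/andP: zy.
move=> w; rewrite inE => /predU1P[->|/tP[wab y1w F'w]]; last first.
  by split => //; exact: lt_trans y1w.
split; [lra|by case/andP: zy|].
have dFz : is_derive z 1 F (F' z) by apply: dF; lra.
by have <- := @derive_val _ _ _ _ _ _ _ dFz; exact: derive_val.
Qed.

Lemma rolle_iter (F : nat -> R -> R) n a b s :
  (forall i x, (i < n)%N -> a < x < b -> is_derive x 1 (F i) (F i.+1 x)) ->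
  sorted <%R s -> size s = n.+1 -> (forall y, y \in s -> a < y < b) ->
  (forall y, y \in s -> F 0%N y = 0) -> exists2 x, a < x < b & F n x = 0.
Proof.
elim: n F s => [|n IH] F [|y0 s]//= dF ss [sn] sab F0.
  by exists y0; [apply: sab|apply: F0]; rewrite mem_head.
have [t [st sot tP]] := rolle_seq (dF 0%N ^~ isT) ss sab F0.
apply: (IH (fun i => F i.+1) t) => //; rewrite ?st//.
- by move=> i x ni; exact: dF.
- by move=> y /tP[].
- by move=> y /tP[].
Qed.

(** Rolle's theorem, iterated [n] times, for the difference between [F 0] and its Lagrange
    interpolant, whose leading coefficient is the divided difference. *)
Lemma divdiff_mvt (F : nat -> R -> R) n a b s :
  (forall i x, (i < n)%N -> a < x < b -> is_derive x 1 (F i) (F i.+1 x)) ->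
  uniq s -> size s = n.+1 -> (forall y, y \in s -> a < y < b) ->
  exists2 x, a < x < b & divdiff (F 0%N) s * n`!%:R = F n x.
Proof.
move=> dF us sn sab; pose L := lagrange (F 0%N) s.
pose G i x := F i x - (L^`(i)).[x].
have [|||||x xab Gx] := @rolle_iter G n a b (sort <=%R s).
- move=> i x ni xab; apply: is_deriveB; exact: dF.
- by rewrite sort_lt_sorted.
- by rewrite size_sort.
- by move=> y; rewrite mem_sort; exact: sab.
- by move=> y; rewrite mem_sort => ys; rewrite /G derivn0 lagrange_interp// subrr.
exists x => //; move: Gx => /eqP; rewrite subr_eq0 => /eqP ->.
have sL : (size L <= n.+1)%N by rewrite -sn size_lagrange.
rewrite (size1_polyC (p := L^`(n))).
  by rewrite hornerC coef_derivn addn0 coef_lagrange// ffactnn mulr_natr.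
apply/leq_sizeP => j j0; rewrite coef_derivn nth_default ?mul0rn//.
by rewrite (leq_trans sL)//; lia.
Qed.

(** The points of [s] are shifted one at a time, those already shifted being collected in [t]. By
    the recurrence each exchange costs [e] times a divided difference of the next order, whence the
    factor [size s]. *)
Lemma divdiff_shift_bound m K a b f e s t :
  divdiff_bounded m.+1 K a b f -> (forall y, y \in s -> a < y < b) ->
  (forall y, y \in s -> a < y + e < b) -> (forall y, y \in t -> a < y < b) ->
  uniq (t ++ s ++ [seq y + e | y <- s]) -> (size t + size s = m.+1)%N ->
  `|divdiff f (t ++ [seq y + e | y <- s]) - divdiff f (t ++ s)| <= (size s)%:R * (`|e| * K).
Proof.
move=> fK; elim: s t => [|y s IH] t sab seab tab ust smooth.
  by rewrite subrr normr0 mul0r.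
pose s' := [seq y + e | y <- s].
have uy : uniq (y :: ((t ++ [:: y + e]) ++ s ++ s')).
  have pA : perm_eq (t ++ (y :: s) ++ [seq y + e | y <- y :: s])
      (y :: ((t ++ [:: y + e]) ++ s ++ s')).
    by apply/permP => P; rewrite /s' /= !count_cat/= !count_cat/=; lia.
  by rewrite -(perm_uniq pA).
have u2 : uniq [:: y + e, y & t ++ s].
  have pA : perm_eq (t ++ (y :: s) ++ [seq y + e | y <- y :: s])
      ([:: y + e, y & t ++ s] ++ s').
    by apply/permP => P; rewrite /s' /= !count_cat/= !count_cat/=; lia.
  by move: ust; rewrite (perm_uniq pA) cat_uniq => /andP[].
have /= -> := divdiff_perm f (_ : perm_eq (t ++ (y + e) :: s') ((t ++ [:: y + e]) ++ s'));
  last first.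
  by rewrite -catA.
set A := divdiff f ((t ++ [:: y + e]) ++ s').
pose B := divdiff f ((t ++ [:: y + e]) ++ s).
rewrite (_ : A - _ = (A - B) + (B - divdiff f (t ++ y :: s))); last by ring.
rewrite (le_trans (ler_normD _ _))// -[in leRHS]natr1 mulrDl mul1r lerD//.
  apply: IH.
  - by move=> z zs; apply: sab; rewrite inE zs orbT.
  - by move=> z zs; apply: seab; rewrite inE zs orbT.
  - move=> z; rewrite mem_cat !inE => /orP[/tab//|/eqP->].
    by apply: seab; rewrite mem_head.
  - by case/andP: uy.
  - by rewrite size_cat/= -smooth/=; lia.
have := divdiff_recr f u2; rewrite addrAC subrr add0r => E.
have -> : B = divdiff f (y + e :: t ++ s).
  by apply/divdiff_perm/permP => P; rewrite /= !count_cat/=; lia.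
have -> : divdiff f (t ++ y :: s) = divdiff f (y :: t ++ s).
  by apply/divdiff_perm/permP => P; rewrite /= !count_cat/=; lia.
rewrite -E normrM mulrC ler_wpM2l//; apply: fK => //.
  by rewrite /= size_cat -smooth/=; lia.
move=> z; rewrite !inE mem_cat => /or4P[/eqP->|/eqP->|/tab//|zs].
- by apply: seab; rewrite mem_head.
- by apply: sab; rewrite mem_head.
- by apply: sab; rewrite inE zs orbT.
Qed.

Lemma is_derive_cvg f x c : is_derive x 1 f c ->
  h^-1 * (f (h + x) - f x) @[h --> 0^'] --> c.
Proof.
move=> [df <-]; rewrite (_ : (fun h => _) = (fun h => h^-1 *: ((f \o shift x) (h *: 1) - f x))).
  exact: df.
by apply/funext => h; rewrite /= [h *: 1]mulr1.
Qed.

(** Divided differences of [g] are limits of those of the difference quotients of [f]; the latter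
    arise from shifting all [m.+1] points, which explains the factor. *)
Lemma divdiff_bounded_deriv m K a b f g :
  (forall x, a < x < b -> is_derive x 1 f (g x)) ->
  divdiff_bounded m.+1 K a b f -> divdiff_bounded m (m.+1%:R * K) a b g.
Proof.
move=> dfg fK ys uys sys yab.
have E e : e != 0 -> divdiff (fun y => e^-1 * (f (e + y) - f y)) ys =
    e^-1 * (divdiff f [seq y + e | y <- ys] - divdiff f ys).
  move=> e0; rewrite divdiffZ divdiffB; congr (_ * (_ - _)).
  rewrite /divdiff big_map; apply: eq_bigr => y _; rewrite (addrC e); congr (_ / _).
  rewrite big_map; apply: eq_big => [z|z _]; last by ring.
  by rewrite (inj_eq (addIr e)).
have cvgE : e^-1 * (divdiff f [seq y + e | y <- ys] - divdiff f ys) @[e --> 0^'] --> divdiff g ys.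
  apply: (@cvg_trans _ ((fun e => divdiff (fun y => e^-1 * (f (e + y) - f y)) ys) @ 0^')).
    by apply: near_eq_cvg; near=> e; rewrite E//; near: e; exact: nbhs_dnbhs_neq.
  apply: cvg_sum_seq => y yys; apply: cvgMl.
  exact: is_derive_cvg (dfg y (yab y yys)).
rewrite -(cvg_lim (@Rhausdorff R) (cvg_norm cvgE)).
apply: limr_le; first by apply/cvg_ex; eexists; exact: cvg_norm cvgE.
have cid e0 : e @[e --> e0^'] --> e0 by apply: cvg_trans (@cvg_id _ (nbhs e0)); exact: nbhs_dnbhs.
have n1 : \forall e \near 0^', forall y, y \in ys -> a < y + e < b.
  apply: near_all_seq => y yys; have := yab y yys => yab'.
  near=> e; have : `|e| < Num.min (y - a) (b - y).
    near: e; apply: cvgr0_norm_lt; first exact: cid.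
    by rewrite lt_min; lra.
  by rewrite lt_min ltr_norml => /andP[] ? /ltr_normlP[]; lra.
(* Divided differences require distinct points, so for small nonzero [e] the shifted points must
   avoid the original ones. *)
have n2 : \forall e \near 0^', forall y, y \in ys -> forall z, z \in ys -> y + e != z.
  apply: near_all_seq => y yys; apply: near_all_seq => z zys.
  have [<-|yz] := eqVneq y z.
    near=> e; rewrite -subr_eq0 addrAC subrr add0r.
    by near: e; exact: nbhs_dnbhs_neq.
  near=> e; rewrite -subr_eq0 addrAC; near: e; apply: (cvgr_neq0 (y - z)).
    by rewrite -[X in _ --> X]addr0; apply: cvgD; [exact: cvg_cst|exact: cid].
  by rewrite subr_eq0.
near=> e.
have e0 : e != 0 by near: e; exact: nbhs_dnbhs_neq.
rewrite normrM normfV ler_pdivrMl ?normr_gt0//.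
have n1e : forall y, y \in ys -> a < y + e < b by near: e; exact: n1.
have n2e : forall y, y \in ys -> forall z, z \in ys -> y + e != z.
  by near: e; exact: n2.
have := @divdiff_shift_bound m K a b f e ys [::] fK yab n1e _ _ sys.
rewrite sys mulrCA; apply => //.
rewrite cat0s cat_uniq uys (map_inj_uniq (addIr e)) uys andbT.
apply/hasPn => _ /mapP[y yys ->]; apply/negP => yeys.
by have := n2e y yys _ yeys; rewrite eqxx.
Unshelve. all: end_near. Qed.

Lemma norm_prod_le (h : R -> R) s c :
  (forall y, y \in s -> `|h y| <= c) -> `|\prod_(y <- s) h y| <= c ^+ size s.
Proof.
elim: s => [|y s IH] H; first by rewrite big_nil normr1 expr0.
rewrite big_cons normrM exprS ler_pM// ?H ?mem_head// IH// => z zs.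
by apply: H; rewrite inE zs orbT.
Qed.

(** Newton's remainder for the Lagrange interpolant at [m.+1] interior points, each factor [x - y]
    being at most [b - a]. *)
Lemma divdiff_bounded_approx m K a b f : a < b -> 0 <= K -> divdiff_bounded m.+1 K a b f ->
  exists2 p : {poly R}, (size p <= m.+1)%N &
    forall x, a < x < b -> `|f x - p.[x]| <= K * (b - a) ^+ m.+1.
Proof.
move=> ab K0 fK; pose s := [seq a + (b - a) / i.+2%:R | i <- iota 0 m.+1].
have us : uniq s.
  rewrite map_inj_uniq ?iota_uniq// => i j /addrI /mulfI.
  rewrite subr_eq0 gt_eqF// => /(_ isT)/invr_inj/eqP.
  by rewrite eqr_nat => /eqP[].
have sab y : y \in s -> a < y < b.
  move=> /mapP[i _ ->]; have i0 : 0 < i.+2%:R :> R by rewrite ltr0n.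
  rewrite ltrDl divr_gt0 ?subr_gt0//= -ltrBrDl ltr_pdivrMr//.
  by rewrite ltr_pMr ?subr_gt0// ltr1n.
have ss : size s = m.+1 by rewrite size_map size_iota.
exists (lagrange f s); first by rewrite -ss size_lagrange.
move=> x xab; have [xs|xs] := boolP (x \in s).
  by rewrite lagrange_interp// subrr normr0 mulr_ge0// exprn_ge0//; lra.
have uxs : uniq (x :: s) by rewrite cons_uniq xs.
rewrite (lagrange_newton f uxs) addrAC subrr add0r normrM ler_pM//.
  apply: fK => //; first by rewrite -ss.
  by move=> y; rewrite inE => /predU1P[->|/sab].
rewrite -ss; apply: norm_prod_le => y ys; rewrite ler_norml.
by have := sab y ys; lra.
Qed.

Lemma divdiff_bounded_lip K a b f x y : divdiff_bounded 1 K a b f -> a < x < b -> a < y < b ->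
  `|f x - f y| <= K * `|x - y|.
Proof.
move=> fK xab yab; have [->|xy] := eqVneq x y.
  by rewrite !subrr normr0 mulr0.
have u2 : uniq [:: x; y] by rewrite /= inE xy.
have := divdiff_recr f u2.
have E z : divdiff f [:: z] = f z.
  by rewrite /divdiff big_seq1 big_cons big_nil eqxx divr1.
rewrite !E => <-; rewrite normrM ler_wpM2r//; apply: fK => //.
by move=> z; rewrite !inE => /orP[/eqP->|/eqP->].
Qed.

Lemma divdiff_bounded_mvt (F : nat -> R -> R) n a b K :
  (forall i x, (i < n)%N -> a < x < b -> is_derive x 1 (F i) (F i.+1 x)) ->
  (forall x, a < x < b -> `|F n x| <= K) -> divdiff_bounded n K a b (F 0%N).
Proof.
move=> dF FK s us sn sab; have [x xab E] := divdiff_mvt dF us sn sab.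
have n1 : 1 <= n`!%:R :> R by rewrite ler1n fact_gt0.
rewrite (le_trans _ (FK x xab))// -E normrM ler_peMr// ger0_norm.
- by [].
- exact: ler0n.
Qed.

End DividedDifferences.

(** * Divided differences and weak derivatives *)

Section SmoothStep.
Context (R : realType).
Implicit Types (a b c x y z : R) (f g : R -> R) (p q : {poly R}).

Lemma poly_le_expR p : exists2 C : R, 0 < C & forall y, 0 <= y -> `|p.[y]| <= C * expR y.
Proof.
exists (1 + \sum_(i < size p) `|p`_i| * i%:R ^+ i).
  by rewrite ltr_pwDl// sumr_ge0// => i _; rewrite mulr_ge0// exprn_ge0.
move=> y y0; rewrite mulrDl mul1r horner_coef.
apply: le_trans (_ : \sum_(i < size p) `|p`_i| * i%:R ^+ i * expR y <= _); last first.
  by rewrite -big_distrl/= lerDr expR_ge0.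
rewrite (le_trans (ler_norm_sum _ _ _))//; apply: ler_sum => i _.
rewrite normrM -mulrA ler_wpM2l// ger0_norm ?exprn_ge0//.
case: (nat_of_ord i) => [|n]; first by
  rewrite !expr0 mul1r (le_trans _ (expR_ge1Dx _))// lerDl.
have n0 : n.+1%:R != 0 :> R by rewrite pnatr_eq0.
have -> : expR y = expR (y / n.+1%:R) ^+ n.+1.
  by rewrite -expRM_natl mulrC divfK.
rewrite -exprMn lerXn2r ?nnegrE ?mulr_ge0 ?expR_ge0//.
rewrite -ler_pdivrMl ?ltr0n// mulrC (le_trans _ (expR_ge1Dx _))//.
by rewrite lerDr.
Qed.

(** The polynomial factor makes the class of these functions closed under differentiation: [p] is
    replaced by [X ^ 2 * (p - p')]. *)
Definition flat p x : R := if 0 < x then p.[x^-1] * expR (- x^-1) else 0.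

Lemma is_derive_conv f g x c d :
  (forall y, f y = g y) -> c = d -> is_derive x 1 f c -> is_derive x 1 g d.
Proof. by move=> /funext -> ->. Qed.

Lemma cvg_is_derive f x c :
  h^-1 * (f (h + x) - f x) @[h --> 0^'] --> c -> is_derive x 1 f c.
Proof.
move=> H.
have H' : h^-1 *: ((f \o shift x) (h *: 1) - f x) @[h --> 0^'] --> c.
  move: H; rewrite (_ : (fun h => _) = (fun h => h^-1 *: ((f \o shift x) (h *: 1) - f x)))//.
  by apply/funext => h; rewrite /= [h *: 1]mulr1.
split; first by apply/cvg_ex; exists c.
exact: (cvg_lim (@Rhausdorff R) H').
Qed.

Lemma is_derive_flat p x :
  is_derive x 1 (flat p) (flat ('X ^+ 2 * (p - p^`())) x).
Proof.
have [x0|x0|->] := ltgtP x 0.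
- apply: (near_eq_is_derive (f := fun=> 0)).
    near=> y; rewrite /flat; case: ltP => // y0; exfalso; move: y0; apply/negP.
    by rewrite -leNgt ltW//; near: y; exact: lt_nbhsl.
  rewrite /flat ltNge ltW//=; exact: is_derive_cst.
- apply: (near_eq_is_derive (f := fun y => p.[y^-1] * expR (- y^-1))).
    near=> y; rewrite /flat ifT//; near: y; exact: lt_nbhsr.
  have dV : is_derive x 1 (fun y : R => y^-1) (- x ^- 2).
    have := @is_deriveV R id x 1 1 (lt0r_neq0 x0) _.
    by rewrite /= => /(_ (is_derive_id _ _)); rewrite scaler1/=.
  have dp := @is_derive1_comp R (horner p) (fun y => y^-1) x _ _ (is_derive_poly p _) dV.
  have de := @is_derive1_comp R expR (fun y => - y^-1) x _ _ (is_derive_expR _) (is_deriveN dV).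
  apply: (is_derive_conv _ _ (is_deriveM dp de)) => //.
  rewrite /flat x0 /=; rewrite !hornerE/=; rewrite -![_ *: _]/(_ * _); field.
  by rewrite gt_eqF.
rewrite [flat _ 0]/flat ltxx; apply: cvg_is_derive.
(* At 0, one factor [X] absorbs the division by [h]; the other leaves a factor [h], which tends to
   0. *)
have [C C0 CP] := poly_le_expR (p * 'X ^+ 2).
apply/cvgrPdist_le => /= e e0; near=> h.
rewrite sub0r normrN addr0 [flat p 0]/flat ltxx subr0.
rewrite /flat; case: ltP => h0; last by rewrite mulr0 normr0 ltW.
have hi : 0 < h^-1 by rewrite invr_gt0.
have := CP _ (ltW hi); rewrite hornerM hornerXn normrM (gtr0_norm (exprn_gt0 _ hi)) => H.
have hC : `|h| <= e / C.
  near: h; apply: dnbhs0_le; exact: divr_gt0.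
rewrite ler_pdivlMr// gtr0_norm// in hC; apply: le_trans hC.
rewrite !normrM (ger0_norm (expR_ge0 _)) normfV (gtr0_norm h0).
have E0 := expR_gt0 h^-1; rewrite expRN.
have -> : h^-1 * (`|p.[h^-1]| / expR h^-1) = h * (`|p.[h^-1]| * h^-1 ^+ 2 / expR h^-1).
  by field; rewrite !gt_eqF.
by rewrite ler_pM2l// ler_pdivrMr.
Unshelve. all: end_near. Qed.

(** A syntactic class: closure under differentiation, proved once by induction on the construction,
    yields the derivatives of all orders that [test_function] asks for. *)
Inductive smooth : (R -> R) -> Prop :=
| smooth_cst c : smooth (fun=> c)
| smooth_id : smooth (fun x => x)
| smooth_flat p a b : smooth (fun x => flat p (a * x + b))
| smooth_add f g : smooth f -> smooth g -> smooth (fun x => f x + g x)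
| smooth_mul f g : smooth f -> smooth g -> smooth (fun x => f x * g x)
| smooth_inv f : smooth f -> (forall x, f x != 0) -> smooth (fun x => (f x)^-1).

Lemma is_derive_affine f a b x c : is_derive (a * x + b) 1 f c ->
  is_derive x 1 (fun x => f (a * x + b)) (a * c).
Proof.
move=> df; have da : is_derive x 1 (fun x => a * x + b) a.
  have := is_derive_poly (a *: 'X + b%:P) x.
  apply: is_derive_conv => [y|]; first by rewrite !hornerE.
  by rewrite derivD derivZ derivX derivC !hornerE.
rewrite mulrC; exact: (@is_derive1_comp R f (fun x => a * x + b)).
Qed.

Lemma smooth_derive f : smooth f -> exists2 g, smooth g & forall x, is_derive x 1 f (g x).
Proof.
elim=> {f} [c||p a b|f g sf [f' sf' df] sg [g' sg' dg]|f g sf [f' sf' df] sg [g' sg' dg]|f sf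
  [f' sf' df] f0].
- by exists (fun=> 0) => [|x]; [exact: smooth_cst|exact: is_derive_cst].
- by exists (fun=> 1) => [|x]; [exact: smooth_cst|exact: is_derive_id].
- exists (fun x => a * flat ('X ^+ 2 * (p - p^`())) (a * x + b)).
    by apply: smooth_mul; [exact: smooth_cst|exact: smooth_flat].
  by move=> x; apply: is_derive_affine; exact: is_derive_flat.
- by exists (fun x => f' x + g' x) => [|x]; [exact: smooth_add|exact: is_deriveD].
- exists (fun x => f x * g' x + g x * f' x).
    by apply: smooth_add; exact: smooth_mul.
  by move=> x; exact: is_deriveM (df x) (dg x).
exists (fun x => (-1 * ((f x)^-1 * (f x)^-1)) * f' x).
  apply: smooth_mul => //; apply: smooth_mul; first exact: smooth_cst.
  by apply: smooth_mul; exact: smooth_inv.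
move=> x; apply: (is_derive_conv _ _ (is_deriveV (f0 x) (df x))) => //.
by rewrite -[_ *: _]/(_ * _) expr2 invfM mulN1r.
Qed.

Lemma smooth_derive1 f : smooth f -> smooth (derive1 f) /\ forall x, is_derive x 1 f (derive1 f x).
Proof.
move=> sf; have [g sg dg] := smooth_derive sf.
have -> : derive1 f = g by apply/funext => x; rewrite derive1E; exact: derive_val.
by [].
Qed.

Lemma smooth_derive1n f n : smooth f -> smooth (derive1n n f).
Proof. by move=> sf; elim: n => // n IH; rewrite derive1nS; exact: (smooth_derive1 IH).1. Qed.

Lemma smooth_is_derive f n x : smooth f ->
  is_derive x 1 (derive1n n f) (derive1n n.+1 f x).
Proof. by move=> sf; rewrite derive1nS; exact: (smooth_derive1 (smooth_derive1n n sf)).2. Qed.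

Lemma smooth_continuous f : smooth f -> continuous f.
Proof.
move=> sf x; apply: differentiable_continuous; apply/derivable1_diffP.
by case: ((smooth_derive1 sf).2 x).
Qed.

Lemma derive1n_affine f a b n x : smooth f ->
  derive1n n (fun x => f (a * x + b)) x = a ^+ n * derive1n n f (a * x + b).
Proof.
move=> sf; elim: n x => [|n IH] x; first by rewrite expr0 mul1r.
rewrite derive1nS; have -> : (fun x => f (a * x + b))^`(n)%classic =
   (fun x => a ^+ n * derive1n n f (a * x + b)) by apply/funext.
rewrite derive1E exprS -mulrA mulrCA.
have dfa := is_derive_affine (smooth_is_derive n (a * x + b) sf).
have := @is_deriveZ _ _ _ (fun x => derive1n n f (a * x + b)) (a ^+ n) x 1 _ dfa.
by move=> [_ ->].
Qed.

Lemma smooth_affine f a b : smooth f -> smooth (fun x => f (a * x + b)).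
Proof.
elim=> {f} [c||p c d|f g sf If sg Ig|f g sf If sg Ig|f sf If f0].
- exact: smooth_cst.
- by apply: smooth_add; [apply: smooth_mul; [exact: smooth_cst|exact: smooth_id]|exact: smooth_cst].
- rewrite (_ : (fun x => _) = (fun x => flat p ((c * a) * x + (c * b + d)))).
    exact: smooth_flat.
  by apply/funext => x; congr (flat p _); ring.
- exact: smooth_add.
- exact: smooth_mul.
by apply: smooth_inv.
Qed.

Lemma smooth_sum (I : Type) (r : seq I) (F : I -> R -> R) :
  (forall i, smooth (F i)) -> smooth (fun x => \sum_(i <- r) F i x).
Proof.
move=> H; elim: r => [|i r IH].
  rewrite (_ : (fun x => _) = (fun=> 0)); first exact: smooth_cst.
  by apply/funext => x; rewrite big_nil.
rewrite (_ : (fun x => _) = (fun x => F i x + \sum_(i <- r) F i x)).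
  exact: smooth_add.
by apply/funext => x; rewrite big_cons.
Qed.

Lemma smooth_horner p : smooth (horner p).
Proof.
elim/poly_ind: p => [|p c IH].
  rewrite (_ : horner 0 = (fun=> 0)); first exact: smooth_cst.
  by apply/funext => x; rewrite horner0.
rewrite (_ : horner _ = (fun x => p.[x] * x + c)).
  by apply: smooth_add; [exact: smooth_mul smooth_id|exact: smooth_cst].
by apply/funext => x; rewrite !hornerE.
Qed.

Lemma derive1nD f g n x : smooth f -> smooth g ->
  derive1n n (fun x => f x + g x) x = derive1n n f x + derive1n n g x.
Proof.
move=> sf sg; elim: n x => [//|n IH] x; rewrite !derive1nS.
have -> : (fun x => f x + g x)^`(n)%classic = (fun x => derive1n n f x + derive1n n g x).
  exact/funext.
have := is_deriveD (smooth_is_derive n x sf) (smooth_is_derive n x sg).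
by rewrite derive1E => -[_ ->]; rewrite !derive1nS.
Qed.

Lemma derive1n_sum (I : Type) (r : seq I) (F : I -> R -> R) n x :
  (forall i, smooth (F i)) ->
  derive1n n (fun x => \sum_(i <- r) F i x) x = \sum_(i <- r) derive1n n (F i) x.
Proof.
move=> H; elim: r => [|i r IH].
  rewrite big_nil (_ : (fun x => _) = (fun=> 0)); last first.
    by apply/funext => y; rewrite big_nil.
  by elim: n x => // n IHn x; rewrite derive1nS (funext IHn) derive1_cst.
rewrite (_ : (fun x => _) = (fun x => F i x + \sum_(i <- r) F i x)); last first.
  by apply/funext => y; rewrite big_cons.
by rewrite big_cons -IH derive1nD//; exact: smooth_sum.
Qed.

Lemma derive1n_eq_open (U : set R) f g n x : open U -> (forall y, U y -> f y = g y) ->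
  U x -> derive1n n f x = derive1n n g x.
Proof.
move=> oU fg; elim: n x => [|n IH] x Ux; first exact: fg.
rewrite !derive1nS !derive1E; apply: near_eq_derive.
near=> y; apply: IH; near: y; exact: open_nbhs_nbhs.
Unshelve. all: end_near. Qed.

Lemma derive1n_horner p n : derive1n n (horner p) = horner p^`(n).
Proof. by elim: n => [|n IH]; rewrite ?derivn0// derive1nS IH derivnS derivE. Qed.

(* A smooth function that agrees with [(x_+)^m / m!] where [1 <= `|x|]. *)
Definition step m x : R :=
  ((m`!)%:R^-1 *: 'X^m).[x] *
    (flat 1 (1 * x + 1) * (flat 1 (1 * x + 1) + flat 1 ((-1) * x + 1))^-1).

Lemma flat1_gt0 x : 0 < x -> 0 < flat 1 x.
Proof. by move=> x0; rewrite /flat x0 hornerC mul1r expR_gt0. Qed.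

Lemma flat1_ge0 x : 0 <= flat 1 x.
Proof.
have [/flat1_gt0/ltW//|x0] := ltP 0 x.
by rewrite /flat ltNge x0.
Qed.

Lemma smooth_step m : smooth (step m).
Proof.
apply: smooth_mul; first exact: smooth_horner.
apply: smooth_mul; first exact: smooth_flat.
apply: smooth_inv; first by apply: smooth_add; exact: smooth_flat.
move=> x; apply: lt0r_neq0; have [x0|x0] := ltP (-1) x.
  by rewrite ltr_pwDl ?flat1_ge0// flat1_gt0//; lra.
by rewrite ltr_wpDl ?flat1_ge0// flat1_gt0//; lra.
Qed.

Lemma step_lt m x : x <= -1 -> step m x = 0.
Proof.
move=> x1; rewrite /step [X in _ * (X * _)](_ : _ = 0) ?mul0r ?mulr0//.
by rewrite /flat ltNge (_ : _ <= 0)//; lra.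
Qed.

Lemma step_gt m x : 1 <= x -> step m x = ((m`!)%:R^-1 *: 'X^m).[x].
Proof.
move=> x1; rewrite /step [flat 1 (-1 * x + 1)](_ : _ = 0).
  by rewrite addr0 mulfV ?mulr1// gt_eqF// flat1_gt0//; lra.
by rewrite /flat ltNge (_ : _ <= 0)//; lra.
Qed.

Lemma step_derive_lt m n x : x < -1 -> derive1n n (step m) x = 0.
Proof.
move=> x1; rewrite (@derive1n_eq_open [set y | y < -1] _ (horner 0))//.
- by rewrite derive1n_horner linear0 horner0.
- by move=> y /ltW/step_lt ->; rewrite horner0.
Qed.

Lemma step_derive_gt m n x : 1 < x ->
  derive1n n (step m) x = ((m`!)%:R^-1 *: 'X^m)^`(n).[x].
Proof.
move=> x1; rewrite (@derive1n_eq_open [set y | 1 < y] _ (horner ((m`!)%:R^-1 *: 'X^m)))//.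
- by rewrite derive1n_horner.
- by move=> y /ltW/step_gt ->.
Qed.

Lemma step_derive_top m x : 1 < x -> derive1n m (step m) x = 1.
Proof.
move=> x1; rewrite step_derive_gt// derivnZ hornerZ derivnXn ffactnn subnn expr0.
by rewrite hornerMn hornerC mulVf// pnatr_eq0 -lt0n fact_gt0.
Qed.

Lemma step_derive_over m x : 1 < x -> derive1n m.+1 (step m) x = 0.
Proof.
by move=> x1; rewrite step_derive_gt// derivnZ hornerZ derivnXn ffact_small// mulr0n horner0 mulr0.
Qed.

(** Outside [[-1, 1]] the derivative of order [m] is 0 or 1 and the next one is 0; in between,
    compactness applies. Derivatives of lower order grow without bound. *)
Lemma step_derive_bounded m n : (m <= n <= m.+1)%N ->
  exists2 C : R, 0 < C & forall x, `|derive1n n (step m) x| <= C.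
Proof.
move=> mn.
have /bmeas_continuous[_ [B HB]] : {within `[-2, 2], continuous (derive1n n (step m))}.
  by apply: continuous_subspaceT; apply: smooth_continuous; apply: smooth_derive1n;
    exact: smooth_step.
exists (1 + `|B|); first by rewrite ltr_pwDl.
move=> x; have [x2|x2] := ltP x (-1); first by rewrite step_derive_lt// normr0 addr_ge0.
have [x3|x3] := ltP 1 x; last first.
  by rewrite (le_trans (HB x _))//; [lra|rewrite (le_trans (ler_norm _))// lerDr].
move: mn; rewrite leq_eqVlt => /andP[/predU1P[<- _|mn nm]].
  by rewrite step_derive_top// normr1 lerDl.
have -> : n = m.+1 by apply/eqP; rewrite eqn_leq nm mn.
by rewrite step_derive_over// normr0 addr_ge0.
Qed.

Lemma seq_min s : s != [::] -> exists2 y : R, y \in s & forall z, z \in s -> y <= z.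
Proof.
elim: s => // x [|x' s] IH _.
  by exists x; [exact: mem_head|move=> z; rewrite inE => /eqP->].
have [//|y ys yP] := IH _.
have [xy|yx] := leP x y.
  exists x; first exact: mem_head.
  by move=> z; rewrite inE => /predU1P[->//|/yP]; exact: le_trans.
exists y; first by rewrite inE ys orbT.
by move=> z; rewrite inE => /predU1P[->|/yP//]; exact: ltW.
Qed.

Lemma seq_extremes s : uniq s -> (1 < size s)%N -> exists y0 y1 t,
  [/\ perm_eq s [:: y0, y1 & t], y0 < y1 & forall z, z \in s -> y0 <= z <= y1].
Proof.
move=> us ss; have s0 : s != [::] by case: s us ss.
have [y0 y0s y0P] := seq_min s0.
have s1 : [seq - y | y <- s] != [::] by case: s us ss y0s y0P s0.
have [_ /mapP[y1 y1s ->] y1P] := seq_min s1.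
have y1P' z : z \in s -> z <= y1.
  by move=> zs; rewrite -lerN2; apply: y1P; apply: map_f.
have y01 : y0 != y1.
  apply: contraTneq ss => y01; rewrite -leqNgt.
  have H z : z \in s -> z = y0.
    by move=> zs; apply/eqP; rewrite eq_le y0P// {1}y01 y1P'.
  case: s us H {s0 s1 y1P y0P y1P' y0s y1s} => [|a [|b s]]//= /andP[].
  rewrite inE negb_or => /andP[ab _] _ H.
  have ea := H a (mem_head _ _).
  have cell_basis : b = y0 by apply: H; rewrite !inE eqxx orbT.
  by rewrite ea cell_basis eqxx in ab.
exists y0, y1, (rem y1 (rem y0 s)); split.
- apply: (perm_trans (perm_to_rem y0s)); rewrite perm_cons; apply: perm_to_rem.
  by rewrite mem_rem_uniq// inE eq_sym y01.
- by rewrite lt_neqAle y01 y0P.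
- by move=> z zs; rewrite y0P ?y1P'.
Qed.

(** In mean value form the divided difference is a multiple of a derivative of [p] whose order
    exceeds the degree. *)
Lemma divdiff_poly_small p s : uniq s -> (size p < size s)%N -> divdiff (horner p) s = 0.
Proof.
case: s => // y s us; rewrite ltnS => sp.
pose a := - (1 + \sum_(z <- y :: s) `|z|); pose b := 1 + \sum_(z <- y :: s) `|z|.
have sab z : z \in y :: s -> a < z < b.
  move=> zs; rewrite -ltr_norml -/b ltr_pwDl// (big_rem z)//= lerDl.
  by rewrite sumr_ge0.
have [x _] := @divdiff_mvt _ (fun i => horner p^`(i)) (size s) a b (y :: s) (fun i x _ _ =>
  is_derive_poly _ _) us erefl sab.
rewrite derivn0 => /eqP; rewrite (_ : p^`(size s) = 0).
  by rewrite horner0 mulf_eq0 pnatr_eq0 (gtn_eqF (fact_gt0 _)) orbF => /eqP.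
by apply/polyP => i; rewrite coef_derivn nth_default ?mul0rn ?coef0// (leq_trans sp)// leq_addr.
Qed.

(** The derivative of order [m] of [step m] climbs from 0 to 1, so this is an approximate identity
    of width [e] at [y]. Its sign is not controlled, only its mass and its size. *)
Definition smoothing_kernel m (e y x : R) : R := e^-1 * derive1n m.+1 (step m) ((y - x) / e).

Lemma affine_arg (e y x : R) : (y - x) / e = (- e^-1) * x + y / e.
Proof. by ring. Qed.

Lemma smoothing_kernel_mass m a b (e y : R) : 0 < e -> a + e < y < b - e ->
  itvint a b (smoothing_kernel m e y) = 1.
Proof.
move=> e0 yab; pose F x := - derive1n m (step m) ((- e^-1) * x + y / e).
have dF x : is_derive x 1 F (smoothing_kernel m e y x).
  have d1 := is_derive_affine (smooth_is_derive m ((- e^-1) * x + y / e) (smooth_step m)).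
  apply: (is_derive_conv _ _ (is_deriveN d1)) => //.
  by rewrite /smoothing_kernel affine_arg mulNr opprK.
have cF : continuous F.
  by move=> x; apply: differentiable_continuous; apply/derivable1_diffP; case: (dF x).
have ck : continuous (smoothing_kernel m e y).
  apply: smooth_continuous; apply: smooth_mul; first exact: smooth_cst.
  rewrite (_ : (fun x => _) = (fun x => derive1n m.+1 (step m) ((- e^-1) * x + y / e))).
    by apply: smooth_affine; apply: smooth_derive1n; exact: smooth_step.
  by apply/funext => x; rewrite affine_arg.
rewrite (@itvint_ftc _ a b _ F)//; last 3 first.
- by lra.
- exact: continuous_subspaceT.
- exact: continuous_subspaceT.
rewrite /F -!affine_arg step_derive_lt; last first.
  by rewrite ltr_pdivrMr//; lra.
by rewrite step_derive_top ?opprK ?oppr0 ?add0r// ltr_pdivlMr//; lra.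
Qed.

Lemma bmeas_smoothing_kernel m a b (e y : R) : bmeas a b (smoothing_kernel m e y).
Proof.
apply: bmeas_continuous; apply: continuous_subspaceT; apply: smooth_continuous.
apply: smooth_mul; first exact: smooth_cst.
rewrite (_ : (fun x => _) = (fun x => derive1n m.+1 (step m) ((- e^-1) * x + y / e))).
  by apply: smooth_affine; apply: smooth_derive1n; exact: smooth_step.
by apply/funext => x; rewrite affine_arg.
Qed.

Lemma itvint_local a b c d f (B : R) : a < c -> c < d -> d < b -> bmeas a b f ->
  (forall x, a < x <= c -> f x = 0) -> (forall x, d <= x < b -> f x = 0) ->
  (forall x, c < x < d -> `|f x| <= B) -> `|itvint a b f| <= B * (d - c).
Proof.
move=> ac cd db mf f0 f1 fB.
rewrite (@itvint_split _ a c b)//; last by lra.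
rewrite (@itvint_split _ c d b)//; last by apply: bmeas_sub mf; lra.
rewrite (_ : itvint a c f = 0); last first.
  by rewrite -(itvint0 a c); apply: itvint_ext => x xac; apply: f0; lra.
rewrite (_ : itvint d b f = 0); last first.
  by rewrite -(itvint0 d b); apply: itvint_ext => x xac; apply: f1; lra.
rewrite add0r addr0; apply: itvint_bound => //; first exact: ltW.
by apply: bmeas_sub mf; lra.
Qed.

Lemma smoothing_kernel_cvg m a b f y : bmeas a b f -> a < y < b -> {for y, continuous f} ->
  itvint a b (fun x => f x * smoothing_kernel m e y x) @[e --> 0^'+] --> f y.
Proof.
move=> mf yab cf; have [M M0 MP] := @step_derive_bounded m m.+1 ltac:(lia).
apply/cvgrPdist_le => /= eta eta0.
have M2 : 0 < M * 4 by lra.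
have /cvgrPdist_le/(_ _ (divr_gt0 eta0 M2)) := cf.
move=> [del /= del0 delP].
near=> e.
have e0 : 0 < e by near: e; exact: nbhs_right_gt.
have e1 : e < del / 2 by near: e; apply: nbhs_right_lt; rewrite divr_gt0.
have e2 : e < (y - a) / 2 by near: e; apply: nbhs_right_lt; lra.
have e3 : e < (b - y) / 2 by near: e; apply: nbhs_right_lt; lra.
have yab' : a + e < y < b - e by lra.
have h1 : a < y - 2 * e by lra.
have h2 : y - 2 * e < y + 2 * e by lra.
have h3 : y + 2 * e < b by lra.
have kz x : e < `|y - x| -> smoothing_kernel m e y x = 0.
  move=> xe; rewrite /smoothing_kernel; have [xy|xy] := leP x y.
    rewrite step_derive_over ?mulr0// ltr_pdivlMr// mul1r.
    by move: xe; rewrite ger0_norm//; lra.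
  rewrite step_derive_lt ?mulr0// ltr_pdivrMr//.
  by move: xe; rewrite ltr0_norm//; lra.
have mk := bmeas_smoothing_kernel m a b e y.
rewrite -[f y]mulr1 -(smoothing_kernel_mass m e0 yab') -itvintZ// -itvintB; last 2 first.
- exact: bmeasZ.
- exact: bmeasM.
(* Within distance [2 * e] of [y], [f] varies by at most [eta / (M * 4)] and the kernel is at most
   [M / e]; the window has length [4 * e]. *)
rewrite (@le_trans _ _ (eta / (M * 4) * (e^-1 * M) * ((y + 2 * e) - (y - 2 * e))))//.
  apply: (itvint_local h1 h2 h3).
  - by apply: bmeasB; [exact: bmeasZ|exact: bmeasM].
  - move=> x xay; rewrite kz ?mulr0 ?subrr//.
    by rewrite ger0_norm; lra.
  - move=> x xay; rewrite kz ?mulr0 ?subrr//.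
    by rewrite ler0_norm; lra.
  move=> x xy; rewrite -mulrBl normrM ler_pM//.
    by apply: delP; rewrite /= ltr_norml; lra.
  rewrite /smoothing_kernel normrM ger0_norm ?invr_ge0 ?(ltW e0)//.
  by rewrite ler_wpM2l// invr_ge0 ltW.
rewrite le_eqVlt; apply/orP; left; apply/eqP; field.
by rewrite !gt_eqF.
Unshelve. all: end_near. Qed.

(** The B-spline of degree [m] with knots [s], written as a divided difference of truncated powers
    [(y - x)_+ ^ m / m!], each smoothed at scale [e]. *)
Definition smoothed_bspline m s (e x : R) : R := divdiff (fun y => e ^+ m * step m ((y - x) / e)) s.

Lemma smoothed_bsplineE m s (e : R) : smoothed_bspline m s e =
  (fun x => \sum_(y <- s) (e ^+ m / \prod_(z <- s | z != y) (y - z)) *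
      step m ((- e^-1) * x + y / e)).
Proof.
apply/funext => x; apply: eq_bigr => y _.
by rewrite affine_arg mulrAC.
Qed.

Lemma smooth_smoothed_bspline m s (e : R) : smooth (smoothed_bspline m s e).
Proof.
rewrite smoothed_bsplineE; apply: smooth_sum => y; apply: smooth_mul; first exact: smooth_cst.
by apply: smooth_affine; exact: smooth_step.
Qed.

Lemma derive1nZ c f n x : smooth f ->
  derive1n n (fun x => c * f x) x = c * derive1n n f x.
Proof.
move=> sf; elim: n x => [//|n IH] x; rewrite !derive1nS.
have -> : (fun x => c * f x)^`(n)%classic = (fun x => c * derive1n n f x) by exact/funext.
have := @is_deriveZ _ _ _ (derive1n n f) c x 1 _ (smooth_is_derive n x sf).
by rewrite derive1E => -[_ ->]; rewrite derive1nS.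
Qed.

Lemma smoothed_bspline_derive m s (e x : R) : 0 < e ->
  derive1n m.+1 (smoothed_bspline m s e) x = (-1) ^+ m.+1 * divdiff (fun y =>
    smoothing_kernel m e y x) s.
Proof.
move=> e0; rewrite smoothed_bsplineE derive1n_sum => [|y]; last first.
  apply: smooth_mul; first exact: smooth_cst.
  by apply: smooth_affine; exact: smooth_step.
rewrite /divdiff big_distrr/=; apply: eq_bigr => y _.
rewrite -derive1nS derive1nZ; last by apply: smooth_affine; exact: smooth_step.
rewrite derive1n_affine; last exact: smooth_step.
have -> : (- e^-1) ^+ m.+1 = (-1) ^+ m.+1 / e ^+ m.+1 by rewrite -[- e^-1]mulN1r exprMn exprVn.
rewrite /smoothing_kernel affine_arg [e ^+ m.+1]exprS invfM.
set X := derive1n _ _ _; set Y := \prod_(_ <- _ | _) _.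
by have := prod_sub_neq0 y s; rewrite -/Y => Y0; field; rewrite Y0 !gt_eqF ?exprn_gt0.
Qed.

(** To the left of all knots the truncated powers are genuine polynomials of degree [m] in the knot,
    which a divided difference over more than [m.+1] points annihilates. *)
Lemma smoothed_bspline_left m s (e x : R) : 0 < e -> uniq s -> (m.+1 < size s)%N ->
  (forall y, y \in s -> x + e <= y) -> smoothed_bspline m s e x = 0.
Proof.
move=> e0 us ms xs.
pose p : {poly R} := (m`!)%:R^-1 *: ('X - x%:P) ^+ m.
rewrite -[RHS](@divdiff_poly_small p s)//; last first.
  rewrite (leq_ltn_trans (size_scale_leq _ _))// size_exp_XsubC//.
apply: divdiff_ext => y /xs xy; rewrite step_gt; last by rewrite ler_pdivlMr//; lra.
rewrite /p !hornerZ hornerXn horner_exp hornerXsubC expr_div_n mulrCA.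
by congr (_ * _); rewrite mulrC divfK// expf_neq0// gt_eqF.
Qed.

Lemma smoothed_bspline_right m s (e x : R) : 0 < e ->
  (forall y, y \in s -> y <= x - e) -> smoothed_bspline m s e x = 0.
Proof.
move=> e0 xs; rewrite /smoothed_bspline (@divdiff_ext _ _ (fun y => 0 * 0));
  first by rewrite divdiffZ mul0r.
move=> y /xs xy; rewrite step_lt ?mulr0 ?mul0r//.
by rewrite ler_pdivrMr//; lra.
Qed.

(** One step of the recurrence in [y0], [y1] leaves two divided differences of order [m]; these are
    bounded by the derivative of order [m] of [step m], uniformly in [e]. The factor [1 / (y1 - y0)]
    is balanced later by the length of the support. *)
Lemma smoothed_bspline_bound m (C : R) : (forall x, `|derive1n m (step m) x| <= C) ->
  forall s (e x y0 y1 : R) t, 0 < e -> uniq s -> size s = m.+2 ->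
  perm_eq s [:: y0, y1 & t] -> y0 < y1 ->
  `|smoothed_bspline m s e x| <= 2 * C / (y1 - y0).
Proof.
move=> HC s e x y0 y1 t e0 us ss sp y01.
have B u : uniq u -> size u = m.+1 -> `|smoothed_bspline m u e x| <= C.
  move=> uu su.
  pose F i y := e ^+ (m - i) * derive1n i (step m) ((y - x) / e).
  pose a := - (1 + \sum_(z <- u) `|z|); pose b := 1 + \sum_(z <- u) `|z|.
  have uab z : z \in u -> a < z < b.
    move=> zu; rewrite -ltr_norml -/b ltr_pwDl// (big_rem z)//= lerDl.
    by rewrite sumr_ge0.
  have E : smoothed_bspline m u e x = divdiff (F 0%N) u by rewrite /smoothed_bspline /F subn0.
  rewrite E; apply: (@divdiff_bounded_mvt _ F m a b) => //.
    move=> i y im _; rewrite /F.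
    have arg z : (z - x) / e = e^-1 * z + - x / e by ring.
    have d1 := is_derive_affine (smooth_is_derive i (e^-1 * y + - x / e) (smooth_step m)).
    have := @is_deriveZ _ _ _ (fun y => derive1n i (step m) (e^-1 * y +
      - x / e)) (e ^+ (m - i)) y 1 _ d1.
    apply: is_derive_conv => [z|]; first by rewrite arg.
    rewrite arg -[LHS]/(_ * _) mulrA; congr (_ * _).
    by rewrite -[(m - i)%N]prednK ?subn_gt0// -subnS exprS mulrAC mulfV ?mul1r// gt_eqF.
  by move=> y _; rewrite /F subnn expr0 mul1r.
have u2 : uniq [:: y0, y1 & t] by rewrite -(perm_uniq sp).
have s2 : size [:: y0, y1 & t] = m.+2 by rewrite -(perm_size sp).
rewrite ler_pdivlMr ?subr_gt0//.
have -> : smoothed_bspline m s e x = smoothed_bspline m [:: y0, y1 & t] e x by exact: divdiff_perm.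
have -> : y1 - y0 = `|y0 - y1| by rewrite distrC ger0_norm// subr_ge0 ltW.
rewrite -normrM /smoothed_bspline divdiff_recr// (le_trans (ler_normB _ _))//.
rewrite mulr_natl mulr2n; case: s2 => s2.
move: u2 => /= /andP[]; rewrite inE negb_or => /andP[y0y1 y0t] /andP[y1t ut].
by apply: lerD; apply: B; rewrite /= ?y0t ?y1t ?s2.
Qed.

(* The divided difference of [f] is the limit of [+- int f psi^(m+1)] as the
   smoothed B-spline [psi] tends to the B-spline with the same knots. *)
Lemma weak_divdiff_bounded m : exists2 C : R, 0 < C & forall a b f g (K : R),
  bmeas a b f -> (forall x, a < x < b -> {for x, continuous f}) ->
  bmeas a b g -> (forall x, a < x < b -> `|g x| <= K) ->
  (forall phi, test_function a b phi ->
     itvint a b (fun x => f x * derive1n m.+1 phi x) =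
     (-1) ^+ m.+1 * itvint a b (fun x => g x * phi x)) ->
  divdiff_bounded m.+1 (C * K) a b f.
Proof.
have [C C0 HC] := @step_derive_bounded m m ltac:(lia).
(* The factor 2 comes from the bound on the spline, the factor 3 from its support, of length at most
   [3 * (y1 - y0)] as soon as [e < y1 - y0]. *)
exists (6 * C); first by rewrite mulr_gt0.
move=> a b f g K mf cf mg gK fg s us ss sab.
have [|y0 [y1 [t [sp y01 y0P]]]] := seq_extremes us; first by rewrite ss.
have y0s : y0 \in s by rewrite (perm_mem sp) mem_head.
have y1s : y1 \in s by rewrite (perm_mem sp) !inE eqxx orbT.
have y0ab := sab _ y0s; have y1ab := sab _ y1s.
have K0 : 0 <= K by rewrite (le_trans _ (gK _ y0ab)).
have cvgW : divdiff (fun y => itvint a b (fun x => f x * smoothing_kernel m e y x)) s @[e -->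
  0^'+] --> divdiff f s.
  apply: cvg_sum_seq => y ys; apply: cvgMl; apply: smoothing_kernel_cvg => //; first exact: sab.
  by apply: cf; exact: sab.
rewrite -(cvg_lim (@Rhausdorff R) (cvg_norm cvgW)).
apply: limr_le; first by apply/cvg_ex; eexists; exact: cvg_norm cvgW.
near=> e.
have e0 : 0 < e by near: e; exact: nbhs_right_gt.
have e1 : e < y1 - y0 by near: e; apply: nbhs_right_lt; lra.
have e2 : e < (y0 - a) / 2 by near: e; apply: nbhs_right_lt; lra.
have e3 : e < (b - y1) / 2 by near: e; apply: nbhs_right_lt; lra.
have h1 : a < y0 - e by lra.
have h2 : y0 - e < y1 + e by lra.
have h3 : y1 + e < b by lra.
have tf : test_function a b (smoothed_bspline m s e).
  split; first by move=> n x; case: (smooth_is_derive n x (smooth_smoothed_bspline m s e)).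
  exists (y0 - e), (y1 + e); split => // x /=; rewrite in_itv/=.
  move=> /negP; rewrite negb_and -!ltNge => /orP[xy|xy].
    by apply: smoothed_bspline_left => //; rewrite ?ss// => y /y0P; lra.
  by apply: smoothed_bspline_right => // y /y0P; lra.
have sg z : (-1) ^+ m.+1 * ((-1) ^+ m.+1 * z) = z :> R.
  by rewrite mulrA -exprMn mulrNN mulr1 expr1n mul1r.
have E : divdiff (fun y => itvint a b (fun x => f x * smoothing_kernel m e y x)) s =
    (-1) ^+ m.+1 * itvint a b (fun x => f x * derive1n m.+1 (smoothed_bspline m s e) x).
  rewrite -itvintZ; last first.
    apply: bmeasM => //; apply: bmeas_continuous; apply: continuous_subspaceT.
    by apply: smooth_continuous; apply: smooth_derive1n; exact: smooth_smoothed_bspline.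
  transitivity (itvint a b (fun x => \sum_(y <- s) (\prod_(z <- s | z != y) (y - z))^-1 * (f x *
    smoothing_kernel m e y x))).
    rewrite itvint_sum; last by move=> y _; apply/bmeasZ/bmeasM => //;
      exact: bmeas_smoothing_kernel.
    apply: eq_bigr => y _; rewrite itvintZ; first by rewrite mulrC.
    by apply: bmeasM => //; exact: bmeas_smoothing_kernel.
  apply: itvint_ext => x _; rewrite smoothed_bspline_derive// (mulrCA (f x)) sg.
  by rewrite /divdiff big_distrr/=; apply: eq_bigr => y _; ring.
have mpsi : bmeas a b (smoothed_bspline m s e).
  by apply: bmeas_continuous; apply: continuous_subspaceT; apply: smooth_continuous;
    exact: smooth_smoothed_bspline.
rewrite E fg// sg.
rewrite (@le_trans _ _ (K * (2 * C / (y1 - y0)) * ((y1 + e) - (y0 - e))))//.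
  apply: (itvint_local h1 h2 h3).
  - exact: bmeasM.
  - by move=> x xa; rewrite smoothed_bspline_left ?mulr0// ?ss// => y /y0P; lra.
  - by move=> x xa; rewrite smoothed_bspline_right ?mulr0// => y /y0P; lra.
  move=> x xy; rewrite normrM ler_pM// ?gK//; first by rewrite (lt_trans h1) ?(lt_trans _ h3);
    case/andP: xy.
  exact: (smoothed_bspline_bound HC x e0 us ss sp y01).
rewrite [leRHS](_ : _ = K * (2 * C / (y1 - y0)) * (3 * (y1 - y0))); last first.
  by field; rewrite subr_eq0 gt_eqF.
rewrite ler_wpM2l//; last lra.
by rewrite mulr_ge0// divr_ge0 ?mulr_ge0 ?(ltW C0)//; lra.
Unshelve. all: end_near. Qed.

End SmoothStep.

(** * Sobolev norms as bounds on divided differences *)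

Section SobolevDividedDifferences.
Context (R : realType).
Implicit Types (a b x K : R) (f g : R -> R).
Local Notation mu := (@lebesgue_measure R).

Lemma Winf_norm_lt a b m f K : (Winf_norm a b m f < K%:E)%E ->
  exists2 g, weak_derivatives a b m f g &
    forall i, (i <= m)%N -> {ae mu, forall x, a < x < b -> `|g i x| <= K}.
Proof.
move=> /ereal_inf_lt[_ [g wg ->] gK]; exists g => // i im.
have muT : (0 < mu [set: R])%E by rewrite -set_itvNyy lebesgue_measure_itv/= ltry.
have : ('N[mu]_+oo [EFin \o (g i \_ `]a, b[)] <= K%:E)%E.
  apply: le_trans (ltW gK).
  exact: (@le_bigmax _ _ _ 0%E (fun j : 'I_m.+1 => 'N[mu]_+oo [EFin \o (g j \_ `]a,
    b[)]%E) (Ordinal (n := m.+1) (m := i) im)).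
rewrite unlock/= muT => /ess_supP; apply: filterS => x /= + xab.
by rewrite lee_fin patchE mem_set//= in_itv.
Qed.

(** A weak derivative is bounded only almost everywhere. Truncating it at [K] changes no integral
    and makes the bound hold at every point, as [bmeas] demands. *)
Lemma clip_bounded a b g K : 0 <= K -> measurable_fun `]a, b[ g ->
  {ae mu, forall x, a < x < b -> `|g x| <= K} ->
  exists g', [/\ bmeas a b g', forall x, a < x < b -> `|g' x| <= K &
    forall phi, bmeas a b phi -> itvint a b (fun x => g x * phi x) = itvint a b (fun x =>
      g' x * phi x)].
Proof.
move=> K0 mg gK; pose g' x := Num.max (- K) (Num.min K (g x)).
have mg' : measurable_fun `]a, b[ g'.
  by apply: measurable_maxr => //; exact: measurable_minr.
have g'K x : a < x < b -> `|g' x| <= K.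
  move=> _; rewrite ler_norml /g' le_max lexx/= ge_max ge_min lexx/= andbT.
  by lra.
exists g'; split => //; first by split => //; exists K.
move=> phi [mphi _]; congr fine; apply: ae_eq_integral => //.
- by apply/measurable_EFinP; exact: measurable_funM.
- by apply/measurable_EFinP; exact: measurable_funM.
case: gK => N [mN N0 NS]; exists N; split => // x /= nE; apply: NS => /= H.
apply: nE; rewrite in_itv/= => /H.
rewrite ler_norml => /andP[g1 g2]; congr (_ * _)%:E.
by rewrite /g' (min_idPr _)// (max_idPr _).
Qed.

Lemma Winf_divdiff_bounded m : exists2 C : R, 0 < C & forall a b f K, 0 <= K ->
  (Winf_norm a b m f <= K%:E)%E -> bmeas a b f ->
  (forall x, a < x < b -> {for x, continuous f}) ->
  forall i, (0 < i <= m)%N -> divdiff_bounded i (C * (K + 1)) a b f.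
Proof.
have /choice[C CP] : forall i : nat, exists C : R, 0 < C /\ forall a b f g (K : R),
  bmeas a b f -> (forall x, a < x < b -> {for x, continuous f}) ->
  bmeas a b g -> (forall x, a < x < b -> `|g x| <= K) ->
  (forall phi, test_function a b phi ->
     itvint a b (fun x => f x * derive1n i.+1 phi x) =
     (-1) ^+ i.+1 * itvint a b (fun x => g x * phi x)) ->
  divdiff_bounded i.+1 (C * K) a b f.
  by move=> i; have [C C0 CP] := weak_divdiff_bounded R i; exists C.
exists (1 + \sum_(i < m) C i).
  by rewrite ltr_pwDl// sumr_ge0// => i _; rewrite ltW//; case: (CP i).
move=> a b f K K0 fK mf cf [//|i] /= im.
(* The infimum defining [Winf_norm] need not be attained; the slack 1 provides weak derivatives that
   nearly reach it. *)
have K1 : (K%:E < (K + 1)%:E)%E by rewrite lte_fin; lra.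
have [g [_ wg] gK] := Winf_norm_lt (le_lt_trans fK K1).
have [mg wgi] := wg _ im.
have K10 : 0 <= K + 1 by lra.
have [g' [mg' g'K gg']] := clip_bounded K10 mg (gK _ im).
have [C0 H] := CP i.
have wg' phi : test_function a b phi ->
    itvint a b (fun x => f x * derive1n i.+1 phi x) =
    (-1) ^+ i.+1 * itvint a b (fun x => g' x * phi x).
  move=> tphi; rewrite -gg'; first exact: wgi.
  apply: bmeas_continuous; apply: continuous_subspaceT => x.
  by apply: differentiable_continuous; apply/derivable1_diffP; exact: (tphi.1 0%N).
move=> s us ss sab; rewrite (le_trans (H _ _ _ _ _ mf cf mg' g'K wg' s us ss sab))//.
rewrite ler_wpM2r//.
rewrite (bigD1 (Ordinal im))//= addrCA lerDl addr_ge0// sumr_ge0// => j _.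
by rewrite ltW//; case: (CP j).
Qed.

End SobolevDividedDifferences.

(** * Finite differences in time *)

(** Iterated forward differences with independent increments. They stand in for time derivatives of
    higher order, whose existence is not assumed. *)
Fixpoint tdiff (R : realType) (ts : seq R) (F : R -> R) (t : R) : R :=
  if ts is tau :: ts' then tdiff ts' F (t + tau) - tdiff ts' F t else F t.

(* Every time at which [tdiff ts F t] evaluates [F] lies in [0, T]. *)
Definition admissible (R : realType) (T : R) (ts : seq R) (t : R) : Prop :=
  [/\ 0 <= t, (forall tau, tau \in ts -> 0 <= tau) & t + \sum_(tau <- ts) tau <= T].

Section TimeDerivative.
Context (R : realType) (T : R).
Implicit Types (f F G : R -> R) (t s x : R).

Lemma tderiv_eps F t e : tderivable T F t -> 0 < e ->
  exists2 d : R, 0 < d & forall s, 0 <= s <= T -> s != t -> `|s - t| < d ->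
    `|(F s - F t) / (s - t) - tderive T F t| <= e.
Proof.
move=> dF e0; have := dF; rewrite /tderivable -/(tderive T F t).
move=> /cvgrPdist_le/(_ e e0).
rewrite /within/= /dnbhs /within/= => -[d /= d0 dP].
by exists d => // s sT st sd; rewrite distrC; apply: dP => //=; rewrite distrC.
Qed.

Lemma tderiv_cont F t e : tderivable T F t -> 0 < e ->
  exists2 d : R, 0 < d & forall s, 0 <= s <= T -> `|s - t| < d -> `|F s - F t| <= e.
Proof.
move=> dF e0; have [d d0 dP] := tderiv_eps dF ltr01.
pose L := 1 + `|tderive T F t|.
have L0 : 0 < L by rewrite ltr_pwDl.
exists (Num.min d (e / L)); first by rewrite lt_min d0 divr_gt0.
move=> s sT; rewrite lt_min => /andP[sd se].
have [->|st] := eqVneq s t; first by rewrite subrr normr0 ltW.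
have st0 : s - t != 0 by rewrite subr_eq0.
have -> : F s - F t = (F s - F t) / (s - t) * (s - t) by rewrite mulfVK.
rewrite normrM; apply: le_trans (_ : L * (e / L) <= _); last first.
  by rewrite mulrC divfK// gt_eqF.
rewrite ler_pM//; last exact: ltW.
have := dP s sT st sd; move: (_ / _) => q H.
by rewrite -[q](subrK (tderive T F t)) (le_trans (ler_normD _ _))// lerD.
Qed.

Lemma tderiv_is_derive F t : 0 < t < T -> tderivable T F t ->
  is_derive t 1 F (tderive T F t).
Proof.
move=> tT dF; apply: cvg_is_derive; apply/cvgrPdist_le => e e0.
have [d d0 dP] := tderiv_eps dF e0.
near=> h.
have h0 : h != 0 by near: h; exact: nbhs_dnbhs_neq.
have hd : `|h| < d by near: h; exact: dnbhs0_lt.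
have h1 : `|h| < t by near: h; apply: dnbhs0_lt; lra.
have h2 : `|h| < T - t by near: h; apply: dnbhs0_lt; lra.
rewrite ltr_norml in h1; rewrite ltr_norml in h2.
rewrite distrC; have := dP (h + t); rewrite addrK mulrC; apply => //; first lra.
by rewrite -subr_eq0 addrK.
Unshelve. all: end_near. Qed.

Lemma harm_cvg (c : R) : c / n.+1%:R @[n --> \oo] --> (0 : R).
Proof. by rewrite -[X in _ --> X](mulr0 c); apply: cvgMr; exact: cvg_harmonic. Qed.

Lemma admissible_tail ts tau t : admissible T (tau :: ts) t ->
  [/\ admissible T ts t, admissible T ts (t + tau) & 0 <= tau].
Proof.
move=> [t0 ts0]; rewrite big_cons => tT.
have tau0 : 0 <= tau by apply: ts0; rewrite mem_head.
have ts0' s : s \in ts -> 0 <= s by move=> H; apply: ts0; rewrite inE H orbT.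
have S0 : 0 <= \sum_(s <- ts) s by rewrite big_seq sumr_ge0.
by split => //; split => //; lra.
Qed.

Lemma admissible_time ts t : admissible T ts t -> 0 <= t <= T.
Proof.
move=> [t0 ts0 tT]; have S0 : 0 <= \sum_(s <- ts) s by rewrite big_seq sumr_ge0.
by lra.
Qed.

Lemma tdiff_ext ts F G t : admissible T ts t -> (forall s, 0 <= s <= T -> F s = G s) ->
  tdiff ts F t = tdiff ts G t.
Proof.
elim: ts t => [|tau ts IH] t; first by move=> /admissible_time tT H; exact: H.
by move=> /admissible_tail[at0 at1 _] H /=; rewrite !IH.
Qed.

(** Serves the differential equation, which holds at positive times only. *)
Lemma tdiff_ext_pos ts F G t : admissible T ts t -> 0 < t ->
  (forall s, 0 < s <= T -> F s = G s) -> tdiff ts F t = tdiff ts G t.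
Proof.
move=> + + FG; elim: ts t => [|tau ts IH] t.
  by move=> /admissible_time tT t0; apply: FG; lra.
by move=> /admissible_tail[a0 a1 tau0] t0 /=; rewrite !IH//; lra.
Qed.

Lemma tdiffD ts F G t : tdiff ts (fun s => F s + G s) t = tdiff ts F t + tdiff ts G t.
Proof. by elim: ts t => [//|tau ts IH] t /=; rewrite !IH; ring. Qed.

Lemma tdiffZ ts c F t : tdiff ts (fun s => c * F s) t = c * tdiff ts F t.
Proof. by elim: ts t => [//|tau ts IH] t /=; rewrite !IH; ring. Qed.

Lemma tdiffN ts F t : tdiff ts (fun s => - F s) t = - tdiff ts F t.
Proof. by elim: ts t => [//|tau ts IH] t /=; rewrite !IH; ring. Qed.

Lemma tdiffB ts F G t : tdiff ts (fun s => F s - G s) t = tdiff ts F t - tdiff ts G t.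
Proof. by rewrite tdiffD tdiffN. Qed.

Lemma tdiff0 ts t : tdiff ts (fun=> 0) t = 0.
Proof. by elim: ts t => [//|tau ts IH] t /=; rewrite !IH subrr. Qed.

Lemma tdiff_divdiff ts (f : R -> R -> R) ys t :
  divdiff (fun x => tdiff ts (fun s => f s x) t) ys = tdiff ts (fun s => divdiff (f s) ys) t.
Proof. by elim: ts t => [//|tau ts IH] t /=; rewrite divdiffB !IH. Qed.

Lemma tdiff_tderiv ts F t : (forall s, 0 <= s <= T -> tderivable T F s) ->
  0 < t < T -> admissible T ts t -> t + \sum_(tau <- ts) tau < T ->
  is_derive t 1 (tdiff ts F) (tdiff ts (tderive T F) t).
Proof.
move=> dF; elim: ts t => [|tau ts IH] t tT at0.
  by move=> _; apply: tderiv_is_derive => //; apply: dF; lra.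
rewrite big_cons => tsT /=; have [at1 at2 tau0] := admissible_tail at0.
have S0 : 0 <= \sum_(s <- ts) s by rewrite big_seq sumr_ge0 => [//|s]; case: at1 => _ + _; exact.
apply: is_deriveB; last by apply: IH => //; lra.
have d1 : is_derive (1 * t + tau) 1 (tdiff ts F) (tdiff ts (tderive T F) (1 * t + tau)).
  by rewrite mul1r; apply: IH => //; lra.
have := is_derive_affine d1.
by apply: is_derive_conv => [s|]; rewrite ?mul1r.
Qed.

Lemma tdiff_cont ts F t e : (forall s, 0 <= s <= T -> tderivable T F s) ->
  admissible T ts t -> 0 < e -> exists2 d : R, 0 < d & forall s, admissible T ts s ->
    `|s - t| < d -> `|tdiff ts F s - tdiff ts F t| <= e.
Proof.
move=> dF; elim: ts t e => [|tau ts IH] t e at0 e0.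
  have [d d0 dP] := tderiv_cont (dF t (admissible_time at0)) e0.
  by exists d => // s /admissible_time; exact: dP.
have [at1 at2 tau0] := admissible_tail at0.
have e2 : 0 < e / 2 by rewrite divr_gt0.
have [d1 d10 d1P] := IH _ _ at1 e2; have [d2 d20 d2P] := IH _ _ at2 e2.
exists (Num.min d1 d2); first by rewrite lt_min d10.
move=> s as0; rewrite lt_min => /andP[sd1 sd2] /=.
have [as1 as2 _] := admissible_tail as0.
rewrite (_ : _ - _ = (tdiff ts F (s + tau) - tdiff ts F (t +
  tau)) - (tdiff ts F s - tdiff ts F t)); last by ring.
rewrite (le_trans (ler_normB _ _))// [e]splitr lerD//; last exact: d1P.
by apply: d2P => //; rewrite opprD addrACA subrr addr0.
Qed.

(** The mean value theorem for the outermost increment. The intermediate time is interior, so all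
    derivatives involved are taken at times in []0, T[]. *)
Lemma tdiff_mvt ts F G t tau (K : R) : admissible T (tau :: ts) t ->
  (forall s, 0 <= s <= T -> tderivable T F s) ->
  (forall s, 0 < s < T -> tderive T F s = G s) ->
  (forall s, admissible T ts s -> 0 < s -> `|tdiff ts G s| <= K) ->
  `|tdiff (tau :: ts) F t| <= K * tau.
Proof.
move=> at0 dF FG GK; have [at1 at2 tau0] := admissible_tail at0.
have S0 : 0 <= \sum_(s <- ts) s by rewrite big_seq sumr_ge0 => [//|s]; case: at1 => _ + _; exact.
have [t0 ts0 tT] := at0; rewrite big_cons in tT.
move: tau0; rewrite le_eqVlt => /predU1P[tau0|tau0].
  by rewrite /= -tau0 addr0 subrr normr0 mulr0.
have tt : t < t + tau by rewrite ltrDl.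
have admI s : t <= s <= t + tau -> admissible T ts s.
  by move=> st; case: at1 => _ H _; split => //; lra.
have GI s : t < s < t + tau -> tdiff ts (tderive T F) s = tdiff ts G s.
  move=> st.
  have H (r : seq R) v : (forall s, s \in r -> 0 <= s) -> 0 < v -> v + \sum_(s <- r) s < T ->
      tdiff r (tderive T F) v = tdiff r G v.
    elim: r v => [|w r IH] v r0 v0.
      by rewrite big_nil addr0 => vT /=; rewrite FG// v0.
    rewrite big_cons => vT /=.
    have w0 : 0 <= w by apply: r0; rewrite mem_head.
    have r0' s' : s' \in r -> 0 <= s' by move=> h; apply: r0; rewrite inE h orbT.
    by rewrite !IH//; lra.
  by apply: H; [case: at1|lra|lra].
have [||s] := @MVT _ (tdiff ts F) (tdiff ts (tderive T F)) t (t + tau) tt.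
- move=> x; rewrite in_itv/= => xt; apply: tdiff_tderiv => //; [lra|apply: admI; lra|lra].
- apply/subspace_continuousP => x /=; rewrite in_itv/= => xt.
  apply/cvgrPdist_le => e e0; have [d d0 dP] := tdiff_cont dF (admI x xt) e0.
  rewrite /= /within/=; exists d => //= y yd; rewrite in_itv/= => yt.
  by rewrite distrC; apply: dP; [exact: admI|rewrite distrC].
rewrite in_itv/= => st ->; rewrite GI// normrM (addrC t) addrK (gtr0_norm tau0).
by rewrite ler_wpM2r ?GK ?(ltW tau0)//; [apply: admI; lra|lra].
Qed.

Hypothesis T0 : 0 < T.

Lemma within_proper t : 0 <= t <= T -> ProperFilter (within `[0, T] t^').
Proof.
move=> tT; apply: Build_ProperFilter; rewrite /within/= /dnbhs /within/= => -[d /= d0 dP].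
pose w := Num.min d T / 2.
have w0 : 0 < w by rewrite divr_gt0// lt_min d0.
have wd : w < d by rewrite /w ltr_pdivrMr// mulr_natr mulr2n gt_min; apply/orP; left; lra.
have wT : w <= T / 2 by rewrite /w ler_pM2r// ge_min lexx orbT.
have [tl|tl] := leP t (T / 2).
  apply: (dP (t + w)) => /=; last by rewrite in_itv/=; lra.
    by rewrite opprD addrA subrr sub0r normrN gtr0_norm.
  by rewrite -subr_eq0 addrAC subrr add0r gt_eqF.
apply: (dP (t - w)) => /=; last by rewrite in_itv/=; lra.
  by rewrite opprB addrCA subrr addr0 gtr0_norm.
by rewrite -subr_eq0 addrAC subrr add0r oppr_eq0 gt_eqF.
Qed.

Lemma tderiv_cvg F t l : 0 <= t <= T ->
  time_quotient F t s @[s --> within `[0, T] t^'] --> l ->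
  tderivable T F t /\ tderive T F t = l.
Proof.
move=> tT H; split; first by apply/cvg_ex; exists l.
have PF := within_proper tT.
exact: (cvg_lim (@Rhausdorff R) H).
Qed.

Lemma tderiv_cst c t : 0 <= t <= T ->
  tderivable T (fun=> c) t /\ tderive T (fun=> c) t = 0.
Proof.
move=> tT; apply: tderiv_cvg => //; rewrite /time_quotient.
rewrite (_ : (fun s => _) = fun=> 0); first exact: cvg_cst.
by apply/funext => s; rewrite subrr mul0r.
Qed.

Lemma tderivD F G t : 0 <= t <= T -> tderivable T F t -> tderivable T G t ->
  tderivable T (fun s => F s + G s) t /\
  tderive T (fun s => F s + G s) t = tderive T F t + tderive T G t.
Proof.
move=> tT dF dG; apply: tderiv_cvg => //.
apply: cvg_trans (cvgD dF dG); apply: near_eq_cvg; apply: nearW => s.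
change (time_quotient F t s + time_quotient G t s = time_quotient (fun s => F s + G s) t s).
by rewrite /time_quotient -mulrDl; congr (_ / _); ring.
Qed.

Lemma tderivZ c F t : 0 <= t <= T -> tderivable T F t ->
  tderivable T (fun s => c * F s) t /\
  tderive T (fun s => c * F s) t = c * tderive T F t.
Proof.
move=> tT dF; apply: tderiv_cvg => //.
apply: cvg_trans (_ : c * time_quotient F t s @[s --> within `[0, T] t^'] --> _); last first.
  by apply: cvgMr; exact: dF.
by apply: near_eq_cvg; apply: nearW => s; rewrite /time_quotient mulrA mulrBr.
Qed.

Lemma tderivN F t : 0 <= t <= T -> tderivable T F t ->
  tderivable T (fun s => - F s) t /\ tderive T (fun s => - F s) t = - tderive T F t.
Proof.
move=> tT /(tderivZ (-1) tT)[]; rewrite mulN1r.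
by rewrite (_ : (fun s => -1 * F s) = (fun s => - F s))//; apply/funext => s; rewrite mulN1r.
Qed.

Lemma tderivB F G t : 0 <= t <= T -> tderivable T F t -> tderivable T G t ->
  tderivable T (fun s => F s - G s) t /\
  tderive T (fun s => F s - G s) t = tderive T F t - tderive T G t.
Proof.
by move=> tT dF /(tderivN tT)[dG <-]; exact: tderivD.
Qed.

Lemma tderiv_sum (I : eqType) (r : seq I) (H : I -> R -> R) t : 0 <= t <= T ->
  (forall i, i \in r -> tderivable T (H i) t) ->
  tderivable T (fun s => \sum_(i <- r) H i s) t /\
  tderive T (fun s => \sum_(i <- r) H i s) t = \sum_(i <- r) tderive T (H i) t.
Proof.
move=> tT; elim: r => [|i r IH] dH.
  rewrite big_nil (_ : (fun s => _) = fun=> 0); first exact: tderiv_cst.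
  by apply/funext => s; rewrite big_nil.
have [d1 e1] := IH (fun j jr => dH j (mem_behead (s := i :: r) jr)).
rewrite big_cons -e1 (_ : (fun s => _) = (fun s => H i s + \sum_(j <- r) H j s)).
  by apply: tderivD => //; apply: dH; exact: mem_head.
by apply/funext => s; rewrite big_cons.
Qed.

Lemma tderiv_divdiff (f : R -> R -> R) ys t : 0 <= t <= T ->
  (forall x, tderivable T (fun s => f s x) t) ->
  tderivable T (fun s => divdiff (f s) ys) t /\
  tderive T (fun s => divdiff (f s) ys) t = divdiff (dt T f t) ys.
Proof.
move=> tT df; pose H y s := (\prod_(z <- ys | z != y) (y - z))^-1 * f s y.
have dH y := tderivZ (\prod_(z <- ys | z != y) (y - z))^-1 tT (df y).
have [|d e] := @tderiv_sum _ ys H t tT; first by move=> y _; exact: (dH y).1.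
rewrite (_ : (fun s => _) = (fun s => \sum_(y <- ys) H y s)); last first.
  by apply/funext => s; apply: eq_bigr => y _; rewrite mulrC.
split => //; rewrite e; apply: eq_bigr => y _.
by rewrite (dH y).2 mulrC.
Qed.

Lemma tdiff_xderive ts (f g : R -> R -> R) t x : admissible T ts t ->
  (forall s, 0 <= s <= T -> is_derive x 1 (f s) (g s x)) ->
  is_derive x 1 (fun x => tdiff ts (fun s => f s x) t) (tdiff ts (fun s => g s x) t).
Proof.
move=> + dfg; elim: ts t => [|tau ts IH] t; first by move=> /admissible_time; exact: dfg.
by move=> /admissible_tail[a0 a1 _] /=; apply: is_deriveB; exact: IH.
Qed.

Lemma divdiff_bounded_le n (K K' : R) a b f : K <= K' -> divdiff_bounded n K a b f ->
  divdiff_bounded n K' a b f.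
Proof. by move=> KK fK s us ss sab; rewrite (le_trans (fK s us ss sab)). Qed.

Definition step_prod (ts : seq R) : R := \prod_(tau <- ts) tau.

Lemma step_prod_ge0 ts t : admissible T ts t -> 0 <= step_prod ts.
Proof.
by move=> [_ ts0 _]; rewrite /step_prod big_seq; apply: prodr_ge0.
Qed.

(** Induction on the increments and, inside, on [c]. A space derivative is taken out of the order of
    the divided difference at the price of a factor at most [D]. A time difference is removed by the
    mean value theorem: for the last one the bound on [dt T u] applies; otherwise the equation
    replaces [dt T u] by three space derivatives of order at most 4, whence [3 * D ^+ 4]. So all
    time differences but the last cost four orders, and the last leaves [m] orders instead of
    [m.+1]; this is the form of the order condition. *)
Lemma divdiff_bounded_time (K a b : R) (u : R -> R -> R) (m : nat) :
  0 <= K ->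
  (forall t x n, 0 <= t <= T -> (n < 4)%N -> derivable (derive1n n (u t)) x 1) ->
  (forall t x, 0 <= t <= T -> tderivable T (fun s => u s x) t) ->
  (forall t x, 0 < t <= T ->
    dt T u t x + derive1 (u t) x + derive1n 2 (u t) x + derive1n 4 (u t) x = 0) ->
  (forall t i, 0 <= t <= T -> (0 < i <= m.+1)%N -> divdiff_bounded i K a b (u t)) ->
  (forall t i, 0 < t <= T -> (0 < i <= m)%N -> divdiff_bounded i K a b (dt T u t)) ->
  let D : R := (m + 8)%:R in
  forall ts t n c, admissible T ts t -> (0 < n)%N -> (c <= 4)%N ->
    (if ts is [::] then n + c <= m.+1 else n + c + 4 * size ts <= m + 4)%N ->
    divdiff_bounded n (D ^+ c * ((3 * D ^+ 4) ^+ size ts * K * step_prod ts)) a b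
      (fun x => tdiff ts (fun s => derive1n c (u s) x) t).
Proof.
move=> K0 du dtu pde H1 H2 D.
have D1 : 1 <= D by rewrite /D ler1n addn_gt0 orbT.
have D0 : 0 <= D by rewrite (le_trans ler01).
have Dp n : 1 <= D ^+ n by exact: exprn_ege1.
have Dm p q : (p <= q)%N -> D ^+ p <= D ^+ q by move=> pq; exact: ler_weXn2l.
elim=> [|tau ts IH] t n c at0 n0 c4.
  elim: c c4 n n0 => [|c IHc] c4 n n0 mc.
    rewrite expr0 !mul1r /step_prod big_nil mulr1; apply: H1; first exact: admissible_time at0.
    by rewrite n0; lia.
  have dx x : a < x < b -> is_derive x 1 (derive1n c (u t)) (derive1n c.+1 (u t) x).
    by move=> _; rewrite derive1nS derive1E; apply: DeriveDef => //; apply: du => //;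
      exact: admissible_time at0.
  have n1c : (n.+1 + c <= m.+1)%N by lia.
  apply: divdiff_bounded_le (divdiff_bounded_deriv dx (IHc (ltnW c4) n.+1 isT n1c)).
  rewrite [in leRHS]exprS -[leRHS]mulrA ler_wpM2r//.
    by do ?[exact: step_prod_ge0 at0|apply: mulr_ge0|apply: exprn_ge0] => //.
  by rewrite /D ler_nat; lia.
have P0 := step_prod_ge0 at0.
have [at1 at2 tau0] := admissible_tail at0.
have P1 := step_prod_ge0 at1.
elim: c c4 n n0 => [|c IHc] c4 n n0 mc; last first.
  have dx x : a < x < b -> is_derive x 1 (fun x => tdiff (tau :: ts) (fun s =>
    derive1n c (u s) x) t)
      (tdiff (tau :: ts) (fun s => derive1n c.+1 (u s) x) t).
    move=> _; apply: (@tdiff_xderive (tau :: ts) (fun s => derive1n c (u s)) (fun s =>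
      derive1n c.+1 (u s)) t x at0) => s sT.
    by rewrite derive1nS derive1E; apply: DeriveDef => //; exact: du.
  have n1c : (n.+1 + c + 4 * size (tau :: ts) <= m + 4)%N by lia.
  apply: divdiff_bounded_le (divdiff_bounded_deriv dx (IHc (ltnW c4) n.+1 isT n1c)).
  rewrite [in leRHS]exprS -[leRHS]mulrA ler_wpM2r//.
    by do ?[exact: P0|apply: mulr_ge0|apply: exprn_ge0] => //.
  by rewrite /D ler_nat; lia.
move=> ys uys sys yab; rewrite tdiff_divdiff expr0 mul1r.
have -> : (3 * D ^+ 4) ^+ size (tau :: ts) * K * step_prod (tau :: ts) =
    (3 * D ^+ 4 * ((3 * D ^+ 4) ^+ size ts * K * step_prod ts)) * tau.
  by rewrite /step_prod big_cons /= exprS; ring.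
set B := (3 * D ^+ 4) ^+ size ts * K * step_prod ts.
have B0 : 0 <= B by do ?[exact: P1|apply: mulr_ge0|apply: exprn_ge0] => //.
apply: (@tdiff_mvt ts _ (fun s => divdiff (dt T u s) ys)) => //.
- by move=> s sT; exact: (tderiv_divdiff ys sT (fun x => dtu s x sT)).1.
- move=> s sT; have sT' : 0 <= s <= T by case/andP: sT => /ltW -> /ltW ->.
  exact: (tderiv_divdiff ys sT' (fun x => dtu s x sT')).2.
move=> s as0 s0; move: mc IH B0; rewrite /B; case: ts {at0 at1 at2 P0 P1 B} as0 =>
  [|tau' ts] as0 mc IH B0.
  rewrite /= /step_prod big_nil expr0 mul1r mulr1.
  have [sT0 _] := as0; rewrite big_nil addr0 => sT.
  rewrite (le_trans (H2 s n _ _ ys uys sys yab))//; [lra|by rewrite n0; move: mc => /=; lia|].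
  by rewrite ler_peMl// (le_trans (Dp 4%N))// ler_peMl ?exprn_ge0// ler1n.
set B := (3 * D ^+ 4) ^+ _ * K * _ in B0 *.
rewrite -tdiff_divdiff.
have E y : tdiff (tau' :: ts) (fun s => dt T u s y) s =
  - (tdiff (tau' :: ts) (fun s => derive1n 1 (u s) y) s + tdiff (tau' :: ts) (fun s =>
    derive1n 2 (u s) y) s
     + tdiff (tau' :: ts) (fun s => derive1n 4 (u s) y) s).
  rewrite -!tdiffD -tdiffN; apply: (tdiff_ext_pos as0 s0) => v vT.
  by apply/eqP; rewrite -addr_eq0 !addrA; apply/eqP; exact: pde.
have -> : divdiff (fun y => tdiff (tau' :: ts) (fun s => dt T u s y) s) ys =
  - (divdiff (fun y => tdiff (tau' :: ts) (fun s => derive1n 1 (u s) y) s) ys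
     + divdiff (fun y => tdiff (tau' :: ts) (fun s => derive1n 2 (u s) y) s) ys
     + divdiff (fun y => tdiff (tau' :: ts) (fun s => derive1n 4 (u s) y) s) ys).
  by rewrite -!divdiffD -divdiffN; apply: divdiff_ext => y _; exact: E.
have Hcell c : (0 < c <= 4)%N ->
    `|divdiff (fun y => tdiff (tau' :: ts) (fun s => derive1n c (u s) y) s) ys| <= D ^+ 4 * B.
  move=> /andP[c0 c4']; have nc : (n + c + 4 * size (tau' :: ts) <= m + 4)%N.
    by move: mc; rewrite /=; lia.
  rewrite (le_trans (IH s n c as0 n0 c4' nc ys uys sys yab))//.
  by rewrite ler_wpM2r// Dm.
rewrite normrN (_ : 3 * D ^+ 4 * B = D ^+ 4 * B + D ^+ 4 * B + D ^+ 4 * B); last by ring.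
rewrite (le_trans (ler_normD _ _))// lerD ?Hcell//.
by rewrite (le_trans (ler_normD _ _))// lerD ?Hcell.
Qed.

End TimeDerivative.

(** * Projections on a mesh *)

Section MeshBasics.
Context (R : realType) (M : mesh R).
Local Notation N := (ncells M).
Implicit Types (j : 'I_N) (sigma x : R) (v w f : R -> R).

Definition nl j : R := node M j.
Definition nr j : R := node M j.+1.

Lemma nlr j : nl j < nr j.
Proof. exact: node_lt. Qed.

Lemma pi2_gt0 : 0 < 2 * pi :> R.
Proof. by rewrite mulr_gt0// pi_gt0. Qed.

Lemma ncells_gt0 : (0 < N)%N.
Proof.
rewrite lt0n; apply/eqP => N0; have := node_first M; have := node_last M.
by rewrite N0 => -> /eqP; rewrite gt_eqF// pi2_gt0.
Qed.

Lemma node_le (i j : nat) : (i <= j)%N -> (j <= N)%N -> node M i <= node M j.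
Proof.
elim: j => [|j IH]; first by rewrite leqn0 => /eqP ->.
rewrite leq_eqVlt => /predU1P[->//|ij] jN.
by rewrite (le_trans (IH ij (ltnW jN)))// ltW// node_lt.
Qed.

Lemma mesh_size_ge j : cell_size j <= mesh_size M.
Proof. exact: (@le_bigmax _ _ _ 0 (fun j : 'I_N => cell_size j)). Qed.

Lemma cell_size_gt0 j : 0 < cell_size j.
Proof. by rewrite subr_gt0 nlr. Qed.

Lemma mesh_size_gt0 : 0 < mesh_size M.
Proof.
exact: (lt_le_trans (cell_size_gt0 (Ordinal ncells_gt0)) (mesh_size_ge _)).
Qed.

Lemma cellE j x : cell j x = (nl j < x < nr j).
Proof. by rewrite /cell /= in_itv. Qed.

Lemma innerE j w v : inner j w v = itvint (nl j) (nr j) (fun x => w x * v x).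
Proof. by []. Qed.

Lemma trace_r_eq j v f : (forall x, nl j < x < nr j -> v x = f x) ->
  {for nr j, continuous f} -> trace_r j v = f (nr j).
Proof.
move=> vf cf; apply: cvg_lim => //.
apply: (@cvg_trans _ (f @ (nr j)^'-)); last exact: cvg_at_left_filter.
apply: near_eq_cvg; near=> x; rewrite vf//; apply/andP; split.
  by near: x; apply: nbhs_left_gt; exact: nlr.
by near: x; exact: nbhs_left_lt.
Unshelve. all: end_near. Qed.

Lemma trace_l_eq j v f : (forall x, nl j < x < nr j -> v x = f x) ->
  {for nl j, continuous f} -> trace_l j v = f (nl j).
Proof.
move=> vf cf; apply: cvg_lim => //.
apply: (@cvg_trans _ (f @ (nl j)^'+)); last exact: cvg_at_right_filter.
apply: near_eq_cvg; near=> x; rewrite vf//; apply/andP; split.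
  by near: x; exact: nbhs_right_gt.
by near: x; apply: nbhs_right_lt; exact: nlr.
Unshelve. all: end_near. Qed.

Lemma in_VhP k v : in_Vh M k v -> exists2 p : 'I_N -> {poly R},
  (forall j, (size (p j) <= k.+1)%N) &
  (forall j x, nl j < x < nr j -> v x = (p j).[x]).
Proof.
move=> vV; have /choice[p pP] : forall j, exists p : {poly R}, (size p <= k.+1)%N /\
    forall x, nl j < x < nr j -> v x = p.[x].
  by move=> j; have [p sp pv] := vV j; exists p; split => // x xj; apply: pv; rewrite cellE.
by exists p => j; [exact: (pP j).1|exact: (pP j).2].
Qed.

Definition wtrace_polys sigma (p : 'I_N -> {poly R}) j : R :=
  sigma * (p j).[nr j] + (1 - sigma) * (p (ordS j)).[nl (ordS j)].

Lemma wtrace_poly sigma v (p : 'I_N -> {poly R}) j :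
  (forall j x, nl j < x < nr j -> v x = (p j).[x]) ->
  wtrace sigma j v = wtrace_polys sigma p j.
Proof.
move=> vp; rewrite /wtrace (trace_r_eq (vp j)) ?(trace_l_eq (vp _))//;
  exact: continuous_horner.
Qed.

End MeshBasics.

(** * Mesh-independent bounds from moments and weighted traces *)

Section StaticEstimates.
Context (R : realType).

(** Quantitative form of [sigma <> 1 / 2]: the gap [delta] fixes the constants, the alternative
    tells which of the two traces dominates. *)
Definition dominant (delta sigma : R) : Prop :=
  `|1 - sigma| + delta <= `|sigma| \/ `|sigma| + delta <= `|1 - sigma|.

(** A cyclic bidiagonal system. At an index [j] where [|c j|] is maximal, the row whose dominant
    coefficient multiplies [c j] is used: row [j] in the first case, its predecessor in the
    second. *)
Lemma cyclic_bound N (c : 'I_N -> R) (alpha beta B delta : R) : 0 < delta ->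
  `|beta| + delta <= `|alpha| \/ `|alpha| + delta <= `|beta| ->
  (forall j, `|alpha * c j + beta * c (ordS j)| <= B) -> forall j, `|c j| <= B / delta.
Proof.
move=> d0 ab H j0; rewrite ler_pdivlMr//.
pose j := [arg max_(i > j0) `|c i|]%O.
have jP i : `|c i| <= `|c j| by rewrite /j; case: arg_maxP => // i' _; exact.
apply: (@le_trans _ _ (`|c j| * delta)); first by rewrite ler_wpM2r// ltW.
case: ab => ab.
  have Hj := H j.
  have : `|alpha * c j| <= B + `|beta * c (ordS j)|.
    rewrite -lerBlDr; apply: le_trans Hj; exact: lerB_normD.
  rewrite !normrM => H1.
  have H2 : `|beta| * `|c (ordS j)| <= `|beta| * `|c j| by rewrite ler_wpM2l.
  have H3 : (`|beta| + delta) * `|c j| <= `|alpha| * `|c j| by rewrite ler_wpM2r.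
  by nra.
have := H (ord_pred j); rewrite ord_predK => Hj.
have : `|beta * c j| <= B + `|alpha * c (ord_pred j)|.
  rewrite -lerBlDr; apply: le_trans Hj; rewrite (addrC (alpha * _)); exact: lerB_normD.
rewrite !normrM => H1.
have H2 : `|alpha| * `|c (ord_pred j)| <= `|alpha| * `|c j| by rewrite ler_wpM2l.
have H3 : (`|alpha| + delta) * `|c j| <= `|beta| * `|c j| by rewrite ler_wpM2r.
by nra.
Qed.

Lemma leg_top_endsE k (a b : R) : a < b ->
  (leg_top k a b).[a] = (legendre R k k).[0] /\ (leg_top k a b).[b] = (legendre R k k).[1].
Proof.
move=> ab; have ba : b - a != 0 by rewrite subr_eq0 gt_eqF.
by rewrite /leg_top !horner_comp /to_ref !hornerE subrr mulr0 mulVf.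
Qed.

(** Both end values have square [2 k + 1]. Equal moduli, at least 1, carry the dominance of the
    weights over to the cyclic systems. *)
Lemma legendre_ends k : `|(legendre R k k).[0]| = `|(legendre R k k).[1]| /\ 1 <=
  `|(legendre R k k).[1]|.
Proof.
have := @orthonormal_poly_ends R k (legendre R k k) (size_legendre R (leqnn k))
  (@legendre_last_orth R k).
rewrite legendre_ortho// eqxx => /(_ erefl)[e0 e1]; split.
  by apply/eqP; rewrite -(eqrXn2 (n := 2)) ?normr_ge0// !real_normK ?num_real// e0 e1.
by rewrite -(ler_pXn2r (n := 2)) ?nnegrE// real_normK ?num_real// e1 expr1n ler1n.
Qed.

(** On each cell the moments determine [p j] up to a multiple [c j] of the top Legendre polynomial,
    and the weighted traces form a dominant cyclic system for the [c j]. No power of the mesh size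
    is lost; the estimate serves the projections and all the corrections. *)
Lemma static_estimate k (delta W : R) : 0 < delta -> 0 <= W ->
  exists2 C : R, 0 < C & forall (M : mesh R) (sigma B : R)
    (p : 'I_(ncells M) -> {poly R}) (g : 'I_(ncells M) -> R -> R),
  dominant delta sigma -> `|sigma| <= W -> `|1 - sigma| <= W ->
  (forall j, (size (p j) <= k.+1)%N) ->
  (forall j, bmeas (nl j) (nr j) (g j)) ->
  (forall j x, nl j < x < nr j -> `|g j x| <= B) ->
  (forall j (q : {poly R}), (size q <= k)%N ->
     itvint (nl j) (nr j) (fun x => ((p j).[x] - g j x) * q.[x]) = 0) ->
  (forall j, `|wtrace_polys sigma p j| <= B) ->
  forall j x, nl j <= x <= nr j -> `|(p j).[x]| <= C * B.
Proof.
move=> d0 W0; have [C C0 CP] := moments_bound R k.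
have [ML ML0 MLP] := leg_top_bounded R k.
have [e01 e1] := legendre_ends k.
exists (C + (1 + 2 * W * C) / delta * ML).
  by rewrite ltr_pwDl// mulr_ge0 ?ltW// divr_gt0// ltr_pwDl// !mulr_ge0// ltW.
move=> M sigma B p g dom sW sW' sp mg gB pg wB.
have B0 : 0 <= B by exact: le_trans (wB (Ordinal (ncells_gt0 M))).
have /choice[c cP] : forall j, exists c : R, exists p1 : {poly R},
    p j = p1 + c *: leg_top k (nl j) (nr j) /\
    forall x, nl j <= x <= nr j -> `|p1.[x]| <= C * B.
  by move=> j; exact: (CP _ _ _ (g j) B (nlr j) (sp j) (mg j) (gB j) (pg j)).
have /choice[p1 p1P] := cP.
have cB j : `|c j| <= ((1 + 2 * W * C) * B) / delta.
  pose L0 := (legendre R k k).[0]; pose L1 := (legendre R k k).[1].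
  apply: (@cyclic_bound _ c (sigma * L1) ((1 - sigma) * L0)) => //.
    rewrite !normrM /L0 e01; case: dom => H; [left|right].
      apply: (@le_trans _ _ ((`|1 - sigma| + delta) * `|L1|)); last by rewrite ler_wpM2r.
      by rewrite mulrDl lerD2l ler_peMr// ltW.
    apply: (@le_trans _ _ ((`|sigma| + delta) * `|L1|)); last by rewrite ler_wpM2r.
    by rewrite mulrDl lerD2l ler_peMr// ltW.
  move=> i; have [pE1 pB1] := p1P i; have [pE2 pB2] := p1P (ordS i).
  have [_ l1] := leg_top_endsE k (nlr i); have [l2 _] := leg_top_endsE k (nlr (ordS i)).
  have := wB i; rewrite /wtrace_polys pE1 pE2 !hornerD !hornerZ l1 l2 -/L0 -/L1.
  set A1 := (p1 i).[_]; set A2 := (p1 _).[_] => H.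
  have H1 : `|A1| <= C * B by apply: pB1; rewrite lexx ltW// nlr.
  have H2 : `|A2| <= C * B by apply: pB2; rewrite lexx ltW// nlr.
  rewrite (_ : sigma * L1 * c i + (1 - sigma) * L0 * c (ordS i) =
     (sigma * (A1 + c i * L1) + (1 - sigma) * (A2 + c (ordS i) * L0)) -
     (sigma * A1 + (1 - sigma) * A2)); last by ring.
  rewrite (_ : (1 + 2 * W * C) * B = B + (W * (C * B) + W * (C * B))); last by ring.
  rewrite (le_trans (ler_normB _ _))// lerD// (le_trans (ler_normD _ _))// !normrM.
  by rewrite lerD// ler_pM.
move=> j x xj; have [-> p1B] := p1P j.
rewrite hornerD hornerZ (le_trans (ler_normD _ _))// mulrDl lerD ?p1B//.
rewrite normrM (_ : _ / delta * ML * B = ((1 + 2 * W * C) * B) / delta * ML); last by ring.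
by rewrite ler_pM ?cB// MLP// nlr.
Qed.

End StaticEstimates.

(** * A discrete Poincare inequality *)

Section DiscretePoincare.
Context (R : realType).

Lemma size_deriv_le k (p : {poly R}) : (size p <= k.+1)%N -> (size p^`() <= k)%N.
Proof. by move=> sp; rewrite (leq_trans (size_poly _ _))//; case: (size p) sp. Qed.

Lemma polydot_bound (a b : R) (p q : {poly R}) (G Q : R) : a <= b ->
  (forall x, a < x < b -> `|p.[x]| <= G) -> (forall x, a < x < b -> `|q.[x]| <= Q) ->
  `|polydot a b p q| <= G * Q * (b - a).
Proof.
move=> ab pG qQ; apply: itvint_bound => // [|x xab]; first by apply: bmeasM; exact: bmeas_horner.
by rewrite normrM ler_pM// ?pG ?qQ.
Qed.

Lemma poly_osc (a b : R) (p : {poly R}) (D x y : R) :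
  (forall z, a < z < b -> `|p^`().[z]| <= D) -> a <= x <= b -> a <= y <= b -> x <= y ->
  `|p.[y] - p.[x]| <= D * (y - x).
Proof.
move=> pD xab yab xy; rewrite -itvint_ftc_poly//; apply: itvint_bound => //;
  first exact: bmeas_horner.
by move=> z zxy; apply: pD; lra.
Qed.

Section Jumps.
Variables (M : mesh R) (k : nat) (sigma : R).
Variables (v g : 'I_(ncells M) -> {poly R}).
Hypothesis vg : forall j (phi : {poly R}), (size phi <= k.+1)%N ->
  polydot (nl j) (nr j) (v j) phi^`() - wtrace_polys sigma v j * phi.[nr j]
  + wtrace_polys sigma v (ord_pred j) * phi.[nl j] = - polydot (nl j) (nr j) (g j) phi.

Definition jump j : R := (v (ordS j)).[nl (ordS j)] - (v j).[nr j].

(** Integration by parts on the cell: the fluxes become jumps, and this strong form is what gets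
    tested below. *)
Lemma jump_eq j (phi : {poly R}) : (size phi <= k.+1)%N ->
  (1 - sigma) * jump j * phi.[nr j] + sigma * jump (ord_pred j) * phi.[nl j]
  + polydot (nl j) (nr j) (v j)^`() phi = polydot (nl j) (nr j) (g j) phi.
Proof.
move=> sphi; have := vg j sphi; have := polydot_derivM (v j) phi (ltW (nlr j)).
rewrite /jump /wtrace_polys ord_predK => H1 H2.
set X := polydot _ _ (v j)^`() phi in H1 *; set Y := polydot _ _ (v j) phi^`() in H1 H2.
have -> : X = (v j).[nr j] * phi.[nr j] - (v j).[nl j] * phi.[nl j] - Y by rewrite -H1 addrK.
by apply: oppr_inj; rewrite -H2; ring.
Qed.

End Jumps.

(** [g] acts as the discrete derivative of [v]. Testing with the top Legendre polynomial removes the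
    derivative of [v] and leaves a dominant cyclic system for the jumps; testing with the derivative
    of [v] then bounds it. Summation over the cells bounds the oscillation, and the mean fixes the
    remaining constant. *)
Lemma discrete_poincare k (gamma delta W : R) : 0 < gamma -> 0 < delta -> 0 <= W ->
  exists2 C : R, 0 < C & forall (M : mesh R) (sigma G m : R)
    (v g : 'I_(ncells M) -> {poly R}),
  quasi_uniform gamma M ->
  dominant delta sigma -> `|sigma| <= W -> `|1 - sigma| <= W ->
  (forall j, (size (v j) <= k.+1)%N) ->
  (forall j x, nl j < x < nr j -> `|(g j).[x]| <= G) ->
  (forall j (phi : {poly R}), (size phi <= k.+1)%N ->
    polydot (nl j) (nr j) (v j) phi^`() - wtrace_polys sigma v j * phi.[nr j]
    + wtrace_polys sigma v (ord_pred j) * phi.[nl j] = - polydot (nl j) (nr j) (g j) phi) ->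
  `|\sum_j itvint (nl j) (nr j) (horner (v j))| <= m ->
  forall j x, nl j <= x <= nr j -> `|(v j).[x]| <= C * (G + m).
Proof.
move=> ga0 d0 W0; have [ML ML0 MLP] := leg_top_bounded R k.
have [S S0 SP] := sup_sqr_le_polydot R k; have [e01 e1] := legendre_ends R k.
pose Cj := ML / delta / gamma; pose Cd := S * (1 + 2 * W * Cj).
have Cj0 : 0 < Cj by rewrite /Cj !divr_gt0.
have Cd0 : 0 < Cd by rewrite mulr_gt0// ltr_pwDl// mulr_ge0 ?(ltW Cj0)// mulr_ge0.
have P0 := pi2_gt0 R.
exists ((2 * pi)^-1 + 2 * (Cd + Cj) * (2 * pi)).
  by rewrite addr_gt0 ?invr_gt0// mulr_gt0// mulr_gt0// addr_gt0.
move=> M sigma G m v g qu dom sW sW' sv gG vg vm.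
have j0 : 'I_(ncells M) := Ordinal (ncells_gt0 M).
have G0 : 0 <= G.
  by apply: le_trans (gG j0 ((nl j0 + nr j0) / 2) _) => //; have := nlr j0; lra.
have m0 : 0 <= m by apply: le_trans vm.
have hj (j : 'I_(ncells M)) : 0 < nr j - nl j by rewrite subr_gt0 nlr.
(* By quasi-uniformity the jump is bounded by the length of any chosen cell [i], so that sums of
   jumps telescope into lengths. *)
have jumpB (i j : 'I_(ncells M)) : `|jump v j| <= Cj * G * (nr i - nl i).
  have Jb : `|jump v (ord_pred (ordS j))| <= G * ML * mesh_size M / delta.
    move: (ordS j); apply: (@cyclic_bound _ _ (fun j => jump v (ord_pred j))
       (sigma * (legendre R k k).[0]) ((1 - sigma) * (legendre R k k).[1])) => //.
      rewrite !normrM e01; case: dom => H; [left|right].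
        apply: (@le_trans _ _ ((`|1 - sigma| + delta) * `|(legendre R k k).[1]|));
          last by rewrite ler_wpM2r.
        by rewrite mulrDl lerD2l ler_peMr// ltW.
      apply: (@le_trans _ _ ((`|sigma| + delta) * `|(legendre R k k).[1]|));
        last by rewrite ler_wpM2r.
      by rewrite mulrDl lerD2l ler_peMr// ltW.
    move=> {}j; rewrite ordSK; have [l0 l1] := leg_top_endsE k (nlr j).
    have := jump_eq vg j (phi := leg_top k (nl j) (nr j)).
    rewrite size_leg_top ?nlr// leqnn l0 l1 => /(_ isT).
    rewrite [X in _ + X = _](_ : _ = 0) ?addr0; last first.
      by rewrite polydotC leg_top_orth ?nlr// size_deriv_le.
    move=> H; rewrite (_ : _ + _ = polydot (nl j) (nr j) (g j) (leg_top k (nl j) (nr j)));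
      last first.
      by rewrite -H addrC; congr (_ + _); rewrite mulrAC.
    apply: (@le_trans _ _ (G * ML * (nr j - nl j))).
      by apply: polydot_bound => [|x /gG //|x xj]; [exact: ltW (nlr j)|apply: MLP => //;
        [exact: nlr|lra]].
    by rewrite ler_wpM2l// ?mulr_ge0 ?(ltW ML0)//; exact: mesh_size_ge.
  move: Jb; rewrite ordSK => /le_trans; apply.
  rewrite (_ : Cj * G * _ = G * ML / delta * ((nr i - nl i) / gamma)); last by rewrite /Cj; ring.
  rewrite mulrAC ler_wpM2l ?divr_ge0 ?mulr_ge0 ?(ltW ML0) ?(ltW d0)//.
  by rewrite ler_pdivlMr// mulrC; exact: qu.
have derB j x : nl j <= x <= nr j -> `|(v j)^`().[x]| <= Cd * G.
  pose h := nr j - nl j; pose P := polydot (nl j) (nr j) (v j)^`() (v j)^`().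
  have h0 : 0 < h := hj j.
  have sd : (size (v j)^`() <= k.+1)%N by rewrite ltnW// ltnS size_deriv_le.
  (* [y] is the bound of the inverse estimate for the derivative; testing bounds [P] by a multiple
     of [y], which leaves a quadratic inequality for [y]. *)
  pose y := Num.sqrt (S / h * P).
  have P_ge0 : 0 <= P by exact: polydot_ge0.
  have y0 : 0 <= y by rewrite sqrtr_ge0.
  have yE : y ^+ 2 = S / h * P by rewrite sqr_sqrtr// mulr_ge0// divr_ge0// ltW.
  have yB z : nl j <= z <= nr j -> `|(v j)^`().[z]| <= y.
    move=> zj; rewrite -(ler_pXn2r (n := 2)) ?nnegrE// yE real_normK ?num_real//.
    by apply: SP => //; exact: nlr.
  move=> xj; apply: le_trans (yB _ xj) _.
  have PB : P <= y * (G * h * (1 + 2 * W * Cj)).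
    have := jump_eq vg j sd; rewrite -/P => PE.
    have -> : P = polydot (nl j) (nr j) (g j) (v j)^`() - (1 - sigma) * jump v j * (v j)^`().[nr j]
       - sigma * jump v (ord_pred j) * (v j)^`().[nl j] by rewrite -PE; ring.
    apply: le_trans (ler_norm _) _.
    rewrite (_ : y * _ = G * y * h + W * (Cj * G * h) * y + W * (Cj * G * h) * y); last by ring.
    rewrite (le_trans (ler_normB _ _))// lerD ?(le_trans (ler_normB _ _))// ?lerD//.
    - by apply: polydot_bound => [|z /gG //|z zj]; [exact: ltW (nlr j)|apply: yB; lra].
    - by rewrite !normrM !ler_pM ?mulr_ge0 ?jumpB// yB// lexx ltW// nlr.
    - by rewrite !normrM !ler_pM ?mulr_ge0 ?jumpB// yB// lexx ltW// nlr.
  have [y00|yn0] := eqVneq y 0; first by rewrite y00 mulr_ge0// ltW.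
  have yp : 0 < y by rewrite lt_neqAle eq_sym yn0.
  rewrite -(ler_pM2l yp) -expr2 yE.
  apply: (@le_trans _ _ (S / h * (y * (G * h * (1 + 2 * W * Cj))))).
    by rewrite ler_wpM2l// divr_ge0// ltW.
  by rewrite le_eqVlt; apply/orP; left; apply/eqP; rewrite /Cd; field; rewrite gt_eqF.
pose E := (Cd + Cj) * G; pose c := (v (Ordinal (ncells_gt0 M))).[0].
have E0 : 0 <= E by rewrite mulr_ge0// ltW// addr_gt0.
have osc j x : nl j <= x <= nr j -> `|(v j).[x] - (v j).[nl j]| <= Cd * G * (x - nl j).
  move=> xj; apply: (@poly_osc (nl j) (nr j)) => [z zj||//|].
  - by apply: derB; case/andP: zj => /ltW -> /ltW ->.
  - by rewrite lexx ltW// nlr.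
  - by case/andP: xj.
(* Induction over the cells from the left end: each adds its oscillation and one jump, both
   proportional to its length. *)
have left j : `|(v j).[nl j] - c| <= E * nl j.
  case: j => n; elim: n => [|n IH] nN.
    by rewrite /nl /= node_first (_ : Ordinal _ = Ordinal (ncells_gt0 M)) ?subrr ?normr0
      ?mulr0//; exact: val_inj.
  pose i := Ordinal (ltnW nN); have iS : Ordinal nN = ordS i.
    by apply: val_inj; rewrite /= modn_small.
  have nE : nl (ordS i) = nr i by rewrite -iS.
  rewrite iS nE.
  rewrite (_ : _ - c = jump v i + ((v i).[nr i] - (v i).[nl i]) + ((v i).[nl i] - c)); last first.
    by rewrite /jump nE; ring.
  rewrite (_ : E * nr i = Cj * G * (nr i - nl i) + Cd * G * (nr i - nl i) + E * nl i);
    last by rewrite /E; ring.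
  rewrite (le_trans (ler_normD _ _))// lerD ?IH// (le_trans (ler_normD _ _))// lerD ?jumpB//.
  by apply: osc; rewrite lexx ltW// nlr.
have nl0 (j : 'I_(ncells M)) : 0 <= nl j by rewrite -(node_first M) node_le// ltnW.
have nrle (j : 'I_(ncells M)) : nr j <= 2 * pi by rewrite -(node_last M) node_le.
have all j x : nl j <= x <= nr j -> `|(v j).[x] - c| <= E * (2 * pi).
  move=> xj; rewrite (_ : _ - c = ((v j).[x] - (v j).[nl j]) + ((v j).[nl j] - c)); last by ring.
  apply: (@le_trans _ _ (E * x)); last by rewrite ler_wpM2l//; have := nrle j; lra.
  rewrite (_ : E * x = E * (x - nl j) + E * nl j); last by ring.
  rewrite (le_trans (ler_normD _ _))// lerD// (le_trans (osc _ _ xj))// ler_wpM2r//; first by lra.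
  by rewrite ler_wpM2r// lerDl ltW.
have tot : \sum_(j < ncells M) (nr j - nl j) = 2 * pi.
  rewrite [RHS](_ : _ = node M (ncells M) - node M 0%N); last by rewrite node_last node_first subr0.
  by rewrite -(telescope_sumr (fun i => node M i) (leq0n _)) big_mkord.
have cB : `|c| <= (m + E * (2 * pi) * (2 * pi)) / (2 * pi).
  rewrite ler_pdivlMr// -[X in _ * X](gtr0_norm P0) -normrM.
  rewrite (_ : c * (2 * pi) = \sum_j itvint (nl j) (nr j) (horner (v j))
      - \sum_j itvint (nl j) (nr j) (fun x => (v j).[x] - c)); last first.
    rewrite -sumrB -tot mulr_sumr; apply: eq_bigr => j _.
    rewrite itvintB; [|exact: bmeas_horner|exact: bmeas_cst].
    by rewrite subKr itvint_cst ?(ltW (nlr j)).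
  rewrite (le_trans (ler_normB _ _))// lerD// (le_trans (ler_norm_sum _ _ _))//.
  rewrite -[X in _ * X]tot mulr_sumr ler_sum// => j _; apply: itvint_bound.
  - exact: ltW (nlr j).
  - by apply: bmeasB; [exact: bmeas_horner|exact: bmeas_cst].
  - by move=> x xj; apply: all; lra.
move=> j x xj; rewrite (_ : (v j).[x] = ((v j).[x] - c) + c); last by ring.
apply: (@le_trans _ _ (E * (2 * pi) + (m + E * (2 * pi) * (2 * pi)) / (2 * pi))).
  by rewrite (le_trans (ler_normD _ _))// lerD ?all.
rewrite (_ : _ + _ / _ = m * (2 * pi)^-1 + 2 * (Cd + Cj) * (2 * pi) * G); last first.
  by rewrite /E; move: (2 * pi) P0 => Q Q0; field; rewrite gt_eqF.
have A0 : 0 <= (2 * pi)^-1 :> R by rewrite invr_ge0 ltW.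
have B0 : 0 <= 2 * (Cd + Cj) * (2 * pi).
  by rewrite mulr_ge0 ?(ltW P0)// mulr_ge0// ltW// addr_gt0.
set A := (2 * pi)^-1 in A0 *; set B := 2 * (Cd + Cj) * (2 * pi) in B0 *.
rewrite (_ : (A + B) * (G + m) = m * A + B * G + (A * G + B * m)); last by ring.
by rewrite lerDl addr_ge0// mulr_ge0.
Qed.

End DiscretePoincare.

(** * Size of the correction functions *)

Section TimeDifferenceTools.
Context (R : realType) (T : R).
Hypothesis T0 : 0 < T.

(** Integrals and traces are linear only on functions where they behave well; hence the set [S],
    whose stability under differences is carried along. *)
Lemma tdiff_lin (S : (R -> R) -> Prop) (L : (R -> R) -> R) (w : R -> R -> R) :
  (forall f g, S f -> S g ->
     S (fun x => f x - g x) /\ L (fun x => f x - g x) = L f - L g) ->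
  (forall s, 0 <= s <= T -> S (w s)) -> forall ts t, admissible T ts t ->
  S (fun x => tdiff ts (w^~ x) t) /\
  L (fun x => tdiff ts (w^~ x) t) = tdiff ts (fun s => L (w s)) t.
Proof.
move=> SL Sw; elim => [|tau ts IH] t at_; first by split=> //; apply: Sw;
  exact: admissible_time at_.
have [a1 a2 _] := admissible_tail at_; have [s1 l1] := IH _ a1; have [s2 l2] := IH _ a2.
by have [s3 l3] := SL _ _ s2 s1; split=> //=; rewrite l3 l1 l2.
Qed.

Lemma admissible_cons tau ts t : 0 <= tau -> admissible T ts t -> t + \sum_(a <- ts) a + tau <= T ->
  admissible T (tau :: ts) t.
Proof.
move=> tau0 [t0 ts0 tsT] H; split => //; last by rewrite big_cons; lra.
by move=> a; rewrite in_cons => /predU1P[->|/ts0].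
Qed.

Lemma norm_cvg_le (x_ : nat -> R) x B : (forall n, `|x_ n| <= B) ->
  x_ n @[n --> \oo] --> x -> `|x| <= B.
Proof.
move=> xB /cvg_norm xc; rewrite -(cvg_lim _ xc)//; apply: limr_le.
  by apply/cvg_ex; exists `|x|.
by apply: nearW => n; exact: xB.
Qed.

Lemma tdiff_tderiv_seq (F : R -> R) (h : nat -> R) ts t :
  (forall s, 0 <= s <= T -> tderivable T F s) ->
  (forall n, h n != 0) -> h n @[n --> \oo] --> (0 : R) ->
  (forall n, admissible T ts (t + h n)) -> admissible T ts t ->
  (tdiff ts F (t + h n) - tdiff ts F t) / h n @[n --> \oo] --> tdiff ts (tderive T F) t.
Proof.
move=> dF h0 hc; elim: ts t => [|tau ts IH] t ah at0.
  apply/cvgrPdist_le => /= e e0; have tT := admissible_time at0.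
  have [d d0 dP] := tderiv_eps (dF t tT) e0.
  near=> n; rewrite distrC.
  have -> : h n = (t + h n) - t by ring.
  have -> : t + (t + h n - t) = t + h n by ring.
  apply: dP; first exact: admissible_time (ah n).
    by rewrite -subr_eq0 addrAC subrr add0r.
  rewrite addrAC subrr add0r -[h n]subr0 distrC.
  by near: n; move/cvgrPdist_lt : hc; apply.
have [a1 a2 _] := admissible_tail at0.
have H1 : forall n, admissible T ts (t + h n) by move=> n; have [] := admissible_tail (ah n).
have H2 : forall n, admissible T ts (t + tau + h n).
  by move=> n; have [_ + _] := admissible_tail (ah n); rewrite addrAC.
rewrite [X in X @ _](_ : _ = fun n => (tdiff ts F (t + tau + h n) - tdiff ts F (t + tau)) / h n
    - (tdiff ts F (t + h n) - tdiff ts F t) / h n).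
  by apply: cvgB; exact: IH.
by apply/funext => n /=; rewrite (addrAC t tau) -mulrBl; congr (_ / _); ring.
Unshelve. all: end_near. Qed.

Lemma tdiff_tderiv_bound (F : R -> R) (B : R) ts t :
  (forall s, 0 <= s <= T -> tderivable T F s) ->
  (forall tau t', 0 < tau -> admissible T (tau :: ts) t' ->
     `|tdiff (tau :: ts) F t'| <= B * tau) ->
  admissible T ts t -> t + \sum_(a <- ts) a < T \/ 0 < t ->
  `|tdiff ts (tderive T F) t| <= B.
Proof.
move=> dF FB at0; have [t0 ts0 tT] := at0.
have div_gt (d : R) n : 0 < d -> 0 < d / n.+1%:R by move=> d0; rewrite divr_gt0.
have div_le (d : R) n : 0 < d -> d / n.+1%:R <= d.
  by move=> d0; rewrite ler_pdivrMr// ler_peMr ?ler1n// ltW.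
case=> [tS|tp].
  pose d := T - (t + \sum_(a <- ts) a); have d0 : 0 < d by rewrite subr_gt0.
  have ac n : admissible T (d / n.+1%:R :: ts) t.
    apply: admissible_cons => //; first by rewrite ltW// div_gt.
    by have := div_le d n d0; rewrite -(lerD2l (t + \sum_(a <- ts) a)) => /le_trans -> //;
      rewrite /d addrC subrK.
  apply: (@norm_cvg_le _ _ _ _ (@tdiff_tderiv_seq F (fun n =>
    d / n.+1%:R) ts t dF _ (harm_cvg d) _ at0)).
  - move=> n; rewrite normrM normfV (gtr0_norm (div_gt _ _ d0)) ler_pdivrMr ?div_gt//.
    exact: (FB _ _ (div_gt _ n d0) (ac n)).
  - by move=> n; rewrite gt_eqF// div_gt.
  - by move=> n; have [] := admissible_tail (ac n).
have ac n : admissible T (t / n.+1%:R :: ts) (t - t / n.+1%:R).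
  split; first by rewrite subr_ge0 div_le.
    by move=> a; rewrite in_cons => /predU1P[->|/ts0//]; rewrite ltW// div_gt.
  by rewrite big_cons addrA subrK.
apply: (@norm_cvg_le _ _ _ _ (@tdiff_tderiv_seq F (fun n => - (t / n.+1%:R)) ts t dF _ _ _ at0)).
- move=> n; rewrite normrM normfV normrN (gtr0_norm (div_gt _ _ tp)) ler_pdivrMr ?div_gt//.
  by have := FB _ _ (div_gt _ n tp) (ac n); rewrite /= subrK distrC.
- by move=> n; rewrite oppr_eq0 gt_eqF// div_gt.
- by rewrite -[0]oppr0; apply: cvgN; exact: harm_cvg.
- by move=> n; have [] := admissible_tail (ac n).
Qed.

(** A further small increment fits to the right or to the left, except when [t = 0] and the
    increments exhaust [[0, T]]. Then the first increment is halved, and each half falls under the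
    generic case. *)
Lemma tdiff_tderiv_bound_prod (F : R -> R) (B : R) ts t :
  (forall s, 0 <= s <= T -> tderivable T F s) ->
  (forall ts' t', size ts' = (size ts).+1 -> admissible T ts' t' ->
    `|tdiff ts' F t'| <= B * step_prod ts') ->
  admissible T ts t -> `|tdiff ts (tderive T F) t| <= B * step_prod ts.
Proof.
move=> dF FB at0; have [t0 ts0 tT] := at0.
have gen ts' t' : size ts' = size ts -> admissible T ts' t' ->
  t' + \sum_(a <- ts') a < T \/ 0 < t' ->
    `|tdiff ts' (tderive T F) t'| <= B * step_prod ts'.
  move=> sz; apply: tdiff_tderiv_bound => // tau s tau0 as0.
  rewrite (le_trans (FB _ _ _ as0)) /= ?sz//.
  by rewrite /step_prod big_cons mulrCA mulrC.
case: (ltrP 0 t) => [tp|tn]; first by apply: gen => //; right.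
case: (ltrP (t + \sum_(a <- ts) a) T) => [tS|ST]; first by apply: gen => //; left.
case: ts at0 ts0 tT ST FB gen => [|a ts] at0 ts0 tT ST FB gen.
  by rewrite big_nil in ST; move: T0; lra.
have [a1 a2 a0] := admissible_tail at0.
have S0 : 0 <= \sum_(s <- ts) s by rewrite big_seq sumr_ge0 => [//|s]; case: a1 => _ + _; exact.
rewrite big_cons in ST tT.
have [aE|aN] := eqVneq a 0; first by rewrite /= aE addr0 subrr normr0 /step_prod big_cons mul0r
  mulr0.
have ap : 0 < a by rewrite lt_neqAle eq_sym aN.
have b1 : admissible T (a / 2 :: ts) t by apply: admissible_cons => //; lra.
have b2 : admissible T (a / 2 :: ts) (t + a / 2).
  apply: admissible_cons; [lra| |lra].
  by have [_ ? _] := a1; split=> //; lra.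
have B1 : `|tdiff (a / 2 :: ts) (tderive T F) t| <= B * step_prod (a / 2 :: ts).
  by apply: gen => //; left; rewrite big_cons; lra.
have B2 : `|tdiff (a / 2 :: ts) (tderive T F) (t + a / 2)| <= B * step_prod (a / 2 :: ts).
  by apply: gen => //; right; lra.
have -> : tdiff (a :: ts) (tderive T F) t =
    tdiff (a / 2 :: ts) (tderive T F) (t + a / 2) + tdiff (a / 2 :: ts) (tderive T F) t.
  have E : t + a / 2 + a / 2 = t + a by lra.
  by rewrite /= E; ring.
rewrite (le_trans (ler_normD _ _))//.
have -> : B * step_prod (a :: ts) = B * step_prod (a / 2 :: ts) + B * step_prod (a / 2 :: ts).
  by rewrite /step_prod !big_cons; field.
exact: lerD.
Qed.

(** The time derivative is a pointwise limit of difference quotients bounded by [L]; dominated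
    convergence transfers measurability, the bound and the orthogonality relations. *)
Lemma dt_bounded (w : R -> R -> R) (a b L : R) t : 0 <= t <= T ->
  (forall s, 0 <= s <= T -> bmeas a b (w s)) ->
  (forall s x, 0 <= s <= T -> a < x < b -> tderivable T (w^~ x) s) ->
  (forall tau s x, 0 < tau -> admissible T [:: tau] s -> a < x < b ->
     `|w (s + tau) x - w s x| <= L * tau) ->
  [/\ bmeas a b (dt T w t), (forall x, a < x < b -> `|dt T w t x| <= L) &
    forall p : {poly R}, (forall s, 0 <= s <= T -> itvint a b (fun x => w s x * p.[x]) = 0) ->
      itvint a b (fun x => dt T w t x * p.[x]) = 0].
Proof.
move=> tT wm dw wL.
(* Increments that stay in the time interval: forward for [t < T], backward at [t = T]. *)
have [h [h0 hc hT]] : exists h : nat -> R, [/\ forall n, h n != 0,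
    h n @[n --> \oo] --> (0 : R) & forall n, 0 <= t + h n <= T].
  have div_gt (d : R) n : 0 < d -> 0 < d / n.+1%:R by move=> d0; rewrite divr_gt0.
  have div_le (d : R) n : 0 < d -> d / n.+1%:R <= d.
    by move=> d0; rewrite ler_pdivrMr// ler_peMr ?ler1n// ltW.
  have [tlT|tge] := ltrP t T.
    have d0 : 0 < T - t by rewrite subr_gt0.
    exists (fun n => (T - t) / n.+1%:R); split => [n||n]; last 2 first.
    - exact: harm_cvg.
    - by have := div_gt _ n d0; have := div_le _ n d0; move: (_ / n.+1%:R) => z; lra.
    - by rewrite gt_eqF// div_gt.
  have d0 : 0 < t by move: T0; lra.
  exists (fun n => - (t / n.+1%:R)); split => [n||n]; last 2 first.
  - by rewrite -[0]oppr0; apply: cvgN; exact: harm_cvg.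
  - by have := div_gt _ n d0; have := div_le _ n d0; move: (t / n.+1%:R) => z; lra.
  - by rewrite oppr_eq0 gt_eqF// div_gt.
pose f n x := (w (t + h n) x - w t x) / h n.
have fm n : bmeas a b (f n).
  apply: (@bmeas_ext _ _ _ (fun x => (h n)^-1 * (w (t + h n) x - w t x))).
    by move=> x _; rewrite mulrC.
  by apply: bmeasZ; apply: bmeasB; exact: wm.
have fL n x : a < x < b -> `|f n x| <= L.
  move=> xab; rewrite normrM normfV ler_pdivrMr ?normr_gt0//.
  have := hT n; case: (ltrP 0 (h n)) => [hp|hn] hnT.
    rewrite (gtr0_norm hp); apply: wL => //; apply: admissible_cons => //; first exact: ltW.
      by split=> //; rewrite ?big_nil; lra.
    by rewrite big_nil; lra.
  have hn0 : h n < 0 by rewrite lt_neqAle h0.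
  rewrite distrC (ltr0_norm hn0) -{1}[t](addrK (h n)).
  apply: wL => //; first by rewrite oppr_gt0.
  apply: admissible_cons; first by rewrite oppr_ge0.
    by split=> //; rewrite ?big_nil; lra.
  by rewrite big_nil; lra.
have fc x : a < x < b -> f n x @[n --> \oo] --> dt T w t x.
  move=> xab; apply: (@tdiff_tderiv_seq (w^~ x) h [::] t) => //.
  - by move=> s sT; exact: dw.
  - by move=> n; split=> //; rewrite ?big_nil; have := hT n; lra.
  - by split=> //; rewrite ?big_nil; lra.
have [dm dB _] := bmeas_cvg fm fL fc; split => // p wp.
have [P PP] := horner_bounded a b p.
have [] := @bmeas_cvg _ (fun n x => f n x * p.[x]) a b (fun x => dt T w t x * p.[x]) (L * P).
- by move=> n; apply: bmeasM => //; exact: bmeas_horner.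
- by move=> n x xab; rewrite normrM ler_pM ?fL// PP//; lra.
- by move=> x xab; apply: cvgMl; exact: fc.
move=> _ _ H; have := cvg_lim _ H; move=> <- //; apply: cvg_lim => //.
rewrite (_ : (fun _ => _) = (fun=> 0)); first exact: cvg_cst.
apply/funext => n.
rewrite (@itvint_ext _ _ _ _ (fun x => (h n)^-1 * (w (t + h n) x * p.[x] - w t x * p.[x])));
  last first.
  by move=> x _; rewrite /f; ring.
rewrite itvintZ; last by apply: bmeasB; apply: bmeasM; [exact: wm|exact: bmeas_horner|exact:
  wm|exact: bmeas_horner].
rewrite itvintB ?wp ?subrr ?mulr0//; by apply: bmeasM; [exact: wm|exact: bmeas_horner].
Qed.

End TimeDifferenceTools.

Section VhTools.
Context (R : realType) (M : mesh R).
Local Notation N := (ncells M).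

Lemma bmeas_Vh k v (j : 'I_N) : in_Vh M k v -> bmeas (nl j) (nr j) v.
Proof.
move=> /in_VhP[p _ vp]; apply: bmeas_ext (bmeas_horner _ _ (p j)) => x xj.
by rewrite (vp j).
Qed.

Lemma in_VhB k v w : in_Vh M k v -> in_Vh M k w -> in_Vh M k (fun x => v x - w x).
Proof.
move=> hv hw j; have [p sp vp] := hv j; have [q sq wq] := hw j.
exists (p - q) => [|x xj]; last by rewrite hornerD hornerN vp ?wq.
by rewrite (leq_trans (size_polyD _ _))// size_polyN geq_max sp.
Qed.

Lemma wtrace_VhB k sigma (j : 'I_N) v w : in_Vh M k v -> in_Vh M k w ->
  wtrace sigma j (fun x => v x - w x) = wtrace sigma j v - wtrace sigma j w.
Proof.
move=> /in_VhP[p _ vp] /in_VhP[q _ wq].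
rewrite (wtrace_poly _ _ vp) (wtrace_poly _ _ wq) (@wtrace_poly _ _ _ _ (fun j => p j - q j)).
  by rewrite /wtrace_polys !hornerD !hornerN; ring.
by move=> i x xi; rewrite hornerD hornerN (vp i x xi) (wq i x xi).
Qed.

End VhTools.

Definition weight_of (R : realType) (theta : R) (s : nat) : R :=
  if odd s then 1 - theta else theta.

(* The four quantities u, p, q, r are numbered s = 0, 1, 2, 3: quantity s is
   the s-th space derivative of the solution and carries the weight [weight_of theta s]. *)
Record corr_family (R : realType) (M : mesh R) (k l : nat) (theta T : R)
    (wf : nat -> nat -> R -> R -> R) : Prop := {
  cf_bmeas : forall s j t, (s < 4)%N -> 0 <= t <= T ->
    bmeas (@nl _ M j) (nr j) (wf s 0%N t);
  cf_Vh : forall s i t, (s < 4)%N -> (1 <= i <= l)%N -> 0 <= t <= T ->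
    in_Vh M k (wf s i t);
  cf_dt : forall i t (j : 'I_(ncells M)) x, (i < l)%N -> 0 <= t <= T -> nl j < x < nr j ->
    tderivable T (wf 0%N i ^~ x) t;
  cf_orth0 : forall s t (j : 'I_(ncells M)) (phi : {poly R}), (s < 4)%N -> 0 <= t <= T ->
    (size phi <= k)%N -> itvint (nl j) (nr j) (fun x => wf s 0%N t x * phi.[x]) = 0;
  cf_orth : forall s i t (j : 'I_(ncells M)) (phi : {poly R}), (s < 3)%N -> (i < l)%N ->
    0 <= t <= T -> (size phi <= k)%N ->
    itvint (nl j) (nr j) (fun x => (wf s i.+1 t x - itvint (nl j) x (wf s.+1 i t)) * phi.[x]) = 0;
  cf_orth3 : forall i t (j : 'I_(ncells M)) (phi : {poly R}), (i < l)%N ->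
    0 <= t <= T -> (size phi <= k)%N ->
    itvint (nl j) (nr j) (fun x => (wf 0%N i.+1 t x + wf 1%N i.+1 t x + wf 3%N i.+1 t x
      + itvint (nl j) x (dt T (wf 0%N i) t)) * phi.[x]) = 0;
  cf_trace : forall s i t (j : 'I_(ncells M)), (s < 4)%N -> (1 <= i <= l)%N ->
    0 <= t <= T -> wtrace (weight_of theta s) j (wf s i t) = 0 }.

(** [|theta| - |1 - theta|] equals [2 * theta - 1] for [theta <= 1] and 1 beyond. Odd quantities
    carry the complementary weight and satisfy the other alternative. *)
Lemma weight_of_dominant (R : realType) (theta : R) : 1 / 2 < theta ->
  forall s, dominant (Num.min 1 (2 * theta - 1)) (weight_of theta s).
Proof.
move=> th s; have H : `|1 - theta| + Num.min 1 (2 * theta - 1) <= `|theta|.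
  rewrite [`|theta|]ger0_norm; last by lra.
  have [t1|t1] := leP theta 1.
    rewrite ger0_norm; last by lra.
    apply: (@le_trans _ _ (1 - theta + (2 * theta - 1))); last by lra.
    by rewrite lerD2l ge_min lexx orbT.
  rewrite ltr0_norm; last by lra.
  apply: (@le_trans _ _ (- (1 - theta) + 1)); last by lra.
  by rewrite lerD2l ge_min lexx.
rewrite /weight_of; case: odd; [right|left] => //.
by rewrite opprB addrCA subrr addr0.
Qed.

Lemma min_gt0 (R : realType) (theta : R) : 1 / 2 < theta ->
  0 < Num.min 1 (2 * theta - 1).
Proof. by move=> th; rewrite lt_min ltr01/=; lra. Qed.

Lemma weight_of_norm (R : realType) (theta : R) s :
  `|weight_of theta s| <= 1 + `|theta| /\ `|1 - weight_of theta s| <= 1 + `|theta|.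
Proof.
have H : `|1 - theta| <= 1 + `|theta| by rewrite (le_trans (ler_normB _ _))// normr1.
rewrite /weight_of; case: odd; rewrite ?lerDr// ?subKr ?lerDr//; by split => //; rewrite lerDr.
Qed.

(** * Recursion over the order of the corrections *)

Section Levels.
Context (R : realType) (k l : nat) (theta : R).
Hypothesis htheta : 1 / 2 < theta.

Section Step.
Variables (M : mesh R) (T : R) (wf : nat -> nat -> R -> R -> R).
Hypothesis T0 : 0 < T.
Hypothesis cf : corr_family M k l theta T wf.

(* By the equation, a time difference of the data costs four space derivatives,
   hence the coefficient of [size ts]; each correction uses up one further order. *)
Definition level (i : nat) (B : R) : Prop :=
  forall s ts t (j : 'I_(ncells M)) x, (s < 4)%N -> admissible T ts t ->
    (s + 4 * size ts + i <= l + 6)%N -> nl j < x < nr j ->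
    `|tdiff ts (fun t => wf s i t x) t| <= B * step_prod ts.

Lemma cf_bdmi s i j t : (s < 4)%N -> (i <= l)%N -> 0 <= t <= T ->
  bmeas (@nl _ M j) (nr j) (wf s i t).
Proof.
case: i => [|i] s4 il tT; first exact: (cf_bmeas cf).
by apply: (@bmeas_Vh _ _ k); exact: (cf_Vh cf).
Qed.

Lemma level_dt i B j t : (i < l)%N -> level i B -> 0 <= t <= T ->
  [/\ bmeas (@nl _ M j) (nr j) (dt T (wf 0%N i) t),
    (forall x, nl j < x < nr j -> `|dt T (wf 0%N i) t x| <= B) &
    forall p : {poly R},
      (forall s, 0 <= s <= T -> itvint (nl j) (nr j) (fun x => wf 0%N i s x * p.[x]) = 0) ->
      itvint (nl j) (nr j) (fun x => dt T (wf 0%N i) t x * p.[x]) = 0].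
Proof.
move=> il lev tT; apply: dt_bounded => //.
- by move=> s sT; apply: cf_bdmi => //; exact: ltnW.
- by move=> s x sT xj; exact: (cf_dt cf il sT xj).
- move=> tau s x tau0 as_ xj; have := lev 0%N [:: tau] s j x isT as_ _ xj.
  by rewrite /step_prod big_seq1; apply; rewrite /=; lia.
Qed.

Lemma tdiff_Vh s i ts t : (s < 4)%N -> (1 <= i <= l)%N -> admissible T ts t ->
  in_Vh M k (fun x => tdiff ts (fun t => wf s i t x) t) /\
  forall j : 'I_(ncells M), wtrace (weight_of theta s) j (fun x => tdiff ts (fun t =>
    wf s i t x) t) = 0.
Proof.
move=> s4 il at0.
have Vh t' : 0 <= t' <= T -> in_Vh M k (wf s i t') by exact: (cf_Vh cf).
have SL (j : 'I_(ncells M)) f g : in_Vh M k f -> in_Vh M k g ->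
    in_Vh M k (fun x => f x - g x) /\
    wtrace (weight_of theta s) j (fun x => f x - g x) =
    wtrace (weight_of theta s) j f - wtrace (weight_of theta s) j g.
  by move=> hf hg; split; [exact: in_VhB|apply: wtrace_VhB hf hg].
have key (j : 'I_(ncells M)) := @tdiff_lin _ T (in_Vh M k) (wtrace (weight_of theta s) j) (wf s
  i) (SL j) Vh ts t at0.
split => [|j]; first by have [] := key (Ordinal (ncells_gt0 M)).
have [_ ->] := key j.
rewrite (tdiff_ext (G := fun=> 0) at0) ?tdiff0// => t' tT; exact: (cf_trace cf).
Qed.

Lemma tdiff_bmeas (w : R -> R -> R) a b ts t : (forall t, 0 <= t <= T -> bmeas a b (w t)) ->
  admissible T ts t -> bmeas a b (fun x => tdiff ts (fun t => w t x) t).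
Proof.
move=> wm at0; have [] // := @tdiff_lin _ T (bmeas a b) (fun=> 0) w _ wm ts t at0.
by move=> f g hf hg; split; [exact: bmeasB|rewrite subrr].
Qed.

Lemma tdiff_itvint (w : R -> R -> R) a b (p : {poly R}) ts t :
  (forall t, 0 <= t <= T -> bmeas a b (w t)) -> admissible T ts t ->
  itvint a b (fun x => tdiff ts (fun t => w t x) t * p.[x]) =
  tdiff ts (fun t => itvint a b (fun x => w t x * p.[x])) t.
Proof.
move=> wm at0.
have [] // := @tdiff_lin _ T (bmeas a b) (fun f => itvint a b (fun x =>
  f x * p.[x])) w _ wm ts t at0.
move=> f g hf hg; split; first exact: bmeasB.
rewrite -itvintB; try by apply: bmeasM => //; exact: bmeas_horner.
by apply: itvint_ext => x _; rewrite mulrBl.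
Qed.

Lemma tdiff_primitive (w : R -> R -> R) a b x ts t :
  (forall t, 0 <= t <= T -> bmeas a b (w t)) -> admissible T ts t -> x <= b ->
  itvint a x (fun x => tdiff ts (fun t => w t x) t) = tdiff ts (fun t => itvint a x (w t)) t.
Proof.
move=> wm at0 xb.
have [] // := @tdiff_lin _ T (bmeas a b) (fun f => itvint a x f) w _ wm ts t at0.
move=> f g hf hg; split; first exact: bmeasB.
by rewrite itvintB//; [apply: bmeas_sub hf|apply: bmeas_sub hg].
Qed.

End Step.

(** Time differences of the corrections satisfy [static_estimate] with primitives of the preceding
    corrections as data; integration over a cell gains one factor [mesh_size M]. The correction of r
    is treated last, since its equation contains the new corrections of u and p. *)
Lemma level_succ : exists2 C : R, 0 < C & forall (M : mesh R) (T : R) wf i (B : R),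
  0 < T -> corr_family M k l theta T wf -> (i < l)%N -> level M T wf i B ->
  level M T wf i.+1 (C * (mesh_size M * B)).
Proof.
have [Cs Cs0 CsP] := static_estimate k (min_gt0 htheta)
  (addr_ge0 (@ler01 R) (normr_ge0 theta)).
exists (Cs + Cs * (2 * Cs + 1)); first by rewrite addr_gt0// mulr_gt0// addr_gt0// mulr_gt0.
move=> M T wf i B T0 cf il lev; have h0 := mesh_size_gt0 M.
have B0 : 0 <= B.
  pose j0 := Ordinal (ncells_gt0 M); have := lev 0%N [::] 0 j0 ((nl j0 + nr j0) / 2) isT.
  rewrite /step_prod big_nil mulr1 => H; apply: le_trans (H _ _ _); rewrite ?normr_ge0//.
  - by split=> //; rewrite big_nil addr0 ltW.
  - by rewrite /=; lia.
  - by have := nlr j0; lra.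
have step s ts t (g : 'I_(ncells M) -> R -> R) (B' : R) : (s < 4)%N -> admissible T ts t ->
    (forall j, bmeas (nl j) (nr j) (g j)) ->
    (forall j x, nl j < x < nr j -> `|g j x| <= B') ->
    (forall j (q : {poly R}), (size q <= k)%N ->
      itvint (nl j) (nr j) (fun x => (tdiff ts (fun t => wf s i.+1 t x) t - g j x) * q.[x]) = 0) ->
    forall (j : 'I_(ncells M)) x, nl j < x < nr j -> `|tdiff ts (fun t =>
      wf s i.+1 t x) t| <= Cs * B'.
  move=> s4 at0 gm gB gq j x xj.
  have [/in_VhP[p sp fp] ftr] := tdiff_Vh cf s4 (i := i.+1) il at0.
  rewrite (fp j x xj); apply: (CsP M (weight_of theta s) B' p g) => //.
  - exact: weight_of_dominant.
  - by have [] := weight_of_norm theta s.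
  - by have [] := weight_of_norm theta s.
  - move=> j' q sq; rewrite -[RHS](gq j' q sq); apply: itvint_ext => y yj.
    by rewrite (fp j' y yj).
  - move=> j'; rewrite -(wtrace_poly _ _ fp) ftr normr0.
    apply: le_trans (gB j' ((nl j' + nr j') / 2) _) => //.
    by have := nlr j'; lra.
  - lra.
have primB ts t (j : 'I_(ncells M)) x (f : R -> R) B' : admissible T ts t ->
  bmeas (nl j) (nr j) f ->
    (forall x, nl j < x < nr j -> `|f x| <= B' * step_prod ts) -> 0 <= B' -> nl j < x < nr j ->
    `|itvint (nl j) x f| <= mesh_size M * B' * step_prod ts.
  move=> at0 fm fB B'0 xj; apply: le_trans (itvint_primitive_bound fm fB xj) _.
  rewrite [leRHS](_ : _ = B' * step_prod ts * mesh_size M); last by ring.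
  by rewrite ler_wpM2l ?(mesh_size_ge j)// mulr_ge0// (step_prod_ge0 at0).
have low s ts t (j : 'I_(ncells M)) x : (s < 3)%N -> admissible T ts t ->
  (s + 4 * size ts + i.+1 <= l + 6)%N ->
    nl j < x < nr j -> `|tdiff ts (fun t => wf s i.+1 t x) t| <=
      Cs * (mesh_size M * B * step_prod ts).
  move=> s3 at0 sl xj; have s4 : (s < 4)%N := ltnW s3.
  have wm (j' : 'I_(ncells M)) t' : 0 <= t' <= T -> bmeas (nl j') (nr j') (wf s.+1 i t').
    by move=> tT; apply: (cf_bdmi cf) => //; exact: ltnW.
  have wm1 (j' : 'I_(ncells M)) t' : 0 <= t' <= T -> bmeas (nl j') (nr j') (wf s i.+1 t').
    by move=> tT; apply: (cf_bdmi cf).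
  apply: (step s ts t (fun j x => itvint (nl j) x (fun x => tdiff ts (fun t =>
    wf s.+1 i t x) t))) xj => //.
  - by move=> j'; apply: bmeas_primitive; exact: (tdiff_bmeas (wm j')).
  - move=> j' y yj; apply: (primB ts t) => //; first exact: (tdiff_bmeas (wm j')).
    by move=> z zj; apply: lev zj => //; rewrite addSn addSn -addnS.
  - move=> j' q sq.
    rewrite (@itvint_ext _ _ _ _ (fun x => tdiff ts (fun t =>
      wf s i.+1 t x - itvint (nl j') x (wf s.+1 i t)) t * q.[x])); last first.
      by move=> y yj; rewrite tdiffB (tdiff_primitive (wm j') at0)//; lra.
    rewrite (@tdiff_itvint T (fun t x => wf s i.+1 t x - itvint (nl j') x (wf s.+1 i t)))//;
      last first.
      by move=> t' tT; apply: bmeasB; [exact: wm1|apply: bmeas_primitive; exact: wm].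
    rewrite (tdiff_ext (G := fun=> 0) at0) ?tdiff0// => t' tT; exact: (cf_orth cf).
move=> s ts t j x s4 at0 sl xj.
have P0 : 0 <= step_prod ts := step_prod_ge0 at0.
have hB : 0 <= mesh_size M * B * step_prod ts by rewrite !mulr_ge0// ltW.
have [s3|] := ltnP s 3.
  apply: le_trans (low s ts t j x s3 at0 sl xj) _.
  rewrite -!mulrA [mesh_size M * _]mulrA ler_wpM2r// ?lerDl//;
    last by rewrite mulr_ge0 ?addr_ge0 ?mulr_ge0// ltW.
move=> s3; have {s3 s4} sE : s = 3%N by apply/eqP; rewrite eqn_leq -ltnS s4.
rewrite sE in sl *.
have wm s' (j' : 'I_(ncells M)) t' : (s' < 4)%N -> 0 <= t' <= T ->
  bmeas (nl j') (nr j') (wf s' i.+1 t').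
  by move=> s4 tT; apply: (cf_bdmi cf).
have wd (j' : 'I_(ncells M)) t' : 0 <= t' <= T -> bmeas (nl j') (nr j') (dt T (wf 0%N i) t').
  by move=> tT; have [] := level_dt T0 cf j' il lev tT.
pose g (j : 'I_(ncells M)) x := - tdiff ts (fun t => wf 0%N i.+1 t x) t - tdiff ts (fun t =>
  wf 1%N i.+1 t x) t
  - itvint (nl j) x (fun x => tdiff ts (fun t => dt T (wf 0%N i) t x) t).
have gB : `|tdiff ts (fun t => wf 3%N i.+1 t x) t| <= Cs * ((2 * Cs +
  1) * (mesh_size M * B * step_prod ts)).
  apply: (step 3%N ts t g) xj => //.
  - move=> j'; apply: bmeasB; last by apply: bmeas_primitive; exact: (tdiff_bmeas (wd j')).
    apply: bmeasB; last by apply: (tdiff_bmeas (w := wf 1%N i.+1)) at0 => ? ?; exact: wm.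
    by apply: bmeasN; apply: (tdiff_bmeas (w := wf 0%N i.+1)) at0 => ? ?; exact: wm.
  - move=> j' y yj.
    have b0 := low 0%N ts t j' y isT at0; have b1 := low 1%N ts t j' y isT at0.
    rewrite [leRHS](_ : _ = Cs * (mesh_size M * B * step_prod ts) +
      Cs * (mesh_size M * B * step_prod ts)
       + mesh_size M * B * step_prod ts); last by ring.
    rewrite (le_trans (ler_normB _ _))// lerD// ?(le_trans (ler_normB _ _))// ?lerD//.
    + by rewrite normrN; apply: b0 yj; rewrite (leq_trans _ sl)// !leq_add2r.
    + by apply: b1 yj; rewrite (leq_trans _ sl)// !leq_add2r.
    + apply: (primB ts t) => //; first exact: (tdiff_bmeas (wd j')).
      (* From r at order [i.+1] to the time derivative of u at order [i]: three units of [s] and one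
         of [i] pay exactly for the additional time difference. *)
      move=> z zj; apply: tdiff_tderiv_bound_prod => //.
        by move=> t' tT; exact: (cf_dt cf il tT zj).
      by move=> ts' t' sz at'; apply: lev zj => //; rewrite (leq_trans _ sl)// sz mulnS add0n
        addnS leqnn.
  - move=> j' q sq.
    rewrite (@itvint_ext _ _ _ _ (fun x => tdiff ts (fun t =>
      wf 0%N i.+1 t x + wf 1%N i.+1 t x + wf 3%N i.+1 t x
      + itvint (nl j') x (dt T (wf 0%N i) t)) t * q.[x])); last first.
      move=> y yj; rewrite /g (tdiff_primitive (wd j') at0); last by lra.
      by rewrite !tdiffD; congr (_ * _); ring.
    rewrite (@tdiff_itvint T (fun t x => wf 0%N i.+1 t x + wf 1%N i.+1 t x + wf 3%N i.+1 t x
      + itvint (nl j') x (dt T (wf 0%N i) t)))//; last first.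
      move=> t' tT; apply: bmeasD; last by apply: bmeas_primitive; exact: wd.
      by apply: bmeasD; [apply: bmeasD|]; exact: wm.
    rewrite (tdiff_ext (G := fun=> 0) at0) ?tdiff0// => t' tT; exact: (cf_orth3 cf).
apply: le_trans gB _; rewrite !mulrA ler_wpM2r// ler_wpM2r// ler_wpM2r ?(ltW h0)//.
by rewrite lerDr ltW.
Qed.

End Levels.

(** * Projection errors as the start of the recursion *)

Section LevelBase.
Context (R : realType).

Lemma endpoint_bound (f : R -> R) (a b B : R) : a < b ->
  (forall x, a < x < b -> `|f x| <= B) ->
  ({for a, continuous f} -> `|f a| <= B) /\ ({for b, continuous f} -> `|f b| <= B).
Proof.
move=> ab fB; split => cf.
  have H : `|f x| @[x --> a^'+] --> `|f a| by apply: cvg_norm; exact: cvg_at_right_filter.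
  rewrite -(cvg_lim _ H)//; apply: limr_le; first by apply/cvg_ex; exists `|f a|.
  near=> x; apply: fB; apply/andP; split; first by near: x; exact: nbhs_right_gt.
  by near: x; exact: nbhs_right_lt.
have H : `|f x| @[x --> b^'-] --> `|f b| by apply: cvg_norm; exact: cvg_at_left_filter.
rewrite -(cvg_lim _ H)//; apply: limr_le; first by apply/cvg_ex; exists `|f b|.
near=> x; apply: fB; apply/andP; split; last by near: x; exact: nbhs_left_lt.
by near: x; exact: nbhs_left_gt.
Unshelve. all: end_near. Qed.

Lemma wtrace_contB k (M : mesh R) sigma (j : 'I_(ncells M)) c v :
  (forall x, {for x, continuous c}) -> in_Vh M k v ->
  wtrace sigma j (fun x => c x - v x) =
  sigma * c (nr j) + (1 - sigma) * c (nl (ordS j)) - wtrace sigma j v.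
Proof.
move=> cc /in_VhP[p _ vp]; rewrite (wtrace_poly _ _ vp) /wtrace /wtrace_polys.
rewrite (@trace_r_eq _ _ _ _ (fun x => c x - (p j).[x])).
- rewrite (@trace_l_eq _ _ _ _ (fun x => c x - (p (ordS j)).[x])); first by ring.
    by move=> x xj; rewrite (vp _ _ xj).
  by apply: continuousB; [exact: cc|exact: continuous_horner].
- by move=> x xj; rewrite (vp _ _ xj).
- by apply: continuousB; [exact: cc|exact: continuous_horner].
Qed.

Variables (k l : nat) (theta : R).
Hypothesis htheta : 1 / 2 < theta.
Hypothesis l0 : (0 < l)%N.

(** On each cell a polynomial [q] approximates the time difference [U] of the exact quantity. The
    difference between [q] and the projection of [U] solves the projection problem for the small
    function [q - U], so [static_estimate] bounds it. *)
Lemma level_base : exists2 C : R, 0 < C & forall (M : mesh R) (T K : R)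
    (u : R -> R -> R) (P : nat -> R -> R -> R) (wf : nat -> nat -> R -> R -> R),
  0 < T -> 0 <= K ->
  (forall t x n, 0 <= t <= T -> (n < 4)%N -> derivable (derive1n n (u t)) x 1) ->
  (forall t x, 0 <= t <= T -> tderivable T (fun s => u s x) t) ->
  (forall t x, 0 < t <= T ->
    dt T u t x + derive1 (u t) x + derive1n 2 (u t) x + derive1n 4 (u t) x = 0) ->
  (forall (j : 'I_(ncells M)) t i, 0 <= t <= T -> (0 < i <= k + l + 4)%N ->
    divdiff_bounded i K (nl j) (nr j) (u t)) ->
  (forall (j : 'I_(ncells M)) t i, 0 < t <= T -> (0 < i <= k + l + 3)%N ->
    divdiff_bounded i K (nl j) (nr j) (dt T u t)) ->
  (forall s t, (s < 4)%N -> 0 <= t <= T ->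
    is_ggr M k (weight_of theta s) (derive1n s (u t)) (P s t)) ->
  (forall s t x, (s < 4)%N -> 0 <= t <= T ->
    wf s 0%N t x = derive1n s (u t) x - P s t x) ->
  level l M T wf 0 (C * (K * mesh_size M ^+ k.+1)).
Proof.
have [Cs Cs0 CsP] := static_estimate k (min_gt0 htheta)
  (addr_ge0 (@ler01 R) (normr_ge0 theta)).
pose D : R := (k + l + 3 + 8)%:R; pose E := D ^+ 3 * (3 * D ^+ 4) ^+ (l + 6).
have D1 : 1 <= D by rewrite ler1n; lia.
have D41 : 1 <= 3 * D ^+ 4.
  by rewrite (le_trans (exprn_ege1 4 D1))// ler_peMl ?exprn_ge0 ?(le_trans ler01)//; lra.
have E0 : 0 < E by rewrite mulr_gt0 ?exprn_gt0 ?(lt_le_trans ltr01).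
exists ((1 + Cs * (2 + 2 * `|theta|)) * E).
  by rewrite mulr_gt0// addr_gt0// mulr_gt0// ltr_pwDl// mulr_ge0.
move=> M T K u P wf T0 K0 dx dtu eq uK utK Pggr wfE s ts t j x s4 at0 sl xj.
pose U x := tdiff ts (fun t => derive1n s (u t) x) t.
have P0 : 0 <= step_prod ts := step_prod_ge0 at0.
pose B := E * K * step_prod ts * mesh_size M ^+ k.+1.
have hEK : 0 <= E * K * step_prod ts by apply: mulr_ge0 => //; apply: mulr_ge0 => //; exact: ltW.
have B0 : 0 <= B by apply: mulr_ge0 => //; rewrite exprn_ge0// ltW// mesh_size_gt0.
(* With [m = k + l + 3], [n = k.+1] and [c = s] the order condition reads [s + 4 * size ts <= l + 6]
   when there are time differences: this is the threshold in [level]. *)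
have Uddb (i : 'I_(ncells M)) : divdiff_bounded k.+1 (E * K * step_prod ts) (nl i) (nr i) U.
  have := divdiff_bounded_time T0 K0 dx dtu eq (m := (k + l + 3)%N) _ _ at0 (n := k.+1) (c := s).
  move=> /(_ (nl i) (nr i)); rewrite -/D => H; apply: divdiff_bounded_le (H _ _ _ _ _) => //.
  - rewrite mulrA mulrA ler_wpM2r// ler_wpM2r// ler_pM ?exprn_ge0 ?(le_trans ler01)//.
      by rewrite ler_weXn2l// -ltnS.
    by rewrite ler_weXn2l//; clear -sl; lia.
  - by move=> t' i' tT ii; apply: uK => //; rewrite addnS.
  - by move=> t' i' tT ii; apply: utK.
  - exact: ltnW.
  - by clear -sl s4 l0; case: (ts) sl => [|a ts'] /= sl; lia.
have /choice[q qP] : forall i : 'I_(ncells M), exists q : {poly R}, (size q <= k.+1)%N /\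
    forall x, nl i < x < nr i -> `|U x - q.[x]| <= B.
  move=> i; have [q sq qB] := divdiff_bounded_approx (nlr i) hEK (Uddb i).
  exists q; split => // y yi; apply: le_trans (qB y yi) _.
  rewrite ler_wpM2l//.
  rewrite ler_pXn2r ?nnegrE ?subr_ge0 ?(ltW (nlr i)) ?(ltW (mesh_size_gt0 M))//.
  exact: mesh_size_ge.
have Uc y : {for y, continuous U}.
  apply: differentiable_continuous; apply/derivable1_diffP.
  have [] // := @tdiff_xderive _ T ts (fun t => derive1n s (u t)) (fun t =>
    derive1 (derive1n s (u t))) t y at0.
  move=> t' tT; apply: DeriveDef; first exact: dx.
  by rewrite derive1E.
have Vh t' : 0 <= t' <= T -> in_Vh M k (P s t').
  by move=> tT; have [] := Pggr s t' s4 tT.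
have SL (i : 'I_(ncells M)) f g : in_Vh M k f -> in_Vh M k g ->
    in_Vh M k (fun x => f x - g x) /\
    wtrace (weight_of theta s) i (fun x => f x - g x) =
    wtrace (weight_of theta s) i f - wtrace (weight_of theta s) i g.
  by move=> hf hg; split; [exact: in_VhB|apply: wtrace_VhB hf hg].
have key (i : 'I_(ncells M)) := @tdiff_lin _ T (in_Vh M k) (wtrace (weight_of theta s) i) (P s)
  (SL i) Vh ts t at0.
have [/in_VhP[p sp pE] _] := key j.
have uc t' y : 0 <= t' <= T -> {for y, continuous (derive1n s (u t'))}.
  by move=> tT; apply: differentiable_continuous; apply/derivable1_diffP; exact: dx.
have ubdm t' (i : 'I_(ncells M)) : 0 <= t' <= T -> bmeas (nl i) (nr i) (derive1n s (u t')).
  by move=> tT; apply: bmeas_continuous; apply: continuous_subspaceT => y; exact: uc.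
have tr (i : 'I_(ncells M)) : wtrace_polys (weight_of theta s) p i =
    weight_of theta s * U (nr i) + (1 - weight_of theta s) * U (nl (ordS i)).
  rewrite -(wtrace_poly _ _ pE); have [_ ->] := key i.
  rewrite -!tdiffZ -tdiffD; apply: (tdiff_ext at0) => t' tT; apply/eqP.
  have [_ _ /(_ i)] := Pggr s t' s4 tT.
  rewrite (@wtrace_contB k _ _ _ (derive1n s (u t')) (P s t'))//; last first.
  - exact: Vh.
  - by move=> y; exact: uc.
  by move=> /eqP; rewrite subr_eq0 eq_sym.
have UP (i : 'I_(ncells M)) (phi : {poly R}) : (size phi <= k)%N ->
    itvint (nl i) (nr i) (fun x => U x * phi.[x]) = itvint (nl i) (nr i) (fun x =>
      (p i).[x] * phi.[x]).
  move=> sphi; rewrite (@tdiff_itvint _ T (fun t => derive1n s (u t)))//; last by move=> t';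
    exact: ubdm.
  rewrite (@itvint_ext _ _ _ (fun x => (p i).[x] * _) (fun x => tdiff ts (fun t =>
    P s t x) t * phi.[x])); last first.
    by move=> y yi; rewrite (pE _ _ yi).
  rewrite (@tdiff_itvint _ T)//; last by move=> t' tT; apply: (@bmeas_Vh _ _ k); exact: Vh.
  apply: (tdiff_ext at0) => t' tT; apply/eqP; rewrite -subr_eq0.
  have [_ /(_ i phi sphi) <- _] := Pggr s t' s4 tT.
  rewrite innerE -itvintB.
  - by apply/eqP/itvint_ext => y _; rewrite -mulrBl.
  - by apply: bmeasM; [exact: ubdm|exact: bmeas_horner].
  - by apply: bmeasM; [apply: (@bmeas_Vh _ _ k); exact: Vh|exact: bmeas_horner].
(* The weighted traces are taken at the nodes, so the bound has to reach the closed cell. *)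
have qB (i : 'I_(ncells M)) y : nl i <= y <= nr i -> `|(q i).[y] - U y| <= B.
  have fB z : nl i < z < nr i -> `|(q i).[z] - U z| <= B by move=> /(qP i).2; rewrite distrC.
  have [e1 e2] := endpoint_bound (nlr i) fB.
  have cf z : {for z, continuous (fun y => (q i).[y] - U y)}.
    by apply: continuousB; [exact: continuous_horner|exact: Uc].
  case/andP; rewrite le_eqVlt => /predU1P[<- _|y1]; first exact: e1.
  rewrite le_eqVlt => /predU1P[->|y2]; first exact: e2.
  by apply: fB; rewrite y1.
have Um (i : 'I_(ncells M)) : bmeas (nl i) (nr i) U.
  by apply: bmeas_continuous; apply: continuous_subspaceT => y; exact: Uc.
have [W1 W2] := weight_of_norm theta s.
have st : `|(q j - p j).[x]| <= Cs * ((2 + 2 * `|theta|) * B).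
  apply: (CsP M (weight_of theta s) _ (fun i => q i - p i) (fun i x => (q i).[x] - U x)) => //.
  - exact: weight_of_dominant.
  - move=> i; rewrite (leq_trans (size_polyD _ _))// size_polyN geq_max sp andbT.
    exact: (qP i).1.
  - by move=> i; apply: bmeasB => //; exact: bmeas_horner.
  - move=> i y yi; apply: (@le_trans _ _ B); first by apply: qB; lra.
    by rewrite ler_peMl//; have := normr_ge0 theta; lra.
  - move=> i phi sphi.
    rewrite (@itvint_ext _ _ _ _ (fun x => U x * phi.[x] - (p i).[x] * phi.[x])); last first.
      by move=> y _; rewrite hornerD hornerN; ring.
    rewrite itvintB ?UP ?subrr//; first by apply: bmeasM => //; exact: bmeas_horner.
    by apply: bmeasM; exact: bmeas_horner.
  - move=> i; have -> : wtrace_polys (weight_of theta s) (fun i => q i - p i) i =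
      weight_of theta s * ((q i).[nr i] - U (nr i)) +
      (1 - weight_of theta s) * ((q (ordS i)).[nl (ordS i)] - U (nl (ordS i))).
      have := tr i; rewrite /wtrace_polys !hornerD !hornerN => H.
      set a := (p i).[_] in H *; set b := (p _).[_] in H *.
      by apply/eqP; rewrite -subr_eq0; apply/eqP; move: H => /eqP; rewrite -subr_eq0 => /eqP H;
        rewrite -[RHS]oppr0 -H; ring.
    rewrite (_ : (2 + 2 * `|theta|) * B = (1 + `|theta|) * B + (1 + `|theta|) * B); last by ring.
    rewrite (le_trans (ler_normD _ _))// !normrM lerD// ler_pM// qB//.
      by rewrite lexx ltW// nlr.
    by rewrite lexx ltW// nlr.
  - lra.
have -> : tdiff ts (fun t => wf s 0%N t x) t = (U x - (q j).[x]) + (q j - p j).[x].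
  rewrite (tdiff_ext (G := fun t => derive1n s (u t) x - P s t x) at0); last first.
    by move=> t' tT; rewrite wfE.
  by rewrite tdiffB (pE _ _ xj) hornerD hornerN /U; ring.
apply: (@le_trans _ _ (B + Cs * ((2 + 2 * `|theta|) * B))).
  by rewrite (le_trans (ler_normD _ _))// lerD//; exact: (qP j).2.
by rewrite le_eqVlt; apply/orP; left; apply/eqP; rewrite /B; ring.
Qed.

Lemma level_all : exists2 C : R, 0 < C & forall (M : mesh R) (T B : R)
    (wf : nat -> nat -> R -> R -> R), 0 < T -> 0 <= B ->
  corr_family M k l theta T wf -> level l M T wf 0 B ->
  forall i, (i <= l)%N -> level l M T wf i (C * (B * mesh_size M ^+ i)).
Proof.
have [C C0 CP] := level_succ k l htheta.
exists (\sum_(i < l.+1) C ^+ i).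
  rewrite big_ord_recl expr0 ltr_pwDl// sumr_ge0// => i _; by rewrite exprn_ge0// ltW.
move=> M T B wf T0 B0 cf lev0 i il; have h0 := mesh_size_gt0 M.
have H n : (n <= l)%N -> level l M T wf n (C ^+ n * (B * mesh_size M ^+ n)).
  elim: n => [_|n IH nl]; first by rewrite expr0 mul1r expr0 mulr1.
  have := CP M T wf n _ T0 cf nl (IH (ltnW nl)).
  by rewrite (_ : C * _ = C ^+ n.+1 * (B * mesh_size M ^+ n.+1))// !exprS; ring.
move=> s ts t j x s4 at0 sl xj; apply: le_trans (H i il s ts t j x s4 at0 sl xj) _.
rewrite ler_wpM2r ?(step_prod_ge0 at0)// ler_wpM2r ?mulr_ge0 ?exprn_ge0 ?(ltW h0)//.
have il' : (i < l.+1)%N by [].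
rewrite (bigD1 (Ordinal il'))//= lerDl sumr_ge0// => i' _; by rewrite exprn_ge0// ltW.
Qed.

End LevelBase.

(** * The matrix of the scheme *)

Section DGMatrix.
Context (R : realType) (M : mesh R) (k : nat).
Local Notation N := (ncells M).
Implicit Types (p q : 'I_N -> {poly R}) (j : 'I_N) (phi : {poly R}) (sigma : R).

Definition dof : finType := ('I_N * 'I_k.+1)%type.

Definition cell_basis (al : dof) : {poly R} := itv_basis k (nl al.1) (nr al.1) al.2.

Definition cell_basis_ext (al : dof) (j : 'I_N) : {poly R} := if j == al.1 then cell_basis al
  else 0.

Definition Hpoly sigma p j phi : R :=
  polydot (nl j) (nr j) (p j) phi^`() - wtrace_polys sigma p j * phi.[nr j]
  + wtrace_polys sigma p (ord_pred j) * phi.[nl j].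

Definition poly_coords p (al : dof) : R := polydot (nl al.1) (nr al.1) (p al.1) (cell_basis al).

Lemma size_cell_basis al : (size (cell_basis al) <= k.+1)%N.
Proof. by rewrite size_itv_basis ?nlr// -ltnS. Qed.

Lemma Hpoly_suml sigma (I : Type) (r : seq I) (c : I -> R) (F : I -> 'I_N -> {poly R}) j phi :
  Hpoly sigma (fun j => \sum_(i <- r) c i *: F i j) j phi =
    \sum_(i <- r) c i * Hpoly sigma (F i) j phi.
Proof.
have W (j' : 'I_N) : wtrace_polys sigma (fun j => \sum_(i <- r) c i *: F i j) j' =
    \sum_(i <- r) c i * wtrace_polys sigma (F i) j'.
  rewrite /wtrace_polys !horner_sum !mulr_sumr -big_split/=; apply: eq_bigr => i _.
  by rewrite !hornerZ; ring.
rewrite /Hpoly !W polydot_suml !mulr_suml -sumrB -big_split/=; apply: eq_bigr => i _.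
by rewrite polydotZl; ring.
Qed.

Lemma Hpoly_sumr sigma (I : Type) (r : seq I) (c : I -> R) (F : I -> {poly R}) p j :
  Hpoly sigma p j (\sum_(i <- r) c i *: F i) = \sum_(i <- r) c i * Hpoly sigma p j (F i).
Proof.
rewrite /Hpoly !horner_sum !mulr_sumr raddf_sum polydot_sumr -sumrB -big_split/=.
by apply: eq_bigr => i _; rewrite derivZ polydotC polydotZl polydotC !hornerZ; ring.
Qed.

Lemma Hpoly0 sigma p j : Hpoly sigma p j 0 = 0.
Proof. by rewrite /Hpoly deriv0 !horner0 polydotC polydot0l; ring. Qed.

Lemma sum_dof (F : dof -> R) : \sum_al F al = \sum_j \sum_(i < k.+1) F (j, i).
Proof. by rewrite pair_bigA; apply: eq_bigr => -[]. Qed.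

Lemma poly_expand p j : (size (p j) <= k.+1)%N ->
  p j = \sum_(i < k.+1) poly_coords p (j, i) *: cell_basis (j, i).
Proof. by move=> sp; rewrite [LHS](itv_basis_expand (nlr j) sp). Qed.

Lemma family_expand p j : (size (p j) <= k.+1)%N -> p j = \sum_al poly_coords p al *:
  cell_basis_ext al j.
Proof.
move=> sp; rewrite {1}(poly_expand sp).
transitivity (\sum_(j' : 'I_N) \sum_(i < k.+1) poly_coords p (j', i) *: cell_basis_ext (j',
  i) j); last first.
  by rewrite pair_bigA; apply: eq_bigr => -[].
rewrite (bigD1 j)//= [X in _ = _ + X]big1 ?addr0.
  by apply: eq_bigr => i _; rewrite /cell_basis_ext eqxx.
by move=> j' jj'; apply: big1 => i _; rewrite /cell_basis_ext eq_sym (negbTE jj') scaler0.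
Qed.

Lemma sum_ordS (F : 'I_N -> R) : \sum_j F (ordS j) = \sum_j F j.
Proof.
rewrite [RHS](reindex_inj (h := @ordS N))//; exact: (can_inj (@ordSK N)).
Qed.

(** Integration by parts on each cell; [1 - sigma] is the weight for which the interface terms form
    a telescoping sum around the circle. *)
Lemma Hpoly_skew sigma p q :
  \sum_j Hpoly (1 - sigma) p j (q j) = - \sum_j Hpoly sigma q j (p j).
Proof.
pose a j := (p j).[nr j]; pose b j := (p j).[nl j].
pose c j := (q j).[nr j]; pose d j := (q j).[nl j].
have shift (tau : R) (f g : 'I_N -> {poly R}) : \sum_j Hpoly tau f j (g j) =
    \sum_j (polydot (nl j) (nr j) (f j) (g j)^`() - wtrace_polys tau f j * ((g j).[nr j] - (g
      (ordS j)).[nl (ordS j)])).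
  rewrite /Hpoly big_split/= -[X in _ + X](sum_ordS (fun j =>
    wtrace_polys tau f (ord_pred j) * (g j).[nl j])).
  under [X in _ + X]eq_bigr => j _ do rewrite ordSK.
  by rewrite -big_split/=; apply: eq_bigr => j _; ring.
rewrite !shift; apply/eqP; rewrite -addr_eq0 -big_split/=; apply/eqP.
transitivity (\sum_j (a j * c j - b j * d j) - \sum_j (a j * c j - b (ordS j) * d (ordS j))).
  rewrite -sumrB; apply: eq_bigr => j _; have := polydot_derivM (p j) (q j) (ltW (nlr j)).
  rewrite [polydot _ _ _^`() _]polydotC -/(a j) -/(b j) -/(c j) -/(d j) => <-.
  by rewrite /wtrace_polys -/(a j) -/(b j) -/(c j) -/(d j) -/(b (ordS j)) -/(d (ordS j)); ring.
by rewrite !sumrB (sum_ordS (fun j => b j * d j)) subrr.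
Qed.

(** The quadratic form equals [- (sigma - 1 / 2)] times the sum of the squared jumps at the
    nodes. *)
Lemma Hpoly_neg sigma p : 1 / 2 < sigma -> \sum_j Hpoly sigma p j (p j) <= 0.
Proof.
move=> hs; pose a j := (p j).[nr j]; pose b j := (p j).[nl j].
have -> : \sum_j Hpoly sigma p j (p j) = - ((sigma - 1 / 2) * \sum_j (a j - b (ordS j)) ^+ 2).
  transitivity (\sum_j ((a j ^+ 2 - b j ^+ 2) / 2 - wtrace_polys sigma p j * (a j - b (ordS j)))).
    rewrite /Hpoly [RHS]sumrB big_split/= -[X in _ + X](sum_ordS (fun j =>
      wtrace_polys sigma p (ord_pred j) * (p j).[nl j])).
    under [X in _ + X]eq_bigr => j _ do rewrite ordSK.
    rewrite -big_split/= -sumrB; apply: eq_bigr => j _.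
    have := polydot_derivM (p j) (p j) (ltW (nlr j)).
    rewrite [polydot _ _ _^`() _]polydotC -/(a j) -/(b j) => H.
    rewrite -/(b (ordS j)) (_ : polydot (nl j) (nr j) (p j) (p j)^`() = (a j ^+ 2 - b j ^+ 2) / 2).
      by rewrite /a; ring.
    by rewrite !expr2 -H; field.
  rewrite sumrB -mulr_suml sumrB -(sum_ordS (fun j => b j ^+ 2)) -sumrB mulr_suml -sumrB.
  rewrite mulr_sumr -sumrN; apply: eq_bigr => j _.
  by rewrite /wtrace_polys -/(a j) -/(b (ordS j)); field.
by rewrite oppr_le0 mulr_ge0 ?sumr_ge0// => [|j _]; rewrite ?sqr_ge0//; lra.
Qed.

Variable theta : R.

Definition dg_matrix (al be : dof) : R := Hpoly theta (cell_basis_ext be) al.1 (cell_basis al).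

Lemma Hpoly_ext sigma p q j phi : (forall i, p i = q i) -> Hpoly sigma p j phi =
  Hpoly sigma q j phi.
Proof. by move=> /funext ->. Qed.

Lemma Hpoly_dg_matrix p al : (forall j, (size (p j) <= k.+1)%N) ->
  Hpoly theta p al.1 (cell_basis al) = \sum_be dg_matrix al be * poly_coords p be.
Proof.
move=> sp; rewrite (Hpoly_ext _ _ _ (fun j => family_expand (sp j))) Hpoly_suml.
by apply: eq_bigr => be _; rewrite mulrC.
Qed.

Lemma Hpoly_dg_matrixT p al : (forall j, (size (p j) <= k.+1)%N) ->
  Hpoly (1 - theta) p al.1 (cell_basis al) = - \sum_be dg_matrix be al * poly_coords p be.
Proof.
move=> sp; transitivity (\sum_j Hpoly (1 - theta) p j (cell_basis_ext al j)).
  rewrite (bigD1 al.1)//= big1 ?addr0 /cell_basis_ext ?eqxx// => j jal.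
  by rewrite (negbTE jal) Hpoly0.
rewrite Hpoly_skew sum_dof; congr (- _); apply: eq_bigr => j _.
rewrite {1}(poly_expand (sp j)) Hpoly_sumr; apply: eq_bigr => i _.
by rewrite mulrC.
Qed.

Lemma dg_matrix_neg (v : dof -> R) : 1 / 2 < theta ->
  \sum_al \sum_be dg_matrix al be * v al * v be <= 0.
Proof.
move=> ht; pose p j := \sum_(i < k.+1) v (j, i) *: cell_basis (j, i).
have sp j : (size (p j) <= k.+1)%N.
  rewrite (leq_trans (size_sum _ _ _))//; apply/bigmax_leqP => i _.
  by rewrite (leq_trans (size_scale_leq _ _))// size_cell_basis.
have cp al : poly_coords p al = v al.
  case: al => j i; rewrite /poly_coords polydot_suml (bigD1 i)//= polydotZl.
  have ik (i' : 'I_k.+1) : (i' <= k)%N by rewrite -ltnS.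
  rewrite itv_basis_ortho ?nlr ?ik// eqxx mulr1 big1 ?addr0// => i' ii'.
  by rewrite polydotZl itv_basis_ortho ?nlr ?ik// (inj_eq val_inj) (negbTE ii') mulr0.
apply: le_trans (Hpoly_neg p ht); rewrite sum_dof ler_sum// => j _.
rewrite (_ : Hpoly theta p j (p j) = Hpoly theta p j (\sum_(i < k.+1) v (j, i) *: cell_basis (j,
  i)))//.
rewrite Hpoly_sumr ler_sum// => i _.
rewrite (_ : Hpoly _ _ _ _ = Hpoly theta p (j, i).1 (cell_basis (j,
  i)))// Hpoly_dg_matrix// mulr_sumr ler_sum// => be _.
by rewrite cp -mulrA mulrCA.
Qed.

End DGMatrix.

(** * Energy estimate *)

Section Gronwall.
Context (R : realType).
Implicit Types (Phi G D : R -> R) (s t e tau : R).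

(* The Dini condition allows a step to the right from the last point at which
   [Phi r - e * r] does not exceed its initial value. *)
Lemma dini_linear Phi s t e : s <= t -> continuous Phi ->
  (forall r, s <= r < t ->
     \forall tau \near 0^'+, Phi (r + tau) - Phi r <= e * tau) ->
  Phi t - Phi s <= e * (t - s).
Proof.
move=> st cPhi H; pose Psi r := Phi r - e * r.
suff : Psi t <= Psi s by rewrite /Psi mulrBr; lra.
have cPsi r : {for r, continuous Psi}.
  apply: continuousB; first exact: cPhi.
  by apply: continuousM; [exact: cst_continuous|exact: cvg_id].
rewrite leNgt; apply/negP => st'.
pose A := [set r | s <= r <= t /\ Psi r <= Psi s]; pose m := sup A.
have As : A s by split; rewrite ?lexx.
have Aub : ubound A t by move=> r [/andP[]].
have hA : has_sup A by split; [exists s|exists t].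
have smooth : s <= m by apply: sup_upper_bound.
have mt : m <= t by apply: ge_sup => //; exists s.
have Pm : Psi m <= Psi s.
  rewrite leNgt; apply/negP => ms.
  have : \forall r \near m, Psi s < Psi r by exact: (cvgr_gt _ (cPsi m)).
  case/nbhs_ballP => d /= d0 dP.
  have [r Ar mr] := sup_adherent d0 hA.
  have rm : r <= m by exact: sup_upper_bound.
  have /dP : ball m d r by rewrite /ball/= ger0_norm ?subr_ge0// ltrBlDl -ltrBlDr.
  by case: Ar => _; rewrite leNgt => /negbTE ->.
have mt' : m < t by rewrite lt_neqAle mt andbT; apply: contraTneq st' => <-; rewrite -leNgt.
have Hm : \forall tau \near 0^'+, Phi (m + tau) - Phi m <= e * tau by apply: H; rewrite smooth.
near (0 : R)^'+ => tau.
have tau0 : 0 < tau by near: tau; exact: nbhs_right_gt.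
have taut : tau < t - m by near: tau; apply: nbhs_right_lt; rewrite subr_gt0.
have Ptau : Phi (m + tau) - Phi m <= e * tau by near: tau.
have : m + tau <= m.
  apply: sup_upper_bound => //; split; first by lra.
  by move: Pm; rewrite /Psi mulrDr; lra.
by lra.
Unshelve. all: end_near. Qed.

(** The Dini condition is not given at [s], so [dini_linear] is started at some [s' > s] with an
    arbitrarily small slope; then [s'] tends to [s]. *)
Lemma dini_le Phi s t : s < t -> continuous Phi ->
  (forall r, s < r < t -> forall e, 0 < e ->
     \forall tau \near 0^'+, Phi (r + tau) - Phi r <= e * tau) ->
  Phi t <= Phi s.
Proof.
move=> st cPhi H.
have main s' : s < s' < t -> Phi t <= Phi s'.
  move=> /andP[ss' s't]; apply/ler_addgt0Pr => e e0.
  have d0 : 0 < t - s' by rewrite subr_gt0.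
  have -> : e = e / (t - s') * (t - s') by rewrite divfK ?gt_eqF.
  rewrite -lerBlDl; apply: dini_linear => //; first exact: ltW.
  by move=> r /andP[s'r rt]; apply: H; rewrite ?divr_gt0// rt (lt_le_trans ss').
have C : Phi r @[r --> s^'+] --> Phi s by apply: cvg_at_right_filter; exact: cPhi.
apply: (cvgr_to_ge C); near=> r; apply: main; apply/andP; split.
  by near: r; exact: nbhs_right_gt.
by near: r; exact: nbhs_right_lt.
Unshelve. all: end_near. Qed.

Lemma cvg_right_of_punctured (f : R -> R) (x l : R) :
  f h @[h --> x^'] --> l -> f h @[h --> x^'+] --> l.
Proof.
apply: cvg_trans => A HA; apply: (@filterS _ (nbhs x) _ _ _ _ HA) => h hA xh.
by apply: hA; rewrite gt_eqF.
Qed.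

Lemma itvint_interval_le a b D (B : R) s t : a < s -> t < b -> s < t -> bmeas a b D ->
  (forall r, s < r < t -> D r <= B) -> itvint a t D - itvint a s D <= B * (t - s).
Proof.
move=> as_ tb st mD DB; have asb := lt_trans as_ st.
rewrite (itvint_split as_ st); last by apply: bmeas_sub mD => //; exact: ltW.
rewrite addrC addKr -(itvint_cst B (ltW st)); apply: itvint_le => //; last exact: bmeas_cst.
by apply: bmeas_sub mD; exact: ltW.
Qed.

(** The function [expR (- c t) * G t] plus [expR (- c T)] times the integral of [D] up to [t] does
    not increase: as [expR (- c T) <= expR (- c t)], the growth of the integral is absorbed by the
    term [- D]. *)
Lemma dini_gronwall G D (c T : R) : 0 < T -> 0 <= c -> continuous G -> continuous D ->
  (forall t, 0 <= D t) -> (forall t, 0 <= G t) ->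
  (forall t, 0 < t < T -> forall e, 0 < e ->
     \forall tau \near 0^'+, G (t + tau) - G t <= (c * G t - D t + e) * tau) ->
  forall t, 0 <= t <= T ->
    G t <= expR (c * T) * G 0 /\ itvint 0 t D <= expR (c * T) * G 0.
Proof.
move=> T0 c0 cG cD D0 G0 H.
(* [dini_le] asks for a function continuous on the whole line: the primitive starts at [a < 0], and
   its argument is clamped to [[0, T]]. *)
pose a : R := -1; pose b := T + 1.
have mD : bmeas a b D by apply: bmeas_continuous; exact: continuous_subspaceT.
have [BD BDP] := mD.2.
pose J t := itvint a t D.
pose Phi t := expR (- c * t) * G t + expR (- c * T) * (J (Num.max 0 (Num.min T t))).
have clampI t : a < Num.max 0 (Num.min T t) < b.
  have : 0 <= Num.max 0 (Num.min T t) <= T by rewrite le_max lexx ge_max ge_min lexx (ltW T0).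
  by rewrite /a /b; move: (Num.max _ _) => z; lra.
have clampE t : 0 <= t <= T -> Num.max 0 (Num.min T t) = t.
  by move=> /andP[t0 tT]; rewrite min_r// max_r.
have cPhi t : {for t, continuous Phi}.
  apply: continuousD.
    apply: continuousM; last exact: cG.
    apply: (continuous_comp (f := fun t => - c * t) (g := expR)); last exact: continuous_expR.
    by apply: continuousM; [exact: cst_continuous|exact: cvg_id].
  apply: continuousM; first exact: cst_continuous.
  apply/cvgrPdist_le => /= e e0.
  have cc : {for t, continuous (fun t => Num.max 0 (Num.min T t))}.
    apply: continuous_max; first exact: cst_continuous.
    by apply: continuous_min; [exact: cst_continuous|exact: cvg_id].
  have e1 : 0 < e / (`|BD| + 1) by rewrite divr_gt0// ltr_wpDl.
  move/cvgrPdist_le: cc => /(_ _ e1); apply: filterS => s /= st.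
  rewrite distrC (le_trans (itvint_lip (B := BD) mD _ _ _))//.
  apply: (@le_trans _ _ ((`|BD| + 1) * (e / (`|BD| + 1))));
    last by rewrite mulrCA divff ?mulr1// gt_eqF// ltr_wpDl.
  rewrite (le_trans (ler_norm _))// normrM normr_id ler_pM//; first by rewrite lerDl.
  by rewrite distrC.
have E0 r : 0 < expR r :> R by exact: expR_gt0.
have step t : 0 < t < T -> forall e, 0 < e ->
    \forall tau \near 0^'+, Phi (t + tau) - Phi t <= e * tau.
  move=> tT e e0.
  pose w := expR (- c * t).
  pose e' := e / 4.
  have e'0 : 0 < e' by rewrite divr_gt0.
  have w1 : w <= 1 by rewrite -[1]expR0 ler_expR mulNr oppr_le0 mulr_ge0//; lra.
  have wT : expR (- c * T) <= w by rewrite ler_expR !mulNr lerN2 ler_wpM2l//; lra.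
  have dE : is_derive t 1 (fun s => expR (- c * s)) (- c * w).
    have := is_derive_affine (f := expR) (a := - c) (b := 0) (x := t) (is_derive_expR _).
    by apply: is_derive_conv => [s|]; rewrite addr0.
  have qc : (fun tau => expR (- c * (t + tau)) * (c * G t - D t + e') +
      (expR (- c * (t + tau)) - w) / tau * G t + expR (- c * T) * (D t + e')) @ 0^'+ -->
      (w * (c * G t - D t + e') + (- c * w) * G t + expR (- c * T) * (D t + e')).
    have ec : expR (- c * (t + tau)) @[tau --> (0 : R)^'+] --> w.
      have : {for (0 : R), continuous (fun tau => expR (- c * (t + tau)))}.
        apply: (continuous_comp (f := fun s => - c * (t + s)) (g := expR));
          last exact: continuous_expR.
        apply: continuousM; first exact: cst_continuous.
        by apply: continuousD; [exact: cst_continuous|exact: cvg_id].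
      by move/cvg_at_right_filter; rewrite addr0.
    have := cvg_right_of_punctured (is_derive_cvg dE) => ed.
    apply: cvgD; last exact: cvg_cst.
    apply: cvgD; first by apply: cvgMl.
    apply: cvgMl; apply: cvg_trans ed.
    by apply: near_eq_cvg; apply: nearW => tau /=; rewrite mulrC (addrC t).
  have lim : w * (c * G t - D t + e') + (- c * w) * G t + expR (- c * T) * (D t + e') < e.
    have Dt := D0 t.
    have : (w - expR (- c * T)) * D t >= 0 by rewrite mulr_ge0// subr_ge0.
    have : w * e' <= e' by rewrite ler_piMl// ltW.
    have : expR (- c * T) * e' <= e' by rewrite ler_piMl ?(le_trans wT)// ltW.
    have : e' < e / 2 by rewrite /e'; lra.
    by move: (expR (- c * T)) => v; rewrite /e'; nra.
  have [d /= d0 dP] : \forall s \near t, D s < D t + e'.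
    by apply: (cvgr_lt _ (cD t)); rewrite ltrDl.
  near=> tau.
  have tau0 : 0 < tau by near: tau; exact: nbhs_right_gt.
  have tauT : tau < T - t by near: tau; apply: nbhs_right_lt; rewrite subr_gt0; case/andP: tT.
  have hq : expR (- c * (t + tau)) * (c * G t - D t + e') +
      (expR (- c * (t + tau)) - w) / tau * G t + expR (- c * T) * (D t + e') <= e.
    by near: tau; apply: (cvgr_le _ qc).
  have hG : G (t + tau) - G t <= (c * G t - D t + e') * tau by near: tau; exact: H.
  have hJ : J (t + tau) - J t <= (D t + e') * tau.
    have taud : tau < d by near: tau; exact: nbhs_right_lt.
    rewrite [X in _ * X](_ : tau = (t + tau) - t); last by ring.
    apply: (itvint_interval_le _ _ _ mD); rewrite /a /b; [lra|lra|lra|].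
    move=> r rt; apply/ltW/dP; rewrite /ball/= distrC ger0_norm; lra.
  apply: (@le_trans _ _ (tau * (expR (- c * (t + tau)) * (c * G t - D t + e') +
      (expR (- c * (t + tau)) - w) / tau * G t + expR (- c * T) * (D t + e')))); last first.
    by rewrite mulrC ler_wpM2r// ltW.
  rewrite /Phi !clampE; [|lra|lra].
  rewrite (_ : _ - _ = expR (- c * (t + tau)) * (G (t + tau) - G t) +
     (expR (- c * (t + tau)) - w) * G t + expR (- c * T) * (J (t + tau) - J t));
       last by rewrite /w; ring.
  rewrite (_ : tau * _ = expR (- c * (t + tau)) * ((c * G t - D t + e') * tau) +
     (expR (- c * (t + tau)) - w) * G t + expR (- c * T) * ((D t + e') * tau)); last first.
    by field; rewrite gt_eqF.
  by rewrite !lerD// ler_wpM2l// ltW.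
move=> t tT.
have : Phi t <= Phi 0.
  case/andP: tT; rewrite le_eqVlt => /predU1P[<- //|t0 tT].
  by apply: dini_le => // r /andP[r0 rt]; apply: step; rewrite r0 (lt_le_trans rt).
have z0 : 0 <= (0 : R) <= T by rewrite lexx ltW.
rewrite /Phi (clampE t tT) (clampE 0 z0) mulr0 expR0 mul1r => H1.
have JE : J t - J 0 = itvint 0 t D.
  case/andP: tT; rewrite le_eqVlt => /predU1P[<- _|t0 tT].
    by rewrite subrr /itvint set_itvoo0 Rintegral_set0.
  rewrite /J (itvint_split (b := 0)) ?ltrN10//; first by ring.
  by apply: bmeas_sub mD; rewrite // /b; lra.
have H2 : expR (- c * t) * G t + expR (- c * T) * itvint 0 t D <= G 0 by rewrite -JE mulrBr; lra.
have I0 : 0 <= itvint 0 t D by apply: itvint_ge0.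
have cancel (x y : R) : 0 <= x -> y <= T -> expR (- c * y) * x <= G 0 -> x <= expR (c * T) * G 0.
  move=> x0 yT Hx; apply: (@le_trans _ _ (expR (c * T) * (expR (- c * y) * x)));
    last by rewrite ler_wpM2l// ltW.
  rewrite mulrA -expRD ler_peMl// -[1]expR0 ler_expR mulNr subr_ge0 ler_wpM2l//.
split.
  apply: (cancel _ t) => //; first by case/andP: tT.
  by apply: le_trans H2; rewrite lerDl mulr_ge0// ltW.
apply: (cancel _ T) => //; apply: le_trans H2; rewrite lerDr mulr_ge0// ltW.
Unshelve. all: end_near. Qed.

End Gronwall.

(** * Energy inequality for the coordinates of the errors *)

Section Energy.
Context (R : realType) (I : finType) (A : I -> I -> R).
Implicit Types (v w x y z : I -> R).

Definition dot v w : R := \sum_i v i * w i.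
Definition matvec v (i : I) : R := \sum_j A i j * v j.
Definition matvecT v (i : I) : R := \sum_j A j i * v j.

Lemma dotC v w : dot v w = dot w v.
Proof. by apply: eq_bigr => i _; rewrite mulrC. Qed.

Lemma dot_ge0 v : 0 <= dot v v.
Proof. by apply: sumr_ge0 => i _; rewrite -expr2 sqr_ge0. Qed.

Lemma dot_matvec v w : dot v (matvec w) = dot (matvecT v) w.
Proof.
rewrite /dot /matvec /matvecT; under eq_bigr => i _ do rewrite mulr_sumr.
rewrite exchange_big/=; apply: eq_bigr => j _; rewrite mulr_suml.
by apply: eq_bigr => i _; ring.
Qed.

Lemma dot_matvec_diag v : dot v (matvec v) = \sum_i \sum_j A i j * v i * v j.
Proof.
by apply: eq_bigr => i _; rewrite mulr_sumr; apply: eq_bigr => j _; ring.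
Qed.

Lemma dot_le (F G : I -> R) : (forall i, F i <= G i) -> \sum_i F i <= \sum_i G i.
Proof. by move=> FG; apply: ler_sum. Qed.

Lemma dot_young (s : R) v w : 0 < s ->
  dot v w <= s / 2 * dot v v + (2 * s)^-1 * dot w w /\
  - dot v w <= s / 2 * dot v v + (2 * s)^-1 * dot w w.
Proof.
move=> s0; have s2 : 0 <= (2 * s)^-1 by rewrite invr_ge0 mulr_ge0// ltW.
have sn : s != 0 by rewrite gt_eqF.
split; rewrite /dot !mulr_sumr -?sumrN -big_split/=; apply: dot_le => i.
  rewrite -subr_ge0 (_ : _ - _ = (2 * s)^-1 * (s * v i - w i) ^+ 2); last by field.
  by rewrite mulr_ge0 ?sqr_ge0.
rewrite -subr_ge0 (_ : _ - _ = (2 * s)^-1 * (s * v i + w i) ^+ 2); last by field.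
by rewrite mulr_ge0 ?sqr_ge0.
Qed.

Lemma dot_add_le v w : dot (fun i => v i + w i) (fun i => v i + w i) <= 2 * dot v v + 2 * dot w w.
Proof.
rewrite /dot !mulr_sumr -big_split/=; apply: dot_le => i.
by have := sqr_ge0 (v i - w i); lra.
Qed.

Lemma dot_scale (s : R) v : dot (fun i => s * v i) (fun i => s * v i) = s ^+ 2 * dot v v.
Proof. by rewrite /dot mulr_sumr; apply: eq_bigr => i _; ring. Qed.

Lemma dot_opp v : dot (fun i => - v i) (fun i => - v i) = dot v v.
Proof. by apply: eq_bigr => i _; rewrite mulrNN. Qed.

Hypothesis Aneg : forall v, dot v (matvec v) <= 0.

(* [X = z . A^T y] equals both [z.(z+c)] and [- y.(w+d)]; writing [X] as
   3 times the second minus 2 times the first turns its sign around. *)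
Lemma energy_test x y z w b c d :
  (forall i, y i + matvec x i = - b i) -> (forall i, z i - matvecT y i = - c i) ->
  (forall i, w i + matvec z i = - d i) ->
  dot (fun i => 4 * x i - z i) (fun i => matvec x i - matvecT y i - matvecT w i) <=
  - dot z z - 2^-1 * dot w w + 20 * dot x x + 6 * dot y y + 33 * dot b b
  + 5 * dot c c + 5 * dot d d.
Proof.
move=> yE zE wE.
have Ax i : matvec x i = - y i - b i by have := yE i; lra.
have Ty i : matvecT y i = z i + c i by have := zE i; lra.
have Az i : matvec z i = - w i - d i by have := wE i; lra.
have S1 : dot x (matvecT w) = dot (matvec x) w by rewrite dotC -dot_matvec dotC.
have S2 : dot z (matvecT w) = dot (matvec z) w by rewrite dotC -dot_matvec dotC.
have S3 : dot z (matvecT y) = dot (matvec z) y by rewrite dotC -dot_matvec dotC.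
have -> : dot (fun i => 4 * x i - z i) (fun i => matvec x i - matvecT y i - matvecT w i) =
    4 * dot x (matvec x) - 4 * dot x (matvecT y) - 4 * dot x (matvecT w) - dot z (matvec x)
    + (3 * dot z (matvecT y) - 2 * dot z (matvecT y)) + dot z (matvecT w).
  by rewrite /dot !mulr_sumr -!sumrN -!big_split/=; apply: eq_bigr => i _; ring.
rewrite {1}S3 S1 S2.
apply: (@le_trans _ _ (- (4 * dot x (matvecT y)) - 4 * dot (matvec x) w - dot z (matvec x)
    + (3 * dot (matvec z) y - 2 * dot z (matvecT y)) + dot (matvec z) w)).
  by have := Aneg x; lra.
rewrite /dot !mulr_sumr -!sumrN -!big_split/=; apply: dot_le => i.
rewrite Ax Ty Az; clear yE zE wE Ax Ty Az S1 S2 S3; move: (x i) (y i) (z i) (w i) (b i) (c i) (d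
  i) => {}x {}y {}z {}w {}b {}c {}d.
(* Young's inequality as completed squares, one for each of the nine mixed products that occur: xz,
   yz, bz, cz, yw, bw, dw, xc and yd. *)
have : 0 <= 4^-1 * (z + 8 * x) ^+ 2 by rewrite mulr_ge0 ?sqr_ge0// invr_ge0.
have : 0 <= (z / 2 - y) ^+ 2 by rewrite sqr_ge0.
have : 0 <= (z / 2 - b) ^+ 2 by rewrite sqr_ge0.
have : 0 <= (z / 2 + 2 * c) ^+ 2 by rewrite sqr_ge0.
have : 0 <= 8^-1 * (w - 4 * y) ^+ 2 by rewrite mulr_ge0 ?sqr_ge0// invr_ge0.
have : 0 <= 8^-1 * (w - 16 * b) ^+ 2 by rewrite mulr_ge0 ?sqr_ge0// invr_ge0.
have : 0 <= 8^-1 * (w + 4 * d) ^+ 2 by rewrite mulr_ge0 ?sqr_ge0// invr_ge0.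
have : 0 <= (2 * x + c) ^+ 2 by rewrite sqr_ge0.
have : 0 <= 3 / 4 * (y + 2 * d) ^+ 2 by rewrite mulr_ge0 ?sqr_ge0.
have : 0 <= y * y by rewrite -expr2 sqr_ge0.
have : 0 <= d * d by rewrite -expr2 sqr_ge0.
have : 0 <= w * w by rewrite -expr2 sqr_ge0.
lra.
Qed.

(** This bound on [A] depends on the mesh, but it only multiplies terms quadratic in the time
    increment, so it disappears from the Dini derivative. *)
Definition frobenius : R := \sum_i \sum_j A i j ^+ 2.

Lemma frobenius_ge0 : 0 <= frobenius.
Proof. by apply: sumr_ge0 => i _; apply: sumr_ge0 => j _; rewrite sqr_ge0. Qed.

Lemma cauchy_schwarz_sum (F G : I -> R) :
  (\sum_i F i * G i) ^+ 2 <= (\sum_i F i ^+ 2) * (\sum_i G i ^+ 2).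
Proof.
set a := \sum_i F i ^+ 2; set c := \sum_i G i ^+ 2; set b := \sum_i F i * G i.
have a0 : 0 <= a by apply: sumr_ge0 => i _; rewrite sqr_ge0.
have c0 : 0 <= c by apply: sumr_ge0 => i _; rewrite sqr_ge0.
have [cE|cn] := eqVneq c 0.
  have G0 i : G i = 0.
    apply/eqP; rewrite -sqrf_eq0 eq_le sqr_ge0 andbT -cE /c (bigD1 i)//= lerDl.
    by apply: sumr_ge0 => j _; rewrite sqr_ge0.
  by rewrite cE mulr0 /b big1 ?expr0n// => i _; rewrite G0 mulr0.
have cp : 0 < c by rewrite lt_neqAle eq_sym cn.
have : 0 <= \sum_i (c * F i - b * G i) ^+ 2 by apply: sumr_ge0 => i _; rewrite sqr_ge0.
have -> : \sum_i (c * F i - b * G i) ^+ 2 = c * (c * a - b ^+ 2).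
  transitivity (\sum_i (c ^+ 2 * F i ^+ 2 + - (2 * c * b) * (F i * G i) + b ^+ 2 * G i ^+ 2)).
    by apply: eq_bigr => i _; ring.
  by rewrite !big_split/= -!mulr_sumr -/a -/b -/c; ring.
by rewrite pmulr_rge0// subr_ge0 mulrC.
Qed.

Lemma matvec_bound v : dot (matvec v) (matvec v) <= frobenius * dot v v.
Proof.
rewrite /frobenius mulr_suml; apply: dot_le => i; rewrite -expr2.
apply: le_trans (cauchy_schwarz_sum (A i) v) _.
by rewrite le_eqVlt; apply/orP; left; apply/eqP; congr (_ * _); apply: eq_bigr.
Qed.

Section Evolution.
Variables (T B K0 : R) (x y z w a b c d : R -> I -> R).
Hypotheses (T0 : 0 < T) (B0 : 0 <= B).
Hypothesis yE : forall t i, y t i + matvec (x t) i = - b t i.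
Hypothesis zE : forall t i, z t i - matvecT (y t) i = - c t i.
Hypothesis wE : forall t i, w t i + matvec (z t) i = - d t i.
Hypothesis fc : forall i, continuous (fun t => x t i + a t i).
Hypothesis fd : forall t i, 0 < t < T ->
  is_derive t 1 (fun t => x t i + a t i) (matvec (x t) i - matvecT (y t) i - matvecT (w t) i).

Definition lip_in_time (v : R -> I -> R) : Prop := forall s t,
  dot (fun i => v s i - v t i) (fun i => v s i - v t i) <= (B * (s - t)) ^+ 2.

Hypotheses (aL : lip_in_time a) (bL : lip_in_time b) (cL : lip_in_time c).
Hypothesis bB : forall t, dot (b t) (b t) <= B ^+ 2.
Hypothesis cB : forall t, dot (c t) (c t) <= B ^+ 2.
Hypothesis dB : forall t, dot (d t) (d t) <= B ^+ 2.
Hypothesis x0 : dot (x 0) (x 0) <= K0 * B ^+ 2.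
Hypothesis y0 : dot (y 0) (y 0) <= K0 * B ^+ 2.

Lemma lip_continuous (v : R -> I -> R) i : lip_in_time v -> continuous (fun t => v t i).
Proof.
move=> vL t; apply/cvgrPdist_le => /= e e0.
have d0 : 0 < e / (B + 1) by rewrite divr_gt0// ltr_wpDl.
near=> s; have st : `|t - s| < e / (B + 1).
  by near: s; apply: (@cvgr_dist_lt _ R^o) => //; exact: cvg_id.
rewrite -(ler_pXn2r (n := 2)) ?nnegrE ?(ltW e0)// real_normK ?num_real//.
apply: (@le_trans _ _ (dot (fun i => v t i - v s i) (fun i => v t i - v s i))).
  by rewrite /dot (bigD1 i)//= -expr2 lerDl sumr_ge0// => j _; rewrite -expr2 sqr_ge0.
apply: le_trans (vL t s) _.
rewrite -[(B * _) ^+ 2]real_normK ?num_real// ler_pXn2r ?nnegrE ?(ltW e0)//.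
rewrite normrM (ger0_norm B0) (le_trans (ler_wpM2l B0 (ltW st)))//.
rewrite mulrA ler_pdivrMr ?ltr_wpDl// mulrC ler_wpM2l ?(ltW e0)//.
by rewrite lerDl.
Unshelve. all: end_near. Qed.

Lemma continuous_sumI (F : I -> R -> R) : (forall i, continuous (F i)) ->
  continuous (fun t => \sum_i F i t).
Proof.
by move=> Fc t; apply: cvg_sum_seq => i _; exact: Fc.
Qed.

Lemma x_cont i : continuous (fun t => x t i).
Proof.
move=> t; have -> : (fun t => x t i) = (fun t => (x t i + a t i) - a t i).
  by apply/funext => s; rewrite addrK.
by apply: cvgB; [exact: fc|exact: lip_continuous].
Qed.

Lemma matvec_cont (v : R -> I -> R) i : (forall i, continuous (fun t => v t i)) ->
  continuous (fun t => matvec (v t) i).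
Proof.
move=> vc; apply: (continuous_sumI (F := fun j t => A i j * v t j)) => j t.
by apply: cvgM; [exact: cvg_cst|exact: vc].
Qed.

Lemma matvecT_cont (v : R -> I -> R) i : (forall i, continuous (fun t => v t i)) ->
  continuous (fun t => matvecT (v t) i).
Proof.
move=> vc; apply: (continuous_sumI (F := fun j t => A j i * v t j)) => j t.
by apply: cvgM; [exact: cvg_cst|exact: vc].
Qed.

Lemma y_cont i : continuous (fun t => y t i).
Proof.
move=> t; have -> : (fun t => y t i) = (fun t => - b t i - matvec (x t) i).
  by apply/funext => s; rewrite -(yE s i) addrK.
apply: cvgB; last exact: (matvec_cont x_cont).
by apply: cvgN; exact: lip_continuous.
Qed.

Lemma z_cont i : continuous (fun t => z t i).
Proof.
move=> t; have -> : (fun t => z t i) = (fun t => - c t i + matvecT (y t) i).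
  by apply/funext => s; rewrite -(zE s i) subrK.
apply: cvgD; last exact: (matvecT_cont y_cont).
by apply: cvgN; exact: lip_continuous.
Qed.

Lemma dot_cont (v u : R -> I -> R) : (forall i, continuous (fun t => v t i)) ->
  (forall i, continuous (fun t => u t i)) -> continuous (fun t => dot (v t) (u t)).
Proof.
move=> vc uc; apply: (continuous_sumI (F := fun i t => v t i * u t i)) => i t.
by apply: cvgM; [exact: vc|exact: uc].
Qed.

(* Unlike [w] itself, the fluxes [w + d = - A z] and [z + c = A^T y] depend
   continuously on time, so their squares can be integrated. *)
Definition flux t : R := dot (matvecT (y t)) (matvecT (y t)) + dot (matvec (z t)) (matvec (z t)).

Lemma flux_cont : continuous flux.
Proof.
move=> t; apply: cvgD.
  by apply: (dot_cont (v := fun t => matvecT (y t)) (u := fun t => matvecT (y t))) => i;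
    exact: (matvecT_cont y_cont).
by apply: (dot_cont (v := fun t => matvec (z t)) (u := fun t => matvec (z t))) => i;
  exact: (matvec_cont z_cont).
Qed.

Lemma flux_ge0 t : 0 <= flux t.
Proof. by rewrite addr_ge0// dot_ge0. Qed.

Lemma flux_bound t : dot (z t) (z t) + dot (w t) (w t) <= 2 * flux t + 4 * B ^+ 2.
Proof.
apply: (@le_trans _ _ (2 * flux t + 2 * dot (c t) (c t) + 2 * dot (d t) (d t))).
  rewrite /flux /dot -!big_split/= !mulr_sumr -!big_split/=; apply: dot_le => i.
  have -> : matvecT (y t) i = z t i + c t i by have := zE t i; lra.
  have -> : matvec (z t) i = - w t i - d t i by have := wE t i; lra.
  have := sqr_ge0 (z t i + 2 * c t i); have := sqr_ge0 (w t i + 2 * d t i).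
  by move: (z t i) (w t i) (c t i) (d t i) => z' w' c' d'; lra.
by have := cB t; have := dB t; lra.
Qed.

Lemma flux_bound' t : flux t <= 2 * dot (z t) (z t) + 2 * dot (w t) (w t) + 4 * B ^+ 2.
Proof.
apply: (@le_trans _ _ (2 * dot (z t) (z t) + 2 * dot (w t) (w t)
   + 2 * dot (c t) (c t) + 2 * dot (d t) (d t))); last by have := cB t; have := dB t; lra.
rewrite /flux /dot !mulr_sumr -!big_split/=; apply: dot_le => i.
have -> : matvecT (y t) i = z t i + c t i by have := zE t i; lra.
have -> : matvec (z t) i = - w t i - d t i by have := wE t i; lra.
have := sqr_ge0 (z t i - c t i); have := sqr_ge0 (w t i - d t i).
by move: (z t i) (w t i) (c t i) (d t i) => z' w' c' d'; lra.
Qed.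

(** The cross term arises from testing with [- z]: the relations give
    [- (z, x') = (y, y') + (c, x') + (y, b')] formally, and [(c, x')] is the derivative of [c . x]
    up to [(c', x)]. The constant [3 * B ^+ 2] makes the sum positive whatever the sign of the cross
    term. *)
Definition energy t : R :=
  2 * dot (x t) (x t) + 2^-1 * dot (y t) (y t) + dot (c t) (x t) + 3 * B ^+ 2.

Lemma energy_ge t : dot (x t) (x t) + 2^-1 * dot (y t) (y t) + 2 * B ^+ 2 <= energy t.
Proof.
apply: (@le_trans _ _ (2 * dot (x t) (x t) + 2^-1 * dot (y t) (y t) + dot (c t) (x t)
  + dot (c t) (c t) + 2 * B ^+ 2)); last by rewrite /energy; have := cB t; lra.
rewrite lerD2r /dot !mulr_sumr -!big_split/=; apply: dot_le => i.
have := sqr_ge0 (x t i + c t i / 2); have := sqr_ge0 (c t i).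
by move: (x t i) (y t i) (c t i) => x' y' c'; lra.
Qed.

Lemma energy_cont : continuous energy.
Proof.
move=> t; apply: cvgD; last exact: cvg_cst.
apply: cvgD; last by apply: dot_cont => i; [exact: lip_continuous|exact: x_cont].
by apply: cvgD; apply: cvgM; [exact: cvg_cst|apply: dot_cont => i; exact: x_cont
  |exact: cvg_cst|apply: dot_cont => i; exact: y_cont].
Qed.

Let F t i := matvec (x t) i - matvecT (y t) i - matvecT (w t) i.

(** Only [x + a] is assumed differentiable, so its difference quotient [q] is used and the
    increments of [a], [b], [c] are estimated by their Lipschitz bounds. All quadratic contributions
    are collected behind the second factor [tau]. *)
Lemma energy_increment t tau (q : I -> R) : 0 < tau ->
  (forall i, tau * q i = (x (t + tau) i + a (t + tau) i) - (x t i + a t i)) ->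
  energy (t + tau) - energy t <=
  tau * (dot (fun i => 4 * x t i - z t i) q
    + (5 * dot (x t) (x t) + dot (y t) (y t) + 4^-1 * dot (z t) (z t) + 3 * B ^+ 2)
    + tau * ((5 / 2 + frobenius) * (2 * dot q q + 2 * B ^+ 2) + 2 * B ^+ 2)).
Proof.
move=> tau0 qE.
pose da i := a (t + tau) i - a t i; pose db i := b (t + tau) i - b t i.
pose dc i := c (t + tau) i - c t i; pose dx i := tau * q i - da i.
pose dy i := y (t + tau) i - y t i.
have dxE i : x (t + tau) i = x t i + dx i by rewrite /dx qE /da; ring.
have mvD i : matvec (x (t + tau)) i = matvec (x t) i + matvec dx i.
  by rewrite /matvec -big_split/=; apply: eq_bigr => j _; rewrite dxE; ring.
have dyE i : dy i = - matvec dx i - db i.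
  by rewrite /dy /db; have := yE t i; have := yE (t + tau) i; rewrite mvD; lra.
have H2 (v : R -> I -> R) : lip_in_time v ->
    dot (fun i => v (t + tau) i - v t i) (fun i => v (t + tau) i - v t i) <= tau ^+ 2 * B ^+ 2.
  by move=> /(_ (t + tau) t); rewrite addrAC subrr add0r exprMn mulrC.
have Ha := H2 _ aL; have Hb := H2 _ bL; have Hcell := H2 _ cL.
rewrite -/da in Ha; rewrite -/db in Hb; rewrite -/dc in Hcell.
have E1 : energy (t + tau) - energy t =
    (tau * dot (fun i => 4 * x t i - z t i) q - dot (fun i => 4 * x t i - z t i) da
     - dot (y t) db + dot dc (x t)) +
    (2 * dot dx dx + 2^-1 * dot dy dy + dot dc dx).
  (* [A^T y = z + c] turns the increment of [|y|^2 / 2], to first order, into products with [z] and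
     [c]; the product with [c] cancels against the increment of [c . x]. *)
  have key : dot (y t) dy = - dot dx (z t) - dot dx (c t) - dot (y t) db.
    transitivity (- dot (y t) (matvec dx) - dot (y t) db).
      by rewrite /dot -!sumrN -!big_split/=; apply: eq_bigr => i _; rewrite dyE; ring.
    rewrite dot_matvec; congr (_ - _); rewrite /dot -!sumrN -!big_split/=; apply: eq_bigr => i _.
    by rewrite (_ : matvecT (y t) i = z t i + c t i); [ring|have := zE t i; lra].
  transitivity (4 * dot (x t) dx + 2 * dot dx dx + dot (y t) dy + 2^-1 * dot dy dy
     + dot (c t) dx + dot dc (x t) + dot dc dx).
    rewrite /energy opprD addrACA subrr addr0 !opprD.
    rewrite /dot !mulr_sumr -!sumrN -!big_split/=; apply: eq_bigr => i _.
    rewrite dxE (_ : y (t + tau) i = y t i + dy i); last by rewrite /dy; ring.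
    by rewrite (_ : c (t + tau) i = c t i + dc i); [field|rewrite /dc; ring].
  rewrite key /dot !mulr_sumr -!sumrN -!big_split/=; apply: eq_bigr => i _.
  by rewrite /dx; field.
have tn : tau != 0 by rewrite gt_eqF.
have frob0 := frobenius_ge0; have B20 : 0 <= B ^+ 2 by rewrite sqr_ge0.
have inv2 (r : R) : r <= tau ^+ 2 * B ^+ 2 -> (2 * tau)^-1 * r <= tau * (2^-1 * B ^+ 2).
  move=> H; apply: (@le_trans _ _ ((2 * tau)^-1 * (tau ^+ 2 * B ^+ 2))).
    by rewrite ler_wpM2l// invr_ge0 mulr_ge0// ltW.
  by rewrite le_eqVlt; apply/orP; left; apply/eqP; field.
have D1 : - dot (fun i => 4 * x t i - z t i) da <=
    tau * (4 * dot (x t) (x t) + 4^-1 * dot (z t) (z t) + 2 * B ^+ 2).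
  have t4 : 0 < tau / 4 by rewrite divr_gt0.
  apply: le_trans (dot_young (fun i => 4 * x t i - z t i) da t4).2 _.
  have V := dot_add_le (fun i => 4 * x t i) (fun i => - z t i).
  rewrite dot_scale dot_opp in V.
  have -> : (2 * (tau / 4))^-1 * dot da da = 4 * ((2 * tau)^-1 * dot da da) by field.
  have := inv2 _ Ha; set DA := (2 * tau)^-1 * dot da da.
  have : tau * dot (fun i => 4 * x t i + - z t i) (fun i => 4 * x t i + - z t i) <=
    tau * (2 * (4 ^+ 2 * dot (x t) (x t)) + 2 * dot (z t) (z t)) by rewrite ler_wpM2l// ltW.
  by move: (dot _ _) (dot _ _) (dot _ _) => a1 a2 a3; lra.
have D2 : - dot (y t) db <= tau * (2^-1 * dot (y t) (y t) + 2^-1 * B ^+ 2).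
  apply: le_trans (dot_young (y t) db tau0).2 _; have := inv2 _ Hb; lra.
have D3 : dot dc (x t) <= tau * (2^-1 * dot (x t) (x t) + 2^-1 * B ^+ 2).
  rewrite dotC; apply: le_trans (dot_young (x t) dc tau0).1 _; have := inv2 _ Hcell; lra.
pose Q := 2 * dot q q + 2 * B ^+ 2.
have X : dot dx dx <= tau ^+ 2 * Q.
  have := dot_add_le (fun i => tau * q i) (fun i => - da i).
  by rewrite dot_scale dot_opp /Q => H; apply: le_trans H _; lra.
have Y : dot dy dy <= 2 * (frobenius * dot dx dx) + 2 * (tau ^+ 2 * B ^+ 2).
  have -> : dot dy dy = dot (fun i => - matvec dx i + - db i) (fun i => - matvec dx i + - db i).
    by apply: eq_bigr => i _; rewrite dyE.
  apply: le_trans (dot_add_le (fun i => - matvec dx i) (fun i => - db i)) _.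
  by rewrite !dot_opp; have := matvec_bound dx; lra.
have D4 : 2 * dot dx dx + 2^-1 * dot dy dy + dot dc dx <=
    tau ^+ 2 * ((5 / 2 + frobenius) * Q + 2 * B ^+ 2).
  have Z := (dot_young dc dx ltr01).1.
  have FX : frobenius * dot dx dx <= frobenius * (tau ^+ 2 * Q) by rewrite ler_wpM2l.
  have TB : 0 <= tau ^+ 2 * B ^+ 2 by rewrite mulr_ge0 ?sqr_ge0.
  rewrite (_ : tau ^+ 2 * _ = 5 / 2 * (tau ^+ 2 * Q) + frobenius * (tau ^+ 2 * Q) +
    2 * (tau ^+ 2 * B ^+ 2)); last by ring.
  by rewrite mulr1 in Z; lra.
rewrite E1.
have Y0 : 0 <= tau * dot (y t) (y t) by rewrite mulr_ge0 ?dot_ge0// ltW.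
have X0 : 0 <= tau * dot (x t) (x t) by rewrite mulr_ge0 ?dot_ge0// ltW.
rewrite -/Q; move: D1 D2 D3 D4 X0 Y0.
move: (dot _ q) (dot _ da) (dot _ db) (dot dc _) (_ + _ + dot dc dx).
by move=> a1 a2 a3 a4 a5; lra.
Qed.

Lemma energy_dini t : 0 < t < T -> forall e, 0 < e ->
  \forall tau \near 0^'+, energy (t + tau) - energy t <= (25 * energy t - 4^-1 * flux t + e) * tau.
Proof.
move=> tT e e0.
pose q tau i := ((x (t + tau) i + a (t + tau) i) - (x t i + a t i)) / tau.
have qc i : q tau i @[tau --> (0 : R)^'+] --> F t i.
  have := cvg_right_of_punctured (is_derive_cvg (fd i tT)); apply: cvg_trans.
  by apply: near_eq_cvg; apply: nearW => tau; rewrite /q mulrC (addrC t).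
have dqc (v : R -> I -> R) (l : I -> R) : (forall i, v tau i @[tau --> (0 : R)^'+] --> l i) ->
    dot (v tau) (q tau) @[tau --> (0 : R)^'+] --> dot l (F t).
  by move=> vc; apply: cvg_sum_seq => i _; apply: cvgM; [exact: vc|exact: qc].
pose S := 5 * dot (x t) (x t) + dot (y t) (y t) + 4^-1 * dot (z t) (z t) + 3 * B ^+ 2.
have lim : dot (fun i => 4 * x t i - z t i) (q tau) + S
    + tau * ((5 / 2 + frobenius) * (2 * dot (q tau) (q tau) + 2 * B ^+ 2) + 2 * B ^+ 2)
    @[tau --> (0 : R)^'+] --> dot (fun i => 4 * x t i - z t i) (F t) + S
    + 0 * ((5 / 2 + frobenius) * (2 * dot (F t) (F t) + 2 * B ^+ 2) + 2 * B ^+ 2).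
  apply: cvgD.
    apply: cvgD; last exact: cvg_cst.
    by apply: (dqc (fun _ i => 4 * x t i - z t i)) => i; exact: cvg_cst.
  apply: cvgM; first by apply: cvg_at_right_filter; exact: cvg_id.
  apply: cvgD; last exact: cvg_cst.
  apply: cvgM; first exact: cvg_cst.
  apply: cvgD; last exact: cvg_cst.
  by apply: cvgM; [exact: cvg_cst|exact: dqc].
(* 25 is the coefficient of [|x|^2]: 20 from [energy_test] and 5 from the increment. By [energy_ge]
   it also covers the 7 [|y|^2] and, the bound on the flux included, the 47 [B ^+ 2]. *)
have main : dot (fun i => 4 * x t i - z t i) (F t) + S
    + 0 * ((5 / 2 + frobenius) * (2 * dot (F t) (F t) + 2 * B ^+ 2) + 2 * B ^+ 2) <
    25 * energy t - 4^-1 * flux t + e.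
  rewrite mul0r addr0 /S.
  have := energy_test (yE t) (zE t) (wE t); rewrite -/(F t).
  have := energy_ge t; have := flux_bound' t; have := bB t; have := cB t; have := dB t.
  have := dot_ge0 (y t); have := dot_ge0 (z t); have := sqr_ge0 B.
  move: (dot _ (F t)) (dot (x t) _) (dot (y t) _) (dot (z t) _) (dot (w t) _) (dot (b t) _)
    (dot (c t) _) (dot (d t) _) (energy t) (flux t) (B ^+ 2) e0.
  by move=> f xx yy zz ww bb cc divdiff E fl B2; lra.
near=> tau.
have tau0 : 0 < tau by near: tau; exact: nbhs_right_gt.
apply: le_trans (energy_increment (q := q tau) tau0 _) _.
  by move=> i; rewrite /q mulrCA divff ?mulr1// gt_eqF.
rewrite [leRHS]mulrC ler_wpM2l ?(ltW tau0)// -/S.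
by near: tau; apply: (cvgr_le _ lim).
Unshelve. all: end_near. Qed.

Lemma energy_bound t : 0 <= t <= T ->
  [/\ dot (x t) (x t) <= expR (25 * T) * (3 * K0 + 4) * B ^+ 2,
      dot (y t) (y t) <= 2 * (expR (25 * T) * (3 * K0 + 4) * B ^+ 2) &
      itvint 0 t flux <= 4 * (expR (25 * T) * (3 * K0 + 4) * B ^+ 2)].
Proof.
move=> tT.
have B2 : 0 <= B ^+ 2 by rewrite sqr_ge0.
(* The energy at time 0 is at most [(3 * K0 + 7 / 2) * B ^+ 2]: [5 / 2 * K0] from the squares,
   [1 / 2 * (K0 + 1)] from the cross term, and the constant 3. *)
have init : expR (25 * T) * energy 0 <= expR (25 * T) * (3 * K0 + 4) * B ^+ 2.
  rewrite -mulrA ler_wpM2l ?expR_ge0// /energy.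
  have := (dot_young (c 0) (x 0) ltr01).1; have := cB 0; have := x0; have := y0.
  by rewrite mulr1; lra.
have [||||G1 G2] := @dini_gronwall _ energy (fun t => 4^-1 * flux t) 25 T T0 _ energy_cont _ _ _
  energy_dini t tT.
- by [].
- by move=> s; apply: cvgM; [exact: cvg_cst|exact: flux_cont].
- by move=> s; rewrite mulr_ge0 ?flux_ge0// invr_ge0.
- move=> s; apply: le_trans (energy_ge s).
  by rewrite !addr_ge0 ?mulr_ge0 ?dot_ge0.
have E := energy_ge t; have X0 := dot_ge0 (x t); have Y0 := dot_ge0 (y t).
have G1' := le_trans G1 init; have G2' := le_trans G2 init.
move: (expR _ * _ * _) G1' G2' {G1 G2 init} => C G1 G2.
have fm : bmeas 0 t flux by apply: bmeas_continuous; apply: continuous_subspaceT => s;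
  exact: flux_cont.
rewrite (itvintZ _ fm) in G2.
split; lra.
Qed.

End Evolution.
End Energy.

(** * Error equations *)

Section CalculusTools.
Context (R : realType).

(** The mean value theorem on [[a, a + h]] approximates [g' a] by values of [g'] inside, so the
    interior Lipschitz bound extends to the end point. *)
Lemma lip_derivative_left (g g' : R -> R) (a b K y : R) :
  (forall x : R, is_derive x 1 g (g' x)) ->
  (forall x z, a < x < b -> a < z < b -> `|g' x - g' z| <= K * `|x - z|) -> 0 <= K ->
  a < y < b -> `|g' a - g' y| <= K * (y - a).
Proof.
move=> dg gL K0 /andP[ay yb].
have C : `|h^-1 * (g (h + a) - g a) - g' y| @[h --> (0 : R)^'+] --> `|g' a - g' y|.
  apply: cvg_norm; apply: cvgB; last exact: cvg_cst.
  exact: cvg_right_of_punctured (is_derive_cvg (dg a)).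
apply: (cvgr_to_le C); near=> h.
have h0 : 0 < h by near: h; exact: nbhs_right_gt.
have hy : h < y - a by near: h; apply: nbhs_right_lt; rewrite subr_gt0.
have gc : {within `[a, h + a], continuous g}.
  apply: continuous_subspaceT => x; apply: differentiable_continuous.
  by apply/derivable1_diffP; have [] := dg x.
have [|c + ->] := MVT (df := g') _ (fun x _ => dg x) gc; first by rewrite ltrDr.
rewrite in_itv/= addrK mulrC mulfK ?gt_eqF// => /andP[ac ch].
rewrite (le_trans (gL _ _ _ _)) ?ac ?ay//; first by lra.
by rewrite ler_wpM2l// ler0_norm; lra.
Unshelve. all: end_near. Qed.

Lemma lip_within (f : R -> R) (a b K : R) : a <= b -> 0 <= K ->
  (forall x y, a <= x <= b -> a <= y <= b -> x <= y -> `|f x - f y| <= K * (y - x)) ->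
  {within `[a, b], continuous f}.
Proof.
move=> ab K0 fL; pose cl x := Num.max a (Num.min b x).
have clI x : a <= cl x <= b by rewrite le_max lexx ge_max ge_min lexx ab.
apply: (@subspace_eq_continuous _ _ _ (f \o cl)).
  move=> x; rewrite inE /= in_itv /= => /andP[ax xb].
  by rewrite /cl min_r// max_r.
apply: continuous_subspaceT => x; apply/cvgrPdist_le => /= e e0.
have cc : {for x, continuous cl}.
  apply: continuous_max; first exact: cst_continuous.
  by apply: continuous_min; [exact: cst_continuous|exact: cvg_id].
have e1 : 0 < e / (K + 1) by rewrite divr_gt0// ltr_wpDl.
move/cvgrPdist_le: cc => /(_ _ e1); apply: filterS => s /= st.
have H : `|f (cl x) - f (cl s)| <= K * `|cl x - cl s|.
  case: (leP (cl x) (cl s)) => [xs|/ltW xs].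
    have -> : `|cl x - cl s| = cl s - cl x by rewrite distrC ger0_norm ?subr_ge0.
    exact: fL.
  have -> : `|cl x - cl s| = cl x - cl s by rewrite ger0_norm ?subr_ge0.
  by rewrite distrC; exact: fL.
rewrite (le_trans H)// (le_trans (ler_wpM2l K0 st))//.
by rewrite mulrA ler_pdivrMr ?ltr_wpDl// mulrC ler_wpM2l ?(ltW e0)// lerDl.
Qed.

(** Meant for the fourth derivative of the solution: its Lipschitz bound holds inside the cells,
    while integration by parts needs continuity up to the nodes. *)
Lemma lip_derivative_continuous (g g' : R -> R) (a b K : R) : a < b -> 0 <= K ->
  (forall x : R, is_derive x 1 g (g' x)) ->
  (forall x y, a < x < b -> a < y < b -> `|g' x - g' y| <= K * `|x - y|) ->
  {within `[a, b], continuous g'}.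
Proof.
move=> ab K0 dg gL.
have L y : a < y < b -> `|g' a - g' y| <= K * (y - a) by exact: lip_derivative_left.
have Rt y : a < y < b -> `|g' y - g' b| <= K * (b - y).
  move=> yab; have := @lip_derivative_left (fun x => g (- x)) (fun x =>
    - g' (- x)) (- b) (- a) K (- y).
  rewrite !opprK (addrC (- g' b)) (addrC (- y)) => H; apply: H => //.
  - move=> x; have := is_derive_affine (f := g) (a := -1) (b := 0) (x := x) (dg _).
    by apply: is_derive_conv => [z|]; rewrite ?mulN1r ?addr0.
  - move=> x z xab zab; rewrite -opprD normrN (le_trans (gL _ _ _ _)); [by []|lra|lra|].
    by rewrite -opprD normrN.
  - by lra.
apply: (lip_within (ltW ab) K0) => x y /andP[ax xb] /andP[ay yb] xy.
move: ax xb ay yb; rewrite le_eqVlt => /predU1P[<- _ ay|ax _ _]; last first.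
  rewrite le_eqVlt => /predU1P[yE|yb].
    move: xy; rewrite yE le_eqVlt => /predU1P[->|xb]; first by rewrite !subrr normr0 mulr0.
    by apply: Rt; rewrite ax.
  rewrite (le_trans (gL _ _ _ _)) ?ax ?(le_lt_trans xy) ?(lt_le_trans ax xy) ?yb//.
  by rewrite distrC ger0_norm ?subr_ge0.
rewrite le_eqVlt => /predU1P[->|yb].
  have m1 : a < (a + b) / 2 < b by lra.
  rewrite (_ : g' a - g' b = (g' a - g' ((a + b) / 2)) + (g' ((a + b) / 2) - g' b)); last by ring.
  rewrite (le_trans (ler_normD _ _))// (le_trans (lerD (L _ m1) (Rt _ m1)))//.
  by rewrite -mulrDr ler_wpM2l//; lra.
move: ay; rewrite le_eqVlt => /predU1P[<-|ay]; first by rewrite !subrr normr0 mulr0.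
by apply: L; rewrite ay.
Qed.

Lemma itvint_parts_poly (a b : R) (f f' : R -> R) (p : {poly R}) : a < b ->
  {within `[a, b], continuous f'} -> (forall x : R, is_derive x 1 f (f' x)) ->
  itvint a b (fun x => f x * p^`().[x]) - f b * p.[b] + f a * p.[a] =
  - itvint a b (fun x => f' x * p.[x]).
Proof.
move=> ab cf' df.
have cf : {within `[a, b], continuous f}.
  apply: continuous_subspaceT => x; apply: differentiable_continuous.
  by apply/derivable1_diffP; have [] := df x.
have cp q : {within `[a, b], continuous (horner q)}.
  exact/continuous_subspaceT/continuous_horner.
have cM (g h : R -> R) : {within `[a, b], continuous g} -> {within `[a, b], continuous h} ->
    {within `[a, b], continuous (fun x => g x * h x)}.
  by move=> cg ch x; apply: cvgM; [exact: cg|exact: ch].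
have := @itvint_ftc _ a b (fun x => f' x * p.[x] + f x * p^`().[x]) (fun x => f x * p.[x]) ab.
rewrite itvintD; [|by apply: bmeas_continuous; exact: cM..].
have dfp (x : R) : a < x < b -> is_derive x 1 (fun x => f x * p.[x]) (f' x * p.[x] +
  f x * p^`().[x]).
  move=> _; have dp := is_derive_poly p x.
  apply: (is_derive_conv _ _ (is_deriveM (df x) dp)) => //.
  by rewrite -![_ *: _]/(_ * _); ring.
have c1 : {within `[a, b], continuous (fun x => f' x * p.[x] + f x * p^`().[x])}.
  by move=> x; apply: cvgD; apply: cM.
have c2 : {within `[a, b], continuous (fun x => f x * p.[x])} by exact: cM.
move=> /(_ c1 c2 dfp) H.
rewrite (_ : itvint a b (fun x => f x * _) = f b * p.[b] - f a * p.[a] - itvint a b (fun x =>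
  f' x * p.[x])); first by ring.
by rewrite -H addrAC subrr add0r.
Qed.

Lemma derive1_periodic (f : R -> R) (c : R) : (forall x, f (x + c) = f x) ->
  forall x, derive1 f (x + c) = derive1 f x.
Proof.
move=> fp x; rewrite /derive1.
rewrite (_ : (fun h => _) = (fun h => h^-1 *: (f (h + x) - f x)))//.
by apply/funext => h; rewrite addrA !fp.
Qed.

Lemma derive1n_periodic (f : R -> R) (c : R) n : (forall x, f (x + c) = f x) ->
  forall x, derive1n n f (x + c) = derive1n n f x.
Proof.
move=> fp; elim: n => [//|n IH] x; rewrite !derive1nS.
exact: derive1_periodic.
Qed.

End CalculusTools.

Section Hform.
Context (R : realType) (M : mesh R) (k : nat).
Local Notation N := (ncells M).
Implicit Types (j : 'I_N) (phi : {poly R}) (sigma : R) (v w : R -> R).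

Definition Hcell sigma j v phi : R :=
  itvint (nl j) (nr j) (fun x => v x * phi^`().[x]) - wtrace sigma j v * phi.[nr j]
  + wtrace sigma (ord_pred j) v * phi.[nl j].

Lemma in_Vh_horner phi : (size phi <= k.+1)%N -> in_Vh M k (horner phi).
Proof. by move=> sphi j; exists phi. Qed.

Lemma Hform_poly sigma j v phi : Hform sigma j v (horner phi) = Hcell sigma j v phi.
Proof.
rewrite /Hform /Hcell innerE (trace_r_eq (f := horner phi))//; last exact: continuous_horner.
rewrite (trace_l_eq (f := horner phi))//; last exact: continuous_horner.
by congr (_ - _ + _); apply: itvint_ext => x _; rewrite -derivE.
Qed.

Lemma Hcell_polys sigma j v (p : 'I_N -> {poly R}) phi :
  (forall j x, nl j < x < nr j -> v x = (p j).[x]) -> Hcell sigma j v phi = Hpoly sigma p j phi.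
Proof.
move=> vp; rewrite /Hcell /Hpoly !(wtrace_poly _ _ vp); congr (_ - _ + _).
by apply: itvint_ext => x xj; rewrite (vp _ _ xj).
Qed.

Lemma HcellB sigma j v w phi : in_Vh M k v -> in_Vh M k w ->
  Hcell sigma j (fun x => v x - w x) phi = Hcell sigma j v phi - Hcell sigma j w phi.
Proof.
move=> hv hw; rewrite /Hcell !(wtrace_VhB _ _ hv hw).
rewrite (@itvint_ext _ _ _ _ (fun x => v x * phi^`().[x] - w x * phi^`().[x])); last first.
  by move=> x _; rewrite mulrBl.
rewrite itvintB; first by ring.
  by apply: bmeasM; [exact: bmeas_Vh hv|exact: bmeas_horner].
by apply: bmeasM; [exact: bmeas_Vh hw|exact: bmeas_horner].
Qed.

Lemma in_VhB_sum n v (f : nat -> R -> R) : in_Vh M k v ->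
  (forall i, (i < n)%N -> in_Vh M k (f i)) -> in_Vh M k (fun x => v x - \sum_(i < n) f i x).
Proof.
move=> hv; elim: n => [|n IH] hf.
  by rewrite (_ : (fun x => _) = v)//; apply/funext => x; rewrite big_ord0 subr0.
rewrite (_ : (fun x => _) = (fun x => (v x - \sum_(i < n) f i x) - f n x)).
  by apply: in_VhB; [apply: IH => i i_n; apply: hf; exact: ltnW|exact: hf].
by apply/funext => x; rewrite big_ord_recr/=; ring.
Qed.

Lemma HcellB_sum sigma j n v (f : nat -> R -> R) phi : in_Vh M k v ->
  (forall i, (i < n)%N -> in_Vh M k (f i)) ->
  Hcell sigma j (fun x => v x - \sum_(i < n) f i x) phi =
  Hcell sigma j v phi - \sum_(i < n) Hcell sigma j (f i) phi.
Proof.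
move=> hv; elim: n => [|n IH] hf.
  rewrite big_ord0 subr0 (_ : (fun x => _) = v)//; apply/funext => x.
  by rewrite big_ord0 subr0.
rewrite (_ : (fun x => _) = (fun x => (v x - \sum_(i < n) f i x) - f n x)); last first.
  by apply/funext => x; rewrite big_ord_recr/=; ring.
have hf' i : (i < n)%N -> in_Vh M k (f i) by move=> i_n; apply: hf; exact: ltnW.
rewrite HcellB ?IH ?big_ord_recr/=; [by ring|by []|exact: in_VhB_sum|exact: hf].
Qed.

End Hform.

(** * Extension of functions of time to the whole line *)

Section ClampedTime.
Context (R : realType) (T : R).
Hypothesis T0 : 0 < T.

(** Composition with [clamp] makes functions on [[0, T]] constant beyond both ends without
    increasing Lipschitz constants; the energy argument can then assume continuity and its algebraic
    relations at all real times. *)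
Definition clamp (t : R) : R := Num.max 0 (Num.min T t).

Lemma clampP t : 0 <= clamp t <= T.
Proof. by rewrite le_max lexx ge_max ge_min lexx (ltW T0). Qed.

Lemma clampE t : 0 <= t <= T -> clamp t = t.
Proof. by move=> /andP[t0 tT]; rewrite /clamp min_r// max_r. Qed.

Lemma clamp_cont : continuous clamp.
Proof.
move=> t; apply: continuous_max; first exact: cst_continuous.
by apply: continuous_min; [exact: cst_continuous|exact: cvg_id].
Qed.

Lemma clamp_lip s t : `|clamp s - clamp t| <= `|s - t|.
Proof.
have H (x y : R) : x <= y -> clamp x <= clamp y /\ clamp y - clamp x <= y - x.
  move=> xy; rewrite /clamp; move: T0; case: (leP T x) => Tx; case: (leP T y) => Ty;
    [case: (leP 0 T)|case: (leP 0 T); case: (leP 0 y)|case: (leP 0 T); case: (leP 0 x)|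
     case: (leP 0 x); case: (leP 0 y)] => *; lra.
case: (leP s t) => [st|/ltW st]; have [c1 c2] := H _ _ st.
  by rewrite distrC ger0_norm ?subr_ge0// distrC ger0_norm ?subr_ge0.
by rewrite ger0_norm ?subr_ge0// ger0_norm ?subr_ge0.
Qed.

Lemma clamp_continuous_comp (f : R -> R) :
  (forall t e, 0 <= t <= T -> 0 < e -> exists2 d : R, 0 < d &
     forall s, 0 <= s <= T -> `|s - t| < d -> `|f s - f t| <= e) ->
  continuous (fun t => f (clamp t)).
Proof.
move=> H t; apply/cvgrPdist_le => /= e e0.
have [d d0 dP] := H (clamp t) e (clampP t) e0.
have /cvgrPdist_lt /(_ _ d0) := @clamp_cont t.
by apply: filterS => s st; rewrite distrC dP ?clampP// distrC.
Qed.

Lemma tderiv_ext (F G : R -> R) t : 0 <= t <= T -> (forall s, 0 <= s <= T -> F s = G s) ->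
  tderivable T F t -> tderivable T G t /\ tderive T G t = tderive T F t.
Proof.
move=> tT FG dF; apply: tderiv_cvg => //.
have C : time_quotient F t s @[s --> within `[0, T] t^'] --> tderive T F t by exact: dF.
apply: cvg_trans C; apply: near_eq_cvg; rewrite /prop_near1 /nbhs/= /within/=.
apply: nearW => s; rewrite in_itv /= => sT.
by rewrite /time_quotient !FG.
Qed.

End ClampedTime.

(** With fixed interpolation points, a time-dependent element of [V_h] is a finite combination of
    its point values, through which time derivatives and limits pass directly. *)
Lemma lagrange_basis (R : realType) (k : nat) (a b : R) : a < b ->
  exists (xs : seq R) (L : R -> {poly R}),
    [/\ forall y, y \in xs -> a < y < b, forall y, y \in xs -> (size (L y) <= k.+1)%N &
     forall p : {poly R}, (size p <= k.+1)%N -> p = \sum_(y <- xs) p.[y] *: L y].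
Proof.
move=> ab; pose xs := [seq a + (b - a) / i.+2%:R | i <- iota 0 k.+1].
have ba : 0 < b - a by rewrite subr_gt0.
have us : uniq xs.
  rewrite map_inj_uniq ?iota_uniq// => i j /addrI /mulfI.
  rewrite gt_eqF// => /(_ isT)/invr_inj/eqP.
  by rewrite eqr_nat => /eqP[].
have sx : size xs = k.+1 by rewrite size_map size_iota.
exists xs, (fun y => (\prod_(z <- xs | z != y) (y - z))^-1 *: \prod_(z <- xs | z != y) ('X - z%:P)).
split.
- move=> y /mapP[i _ ->]; rewrite ltrDl divr_gt0//= -ltrBrDl ltr_pdivrMr//.
  by rewrite ltr_pMr// ltr1n.
- move=> y ys; rewrite (leq_trans (size_scale_leq _ _))//.
  by rewrite -big_filter size_prod_XsubC size_filter -(size_count_neq us ys) sx.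
move=> p sp.
have -> : \sum_(y <- xs) p.[y] *: ((\prod_(z <- xs | z != y) (y - z))^-1 *:
     \prod_(z <- xs | z != y) ('X - z%:P)) = lagrange (horner p) xs.
  by apply: eq_bigr => y _; rewrite scalerA.
apply/eqP; rewrite -subr_eq0; apply: contraT => qn0.
have := max_poly_roots qn0 _ us; rewrite sx => H.
have sq : (size (p - lagrange (horner p) xs)%R <= k.+1)%N.
  rewrite (leq_trans (size_polyD _ _))// size_polyN geq_max sp/=.
  by rewrite -sx size_lagrange.
have : (k.+1 < size (p - lagrange (horner p) xs)%R)%N.
  apply: H; apply/allP => y ys; rewrite /root hornerD hornerN lagrange_interp//.
  by rewrite subrr.
by rewrite ltnNge sq.
Qed.

(** * Coordinates in the orthonormal basis *)

Section Coordinates.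
Context (R : realType) (M : mesh R) (k : nat).
Local Notation N := (ncells M).
Implicit Types (v w : R -> R) (al : dof M k).

Definition coords v al : R := itvint (nl al.1) (nr al.1) (fun x => v x * (cell_basis al).[x]).

Lemma coords_poly_coords v (p : 'I_N -> {poly R}) : (forall j x,
  nl j < x < nr j -> v x = (p j).[x]) ->
  coords v = poly_coords p.
Proof.
by move=> vp; apply/funext => al; apply: itvint_ext => x xj; rewrite (vp _ _ xj).
Qed.

Lemma coordsD v w al : bmeas (nl al.1) (nr al.1) v -> bmeas (nl al.1) (nr al.1) w ->
  coords (fun x => v x + w x) al = coords v al + coords w al.
Proof.
move=> hv hw; rewrite /coords -itvintD.
- by apply: itvint_ext => x _; rewrite mulrDl.
- by apply: bmeasM => //; exact: bmeas_horner.
- by apply: bmeasM => //; exact: bmeas_horner.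
Qed.

Lemma coordsB v w al : bmeas (nl al.1) (nr al.1) v -> bmeas (nl al.1) (nr al.1) w ->
  coords (fun x => v x - w x) al = coords v al - coords w al.
Proof.
move=> hv hw; rewrite /coords -itvintB.
- by apply: itvint_ext => x _; rewrite mulrBl.
- by apply: bmeasM => //; exact: bmeas_horner.
- by apply: bmeasM => //; exact: bmeas_horner.
Qed.

Lemma Hcell_matvec theta v al : in_Vh M k v ->
  Hcell theta al.1 v (cell_basis al) = matvec (dg_matrix theta) (coords v) al.
Proof. by move=> /in_VhP[p sp vp]; rewrite (Hcell_polys _ _ _ vp) (coords_poly_coords vp)
  Hpoly_dg_matrix. Qed.

Lemma Hcell_matvecT theta v al : in_Vh M k v ->
  Hcell (1 - theta) al.1 v (cell_basis al) = - matvecT (dg_matrix theta) (coords v) al.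
Proof. by move=> /in_VhP[p sp vp]; rewrite (Hcell_polys _ _ _ vp) (coords_poly_coords vp)
  Hpoly_dg_matrixT. Qed.

Lemma dot_coords v : in_Vh M k v -> dot (coords v) (coords v) =
  \sum_(j < N) itvint (nl j) (nr j) (fun x => v x ^+ 2).
Proof.
move=> /in_VhP[p sp vp]; rewrite (coords_poly_coords vp) /dot sum_dof; apply: eq_bigr => j _.
transitivity (polydot (nl j) (nr j) (p j) (p j)); first by rewrite (itv_basis_parseval _ (nlr j)
  (sp j)).
apply: itvint_ext => x xj.
by rewrite (vp _ _ xj) expr2.
Qed.

Lemma sum_cells : \sum_(j < N) (nr j - nl j) = 2 * pi :> R.
Proof.
rewrite [RHS](_ : _ = node M N - node M 0%N); last by rewrite node_last node_first subr0.
by rewrite -(telescope_sumr (fun i => node M i) (leq0n _)) big_mkord.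
Qed.

Lemma dot_coords_le v (B : R) : in_Vh M k v -> (forall (j : 'I_N) x,
  nl j < x < nr j -> `|v x| <= B) ->
  dot (coords v) (coords v) <= 2 * pi * B ^+ 2.
Proof.
move=> hv vB; rewrite (dot_coords hv) -sum_cells mulr_suml ler_sum// => j _.
have vm : bmeas (nl j) (nr j) v by exact: bmeas_Vh hv.
rewrite mulrC -(itvint_cst _ (ltW (nlr j))); apply: itvint_le; [|exact: bmeas_cst|].
  by apply: bmeas_ext (bmeasM vm vm) => x _; rewrite expr2.
move=> x xj; rewrite -[v x ^+ 2]real_normK ?num_real// ler_pXn2r ?nnegrE//; first exact: vB xj.
exact: le_trans (vB _ _ xj).
Qed.

Lemma coords_tderiv (T : R) (F : R -> R -> R) t al : 0 < T -> 0 <= t <= T ->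
  (forall s, 0 <= s <= T -> in_Vh M k (F s)) ->
  (forall x, nl al.1 < x < nr al.1 -> tderivable T (F^~ x) t) ->
  [/\ bmeas (nl al.1) (nr al.1) (dt T F t), tderivable T (fun s => coords (F s) al) t &
     tderive T (fun s => coords (F s) al) t = coords (dt T F t) al].
Proof.
move=> T0 tT FV dF; have [xs [L [xsI sL LP]]] := lagrange_basis k (nlr al.1).
have Fx s x : 0 <= s <= T -> nl al.1 < x < nr al.1 -> \sum_(y <- xs) (L y).[x] * F s y = F s x.
  move=> sT xj; have [p sp pF] := FV s sT al.1.
  have in_cell z : nl al.1 < z < nr al.1 -> cell al.1 z by rewrite cellE.
  rewrite (pF x (in_cell _ xj)) [X in _ = X.[x]](LP p sp) horner_sum; apply: eq_big_seq => y ys.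
  by rewrite hornerZ (pF y) 1?mulrC//; apply/in_cell/xsI.
have Hz c y : y \in xs -> tderivable T (fun s => c * F s y) t /\ tderive T (fun s =>
  c * F s y) t = c * dt T F t y.
  by move=> ys; apply: tderivZ => //; apply: dF; exact: xsI.
have dFx x : nl al.1 < x < nr al.1 -> dt T F t x = \sum_(y <- xs) (L y).[x] * dt T F t y.
  move=> xj; have [dS dSE] := @tderiv_sum _ T T0 _ xs (fun y s =>
    (L y).[x] * F s y) t tT (fun y ys => (Hz _ y ys).1).
  rewrite /dt -(tderiv_ext T0 tT (fun s sT => Fx s x sT xj) dS).2 in dSE *.
  by rewrite dSE; apply: eq_big_seq => y ys; rewrite (Hz _ y ys).2.
have Lm (g : R -> R) : bmeas (nl al.1) (nr al.1) (fun x => \sum_(y <- xs) (L y).[x] * g y).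
  apply: bmeas_sum => y _; apply: bmeas_ext (bmeasZ (g y) (bmeas_horner _ _ (L y))) => x _.
  by rewrite mulrC.
have coL (v g : R -> R) : (forall x, nl al.1 < x < nr al.1 ->
  v x = \sum_(y <- xs) (L y).[x] * g y) ->
    coords v al = \sum_(y <- xs) polydot (nl al.1) (nr al.1) (L y) (cell_basis al) * g y.
  move=> vg; rewrite /coords (@itvint_ext _ _ _ _ (fun x =>
    \sum_(y <- xs) g y * ((L y).[x] * (cell_basis al).[x]))); last first.
    by move=> x xj; rewrite (vg x xj) mulr_suml; apply: eq_bigr => y _; ring.
  have LE y : bmeas (nl al.1) (nr al.1) (fun x => (L y).[x] * (cell_basis al).[x]).
    by apply: bmeasM; exact: bmeas_horner.
  rewrite itvint_sum; last by move=> y _; apply: bmeasZ.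
  by apply: eq_bigr => y _; rewrite itvintZ// mulrC.
have [dS dSE] := @tderiv_sum _ T T0 _ xs (fun y s => polydot (nl al.1) (nr al.1) (L y)
  (cell_basis al) * F s y) t tT
  (fun y ys => (Hz _ y ys).1).
have E s : 0 <= s <= T -> \sum_(y <- xs) polydot (nl al.1) (nr al.1) (L y) (cell_basis al) * F s
  y = coords (F s) al.
  by move=> sT; rewrite (coL _ (F s))// => x xj; rewrite Fx.
have [d1 d1E] := tderiv_ext T0 tT E dS; split => //.
  by apply: bmeas_ext (Lm (dt T F t)) => x xj; rewrite -dFx.
rewrite d1E dSE (coL _ (dt T F t) dFx); apply: eq_big_seq => y ys.
by rewrite (Hz _ y ys).2.
Qed.

Lemma coords_points al : exists (xs : seq R) (c : R -> R),
  (forall y, y \in xs -> nl al.1 < y < nr al.1) /\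
  forall v, in_Vh M k v -> coords v al = \sum_(y <- xs) c y * v y.
Proof.
have [xs [L [xsI _ LP]]] := lagrange_basis k (nlr al.1).
exists xs, (fun y => polydot (nl al.1) (nr al.1) (L y) (cell_basis al)); split => // v vV.
have [p sp pF] := vV al.1.
have in_cell z : nl al.1 < z < nr al.1 -> cell al.1 z by rewrite cellE.
transitivity (polydot (nl al.1) (nr al.1) p (cell_basis al)).
  by apply: itvint_ext => x xj; rewrite (pF _ (in_cell _ xj)).
rewrite {1}(LP p sp) polydot_suml; apply: eq_big_seq => y ys.
by rewrite polydotZl mulrC (pF y)//; apply/in_cell/xsI.
Qed.

Lemma coords_clamp_cont (T : R) (F : R -> R -> R) al : 0 < T ->
  (forall s, 0 <= s <= T -> in_Vh M k (F s)) ->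
  (forall x, nl al.1 < x < nr al.1 -> continuous (fun t => F (clamp T t) x)) ->
  continuous (fun t => coords (F (clamp T t)) al).
Proof.
move=> T0 FV Fc; have [xs [c [xsI cP]]] := coords_points al.
rewrite (_ : (fun t => _) = (fun t => \sum_(y <- xs) c y * F (clamp T t) y)); last first.
  by apply/funext => t; rewrite cP//; apply: FV; exact: clampP.
move=> t; apply: cvg_sum_seq => y ys; apply: cvgM; first exact: cvg_cst.
by apply: Fc; exact: xsI.
Qed.

End Coordinates.

Lemma in_VhD (R : realType) (M : mesh R) k v w : in_Vh M k v -> in_Vh M k w ->
  in_Vh M k (fun x => v x + w x).
Proof.
move=> hv hw j; have [p sp vp] := hv j; have [q sq wq] := hw j.
exists (p + q) => [|x xj]; last by rewrite hornerD vp ?wq.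
by rewrite (leq_trans (size_polyD _ _))// geq_max sp.
Qed.

(** * Consistency of the interpolation functions and the error equations *)

Section Consistency.
Context (R : realType) (M : mesh R) (k l : nat) (theta T : R).
Variables (u : R -> R -> R) (P : nat -> R -> R -> R) (wf : nat -> nat -> R -> R -> R).
Local Notation N := (ncells M).
Implicit Types (j : 'I_N) (phi : {poly R}).
Hypotheses (htheta : 1 / 2 < theta) (T0 : 0 < T) (l0 : (0 < l)%N) (lk : (l <= k)%N).
Hypothesis cf : corr_family M k l theta T wf.
Hypothesis lev : forall i, (i <= l)%N -> exists B, level l M T wf i B.

(** Each order costs one degree of orthogonality: by parts, the moment of a primitive against [phi]
    is a boundary term carrying the mean of the preceding correction plus a moment against a
    primitive of [phi]. As [l <= k], the corrections of orders below [l] still have mean zero. *)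
Lemma cf_orthi i : (i <= l)%N -> forall s t j phi, (s < 4)%N -> 0 <= t <= T ->
  (size phi <= k - i)%N -> itvint (nl j) (nr j) (fun x => wf s i t x * phi.[x]) = 0.
Proof.
elim: i => [_ s t j phi s4 tT|i IH il s t j phi s4 tT sphi].
  by rewrite subn0; exact: (cf_orth0 cf).
have sphik : (size phi <= k)%N by rewrite (leq_trans sphi)// leq_subr.
have [Phi PhiE sPhi] := poly_primitive phi.
have sPhi' : (size Phi <= k - i)%N.
  by rewrite (leq_trans sPhi)// (leq_ltn_trans sphi)// ltn_sub2l// (leq_trans il).
have ab := ltW (nlr j).
have prim (g : R -> R) : bmeas (nl j) (nr j) g ->
    (forall q : {poly R}, (size q <= k - i)%N -> itvint (nl j) (nr j) (fun x => g x * q.[x]) = 0) ->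
    itvint (nl j) (nr j) (fun x => itvint (nl j) x g * phi.[x]) = 0.
  move=> gm go; rewrite -PhiE itvint_by_parts// (go Phi sPhi') subr0.
  have := go 1; rewrite size_poly1 subn_gt0 (leq_trans il lk) => /(_ isT).
  rewrite (@itvint_ext _ _ _ _ g) => [->|x _]; first by rewrite mulr0.
  by rewrite hornerE mulr1.
have wm s' i' : (s' < 4)%N -> (i' <= l)%N -> bmeas (nl j) (nr j) (wf s' i' t).
  by move=> s'4 i'l; apply: (cf_bdmi cf).
have pm := bmeas_horner (nl j) (nr j) phi.
have low s' : (s' < 3)%N -> itvint (nl j) (nr j) (fun x => wf s' i.+1 t x * phi.[x]) = 0.
  move=> s3; have := cf_orth cf j s3 il tT sphik.
  have vm : bmeas (nl j) (nr j) (wf s'.+1 i t) by apply: wm => //; exact: ltnW.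
  rewrite (@itvint_ext _ _ _ _ (fun x => wf s' i.+1 t x * phi.[x] - itvint (nl j) x (wf s'.+1 i
    t) * phi.[x])); last first.
    by move=> x _; rewrite mulrBl.
  rewrite itvintB; [|by apply: bmeasM => //; apply: wm => //;
    exact: ltnW|by apply: bmeasM => //; exact: bmeas_primitive].
  rewrite (prim _ vm) ?subr0// => q sq; apply: (IH (ltnW il)) => //.
case: (ltnP s 3) => [s3|s3]; first exact: low.
have -> : s = 3%N by apply/eqP; rewrite eqn_leq -ltnS s4.
have [B levB] := lev (ltnW il); have [dm _ dorth] := level_dt htheta T0 cf j il levB tT.
have := cf_orth3 cf j il tT sphik.
rewrite (@itvint_ext _ _ _ _ (fun x => wf 0%N i.+1 t x * phi.[x] + wf 1%N i.+1 t x * phi.[x]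
   + wf 3%N i.+1 t x * phi.[x] + itvint (nl j) x (dt T (wf 0%N i) t) * phi.[x])); last first.
  by move=> x _; ring.
have wpm s' : (s' < 4)%N -> bmeas (nl j) (nr j) (fun x => wf s' i.+1 t x * phi.[x]).
  by move=> s'4; apply: bmeasM => //; exact: wm.
have dpm : bmeas (nl j) (nr j) (fun x => itvint (nl j) x (dt T (wf 0%N i) t) * phi.[x]).
  by apply: bmeasM => //; exact: bmeas_primitive.
have d0 : itvint (nl j) (nr j) (fun x => itvint (nl j) x (dt T (wf 0%N i) t) * phi.[x]) = 0.
  by apply: prim => // q sq; apply: dorth => t' t'T; exact: (IH (ltnW il)).
have m2 := bmeasD (wpm 0%N isT) (wpm 1%N isT); have m3 := bmeasD m2 (wpm 3%N isT).
rewrite (itvintD m3 dpm) (itvintD m2 (wpm 3%N isT)) (itvintD (wpm 0%N isT) (wpm 1%N isT)).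
by rewrite d0 (low 0%N isT) (low 1%N isT) !add0r addr0.
Qed.

Lemma itvint_parts_orth j (g : R -> R) phi : bmeas (nl j) (nr j) g ->
  itvint (nl j) (nr j) g = 0 ->
  itvint (nl j) (nr j) (fun x => itvint (nl j) x g * phi^`().[x]) =
  - itvint (nl j) (nr j) (fun x => g x * phi.[x]).
Proof. by move=> gm g0; rewrite itvint_by_parts ?(ltW (nlr j))// g0 mulr0 add0r. Qed.

Lemma wf_mean0 i s t j : (i < l)%N -> (s < 4)%N -> 0 <= t <= T ->
  itvint (nl j) (nr j) (wf s i t) = 0.
Proof.
move=> il s4 tT; have := cf_orthi (ltnW il) j (phi := 1) s4 tT.
rewrite size_poly1 subn_gt0 (leq_trans il lk) => /(_ isT) <-.
by apply: itvint_ext => x _; rewrite hornerE mulr1.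
Qed.

Lemma dt_mean0 i t j : (i < l)%N -> 0 <= t <= T ->
  bmeas (nl j) (nr j) (dt T (wf 0%N i) t) /\ itvint (nl j) (nr j) (dt T (wf 0%N i) t) = 0.
Proof.
move=> il tT; have [B levB] := lev (ltnW il).
have [dm _ dorth] := level_dt htheta T0 cf j il levB tT; split => //.
rewrite -(dorth 1); first by apply: itvint_ext => x _; rewrite hornerE mulr1.
move=> t' t'T; apply: (cf_orthi (ltnW il)) => //.
by rewrite size_poly1 subn_gt0 (leq_trans il lk).
Qed.

(** The derivative of [phi] has size at most [k], so the relations defining the correction apply to
    it; the preceding correction has mean zero, so no boundary term remains after integration by
    parts. *)
Lemma cf_step i s t j phi : (i < l)%N -> (s < 3)%N -> 0 <= t <= T -> (size phi <= k.+1)%N ->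
  itvint (nl j) (nr j) (fun x => wf s i.+1 t x * phi^`().[x]) =
  - itvint (nl j) (nr j) (fun x => wf s.+1 i t x * phi.[x]).
Proof.
move=> il s3 tT sphi; have s4 : (s < 4)%N := ltnW s3.
have vm : bmeas (nl j) (nr j) (wf s.+1 i t) by apply: (cf_bdmi cf) => //; exact: ltnW.
rewrite -itvint_parts_orth ?wf_mean0//.
apply/eqP; rewrite -subr_eq0 -itvintB; first 1 last.
- by apply: bmeasM; [apply: (cf_bdmi cf)|exact: bmeas_horner].
- by apply: bmeasM; [exact: bmeas_primitive|exact: bmeas_horner].
rewrite -[X in _ == X](cf_orth cf j s3 il tT (size_deriv_le sphi)).
by apply/eqP/itvint_ext => x _; rewrite mulrBl.
Qed.

Lemma cf_step3 i t j phi : (i < l)%N -> 0 <= t <= T -> (size phi <= k.+1)%N ->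
  itvint (nl j) (nr j) (fun x => wf 0%N i.+1 t x * phi^`().[x]) +
  itvint (nl j) (nr j) (fun x => wf 1%N i.+1 t x * phi^`().[x]) +
  itvint (nl j) (nr j) (fun x => wf 3%N i.+1 t x * phi^`().[x]) =
  itvint (nl j) (nr j) (fun x => dt T (wf 0%N i) t x * phi.[x]).
Proof.
move=> il tT sphi; have [dm d0] := dt_mean0 j il tT.
have wpm s' : (s' < 4)%N -> bmeas (nl j) (nr j) (fun x => wf s' i.+1 t x * phi^`().[x]).
  by move=> s'4; apply: bmeasM; [apply: (cf_bdmi cf)|exact: bmeas_horner].
have m2 := bmeasD (wpm 0%N isT) (wpm 1%N isT); have m3 := bmeasD m2 (wpm 3%N isT).
have dpm : bmeas (nl j) (nr j) (fun x => itvint (nl j) x (dt T (wf 0%N i) t) * phi^`().[x]).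
  by apply: bmeasM; [exact: bmeas_primitive|exact: bmeas_horner].
have := cf_orth3 cf j il tT (size_deriv_le sphi).
rewrite (@itvint_ext _ _ _ _ (fun x => wf 0%N i.+1 t x * phi^`().[x] + wf 1%N i.+1 t x * phi^`().[x]
   + wf 3%N i.+1 t x * phi^`().[x] + itvint (nl j) x (dt T (wf 0%N i) t) * phi^`().[x]));
     last first.
  by move=> x _; ring.
rewrite (itvintD m3 dpm) (itvintD m2 (wpm 3%N isT)) (itvintD (wpm 0%N isT) (wpm 1%N isT)).
by rewrite itvint_parts_orth// => /eqP; rewrite subr_eq0 => /eqP.
Qed.

Hypothesis ux : forall t x n, 0 <= t <= T -> (n < 4)%N -> derivable (derive1n n (u t)) x 1.
Hypothesis uper : forall t x, 0 <= t <= T -> u t (x + 2 * pi) = u t x.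
Hypothesis u4c : forall t j, 0 < t <= T ->
  {within `[nl j, nr j], continuous (derive1n 4 (u t))}.
Hypothesis Pggr : forall s t, (s < 4)%N -> 0 <= t <= T ->
  is_ggr M k (weight_of theta s) (derive1n s (u t)) (P s t).
Hypothesis wfE : forall s t x, (s < 4)%N -> 0 <= t <= T ->
  wf s 0%N t x = derive1n s (u t) x - P s t x.

Definition itp (s : nat) (t x : R) : R := P s t x - \sum_(i < l) wf s i.+1 t x.

Lemma in_Vh_itp s t : (s < 4)%N -> 0 <= t <= T -> in_Vh M k (itp s t).
Proof.
move=> s4 tT; apply: (in_VhB_sum (f := fun i => wf s i.+1 t)); first by have [] := Pggr s4 tT.
by move=> i il; exact: (cf_Vh cf).
Qed.

(** The correction of order 0 is the projection error, so adding the last correction moves the range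
    of summation from 1..l to 0..l-1. *)
Lemma itp_shift s t x : (s < 4)%N -> 0 <= t <= T ->
  itp s t x + wf s l t x = derive1n s (u t) x - \sum_(i < l) wf s i t x.
Proof.
move=> s4 tT; rewrite /itp.
have := wfE x s4 tT => w0.
have : \sum_(i < l.+1) wf s i t x = \sum_(i < l.+1) wf s i t x by [].
rewrite {1}big_ord_recr/= big_ord_recl/= w0 => H.
by rewrite -[X in _ = _ - X](addrK (wf s l t x)) H; ring.
Qed.

Lemma u_cont s t x : (s < 4)%N -> 0 <= t <= T -> {for x, continuous (derive1n s (u t))}.
Proof.
by move=> s4 tT; apply: differentiable_continuous; apply/derivable1_diffP; exact: ux.
Qed.

Lemma u_der s t (x : R) : (s < 4)%N -> 0 <= t <= T ->
  is_derive x 1 (derive1n s (u t)) (derive1n s.+1 (u t) x).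
Proof.
by move=> s4 tT; apply: DeriveDef; [exact: ux|rewrite derive1nS derive1E].
Qed.

Lemma u_derive_within s t j : (s < 4)%N -> 0 <= t <= T -> (s < 3)%N \/ 0 < t ->
  {within `[nl j, nr j], continuous (derive1n s.+1 (u t))}.
Proof.
move=> s4 tT [s3|t0]; first by apply: continuous_subspaceT => x; exact: u_cont.
case: (ltnP s 3) => [s3|s3]; first by apply: continuous_subspaceT => x; exact: u_cont.
have -> : s = 3%N by apply/eqP; rewrite eqn_leq -ltnS s4.
by apply: u4c; rewrite t0; case/andP: tT.
Qed.

Lemma u_periodic_node s t j : 0 <= t <= T ->
  derive1n s (u t) (nl (ordS j)) = derive1n s (u t) (nr j).
Proof.
move=> tT; have := ltn_ord j; rewrite leq_eqVlt => /predU1P[jN|jN].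
  have -> : nl (ordS j) = 0 by rewrite /nl /= jN modnn node_first.
  have -> : nr j = 2 * pi by rewrite /nr jN node_last.
  rewrite -[in RHS](add0r (2 * pi)) derive1n_periodic// => x; exact: uper.
by rewrite /nl /nr /= modn_small.
Qed.

Lemma wtrace_P s t j : (s < 4)%N -> 0 <= t <= T ->
  wtrace (weight_of theta s) j (P s t) = derive1n s (u t) (nr j).
Proof.
move=> s4 tT; have [Vh _ /(_ j)] := Pggr s4 tT.
rewrite (@wtrace_contB _ k _ _ _ (derive1n s (u t)) (P s t))//; last by move=> x; exact: u_cont.
by rewrite u_periodic_node// => /eqP; rewrite subr_eq0 => /eqP <-; ring.
Qed.

(** The weighted traces of the corrections vanish, so these contribute volume terms only, and the
    projection can be exchanged for the exact quantity by its defining relations. For [s = 3] the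
    identity is used in the evolution equation, that is, at positive times. *)
Lemma Hcell_itp s t j phi : (s < 4)%N -> 0 <= t <= T -> (s < 3)%N \/ 0 < t ->
  (size phi <= k.+1)%N ->
  Hcell (weight_of theta s) j (itp s t) phi =
  - itvint (nl j) (nr j) (fun x => derive1n s.+1 (u t) x * phi.[x])
  - \sum_(i < l) itvint (nl j) (nr j) (fun x => wf s i.+1 t x * phi^`().[x]).
Proof.
move=> s4 tT st sphi; have [Vh Ph _] := Pggr s4 tT.
rewrite (@HcellB_sum _ _ k _ _ _ _ (fun i => wf s i.+1 t))//; last first.
  by move=> i il; exact: (cf_Vh cf).
congr (_ - _); last first.
  apply: eq_bigr => i _; rewrite /Hcell !(cf_trace cf)// ?ltnS ?ltn_ord//.
  by rewrite !mul0r subr0 addr0.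
rewrite -(itvint_parts_poly phi (nlr j) (@u_derive_within s t j s4 tT st) (fun x => u_der x s4 tT)).
rewrite /Hcell !wtrace_P// -[in X in _ + X * _](u_periodic_node _ _ tT) ord_predK.
congr (_ - _ + _); apply/esym/eqP; rewrite -subr_eq0 -itvintB.
- rewrite -[X in _ == X](Ph j _ (size_deriv_le sphi)) innerE.
  by apply/eqP/itvint_ext => x _; rewrite mulrBl.
- apply: bmeasM; last exact: bmeas_horner.
  by apply: bmeas_continuous; apply: continuous_subspaceT => x; exact: u_cont.
- by apply: bmeasM; [exact: bmeas_Vh Vh|exact: bmeas_horner].
Qed.

Lemma bmeas_u s t j : (s < 4)%N -> 0 <= t <= T -> (s < 3)%N \/ 0 < t ->
  bmeas (nl j) (nr j) (derive1n s.+1 (u t)).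
Proof. by move=> s4 tT st; apply: bmeas_continuous; exact: u_derive_within. Qed.

(** By [cf_step] the volume term of each correction cancels the correction of the next quantity one
    order lower; only the one of order [l] survives. *)
Lemma Hcell_itp_aux s t j phi : (s < 3)%N -> 0 <= t <= T -> (size phi <= k.+1)%N ->
  Hcell (weight_of theta s) j (itp s t) phi =
  - itvint (nl j) (nr j) (fun x => (itp s.+1 t x + wf s.+1 l t x) * phi.[x]).
Proof.
move=> s3 tT sphi; have s4 : (s < 4)%N := ltnW s3.
rewrite Hcell_itp//; last by left.
rewrite [X in _ = - X](@itvint_ext _ _ _ _ (fun x => derive1n s.+1 (u t) x * phi.[x] -
   \sum_(i < l) wf s.+1 i t x * phi.[x])); last first.
  by move=> x _; rewrite itp_shift// mulrBl mulr_suml.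
have wm i : (i <= l)%N -> bmeas (nl j) (nr j) (fun x => wf s.+1 i t x * phi.[x]).
  by move=> il; apply: bmeasM; [apply: (cf_bdmi cf)|exact: bmeas_horner].
rewrite itvintB; first 1 last.
- by apply: bmeasM; [apply: bmeas_u => //; left|exact: bmeas_horner].
- by apply: bmeas_sum => i _; apply: wm; exact: ltnW.
rewrite itvint_sum; last by move=> i _; apply: wm; exact: ltnW.
rewrite opprB addrC; congr (_ + _); rewrite -sumrN; apply: eq_bigr => i _.
by rewrite cf_step// opprK.
Qed.

Hypothesis ueq : forall t x, 0 < t <= T ->
  dt T u t x + derive1 (u t) x + derive1n 2 (u t) x + derive1n 4 (u t) x = 0.

(** The equation collects the three space derivatives into [dt T u], and [cf_step3] turns the volume
    terms into time derivatives of corrections of orders below [l]. *)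
Lemma Hcell_itp_evol t j phi : 0 < t <= T -> (size phi <= k.+1)%N ->
  bmeas (nl j) (nr j) (dt T u t) /\
  Hcell theta j (itp 0%N t) phi + Hcell (1 - theta) j (itp 1%N t) phi +
    Hcell (1 - theta) j (itp 3%N t) phi =
  itvint (nl j) (nr j) (fun x => dt T u t x * phi.[x])
  - \sum_(i < l) itvint (nl j) (nr j) (fun x => dt T (wf 0%N i) t x * phi.[x]).
Proof.
move=> tT0 sphi; have tT : 0 <= t <= T by case/andP: tT0 => /ltW -> ->.
have t0 : 0 < t by case/andP: tT0.
have um s : (s < 4)%N -> bmeas (nl j) (nr j) (derive1n s.+1 (u t)) by move=> s4;
  apply: bmeas_u => //; right.
have utE x : dt T u t x = - derive1n 1 (u t) x - derive1n 2 (u t) x - derive1n 4 (u t) x.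
  have := ueq x tT0; rewrite (_ : derive1n 1 (u t) x = derive1 (u t) x)//.
  by move: (dt T u t x) (derive1 (u t) x) (derive1n 2 _ _) (derive1n 4 _ _) => a1 a2 a3 a4; lra.
have dm : bmeas (nl j) (nr j) (dt T u t).
  apply: (@bmeas_ext _ _ _ (fun x => - derive1n 1 (u t) x - derive1n 2 (u t) x - derive1n 4 (u
    t) x)).
    by move=> x _; rewrite utE.
  by apply: bmeasB; [apply: bmeasB; [apply: bmeasN|]|]; exact: um.
split => //.
have upm s : (s < 4)%N -> bmeas (nl j) (nr j) (fun x => derive1n s.+1 (u t) x * phi.[x]).
  by move=> s4; apply: bmeasM; [exact: um|exact: bmeas_horner].
pose I s := itvint (nl j) (nr j) (fun x => derive1n s (u t) x * phi.[x]).
pose W s := \sum_(i < l) itvint (nl j) (nr j) (fun x => wf s i.+1 t x * phi^`().[x]).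
have h0 : Hcell theta j (itp 0%N t) phi = - I 1%N - W 0%N.
  by have := @Hcell_itp 0%N t j phi isT tT (or_intror t0) sphi.
have h1 : Hcell (1 - theta) j (itp 1%N t) phi = - I 2%N - W 1%N.
  by have := @Hcell_itp 1%N t j phi isT tT (or_intror t0) sphi.
have h3 : Hcell (1 - theta) j (itp 3%N t) phi = - I 4%N - W 3%N.
  by have := @Hcell_itp 3%N t j phi isT tT (or_intror t0) sphi.
have hW : \sum_(i < l) itvint (nl j) (nr j) (fun x => dt T (wf 0%N i) t x * phi.[x]) =
  W 0%N + W 1%N + W 3%N.
  by rewrite -(eq_bigr _ (fun i _ => cf_step3 j (ltn_ord i) tT sphi)) !big_split/=.
have hI : itvint (nl j) (nr j) (fun x => dt T u t x * phi.[x]) = - I 1%N - I 2%N - I 4%N.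
  transitivity (itvint (nl j) (nr j) (fun x => - (derive1n 1 (u t) x * phi.[x]) - derive1n 2 (u
    t) x * phi.[x]
      - derive1n 4 (u t) x * phi.[x])).
    by apply: itvint_ext => x _; rewrite utE !mulrBl mulNr.
  have m1 := bmeasN (upm 0%N isT); have m2 := bmeasB m1 (upm 1%N isT).
  by rewrite (itvintB m2 (upm 3%N isT)) (itvintB m1 (upm 1%N isT)) (itvintN (upm 0%N isT)).
rewrite h0 h1 h3 hW hI; move: (I 1%N) (I 2%N) (I 4%N) (W 0%N) (W 1%N) (W 3%N) => a1 a2 a3 a4 a5 a6.
by ring.
Qed.

Variable h : nat -> R -> R -> R.
Hypothesis ut : forall t x, 0 <= t <= T -> tderivable T (fun s => u s x) t.
Hypothesis hVh : forall s t, (s < 4)%N -> 0 <= t <= T -> in_Vh M k (h s t).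
Hypothesis haux : forall s t j phi, (s < 3)%N -> 0 <= t <= T -> (size phi <= k.+1)%N ->
  itvint (nl j) (nr j) (fun x => h s.+1 t x * phi.[x]) + Hcell (weight_of theta s) j (h s t) phi
    = 0.
Hypothesis hdt : forall t j x, 0 < t <= T -> nl j < x < nr j ->
  tderivable T (fun s => h 0%N s x) t.
Hypothesis hcont0 : forall j x, nl j < x < nr j -> h 0%N t x @[t --> 0^'+] --> h 0%N 0 x.
Hypothesis hevol : forall t j phi, 0 < t <= T -> (size phi <= k.+1)%N ->
  itvint (nl j) (nr j) (fun x => dt T (h 0%N) t x * phi.[x]) =
  Hcell theta j (h 0%N t) phi + Hcell (1 - theta) j (h 1%N t) phi +
    Hcell (1 - theta) j (h 3%N t) phi.

Definition err (s : nat) (t x : R) : R := itp s t x - h s t x.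

Lemma err_Vh s t : (s < 4)%N -> 0 <= t <= T -> in_Vh M k (err s t).
Proof. by move=> s4 tT; apply: in_VhB; [exact: in_Vh_itp|exact: hVh]. Qed.

Lemma wfl_Vh s t : (s < 4)%N -> 0 <= t <= T -> in_Vh M k (wf s l t).
Proof. by move=> s4 tT; apply: (cf_Vh cf) => //; rewrite l0 leqnn. Qed.

Lemma err_aux s t j phi : (s < 3)%N -> 0 <= t <= T -> (size phi <= k.+1)%N ->
  Hcell (weight_of theta s) j (err s t) phi =
  - itvint (nl j) (nr j) (fun x => (err s.+1 t x + wf s.+1 l t x) * phi.[x]).
Proof.
move=> s3 tT sphi; have s4 : (s < 4)%N := ltnW s3.
rewrite (HcellB _ _ _ (in_Vh_itp s4 tT) (hVh s4 tT)) Hcell_itp_aux//.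
have -> : Hcell (weight_of theta s) j (h s t) phi = - itvint (nl j) (nr j) (fun x =>
  h s.+1 t x * phi.[x]).
  by have /eqP := haux j s3 tT sphi; rewrite addrC addr_eq0 => /eqP.
have im : bmeas (nl j) (nr j) (fun x => (itp s.+1 t x + wf s.+1 l t x) * phi.[x]).
  apply: bmeasM; last exact: bmeas_horner.
  by apply: bmeasD; apply: (@bmeas_Vh _ _ k); [exact: in_Vh_itp|exact: wfl_Vh].
have hm : bmeas (nl j) (nr j) (fun x => h s.+1 t x * phi.[x]).
  by apply: bmeasM; [apply: (@bmeas_Vh _ _ k); exact: hVh|exact: bmeas_horner].
suff -> : itvint (nl j) (nr j) (fun x => (err s.+1 t x + wf s.+1 l t x) * phi.[x]) =
    itvint (nl j) (nr j) (fun x => (itp s.+1 t x + wf s.+1 l t x) * phi.[x]) -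
    itvint (nl j) (nr j) (fun x => h s.+1 t x * phi.[x]) by ring.
rewrite -itvintB//; apply: itvint_ext => x _; rewrite /err; ring.
Qed.

Lemma err_coord s t (al : dof M k) : (s < 3)%N -> 0 <= t <= T ->
  Hcell (weight_of theta s) al.1 (err s t) (cell_basis al) =
    - (coords (err s.+1 t) al + coords (wf s.+1 l t) al).
Proof.
move=> s3 tT; rewrite err_aux ?size_cell_basis// -coordsD//.
  by apply: (@bmeas_Vh _ _ k); exact: err_Vh.
by apply: (@bmeas_Vh _ _ k); exact: wfl_Vh.
Qed.

Local Notation A := (@dg_matrix R M k theta).

Lemma coord_p t (al : dof M k) : 0 <= t <= T ->
  coords (err 1%N t) al + matvec A (coords (err 0%N t)) al = - coords (wf 1%N l t) al.
Proof.
move=> tT; have := err_coord (s := 0%N) al isT tT.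
rewrite (_ : weight_of theta 0%N = theta)// Hcell_matvec; last exact: err_Vh.
by move=> ->; ring.
Qed.

Lemma coord_q t (al : dof M k) : 0 <= t <= T ->
  coords (err 2%N t) al - matvecT A (coords (err 1%N t)) al = - coords (wf 2%N l t) al.
Proof.
move=> tT; have := err_coord (s := 1%N) al isT tT.
rewrite [weight_of theta 1%N]/(1 - theta) Hcell_matvecT; last exact: err_Vh.
by move=> ->; ring.
Qed.

Lemma coord_r t (al : dof M k) : 0 <= t <= T ->
  coords (err 3%N t) al + matvec A (coords (err 2%N t)) al = - coords (wf 3%N l t) al.
Proof.
move=> tT; have := err_coord (s := 2%N) al isT tT.
rewrite (_ : weight_of theta 2%N = theta)// Hcell_matvec; last exact: err_Vh.
by move=> ->; ring.
Qed.

(* The last correction of u need not be differentiable in time, but it cancels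
   in [err 0 + wf 0 l]. *)
Definition err_wf (t x : R) : R := err 0%N t x + wf 0%N l t x.

Lemma err_wfE t x : 0 <= t <= T ->
  u t x - \sum_(i < l) wf 0%N i t x - h 0%N t x = err_wf t x.
Proof.
by move=> tT; have := @itp_shift 0%N t x isT tT; rewrite /err_wf /err => H; rewrite -H; ring.
Qed.

Lemma err_wf_Vh t : 0 <= t <= T -> in_Vh M k (err_wf t).
Proof. by move=> tT; apply: in_VhD; [exact: err_Vh|exact: wfl_Vh]. Qed.

Lemma err_wf_tderiv t j x : 0 < t <= T -> nl j < x < nr j ->
  tderivable T (fun s => err_wf s x) t /\
  dt T err_wf t x = dt T u t x - \sum_(i < l) dt T (wf 0%N i) t x - dt T (h 0%N) t x.
Proof.
move=> tT0 xj; have tT : 0 <= t <= T by case/andP: tT0 => /ltW -> ->.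
have d1 := @ut t x tT.
have dw (i : 'I_l) : i \in index_enum 'I_l -> tderivable T (fun s => wf 0%N i s x) t.
  by move=> _; exact: (cf_dt cf (ltn_ord i) tT xj).
have [d2 d2E] := tderiv_sum T0 tT dw.
have [d3 d3E] := tderivB T0 tT d1 d2.
have [d4 d4E] := tderivB T0 tT d3 (hdt tT0 xj).
have [d5 d5E] := tderiv_ext T0 tT (fun s sT => err_wfE x sT) d4.
by split => //; rewrite /dt d5E d4E d3E d2E.
Qed.

(** At time 0 the scheme gives continuity from the right instead of a derivative, so that time is
    handled separately. *)
Lemma err_wf_cont j x : nl j < x < nr j -> continuous (fun t => err_wf (clamp T t) x).
Proof.
move=> xj; rewrite (_ : (fun t => _) = (fun t => u (clamp T t) x
   - \sum_(i < l) wf 0%N i (clamp T t) x - h 0%N (clamp T t) x)); last first.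
  by apply/funext => t; rewrite err_wfE// clampP.
have tc (f : R -> R) : (forall t, 0 <= t <= T -> tderivable T f t) ->
  continuous (fun t => f (clamp T t)).
  move=> df; apply: clamp_continuous_comp => // t e tT e0.
  by have [d d0 dP] := tderiv_cont (df t tT) e0; exists d.
move=> t; apply: cvgB; last first.
  apply: (clamp_continuous_comp T0 (f := fun t => h 0%N t x)) => t' e /andP[t'0 t'T] e0.
  move: t'0; rewrite le_eqVlt => /predU1P[<-|t'0]; last first.
    have [|d d0 dP] := tderiv_cont (hdt (t := t') _ xj) e0; first by rewrite t'0.
    by exists d.
  have /cvgrPdist_le/(_ _ e0) := hcont0 xj.
  rewrite /at_right near_withinE => /nbhs_ballP[d /= d0 dP].
  exists d => // s /andP[s0 sT]; move: s0; rewrite le_eqVlt => /predU1P[<-|s0].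
    by move=> _; rewrite subrr normr0; exact: ltW.
  by move=> sd; rewrite distrC; apply: dP => //; rewrite /ball/= distrC.
apply: cvgB; first by apply: (tc (fun t => u t x)) => t' t'T; exact: ut.
apply: cvg_sum_seq => i _; apply: (tc (fun t => wf 0%N i t x)) => t' t'T.
exact: (cf_dt cf (ltn_ord i) t'T xj).
Qed.

Lemma coords_err_wf t (al : dof M k) : 0 <= t <= T -> coords (err_wf t) al =
  coords (err 0%N t) al + coords (wf 0%N l t) al.
Proof.
by move=> tT; apply: coordsD; apply: (@bmeas_Vh _ _ k); [exact: err_Vh|exact: wfl_Vh].
Qed.

(** The time derivatives of [u] and of the corrections of orders below [l] cancel against the
    consistency identity, so the right-hand side contains no data. *)
Lemma evolution_coord t (al : dof M k) : 0 < t <= T ->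
  tderivable T (fun s => coords (err_wf s) al) t /\
  tderive T (fun s => coords (err_wf s) al) t =
  matvec A (coords (err 0%N t)) al - matvecT A (coords (err 1%N t)) al - matvecT A (coords (err
    3%N t)) al.
Proof.
move=> tT0; have tT : 0 <= t <= T by case/andP: tT0 => /ltW -> ->.
have [dFm dF dFE] := coords_tderiv T0 tT err_wf_Vh (fun x xj => (@err_wf_tderiv t al.1 x tT0 xj).1).
split => //; rewrite dFE.
have [um E1] := Hcell_itp_evol al.1 tT0 (size_cell_basis al).
have E2 := hevol al.1 tT0 (size_cell_basis al).
have wm : bmeas (nl al.1) (nr al.1) (fun x => \sum_(i < l) dt T (wf 0%N i) t x).
  by apply: bmeas_sum => i _; exact: (dt_mean0 al.1 (ltn_ord i) tT).1.
have hm : bmeas (nl al.1) (nr al.1) (dt T (h 0%N) t).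
  apply: (@bmeas_ext _ _ _ (fun x => dt T u t x - \sum_(i < l) dt T (wf 0%N i) t x - dt T err_wf
    t x)).
    by move=> x xj; rewrite (err_wf_tderiv tT0 xj).2; ring.
  by apply: bmeasB => //; exact: bmeasB.
have -> : coords (dt T err_wf t) al = coords (dt T u t) al - \sum_(i < l) coords (dt T (wf 0%N
  i) t) al - coords (dt T (h 0%N) t) al.
  transitivity (coords (fun x => dt T u t x - \sum_(i < l) dt T (wf 0%N i) t x - dt T (h 0%N) t
    x) al).
    by apply: itvint_ext => x xj; rewrite (err_wf_tderiv tT0 xj).2.
  rewrite coordsB ?coordsB//; last exact: bmeasB.
  congr (_ - _ - _); rewrite /coords -itvint_sum.
    by apply: itvint_ext => x _; rewrite mulr_suml.
  by move=> i _; apply: bmeasM; [exact: (dt_mean0 al.1 (ltn_ord i) tT).1|exact: bmeas_horner].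
have eV s : (s < 4)%N -> in_Vh M k (err s t) by move=> s4; exact: err_Vh.
rewrite -(Hcell_matvec theta al (eV 0%N isT)) -[- matvecT _ (coords (err 1%N t))
  _](Hcell_matvecT theta al (eV 1%N isT)).
rewrite -[- matvecT _ (coords (err 3%N t)) _](Hcell_matvecT theta al (eV 3%N isT)).
rewrite !(HcellB _ _ _ (in_Vh_itp _ tT) (hVh _ tT))//.
transitivity (Hcell theta al.1 (itp 0%N t) (cell_basis al) +
  Hcell (1 - theta) al.1 (itp 1%N t) (cell_basis al)
   + Hcell (1 - theta) al.1 (itp 3%N t) (cell_basis al) - coords (dt T (h 0%N) t) al).
  by rewrite E1.
rewrite [coords (dt T (h 0%N) t) al]E2.
move: (Hcell _ _ (itp 0%N t) _) (Hcell _ _ (itp 1%N t) _) (Hcell _ _ (itp 3%N t) _)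
  (Hcell _ _ (h 0%N t) _) (Hcell _ _ (h 1%N t) _) (Hcell _ _ (h 3%N t) _) => a1 a2 a3 a4 a5 a6.
by ring.
Qed.

Variables (B K0 : R).
Hypothesis B0 : 0 <= B.
Hypothesis wlev : level l M T wf l B.
Let Be := Num.sqrt (2 * pi) * B.
Hypothesis init0 : dot (coords (err 0%N 0)) (coords (err 0%N 0 : R -> R) : dof M k ->
  R) <= K0 * Be ^+ 2.
Hypothesis init1 : dot (coords (err 1%N 0)) (coords (err 1%N 0) : dof M k -> R) <= K0 * Be ^+ 2.

Lemma BeE : Be ^+ 2 = 2 * pi * B ^+ 2.
Proof. by rewrite exprMn sqr_sqrtr// ltW// pi2_gt0. Qed.

Lemma wfl_bound s t : (s < 4)%N -> 0 <= t <= T ->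
  dot (coords (wf s l t)) (coords (wf s l t) : dof M k -> R) <= Be ^+ 2.
Proof.
move=> s4 tT; rewrite BeE; apply: dot_coords_le; first exact: wfl_Vh.
move=> j x xj; have := wlev (ts := [::]) (t := t) s4 _ _ xj.
rewrite /step_prod big_nil mulr1 /=; apply; last by rewrite muln0 addn0; clear -s4; lia.
by split=> //; rewrite ?big_nil ?addr0; case/andP: tT.
Qed.

(** At [i = l] one time difference fits the order condition [s + 4 + l <= l + 6] of [level] for
    [s <= 2] only; the last correction of r is merely known to be bounded. *)
Lemma wfl_lip s : (s < 3)%N -> lip_in_time Be (fun t => coords (wf s l (clamp T t)) : dof M k -> R).
Proof.
move=> s3 s' t; have s4 : (s < 4)%N := ltnW s3.
have key a b : 0 <= a <= T -> 0 <= b <= T -> a <= b ->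
    dot (fun al : dof M k => coords (wf s l b) al - coords (wf s l a) al)
        (fun al => coords (wf s l b) al - coords (wf s l a) al) <= (Be * (b - a)) ^+ 2.
  move=> aT bT ab.
  have -> : (fun al : dof M k => coords (wf s l b) al - coords (wf s l a) al) = coords (fun x =>
    wf s l b x - wf s l a x).
    by apply/funext => al; rewrite coordsB//; apply: (@bmeas_Vh _ _ k); exact: wfl_Vh.
  rewrite (_ : (Be * (b - a)) ^+ 2 = 2 * pi * (B * (b - a)) ^+ 2); last by rewrite exprMn BeE; ring.
  apply: dot_coords_le; first by apply: in_VhB; exact: wfl_Vh.
  move=> j x xj; have ba0 : 0 <= b - a by rewrite subr_ge0.
  have := wlev (ts := [:: b - a]) (t := a) s4 _ _ xj.
  rewrite /step_prod big_seq1 /= subrKC; apply; last by rewrite muln1; clear -s3; lia.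
  apply: admissible_cons => //; last by rewrite big_nil; lra.
  by split=> //; rewrite ?big_nil; lra.
have sT := clampP T0 s'; have tT := clampP T0 t.
have L := clamp_lip T0 s' t.
have Be0 : 0 <= Be by rewrite mulr_ge0// sqrtr_ge0.
have fin (z : R) : 0 <= z <= `|s' - t| -> (Be * z) ^+ 2 <= (Be * (s' - t)) ^+ 2.
  move=> /andP[z0 zs]; rewrite -[leRHS]real_normK ?num_real// ler_pXn2r ?nnegrE ?mulr_ge0//.
  by rewrite normrM (ger0_norm Be0) ler_wpM2l.
case: (leP (clamp T t) (clamp T s')) => [ts|/ltW ts].
  apply: le_trans (key _ _ tT sT ts) (fin _ _).
  by rewrite subr_ge0 ts/=; apply: le_trans L; rewrite ler_norm.
apply: le_trans (le_trans _ (key _ _ sT tT ts)) (fin _ _).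
  by rewrite le_eqVlt; apply/orP; left; apply/eqP; apply: eq_bigr => al _; ring.
by rewrite subr_ge0 ts/=; apply: le_trans L; rewrite distrC ler_norm.
Qed.

(** [Dfl] is the flux of the energy estimate: a continuous function that dominates the squared
    errors of q and r and can be integrated in their place. *)
Lemma error_energy : exists2 Dfl : R -> R, continuous Dfl /\ (forall t, 0 <= Dfl t) &
  forall t, 0 <= t <= T ->
  [/\ dot (coords (err 0%N t)) (coords (err 0%N t) : dof M k ->
    R) <= expR (25 * T) * (3 * K0 + 4) * Be ^+ 2,
      dot (coords (err 1%N t)) (coords (err 1%N t) : dof M k ->
        R) <= 2 * (expR (25 * T) * (3 * K0 + 4) * Be ^+ 2),
      itvint 0 t Dfl <= 4 * (expR (25 * T) * (3 * K0 + 4) * Be ^+ 2) &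
      dot (coords (err 2%N t)) (coords (err 2%N t) : dof M k -> R) +
      dot (coords (err 3%N t)) (coords (err 3%N t) : dof M k -> R) <= 2 * Dfl t + 4 * Be ^+ 2].
Proof.
pose cl := clamp T.
pose X s t : dof M k -> R := coords (err s (cl t)); pose W s t : dof M k ->
  R := coords (wf s l (cl t)).
have Be0 : 0 <= Be by rewrite mulr_ge0// sqrtr_ge0.
have Aneg v : dot v (matvec A v) <= 0 by rewrite dot_matvec_diag; exact: dg_matrix_neg.
have cP t := clampP T0 t.
have yE t al : X 1%N t al + matvec A (X 0%N t) al = - W 1%N t al by exact: coord_p.
have zE t al : X 2%N t al - matvecT A (X 1%N t) al = - W 2%N t al by exact: coord_q.
have wE t al : X 3%N t al + matvec A (X 2%N t) al = - W 3%N t al by exact: coord_r.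
have fc al : continuous (fun t => X 0%N t al + W 0%N t al).
  rewrite (_ : (fun t => _) = (fun t => coords (err_wf (clamp T t)) al)).
    by apply: coords_clamp_cont => //; [exact: err_wf_Vh|move=> x xj; exact: err_wf_cont xj].
  by apply/funext => t; rewrite coords_err_wf ?clampP.
have fd t al : 0 < t < T -> is_derive t 1 (fun t => X 0%N t al + W 0%N t al)
    (matvec A (X 0%N t) al - matvecT A (X 1%N t) al - matvecT A (X 3%N t) al).
  move=> tT; have tT0 : 0 < t <= T by lra.
  have tT' : 0 <= t <= T by lra.
  have [d1 d1E] := evolution_coord al tT0.
  have E s : 0 <= s <= T -> coords (err_wf s) al = X 0%N s al + W 0%N s al.
    by move=> sT; rewrite /X /W /cl clampE// coords_err_wf.
  have [d2 d2E] := tderiv_ext T0 tT' E d1.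
  have := tderiv_is_derive tT d2; rewrite d2E d1E.
  by rewrite /X /cl clampE.
have aL : lip_in_time Be (W 0%N) by exact: wfl_lip.
have bL : lip_in_time Be (W 1%N) by exact: wfl_lip.
have cL : lip_in_time Be (W 2%N) by exact: wfl_lip.
have wB s t : (s < 4)%N -> dot (W s t) (W s t) <= Be ^+ 2 by move=> s4; exact: wfl_bound.
have z0 : 0 <= (0 : R) <= T by rewrite lexx ltW.
have x0 : dot (X 0%N 0) (X 0%N 0) <= K0 * Be ^+ 2 by rewrite /X /cl clampE.
have y0 : dot (X 1%N 0) (X 1%N 0) <= K0 * Be ^+ 2 by rewrite /X /cl clampE.
have b1 t := wB 1%N t isT; have b2 t := wB 2%N t isT; have b3 t := wB 3%N t isT.
exists (flux A (X 1%N) (X 2%N)).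
  split; last by move=> t; exact: flux_ge0.
  exact: (flux_cont Be0 yE zE fc aL bL cL).
move=> t tT.
have [e1 e2 e3] := energy_bound Aneg T0 Be0 yE zE wE fc fd aL bL cL b1 b2 b3 x0 y0 tT.
have e4 := flux_bound zE wE b2 b3 t.
have cE : cl t = t by exact: clampE.
by rewrite /X cE in e1 e2 e4; split.
Qed.

End Consistency.

(** * Integrals over the whole domain and over time *)

Section IntegralTools.
Context (R : realType).
Implicit Types (a b c x : R) (f g : R -> R).

Lemma bmeas_join a b c f : a < b -> b < c -> bmeas a b f -> bmeas b c f -> bmeas a c f.
Proof.
move=> ab bc [mf [B fB]] [mg [C gC]].
have E : `]a, c[%classic = (`]a, b[ `|` [set b]) `|` `]b, c[ :> set R.
  apply/seteqP; split => x /=; rewrite !in_itv/=.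
    case/andP => ax xc; case: (ltgtP x b) => xb; [left; left|right|left; right] => //.
      by rewrite ax.
  by case=> [[|->]|]; lra.
split.
  rewrite E; apply/measurable_funU; [by apply: measurableU|by []|split => //].
  apply/measurable_funU => //; split => //.
  exact: measurable_fun_set1.
exists (Num.max (Num.max `|B| `|C|) `|f b|) => x /andP[ax xc].
case: (ltgtP x b) => xb.
- by rewrite !le_max (le_trans (fB _ _) (ler_norm _))// ax.
- by rewrite !le_max (le_trans (gC _ _) (ler_norm _)) ?orbT// xb.
- by rewrite xb !le_max lexx orbT.
Qed.

Lemma itvint_domain (M : mesh R) f : (forall j : 'I_(ncells M), bmeas (nl j) (nr j) f) ->
  \int[@lebesgue_measure R]_(x in @domain R) f x = \sum_(j < ncells M) itvint (nl j) (nr j) f.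
Proof.
move=> fm.
suff main n : (0 < n <= ncells M)%N -> bmeas 0 (node M n) f /\
    itvint 0 (node M n) f = \sum_(i < n) itvint (node M i) (node M i.+1) f.
  have [|_ H] := main (ncells M); first by rewrite ncells_gt0 leqnn.
  transitivity (itvint 0 (node M (ncells M)) f); first by rewrite node_last.
  exact: H.
elim: n => // n IH nN; have [->|n0] := posnP n.
  have N0 : (0 < ncells M)%N by rewrite ncells_gt0.
  by rewrite big_ord1 node_first; split => //; have := fm (Ordinal N0);
    rewrite /nl /nr /= node_first.
have nN' : (n < ncells M)%N by case/andP: nN.
have [m1 e1] := IH (introT andP (conj n0 (ltnW nN'))).
have lt1 : 0 < node M n.
  rewrite -(node_first M) (lt_le_trans (node_lt (ncells_gt0 M)))//.
  by apply: node_le => //; exact: ltnW.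
have lt2 := node_lt nN'; have m2 := fm (Ordinal nN').
have m3 : bmeas 0 (node M n.+1) f by exact: bmeas_join lt1 lt2 m1 m2.
by split => //; rewrite big_ord_recr/= -e1; exact: itvint_split.
Qed.

(** The integral of a nonnegative function is a supremum over simple functions below it, so no
    measurability is involved. This matters for the errors of q and r, whose measurability in time
    is not established. *)
Lemma ge0_integral_mono (D : set R) (f g : R -> \bar R) :
  (forall x, D x -> (0 <= f x)%E /\ (f x <= g x)%E) ->
  (\int[@lebesgue_measure R]_(x in D) f x <= \int[@lebesgue_measure R]_(x in D) g x)%E.
Proof.
move=> H; rewrite !ge0_integralE; last first.
- by move=> x /H[].
- by move=> x /H[f0 /(le_trans f0)].
apply: le_ereal_sup => _ /= [h hf <-]; exists h => // x.
apply: le_trans (hf x) _; rewrite /patch; case: ifPn => //.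
by rewrite inE => /H[].
Qed.

Lemma integral_closed_itvint (D : R -> R) (c t : R) : 0 <= t -> continuous D ->
  (\int[@lebesgue_measure R]_(s in `[0%R, t]) (2 * D s + c)%:E = (2 * itvint 0 t D + c * t)%:E)%E.
Proof.
move=> t0 cD.
have mD : bmeas 0 t D by apply: bmeas_continuous; exact: continuous_subspaceT.
have mE : bmeas 0 t (fun s => 2 * D s + c) by apply: bmeasD; [exact: bmeasZ|exact: bmeas_cst].
have -> : 2 * itvint 0 t D + c * t = itvint 0 t (fun s => 2 * D s + c).
  by rewrite itvintD; [rewrite itvintZ// itvint_cst// subr0|exact: bmeasZ|exact: bmeas_cst].
have c1 : continuous (fun s => 2 * D s + c).
  by move=> s; apply: cvgD; [apply: cvgM; [exact: cvg_cst|exact: cD]|exact: cvg_cst].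
have mT : measurable_fun [set: R] (EFin \o (fun s => 2 * D s + c)).
  by apply/measurable_EFinP; exact: continuous_measurable_fun.
rewrite -integral_itv_obnd_cbnd; last exact: measurable_funTS.
rewrite -integral_itv_bndo_bndc; last exact: measurable_funTS.
rewrite /itvint /Rintegral fineK//; apply: integrable_fin_num => //.
exact: bmeas_integrable.
Qed.

End IntegralTools.

(** * Initial error *)

Section InitialData.
Context (R : realType).

(** Against the constant 1 only the fluxes remain, and these cancel around the circle. *)
Lemma sum_Hcell1 (M : mesh R) sigma (v : R -> R) :
  \sum_(j < ncells M) Hcell sigma j v 1 = 0.
Proof.
transitivity (\sum_(j < ncells M) (wtrace sigma (ord_pred j) v - wtrace sigma j v)).
  apply: eq_bigr => j _; rewrite /Hcell -polyC1 derivC !hornerC !mulr1.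
  rewrite (@itvint_ext _ _ _ _ (fun=> 0)) ?itvint0; first by rewrite sub0r addrC.
  by move=> x _; rewrite hornerC mulr0.
rewrite sumrB -(sum_ordS (fun j => wtrace sigma (ord_pred j) v)).
by under eq_bigr => j _ do rewrite ordSK; rewrite subrr.
Qed.

(** The means that the Poincare inequality requires have two sources: a hypothesis for u, to be
    supplied by conservation, and for p and q the preceding auxiliary equation tested with 1, by
    which the mean of the error is minus that of the last correction. *)
Lemma initial_bound k (gamma theta : R) : 0 < gamma -> 1 / 2 < theta ->
  exists2 C : R, 0 < C & forall (M : mesh R) (B : R) (e w : nat -> R -> R),
  quasi_uniform gamma M ->
  (forall s, (s < 4)%N -> in_Vh M k (e s)) -> (forall s, (s < 4)%N -> in_Vh M k (w s)) ->
  (forall s (j : 'I_(ncells M)) x, (s < 4)%N -> nl j < x < nr j -> `|w s x| <= B) ->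
  (forall s (j : 'I_(ncells M)) (phi : {poly R}), (s < 3)%N -> (size phi <= k.+1)%N ->
    Hcell (weight_of theta s) j (e s) phi =
    - itvint (nl j) (nr j) (fun x => (e s.+1 x + w s.+1 x) * phi.[x])) ->
  (forall (j : 'I_(ncells M)) x, nl j < x < nr j -> e 3%N x = 0) ->
  `|\sum_(j < ncells M) itvint (nl j) (nr j) (e 0%N)| <= 2 * pi * B ->
  forall s (j : 'I_(ncells M)) x, (s < 3)%N -> nl j < x < nr j -> `|e s x| <= C * B.
Proof.
move=> ga0 htheta.
have [Cp Cp0 CpP] := discrete_poincare k ga0 (min_gt0 htheta) (addr_ge0 (@ler01 R) (normr_ge0
  theta)).
have P0 := pi2_gt0 R.
(* In units of [B]: [c] bounds the error of the next quantity, 1 its last correction, and [2 * pi]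
   the mean. *)
pose f (c : R) := Cp * (c + 1 + 2 * pi).
have f0 c : 0 <= c -> 0 < f c by move=> c0; rewrite mulr_gt0// ltr_wpDl// addr_ge0.
have fc c : 0 <= c -> c <= f c + c by move=> c0; rewrite lerDr ltW// f0.
pose c2 := f 0; pose c1 := f c2; pose c0 := f c1.
have c2p : 0 < c2 by exact: f0.
have c1p : 0 < c1 by apply: f0; exact: ltW.
have c0p : 0 < c0 by apply: f0; exact: ltW.
exists (c0 + c1 + c2); first by rewrite !addr_gt0.
move=> M B e w qu eV wV wB eqs e3 m0.
have B0 : 0 <= B.
  have j0 := Ordinal (ncells_gt0 M).
  by apply: le_trans (wB 0%N j0 ((nl j0 + nr j0) / 2) isT _); rewrite ?normr_ge0//;
    have := nlr j0; lra.
have sumw s : (s < 4)%N -> `|\sum_(j < ncells M) itvint (nl j) (nr j) (w s)| <= 2 * pi * B.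
  move=> s4; rewrite (le_trans (ler_norm_sum _ _ _))// -(sum_cells M) mulr_suml ler_sum// => j _.
  rewrite mulrC; apply: itvint_bound; [exact: ltW (nlr j)|exact: bmeas_Vh (wV s s4)|by move=> x;
    exact: wB].
have mean s : (s < 3)%N -> `|\sum_(j < ncells M) itvint (nl j) (nr j) (e s)| <= 2 * pi * B.
  case: s => [//|s] s3; have s4 : (s.+1 < 4)%N := ltnW s3.
  have em (j : 'I_(ncells M)) := bmeas_Vh j (eV _ s4); have wm (j : 'I_(ncells M)) := bmeas_Vh j
    (wV _ s4).
  have : \sum_(j < ncells M) Hcell (weight_of theta s) j (e s) 1 = 0 by exact: sum_Hcell1.
  rewrite (eq_bigr (fun j => - (itvint (nl j) (nr j) (e s.+1) +
    itvint (nl j) (nr j) (w s.+1)))); last first.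
    move=> j _; rewrite (eqs s j 1 (ltnW s3)) ?size_poly1//.
    by rewrite -itvintD//; congr (- _); apply: itvint_ext => x _; rewrite hornerE mulr1.
  rewrite sumrN big_split/= => /eqP; rewrite oppr_eq0 addr_eq0 => /eqP ->.
  by rewrite normrN; exact: sumw.
have step s c : (s < 3)%N -> 0 <= c ->
    (forall (j : 'I_(ncells M)) x, nl j < x < nr j -> `|e s.+1 x| <= c * B) ->
    forall (j : 'I_(ncells M)) x, nl j < x < nr j -> `|e s x| <= f c * B.
  move=> s3 cp ec j x xj; have s4 : (s < 4)%N := ltnW s3.
  have [p sp ep] := in_VhP (eV _ s4).
  have [g sg gp] := in_VhP (in_VhD (eV s.+1 s3) (wV s.+1 s3)).
  rewrite (ep _ _ xj) (_ : f c * B = Cp * ((c + 1) * B + 2 * pi * B)); last by rewrite /f; ring.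
  have [W1 W2] := weight_of_norm theta s.
  apply: (CpP M (weight_of theta s) _ _ p g) => //.
  - exact: weight_of_dominant.
  - move=> i y yi; rewrite -(gp _ _ yi) (le_trans (ler_normD _ _))// mulrDl mul1r.
    by rewrite lerD ?ec ?(wB _ i)// (ec i).
  - move=> i phi sphi; rewrite -[LHS]/(Hpoly (weight_of theta s) p i phi) -(Hcell_polys _ _ _
    ep) eqs//.
    by congr (- _); apply: itvint_ext => y yi; rewrite (gp _ _ yi).
  - rewrite (eq_bigr (fun j => itvint (nl j) (nr j) (e s))); first exact: mean.
    by move=> i _; apply: itvint_ext => y yi; rewrite (ep _ _ yi).
  - by case/andP: xj => /ltW -> /ltW ->.
have b2 : forall (j : 'I_(ncells M)) x, nl j < x < nr j -> `|e 2%N x| <= c2 * B.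
  by apply: step => // j x xj; rewrite (e3 _ _ xj) normr0 mul0r.
have b1 : forall (j : 'I_(ncells M)) x, nl j < x < nr j -> `|e 1%N x| <= c1 * B.
  by apply: step => //; exact: ltW.
have b0 : forall (j : 'I_(ncells M)) x, nl j < x < nr j -> `|e 0%N x| <= c0 * B.
  by apply: step => //; exact: ltW.
move=> [|[|[|//]]] j x _ xj.
- by apply: le_trans (b0 _ _ xj) _; rewrite ler_wpM2r// -addrA lerDl addr_ge0// ltW.
- by apply: le_trans (b1 _ _ xj) _; rewrite ler_wpM2r// addrAC lerDr addr_ge0// ltW.
- by apply: le_trans (b2 _ _ xj) _; rewrite ler_wpM2r// lerDr addr_ge0// ltW.
Qed.

End InitialData.

Lemma lt3_cases s : (s < 3)%N -> [\/ s = 0%N, s = 1%N | s = 2%N].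
Proof. by case: s => [|[|[|//]]] _; [exact: Or31|exact: Or32|exact: Or33]. Qed.

Lemma lt4_cases s : (s < 4)%N -> [\/ s = 0%N, s = 1%N, s = 2%N | s = 3%N].
Proof.
by case: s => [|[|[|[|//]]]] _; [exact: Or41|exact: Or42|exact: Or43|exact: Or44].
Qed.

(** * The error bound *)

Section Regularity.
Context (R : realType).

Lemma sup_broken_divdiff_bounded m : exists2 C : R, 0 < C &
  forall (M : mesh R) (T : R) (f : R -> R -> R), 0 < T ->
  (sup_broken_norm M T m f < +oo)%E ->
  0 <= fine (sup_broken_norm M T m f) /\
  forall t (j : 'I_(ncells M)) i, 0 <= t <= T -> bmeas (nl j) (nr j) (f t) ->
    (forall x, nl j < x < nr j -> {for x, continuous (f t)}) -> (0 < i <= m)%N ->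
    divdiff_bounded i (C * (fine (sup_broken_norm M T m f) + 1)) (nl j) (nr j) (f t).
Proof.
have [C C0 CP] := Winf_divdiff_bounded R m; exists C => // M T f T0 Sfin.
have leS t : 0 <= t <= T -> (broken_norm M m (f t) <= sup_broken_norm M T m f)%E.
  by move=> tT; apply: ereal_sup_ubound; exists t => //=; rewrite in_itv.
have b0 t : (0 <= broken_norm M m (f t))%E by exact: bigmax_ge_id.
have S0 : (0 <= sup_broken_norm M T m f)%E.
  by apply: le_trans (leS 0 _); rewrite ?b0// lexx ltW.
have SE : (fine (sup_broken_norm M T m f))%:E = sup_broken_norm M T m f.
  by rewrite fineK// ge0_fin_numE.
split; first exact: fine_ge0.
move=> t j i tT fm fc im; apply: CP => //; first exact: fine_ge0.
rewrite SE; apply: le_trans (leS t tT).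
exact: (@le_bigmax _ _ _ 0%E (fun j : 'I_(ncells M) => Winf_norm (node M j) (node M j.+1) m (f t))).
Qed.

(** Four differentiations bring the order of the divided differences from 5 down to 1, where
    boundedness is a Lipschitz condition; the factors 5, 4, 3, 2 accumulate. *)
Lemma u4_lipschitz (K a b : R) (f : R -> R) : 0 <= K ->
  (forall (n : nat) x, (n < 4)%N -> derivable (derive1n n f) x 1) -> divdiff_bounded 5 K a b f ->
  exists2 L : R, 0 <= L & forall x y, a < x < b -> a < y < b ->
    `|derive1n 4 f x - derive1n 4 f y| <= L * `|x - y|.
Proof.
move=> K0 df f5.
have der n (x : R) : (n < 4)%N -> a < x < b -> is_derive x 1 (derive1n n f) (derive1n n.+1 f x).
  by move=> n4 _; apply: DeriveDef; [exact: df|rewrite derive1nS derive1E].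
have d4 := divdiff_bounded_deriv (fun x => @der 0%N x isT) f5.
have d3 := divdiff_bounded_deriv (fun x => @der 1%N x isT) d4.
have d2 := divdiff_bounded_deriv (fun x => @der 2%N x isT) d3.
have d1 := divdiff_bounded_deriv (fun x => @der 3%N x isT) d2.
exists (2%:R * (3%:R * (4%:R * (5%:R * K)))); first by rewrite !mulr_ge0.
by move=> x y; exact: divdiff_bounded_lip.
Qed.

Lemma lip_continuous_at (f : R -> R) (a b L x : R) : 0 <= L ->
  (forall y z, a < y < b -> a < z < b -> `|f y - f z| <= L * `|y - z|) ->
  a < x < b -> {for x, continuous f}.
Proof.
move=> L0 fL xab; apply/cvgrPdist_le => /= e e0.
have e1 : 0 < e / (L + 1) by rewrite divr_gt0// ltr_wpDl.
have xI : \forall y \near x, a < y < b.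
  have /andP[ax xb] := xab; near=> y; apply/andP; split.
    by near: y; exact: lt_nbhsr.
  by near: y; exact: lt_nbhsl.
near=> y; have yI : a < y < b by near: y.
have xy : `|x - y| < e / (L + 1).
  by near: y; apply: (@cvgr_dist_lt _ R^o) => //; exact: cvg_id.
rewrite (le_trans (fL _ _ xab yI))// (le_trans (ler_wpM2l L0 (ltW xy)))//.
by rewrite mulrA ler_pdivrMr ?ltr_wpDl// mulrC ler_wpM2l ?(ltW e0)// lerDl.
Unshelve. all: end_near. Qed.

End Regularity.

Section MainEstimate.
Context (R : realType) (k l : nat) (theta gamma T : R).
Hypotheses (l0 : (0 < l)%N) (lk : (l <= k)%N) (htheta : 1 / 2 < theta).
Hypotheses (hgamma : 0 < gamma) (T0 : 0 < T).

(** The theorem in coordinates, with the four quantities indexed by [s]. [C] is fixed before the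
    mesh and the solution, and the data enter through the single number [K]. *)
Lemma main_estimate : exists2 C : R, 0 < C &
  forall (M : mesh R) (K : R) (u : R -> R -> R) (P h : nat -> R -> R -> R)
    (wf : nat -> nat -> R -> R -> R),
  quasi_uniform gamma M -> 0 <= K ->
  (forall t x n, 0 <= t <= T -> (n < 4)%N -> derivable (derive1n n (u t)) x 1) ->
  (forall t x, 0 <= t <= T -> u t (x + 2 * pi) = u t x) ->
  (forall t x, 0 <= t <= T -> tderivable T (fun s => u s x) t) ->
  (forall t x, 0 < t <= T ->
    dt T u t x + derive1 (u t) x + derive1n 2 (u t) x + derive1n 4 (u t) x = 0) ->
  (forall (j : 'I_(ncells M)) t i, 0 <= t <= T -> (0 < i <= k + l + 4)%N ->
    divdiff_bounded i K (nl j) (nr j) (u t)) ->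
  (forall (j : 'I_(ncells M)) t i, 0 < t <= T -> (0 < i <= k + l + 3)%N ->
    divdiff_bounded i K (nl j) (nr j) (dt T u t)) ->
  (forall s t, (s < 4)%N -> 0 <= t <= T ->
    is_ggr M k (weight_of theta s) (derive1n s (u t)) (P s t)) ->
  (forall s t x, (s < 4)%N -> 0 <= t <= T ->
    wf s 0%N t x = derive1n s (u t) x - P s t x) ->
  corr_family M k l theta T wf ->
  (forall s t, (s < 4)%N -> 0 <= t <= T -> in_Vh M k (h s t)) ->
  (forall s t (j : 'I_(ncells M)) (phi : {poly R}), (s < 3)%N -> 0 <= t <= T ->
    (size phi <= k.+1)%N ->
    itvint (nl j) (nr j) (fun x => h s.+1 t x * phi.[x]) +
      Hcell (weight_of theta s) j (h s t) phi = 0) ->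
  (forall t (j : 'I_(ncells M)) x, 0 < t <= T -> nl j < x < nr j ->
    tderivable T (fun s => h 0%N s x) t) ->
  (forall (j : 'I_(ncells M)) x, nl j < x < nr j ->
    h 0%N t x @[t --> 0^'+] --> h 0%N 0 x) ->
  (forall t (j : 'I_(ncells M)) (phi : {poly R}), 0 < t <= T -> (size phi <= k.+1)%N ->
    itvint (nl j) (nr j) (fun x => dt T (h 0%N) t x * phi.[x]) =
    Hcell theta j (h 0%N t) phi + Hcell (1 - theta) j (h 1%N t) phi +
      Hcell (1 - theta) j (h 3%N t) phi) ->
  (forall (j : 'I_(ncells M)) x, nl j < x < nr j -> err l P wf h 3 0 x = 0) ->
  \sum_(j < ncells M) itvint (nl j) (nr j) (h 0%N 0) = \sum_(j < ncells M) itvint (nl j) (nr j)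
    (u 0) ->
  exists2 D : R -> R, continuous D /\ (forall t, 0 <= D t) &
  forall t, 0 <= t <= T -> let B := C * (K * mesh_size M ^+ (k + l + 1)) ^+ 2 in
  [/\ dot (coords (err l P wf h 0 t)) (coords (err l P wf h 0 t) : dof M k -> R) <= B,
      dot (coords (err l P wf h 1 t)) (coords (err l P wf h 1 t) : dof M k -> R) <= B,
      itvint 0 t D <= B &
      dot (coords (err l P wf h 2 t)) (coords (err l P wf h 2 t) : dof M k -> R) +
      dot (coords (err l P wf h 3 t)) (coords (err l P wf h 3 t) : dof M k -> R) <= 2 * D t + B].
Proof.
have [Cb Cb0 CbP] := level_base k htheta l0.
have [Ca Ca0 CaP] := level_all k l htheta.
have [Ci Ci0 CiP] := initial_bound k hgamma htheta.
have P0 := pi2_gt0 R.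
pose K0 := Ci ^+ 2; pose E := expR (25 * T) * (3 * K0 + 4).
have E1 : 1 <= E.
  have K00 : 0 <= K0 by rewrite sqr_ge0.
  rewrite -[1]mulr1 ler_pM//; last by lra.
  by rewrite -[1]expR0 ler_expR mulr_ge0// ltW.
pose C0 := 2 * pi * (Ca * Cb) ^+ 2.
have C00 : 0 < C0 by rewrite mulr_gt0// exprn_gt0// mulr_gt0.
have E0 : 0 < E by exact: lt_le_trans E1.
(* The four bounds of [error_energy] carry the factors [E], [2 * E], [4 * E] and 4; as [1 <= E], the
   factor [4 * E] covers them all. *)
exists (4 * E * C0); first by apply: mulr_gt0 => //; apply: mulr_gt0.
move=> M K u P h wf qu hK ux uper ut ueq uK utK Pggr wfE cf hVh haux hdt hcont0 hevol e30 mass.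
have h0 := mesh_size_gt0 M.
pose B := Ca * (Cb * (K * mesh_size M ^+ k.+1) * mesh_size M ^+ l).
have B00 : 0 <= Cb * (K * mesh_size M ^+ k.+1) by rewrite mulr_ge0 ?(ltW Cb0)// mulr_ge0//
  exprn_ge0// ltW.
have lev0 := CbP M T K u P wf T0 hK ux ut ueq uK utK Pggr wfE.
have levi := CaP M T _ wf T0 B00 cf lev0.
have lev i : (i <= l)%N -> exists B, level l M T wf i B by move=> /levi; eexists; eassumption.
have levl : level l M T wf l B by exact: levi.
have B0 : 0 <= B by rewrite mulr_ge0 ?(ltW Ca0)// mulr_ge0// exprn_ge0// ltW.
have u4c t (j : 'I_(ncells M)) : 0 < t <= T -> {within `[nl j, nr j],
  continuous (derive1n 4 (u t))}.
  move=> tT; have tT' : 0 <= t <= T by case/andP: tT => /ltW -> ->.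
  have [|L L0 LP] := u4_lipschitz (a := nl j) (b := nr j) hK (fun n x => ux t x n tT').
    have kl : (0 < k + l)%N by rewrite addn_gt0 l0 orbT.
    by apply: uK => //; apply/andP; split => //; exact: (leq_add kl (leqnn 4)).
  apply: (lip_derivative_continuous (g := derive1n 3 (u t)) (nlr j) L0) LP => x.
  exact: (u_der ux).
have z0 : 0 <= (0 : R) <= T by rewrite lexx ltW.
have eV s t : (s < 4)%N -> 0 <= t <= T -> in_Vh M k (err l P wf h s t).
  exact: (err_Vh cf Pggr hVh).
have wV s t : (s < 4)%N -> 0 <= t <= T -> in_Vh M k (wf s l t).
  by move=> s4 tT; apply: (cf_Vh cf) => //; rewrite l0 leqnn.
have wB s t (j : 'I_(ncells M)) x : (s < 4)%N -> 0 <= t <= T -> nl j < x < nr j ->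
  `|wf s l t x| <= B.
  move=> s4 tT xj; have := levl s [::] t j x s4 _ _ xj.
  rewrite /step_prod big_nil mulr1 /=; apply; last by rewrite muln0 addn0; clear -s4; lia.
  by split=> //; rewrite ?big_nil ?addr0; case/andP: tT.
have ini := CiP M B (fun s => err l P wf h s 0) (fun s => wf s l 0) qu
  (fun s s4 => eV s 0 s4 z0) (fun s s4 => wV s 0 s4 z0)
  (fun s j x s4 => wB s 0 j x s4 z0)
  (fun s j phi s3 sphi => err_aux htheta T0 l0 lk cf lev ux uper u4c Pggr wfE hVh haux j s3 z0
    sphi) e30.
have um (j : 'I_(ncells M)) : bmeas (nl j) (nr j) (u 0).
  apply: bmeas_continuous; apply: continuous_subspaceT => x.
  by apply: differentiable_continuous; apply/derivable1_diffP; exact: (ux 0 x 0%N).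
(* The discrete solution conserves the mass of [u], and the corrections of orders below [l] have
   mean zero, so the mean of the initial error is minus that of the last correction. *)
have mean0 : `|\sum_(j < ncells M) itvint (nl j) (nr j) (err l P wf h 0 0)| <= 2 * pi * B.
  have mE (j : 'I_(ncells M)) : itvint (nl j) (nr j) (err l P wf h 0 0) =
      itvint (nl j) (nr j) (u 0) - itvint (nl j) (nr j) (h 0%N 0) - itvint (nl j) (nr j) (wf 0%N
        l 0).
    have wm i : (i <= l)%N -> bmeas (nl j) (nr j) (wf 0%N i 0) by move=> il; apply: (cf_bdmi cf).
    have hm : bmeas (nl j) (nr j) (h 0%N 0) by apply: (@bmeas_Vh _ _ k); exact: hVh.
    have Sm : bmeas (nl j) (nr j) (fun x => \sum_(i < l) wf 0%N i 0 x).
      by apply: bmeas_sum => i _; apply: wm; exact: ltnW.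
    rewrite (@itvint_ext _ _ _ _ (fun x => u 0 x - \sum_(i < l) wf 0%N i 0 x - h 0%N 0 x - wf
      0%N l 0 x)); last first.
      move=> x _; have := @itp_shift _ l _ _ _ _ wfE 0%N 0 x isT z0.
      by rewrite /err /= => <-; ring.
    have m1 := bmeasB (um j) Sm; have m2 := bmeasB m1 hm; have m3 := wm l (leqnn l).
    rewrite (itvintB m2 m3) (itvintB m1 hm) (itvintB (um j) Sm).
    rewrite itvint_sum; last by move=> i _; apply: wm; exact: ltnW.
    rewrite [X in _ - X - _ - _]big1; first by ring.
    by move=> i _; exact: (wf_mean0 htheta T0 lk cf lev j (ltn_ord i)).
  rewrite (eq_bigr _ (fun j _ => mE j)) !sumrB mass subrr sub0r normrN.
  rewrite (le_trans (ler_norm_sum _ _ _))// -(sum_cells M) mulr_suml ler_sum// => j _.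
  rewrite mulrC; apply: itvint_bound; [exact: ltW (nlr j)|by apply: (@bmeas_Vh _ _ k); exact: wV|].
  by move=> x; exact: wB.
have {}ini := ini mean0.
have Be2 : (Num.sqrt (2 * pi) * B) ^+ 2 = C0 * (K * mesh_size M ^+ (k + l + 1)) ^+ 2.
  rewrite exprMn sqr_sqrtr ?(ltW P0)// /C0 /B (_ : (k + l + 1)%N = (k.+1 + l)%N);
    last by rewrite addn1 addSn.
  by rewrite exprD; ring.
have init s : (s < 3)%N -> dot (coords (err l P wf h s 0)) (coords (err l P wf h s 0) : dof M k
  -> R) <=
    K0 * (Num.sqrt (2 * pi) * B) ^+ 2.
  move=> s3; have s4 : (s < 4)%N := ltnW s3.
  apply: le_trans (dot_coords_le (eV s 0 s4 z0) (fun j x xj => ini s j x s3 xj)) _.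
  by rewrite [in leRHS]exprMn sqr_sqrtr ?(ltW P0)// /K0 le_eqVlt; apply/orP; left; apply/eqP; ring.
have [D Dc DP] := error_energy htheta T0 l0 lk cf lev ux uper u4c Pggr wfE ueq ut hVh haux
  hdt hcont0 hevol B0 levl (init 0%N isT) (init 1%N isT).
exists D => // t tT /=.
have [d1 d2 d3 d4] := DP t tT.
rewrite -/E Be2 in d1 d2 d3 d4.
set Z := (K * mesh_size M ^+ (k + l + 1)) ^+ 2 in d1 d2 d3 d4 *.
have CZ0 : 0 <= C0 * Z by rewrite mulr_ge0 ?(ltW C00) ?sqr_ge0.
have EZ : C0 * Z <= E * (C0 * Z) by rewrite ler_peMl.
rewrite (_ : 4 * E * C0 * Z = 4 * (E * (C0 * Z))); last by ring.
move: d1 d2 d3 d4; move: (E * (C0 * Z)) EZ => Y EZ d1 d2 d3 d4.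
split; lra.
Qed.

End MainEstimate.

Theorem theorem4p1 (R : realType) (k l : nat) (theta lambda gamma T : R)
    (hk : (1 <= k)%N) (hl : (1 <= l <= k)%N)
    (htheta : 1 / 2 < theta) (hlambda : theta = lambda)
    (hgamma : 0 < gamma) (hT : 0 < T) :
  exists C : R -> R -> R,
  forall (M : mesh R) (u0 : R -> R) (u p q r : R -> R -> R),
    quasi_uniform gamma M ->
    exact_solution T u0 u ->
    (forall t x, 0 <= t <= T ->
      [/\ p t x = derive1 (u t) x, q t x = derive1 (p t) x & r t x = derive1 (q t) x]) ->
    (sup_broken_norm M T (k + l + 4) u < +oo)%E ->
    (sup_broken_norm M T (k + l + 3) (dt T u) < +oo)%E ->
  forall (Pu Pp Pq Pr : R -> R -> R) (wu wp wq wr : nat -> R -> R -> R),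
    (forall t, 0 <= t <= T ->
      [/\ is_ggr M k theta (u t) (Pu t),
          is_ggr M k (1 - lambda) (p t) (Pp t),
          is_ggr M k lambda (q t) (Pq t) &
          is_ggr M k (1 - theta) (r t) (Pr t)]) ->
    corrections M k l theta lambda T u p q r Pu Pp Pq Pr wu wp wq wr ->
  forall uh ph qh rh : R -> R -> R,
    LDG_solution M k theta lambda T uh ph qh rh ->
    initial_condition M k theta lambda u0 (interp l Pr wr 0)
      (uh 0) (ph 0) (qh 0) (rh 0) ->
  let e_u t x := interp l Pu wu t x - uh t x in
  let e_p t x := interp l Pp wp t x - ph t x in
  let e_q t x := interp l Pq wq t x - qh t x in
  let e_r t x := interp l Pr wr t x - rh t x in
  forall t, 0 < t <= T ->
    ((L2norm (e_u t))%:E + (L2norm (e_p t))%:E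
     + (\int[@lebesgue_measure R]_(tau in `[0%R, t])
          (L2norm (e_q tau) ^+ 2 + L2norm (e_r tau) ^+ 2)%:E) `^ 2^-1
     <= (C (fine (sup_broken_norm M T (k + l + 4) u))
           (fine (sup_broken_norm M T (k + l + 3) (dt T u)))
         * mesh_size M ^+ (k + l + 1))%:E)%E.
Proof.
subst lambda; case/andP: hl => l0 lk.
have [C1 C10 C1P] := sup_broken_divdiff_bounded R (k + l + 4).
have [C2 C20 C2P] := sup_broken_divdiff_bounded R (k + l + 3).
have [Cm Cm0 CmP] := @main_estimate R k l theta gamma T l0 lk htheta hgamma hT.
(* Two terms bound the norms of the errors of u and p. In the third, [2 * Cm] comes from the
   integral of the majorant and [Cm * T] from its constant part. *)
exists (fun K1 K2 => (Num.sqrt Cm + Num.sqrt Cm + Num.sqrt (2 * Cm + Cm * T)) *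
  (C1 * (K1 + 1) + C2 * (K2 + 1))).
move=> M u0 u p q r qu ex pqr Su St Pu Pp Pq Pr wu wp wq wr Hggr corr uh ph qh rh ldg ini.
move=> e_u e_p e_q e_r t0 t0T.
have h0 := mesh_size_gt0 M.
pose P s := if s is 0%N then Pu else if s is 1%N then Pp else if s is 2%N then Pq else Pr.
pose wf s := if s is 0%N then wu else if s is 1%N then wp else if s is 2%N then wq else wr.
pose h s := if s is 0%N then uh else if s is 1%N then ph else if s is 2%N then qh else rh.
have [K10 u_divdiff_bounded] := C1P M T u hT Su; have [K20 ut_divdiff_bounded] := C2P M T (dt T
  u) hT St.
set K1 := fine _ in K10 u_divdiff_bounded *; set K2 := fine _ in K20 ut_divdiff_bounded *.
pose K := C1 * (K1 + 1) + C2 * (K2 + 1).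
have K1n : 0 <= C1 * (K1 + 1) by rewrite mulr_ge0 ?(ltW C10)// addr_ge0.
have K2n : 0 <= C2 * (K2 + 1) by rewrite mulr_ge0 ?(ltW C20)// addr_ge0.
have Kn : 0 <= K by exact: addr_ge0.
have K1K : C1 * (K1 + 1) <= K by rewrite lerDl.
have K2K : C2 * (K2 + 1) <= K by rewrite lerDr.
have ux t x n : 0 <= t <= T -> (n < 4)%N -> derivable (derive1n n (u t)) x 1.
  by move=> tT n4; exact: (exact_dx ex).
have ueq := exact_eq ex; have ut := exact_dt ex; have uper := exact_periodic ex.
have uc s t x : (s < 4)%N -> 0 <= t <= T -> {for x, continuous (derive1n s (u t))}.
  by move=> s4 tT; apply: differentiable_continuous; apply/derivable1_diffP; exact: ux.
have um s t (j : 'I_(ncells M)) : (s < 4)%N -> 0 <= t <= T ->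
  bmeas (nl j) (nr j) (derive1n s (u t)).
  by move=> s4 tT; apply: bmeas_continuous; apply: continuous_subspaceT => x; exact: uc.
have uK (j : 'I_(ncells M)) t i : 0 <= t <= T -> (0 < i <= k + l + 4)%N ->
  divdiff_bounded i K (nl j) (nr j) (u t).
  move=> tT ii; apply: divdiff_bounded_le K1K (u_divdiff_bounded t j i tT _ _ ii);
    first exact: (um 0%N).
  by move=> x _; exact: (uc 0%N).
have w0 (t : R) : 0 < t <= T -> 0 <= t <= T by case/andP => /ltW -> ->.
have utE t x : 0 < t <= T ->
    dt T u t x = - derive1n 1 (u t) x - derive1n 2 (u t) x - derive1n 4 (u t) x.
  move=> tT; have := ueq t x tT; rewrite (_ : derive1n 1 (u t) x = derive1 (u t) x)//.
  by move: (dt T u t x) (derive1 (u t) x) (derive1n 2 _ _) (derive1n 4 _ _) => a1 a2 a3 a4; lra.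
(* Passing from the norm to divided differences requires a bounded, continuous function; for [u_t]
   both properties are read off from the equation and the Lipschitz bound on the fourth
   derivative. *)
have utK (j : 'I_(ncells M)) t i : 0 < t <= T -> (0 < i <= k + l + 3)%N ->
    divdiff_bounded i K (nl j) (nr j) (dt T u t).
  move=> tT ii; have tT' := w0 t tT.
  have kl : (0 < k + l)%N by rewrite addn_gt0 l0 orbT.
  have [|L L0 LP] := u4_lipschitz (a := nl j) (b := nr j) Kn (fun n x => ux t x n tT').
    by apply: uK => //; apply/andP; split => //; exact: (leq_add kl (leqnn 4)).
  have u4c : {within `[nl j, nr j], continuous (derive1n 4 (u t))}.
    by apply: (lip_derivative_continuous (g := derive1n 3 (u t)) (nlr j) L0) LP => x;
      exact: (u_der ux).
  apply: divdiff_bounded_le K2K (ut_divdiff_bounded t j i tT' _ _ ii).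
    apply: (@bmeas_ext _ _ _ (fun x => - derive1n 1 (u t) x - derive1n 2 (u t) x - derive1n 4 (u
      t) x)).
      by move=> x _; rewrite utE.
    apply: bmeasB; last exact: bmeas_continuous.
    by apply: bmeasB; [apply: bmeasN; exact: (um 1%N)|exact: (um 2%N)].
  move=> x xj; rewrite (_ : dt T u t = (fun x => - derive1n 1 (u t) x - derive1n 2 (u t) x -
    derive1n 4 (u t) x)).
    apply: continuousB; last exact: lip_continuous_at L0 LP xj.
    by apply: continuousB; [apply: continuousN; exact: (uc 1%N)|exact: (uc 2%N)].
  by apply/funext => y; rewrite utE.
have pE t : 0 <= t <= T -> p t = derive1n 1 (u t) by move=> tT; apply/funext => x;
  have [] := pqr t x tT.
have qE t : 0 <= t <= T -> q t = derive1n 2 (u t).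
  by move=> tT; apply/funext => x; have [_ -> _] := pqr t x tT; rewrite pE.
have rE t : 0 <= t <= T -> r t = derive1n 3 (u t).
  by move=> tT; apply/funext => x; have [_ _ ->] := pqr t x tT; rewrite qE.
have Pggr s t : (s < 4)%N -> 0 <= t <= T -> is_ggr M k (weight_of theta s) (derive1n s (u t)) (P
  s t).
  move=> s4 tT; have := Hggr t tT; rewrite (pE t tT) (qE t tT) (rE t tT) => -[g0 g1 g2 g3].
  case/lt4_cases: s4 => ->; [exact: g0|exact: g1|exact: g2|exact: g3].
have wfE s t x : (s < 4)%N -> 0 <= t <= T -> wf s 0%N t x = derive1n s (u t) x - P s t x.
  move=> s4 tT; have := corr0 corr x tT; rewrite (pE t tT) (qE t tT) (rE t tT) => -[g0 g1 g2 g3].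
  case/lt4_cases: s4 => ->; [exact: g0|exact: g1|exact: g2|exact: g3].
have halfE (j : 'I_(ncells M)) (v : R -> R) x : half_size j * Dinv j v x = itvint (nl j) x v.
  have hn : half_size j != 0 by rewrite /half_size mulf_neq0 ?invr_eq0// gt_eqF// cell_size_gt0.
  by rewrite /Dinv mulrA divff// mul1r.
have cf : corr_family M k l theta T wf.
  split.
  - move=> s j t s4 tT; apply: (@bmeas_ext _ _ _ (fun x => derive1n s (u t) x - P s t x)).
      by move=> x _; rewrite wfE.
    by apply: bmeasB; [exact: um|apply: (@bmeas_Vh _ _ k); have [] := Pggr s t s4 tT].
  - move=> s i t s4 il tT; have [g0 g1 g2 g3] := corr_Vh corr il tT.
    case/lt4_cases: s4 => ->; [exact: g0|exact: g1|exact: g2|exact: g3].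
  - by move=> i t j x il tT xj; apply: (corr_dt corr il tT (j := j)); rewrite cellE.
  - move=> s t j phi s4 tT sphi; have [_ /(_ j phi sphi) <- _] := Pggr s t s4 tT.
    by apply: itvint_ext => x _; rewrite wfE.
  - move=> s i t j phi s3 il tT sphi; have [g0 g1 g2 _] := corr_orth corr j il tT sphi.
    case/lt3_cases: s3 => ->; [rewrite -[RHS]g0|rewrite -[RHS]g1|rewrite -[RHS]g2];
      by apply: itvint_ext => x _; rewrite halfE.
  - move=> i t j phi il tT sphi; have [_ _ _ g3] := corr_orth corr j il tT sphi.
    by rewrite -[RHS]g3; apply: itvint_ext => x _; rewrite halfE.
  - move=> s i t j s4 il tT; have [g0 g1 g2 g3] := corr_trace corr j il tT.
    case/lt4_cases: s4 => ->; [exact: g0|exact: g1|exact: g2|exact: g3].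
have z0 : 0 <= (0 : R) <= T by rewrite lexx ltW.
have hVh s t : (s < 4)%N -> 0 <= t <= T -> in_Vh M k (h s t).
  move=> s4 tT; have [g0 g1 g2 g3] := LDG_Vh ldg tT.
  case/lt4_cases: s4 => ->; [exact: g0|exact: g1|exact: g2|exact: g3].
have haux s t (j : 'I_(ncells M)) (phi : {poly R}) : (s < 3)%N -> 0 <= t <= T ->
  (size phi <= k.+1)%N ->
    itvint (nl j) (nr j) (fun x => h s.+1 t x * phi.[x]) +
      Hcell (weight_of theta s) j (h s t) phi = 0.
  move=> s3 tT sphi.
  (* At time 0 these relations belong to the initial condition, at later times to the scheme. *)
  have : auxiliary_eqs M k theta theta (uh t) (ph t) (qh t) (rh t).
    move: (tT) => /andP[]; rewrite le_eqVlt => /predU1P[<- _|tp tle];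
      first exact: (init_auxiliary ini).
    by apply: (LDG_auxiliary ldg); rewrite tp.
  move=> /(_ j _ (@in_Vh_horner R M k phi sphi)); rewrite !Hform_poly => -[g2 g1 g0].
  case/lt3_cases: s3 => ->; [exact: g0|exact: g1|exact: g2].
have hdt t (j : 'I_(ncells M)) x : 0 < t <= T -> nl j < x < nr j ->
  tderivable T (fun s => h 0%N s x) t.
  by move=> tT xj; apply: (LDG_dt ldg tT (j := j)); rewrite cellE.
have hcont0 (j : 'I_(ncells M)) x : nl j < x < nr j -> h 0%N t x @[t --> 0^'+] --> h 0%N 0 x.
  by move=> xj; apply: (LDG_continuous0 ldg (j := j)); rewrite cellE.
have hevol t (j : 'I_(ncells M)) (phi : {poly R}) : 0 < t <= T -> (size phi <= k.+1)%N ->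
    itvint (nl j) (nr j) (fun x => dt T (h 0%N) t x * phi.[x]) =
    Hcell theta j (h 0%N t) phi + Hcell (1 - theta) j (h 1%N t) phi +
      Hcell (1 - theta) j (h 3%N t) phi.
  move=> tT sphi; have := LDG_evolution ldg j tT (@in_Vh_horner R M k phi sphi).
  rewrite !Hform_poly innerE => /eqP; rewrite subr_eq0 subr_eq subr_eq => /eqP.
  have swap (a b c x : R) : x = c + b + a -> x = a + b + c by move=> ->; ring.
  exact: swap.
have itpE (v : R -> R -> R) (w : nat -> R -> R -> R) t x :
    interp l v w t x = v t x - \sum_(i < l) w i.+1 t x.
  by rewrite /interp big_add1 big_mkord.
have e30 (j : 'I_(ncells M)) x : nl j < x < nr j -> err l P wf h 3 0 x = 0.
  by move=> xj; rewrite /err /itp /h (init_r ini (j := j)) ?cellE// itpE subrr.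
have mass : \sum_(j < ncells M) itvint (nl j) (nr j) (h 0%N 0) =
  \sum_(j < ncells M) itvint (nl j) (nr j) (u 0).
  have hm (j : 'I_(ncells M)) : bmeas (nl j) (nr j) (uh 0).
    by apply: (@bmeas_Vh _ _ k); exact: (hVh 0%N).
  have u0m (j : 'I_(ncells M)) : bmeas (nl j) (nr j) u0.
    by apply: bmeas_ext (um 0%N 0 j isT z0) => x _; rewrite /= (exact_init ex).
  have := init_mass ini; rewrite (itvint_domain hm) (itvint_domain u0m) => ->.
  by apply: eq_bigr => j _; apply: itvint_ext => x _; rewrite (exact_init ex).
have [D [Dc D0] DP] := CmP M K u P h wf qu Kn ux uper ut ueq uK utK Pggr wfE cf hVh haux hdt
  hcont0 hevol e30 mass.
pose Z := K * mesh_size M ^+ (k + l + 1); have Z0 : 0 <= Z by rewrite mulr_ge0// exprn_ge0// ltW.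
have eV s t : (s < 4)%N -> 0 <= t <= T -> in_Vh M k (err l P wf h s t).
  exact: (err_Vh cf Pggr hVh).
have L2E s t : (s < 4)%N -> 0 <= t <= T ->
    L2norm (err l P wf h s t) ^+ 2 = dot (coords (err l P wf h s t)) (coords (err l P wf h s t)
      : dof M k -> R).
  move=> s4 tT; have em (j : 'I_(ncells M)) : bmeas (nl j) (nr j) (fun x =>
    err l P wf h s t x ^+ 2).
    have m := bmeas_Vh j (eV s t s4 tT).
    by apply: bmeas_ext (bmeasM m m) => x _; rewrite expr2.
  rewrite /L2norm (itvint_domain em) -(dot_coords (eV s t s4 tT)) sqr_sqrtr//.
  exact: dot_ge0.
have L2le s t (b : R) : (s < 4)%N -> 0 <= t <= T ->
    dot (coords (err l P wf h s t)) (coords (err l P wf h s t) : dof M k -> R) <= b * Z ^+ 2 ->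
      0 <= b ->
    L2norm (err l P wf h s t) <= Num.sqrt b * Z.
  move=> s4 tT H b0; rewrite -(ler_pXn2r (n := 2)) ?nnegrE ?sqrtr_ge0 ?(mulr_ge0 (sqrtr_ge0 _)
    Z0)//.
  by rewrite L2E// exprMn sqr_sqrtr.
have erE s : [/\ e_u s = err l P wf h 0 s, e_p s = err l P wf h 1 s,
    e_q s = err l P wf h 2 s & e_r s = err l P wf h 3 s].
  by split; apply/funext => x; rewrite /e_u /e_p /e_q /e_r itpE.
have t0T' := w0 t0 t0T.
have [d0 d1 dI _] := DP t0 t0T'.
have Iq : (\int[@lebesgue_measure R]_(tau in `[0%R, t0])
    (L2norm (e_q tau) ^+ 2 + L2norm (e_r tau) ^+ 2)%:E <= ((2 * Cm + Cm * T) * Z ^+ 2)%:E)%E.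
  apply: (@le_trans _ _ (\int[@lebesgue_measure R]_(tau in `[0%R,
    t0]) (2 * D tau + Cm * Z ^+ 2)%:E)%E).
    apply: ge0_integral_mono => s /=; rewrite in_itv/= => /andP[s0 st].
    have sT : 0 <= s <= T by rewrite s0 (le_trans st)//; case/andP: t0T.
    have [_ _ _ d23] := DP s sT; have [_ _ -> ->] := erE s.
    by rewrite !lee_fin !L2E// d23 addr_ge0// dot_ge0.
  rewrite integral_closed_itvint//; last by case/andP: t0T'.
  rewrite lee_fin [leRHS](_ : _ = 2 * (Cm * Z ^+ 2) + Cm * Z ^+ 2 * T); last by ring.
  apply: lerD; first exact: (ler_wpM2l (ler0n _ 2) dI).
  apply: ler_wpM2l; first exact: (mulr_ge0 (ltW Cm0) (sqr_ge0 _)).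
  by case/andP: t0T.
have [-> -> _ _] := erE t0.
have Ip : ((\int[@lebesgue_measure R]_(tau in `[0%R, t0])
    (L2norm (e_q tau) ^+ 2 + L2norm (e_r tau) ^+ 2)%:E) `^ 2^-1 <=
      (Num.sqrt (2 * Cm + Cm * T) * Z)%:E)%E.
  have c0 : 0 <= 2 * Cm + Cm * T by rewrite addr_ge0 ?mulr_ge0// ltW.
  have I0 : (0 <= \int[@lebesgue_measure R]_(tau in `[0%R, t0])
      (L2norm (e_q tau) ^+ 2 + L2norm (e_r tau) ^+ 2)%:E)%E.
    by apply: integral_ge0 => s _; rewrite lee_fin addr_ge0// sqr_ge0.
  apply: (@le_trans _ _ ((((2 * Cm + Cm * T) * Z ^+ 2)%:E `^ 2^-1)%E)).
    have Z2 := mulr_ge0 c0 (sqr_ge0 Z).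
    by apply: gt0_ler_poweR; rewrite ?in_itv/= ?leey ?lee_fin ?andbT ?invr_ge0.
  by rewrite poweR_EFin powR12_sqrt ?(mulr_ge0 c0 (sqr_ge0 Z))// sqrtrM// sqrtr_sqr ger0_norm.
have b0 := L2le 0%N t0 Cm isT t0T' d0 (ltW Cm0); have b1 := L2le 1%N t0 Cm isT t0T' d1 (ltW Cm0).
rewrite -!lee_fin in b0 b1.
apply: le_trans (leeD (leeD b0 b1) Ip) _.
rewrite -!EFinD lee_fin le_eqVlt; apply/orP; left; apply/eqP.
by rewrite /Z /K; ring.
Qed.
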